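(* Let $n\geq 1$ and $\alpha>-1$. Let $\mathfrak{T}$ be the $C^*$-algebra of bounded operators on $A^2_\alpha$ generated by $\{T_g : g\in L^\infty(\mathbb{B}_n,\mathrm{d}\nu)\}$. If $S\in\mathfrak{T}$ commutes with the Toeplitz operator $T_{z_1^{L_1}\cdots z_n^{L_n}}$ for some integers $L_1,\ldots,L_n\geq 1$, then there is a bounded analytic function $f$ on $\mathbb{B}_n$ such that $S=T_f$.
   Context: $\mathbb{B}_n$ is the open unit ball of $\mathbb{C}^n$ (Euclidean norm $|z|$); $\nu$ is Lebesgue measure on $\mathbb{B}_n$ normalized so that $\nu(\mathbb{B}_n)=1$. For $\alpha>-1$, $\mathrm{d}\nu_\alpha(z)=c_\alpha(1-|z|^2)^\alpha\,\mathrm{d}\nu(z)$ with $c_\alpha=\frac{\Gamma(n+\alpha+1)}{\Gamma(n+1)\Gamma(\alpha+1)}$, so that $\nu_\alpha(\mathbb{B}_n)=1$. $L^2_\alpha=L^2(\mathbb{B}_n,\mathrm{d}\nu_\alpha)$, and the weighted Bergman space $A^2_\alpha$ is the closed subspace of $L^2_\alpha$ consisting of functions analytic on $\mathbb{B}_n$. $P_\alpha:L^2_\alpha\to A^2_\alpha$ is the orthogonal projection. For $g\in L^\infty(\mathbb{B}_n,\mathrm{d}\nu)$, the Toeplitz operator $T_g$ is the bounded operator on $A^2_\alpha$ given by $T_g\varphi=P_\alpha(g\varphi)$. *)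

(* Defs.v *)
From HB Require Import structures.
From mathcomp Require Import all_boot all_order all_algebra.
From mathcomp Require Import complex ring.
From mathcomp Require Import all_classical all_reals all_analysis.
From mathcomp Require Import measurable_realfun.

Set Implicit Arguments.
Unset Strict Implicit.
Unset Printing Implicit Defensive.

Import Order.TTheory GRing.Theory Num.Theory.
Import numFieldNormedType.Exports.

Local Open Scope classical_set_scope.
Local Open Scope ring_scope.
Local Open Scope complex_scope.

(* [m1 \x m2] is only inferred to be sigma-finite for subprobabilities, hence
   this alias. *)
Definition prod_measure d1 d2 (T1 : measurableType d1) (T2 : measurableType d2)
    (R : realType) (m1 : {sigma_finite_measure set T1 -> \bar R})
    (m2 : {sigma_finite_measure set T2 -> \bar R}) :
    set (T1 * T2) -> \bar R :=
  (m1 \x m2)%E.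

Section prod_measure.
Context d1 d2 (T1 : measurableType d1) (T2 : measurableType d2) (R : realType).
Local Open Scope ereal_scope.
Variable m1 : {sigma_finite_measure set T1 -> \bar R}.
Variable m2 : {sigma_finite_measure set T2 -> \bar R}.

HB.instance Definition _ := Measure.copy (prod_measure m1 m2) (m1 \x m2).

Let prod_measure_sigma_finite : sigma_finite setT (prod_measure m1 m2).
Proof.
have /sigma_finiteP[F [TF ndF Foo]] := sigma_finiteT m1.
have /sigma_finiteP[G [TG ndG Goo]] := sigma_finiteT m2.
exists (fun n => F n `*` G n).
  rewrite -setXTT TF TG predeqE => -[x y]; split.
    move=> [/= [n _ Fnx] [k _ Gky]]; exists (maxn n k) => //; split.
    - by move: x Fnx; exact/subsetPset/ndF/leq_maxl.
    - by move: y Gky; exact/subsetPset/ndG/leq_maxr.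
  by move=> [n _ []/= ? ?]; split; exists n.
move=> k; have [? ?] := Foo k; have [? ?] := Goo k.
split; first exact: measurableX.
by rewrite /prod_measure product_measure1E// lte_mul_pinfty// ge0_fin_numE.
Qed.

HB.instance Definition _ := Measure_isSigmaFinite.Build _ _ _
  (prod_measure m1 m2) prod_measure_sigma_finite.

End prod_measure.

Section tuple_measure.
Context d (T : measurableType d) (R : realType).
Local Open Scope ereal_scope.

Definition cons_pair n (x : T * n.-tuple T) : n.+1.-tuple T :=
  [tuple of x.1 :: x.2].

Lemma measurable_cons_pair n :
  measurable_fun [set: T * n.-tuple T] (@cons_pair n).
Proof. exact: measurable_cons. Qed.

Lemma measurable_uncons n :
  measurable_fun [set: n.+1.-tuple T] (fun t => (thead t, [tuple of behead t])).
Proof.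
apply: measurable_fun_pair.
  exact: (@measurable_tnth _ _ _ ord0).
exact: measurable_behead.
Qed.

Variable m : {sigma_finite_measure set T -> \bar R}.

Definition cons_measure n
    (mn : {sigma_finite_measure set (n.-tuple T) -> \bar R}) :
    set (n.+1.-tuple T) -> \bar R :=
  pushforward (prod_measure m mn) (@cons_pair n).

Section instances.
Variables (n : nat) (mn : {sigma_finite_measure set (n.-tuple T) -> \bar R}).

Let cons_measure0 : cons_measure mn set0 = 0.
Proof. by rewrite /cons_measure /pushforward preimage_set0 measure0. Qed.

Let cons_measure_ge0 A : 0 <= cons_measure mn A.
Proof. by rewrite /cons_measure /pushforward measure_ge0. Qed.

Let mcons := @measurable_cons_pair n.

Let cons_measure_sigma_additive : semi_sigma_additive (cons_measure mn).
Proof. rewrite /cons_measure. exact: measure_semi_sigma_additive. Qed.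

HB.instance Definition _ := isMeasure.Build _ _ _ (cons_measure mn)
  cons_measure0 cons_measure_ge0 cons_measure_sigma_additive.

Let cons_measure_sigma_finite : sigma_finite setT (cons_measure mn).
Proof.
have [F TF Foo] := sigma_finiteT (prod_measure m mn).
pose u := fun t : n.+1.-tuple T => (thead t, [tuple of behead t]).
exists (fun k => u @^-1` F k).
  by rewrite -preimage_bigcup -TF preimage_setT.
move=> k; have [mF Fk] := Foo k; split.
  by rewrite -[X in measurable X]setTI; exact: (@measurable_uncons n).
rewrite /cons_measure /pushforward -comp_preimage.
rewrite (_ : u \o _ = id) ?preimage_id//.
apply/funext => -[x t] /=; rewrite /u /cons_pair /= theadE; congr pair.
exact/val_inj.
Qed.

HB.instance Definition _ := Measure_isSigmaFinite.Build _ _ _ (cons_measure mn)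
  cons_measure_sigma_finite.

End instances.

Fixpoint tuple_measure n : {sigma_finite_measure set (n.-tuple T) -> \bar R} :=
  if n is n'.+1 then cons_measure (tuple_measure n')
  else \d_[tuple].

End tuple_measure.

(* The topology and norm of R[i] as a normed space over itself. *)
HB.instance Definition _ (R : realType) := NormedModule.copy R[i] R[i]^o.
HB.instance Definition _ (R : realType) := PseudoPointedMetric.copy R[i] R[i]^o.

Local Notation normc := ComplexField.Normc.normc.

Section complex_space.
Variables (R : realType) (n : nat).

Definition pairs_to_row (t : n.-tuple (R * R)) : 'rV[R[i]]_n :=
  \row_j ((tnth t j).1 +i* (tnth t j).2).

(* As [pairs_to_row] is a bijection R^2n -> C^n, these are the Borel sets of
   C^n. *)
Definition row_measurable : set (set 'rV[R[i]]_n) :=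
  [set A | measurable (pairs_to_row @^-1` A)].

Let row_measurable0 : row_measurable set0.
Proof. by rewrite /row_measurable /= preimage_set0. Qed.

Let row_measurableC A : row_measurable A -> row_measurable (~` A).
Proof.
by move=> mA; rewrite /row_measurable /= preimage_setC; exact: measurableC.
Qed.

Let row_measurable_bigcup (F : (set 'rV[R[i]]_n)^nat) :
  (forall k, row_measurable (F k)) -> row_measurable (\bigcup_k F k).
Proof.
move=> mF; rewrite /row_measurable /= preimage_bigcup.
by apply: bigcup_measurable => k _; exact: mF.
Qed.

HB.instance Definition _ := @isMeasurable.Build default_measure_display
  'rV[R[i]]_n row_measurable row_measurable0 row_measurableC
  row_measurable_bigcup.

Lemma measurable_pairs_to_row : measurable_fun setT pairs_to_row.
Proof. by move=> _ A mA; rewrite setTI. Qed.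

Definition complex_lebesgue : set 'rV[R[i]]_n -> \bar R :=
  pushforward
    (tuple_measure (prod_measure (@lebesgue_measure R) (@lebesgue_measure R)) n)
    pairs_to_row.

Let mpairs_to_row := measurable_pairs_to_row.

Let complex_lebesgue0 : complex_lebesgue set0 = 0%E.
Proof. by rewrite /complex_lebesgue /pushforward preimage_set0 measure0. Qed.

Let complex_lebesgue_ge0 A : (0 <= complex_lebesgue A)%E.
Proof. by rewrite /complex_lebesgue /pushforward measure_ge0. Qed.

Let complex_lebesgue_sigma_additive : semi_sigma_additive complex_lebesgue.
Proof. rewrite /complex_lebesgue; exact: measure_semi_sigma_additive. Qed.

HB.instance Definition _ := isMeasure.Build _ _ _ complex_lebesgue
  complex_lebesgue0 complex_lebesgue_ge0 complex_lebesgue_sigma_additive.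

Definition sqr_enorm (z : 'rV[R[i]]_n) : R := \sum_j normc (z ord0 j) ^+ 2.

Definition enorm (z : 'rV[R[i]]_n) : R := Num.sqrt (sqr_enorm z).

Definition unit_ball : set 'rV[R[i]]_n := [set z | enorm z < 1].

Lemma measurable_sqr_enorm : measurable_fun setT sqr_enorm.
Proof.
pose h (t : n.-tuple (R * R)) : R :=
  \sum_j ((tnth t j).1 ^+ 2 + (tnth t j).2 ^+ 2).
have hE : sqr_enorm \o pairs_to_row = h.
  apply/funext => t; apply: eq_bigr => j _; rewrite mxE /= sqr_sqrtr//.
  by rewrite addr_ge0 ?sqr_ge0.
have mh : measurable_fun setT h.
  apply: measurable_sum => j.
  by apply: measurable_funD; apply: measurable_funX;
    apply: measurableT_comp => //; exact: measurable_tnth.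
move=> _ A mA; rewrite setTI.
rewrite -[measurable _]/(measurable (pairs_to_row @^-1` (sqr_enorm @^-1` A))).
by rewrite -comp_preimage hE -[X in measurable X]setTI; exact: mh.
Qed.

Lemma measurable_enorm : measurable_fun setT enorm.
Proof.
apply: measurableT_comp measurable_sqr_enorm.
by apply: continuous_measurable_fun; exact: sqrt_continuous.
Qed.

Lemma measurable_unit_ball : measurable unit_ball.
Proof.
rewrite -[X in measurable X]setTI.
have -> : unit_ball = enorm @^-1` `]-oo, 1[%classic.
  by apply/seteqP; split => z /=; rewrite in_itv.
exact: measurable_enorm.
Qed.

(* The Dirac measure is the fallback that [mnormalize] asks for in case the
   measure of the ball were 0 or infinite. *)
Definition nu : set 'rV[R[i]]_n -> \bar R :=
  mnormalize (mrestr complex_lebesgue measurable_unit_ball)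
    (\d_(0 : 'rV[R[i]]_n)).

HB.instance Definition _ := Probability.on nu.

End complex_space.

Definition Gamma (R : realType) (s : R) : R :=
  \int[@lebesgue_measure R]_(t in `]0, +oo[) (t `^ (s - 1) * expR (- t)).

Section bergman_measure.
Variables (R : realType) (n : nat) (alpha : R).

Definition bergman_cst : R :=
  Gamma (n%:R + alpha + 1) / (Gamma (n%:R + 1) * Gamma (alpha + 1)).

Definition bergman_weight (z : 'rV[R[i]]_n) : R :=
  bergman_cst * (1 - enorm z ^+ 2) `^ alpha.

Definition nu_alpha (A : set 'rV[R[i]]_n) : \bar R :=
  (\int[@nu R n]_(z in A) (bergman_weight z)%:E)%E.

Lemma Gamma_ge0 (s : R) : 0 <= Gamma s.
Proof.
by apply: Rintegral_ge0 => t _; rewrite mulr_ge0 ?powR_ge0 ?expR_ge0.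
Qed.

Lemma bergman_weight_ge0 z : 0 <= bergman_weight z.
Proof. by rewrite mulr_ge0 ?powR_ge0// divr_ge0 ?mulr_ge0 ?Gamma_ge0. Qed.

Lemma measurable_bergman_weight : measurable_fun setT bergman_weight.
Proof.
apply: measurable_funM => //.
apply: (measurableT_comp (measurable_powR alpha)).
apply: measurable_funB => //; apply: measurable_funX; exact: measurable_enorm.
Qed.

Let nu_alpha0 : nu_alpha set0 = 0%E.
Proof. by rewrite /nu_alpha integral_set0. Qed.

Let nu_alpha_ge0 A : (0 <= nu_alpha A)%E.
Proof. by apply: integral_ge0 => z _; rewrite lee_fin bergman_weight_ge0. Qed.

Let nu_alpha_sigma_additive : semi_sigma_additive nu_alpha.
Proof.
move=> F mF tF mUF; rewrite /nu_alpha ge0_integral_bigcup//; last 2 first.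
- apply: measurable_funTS; apply/measurable_EFinP.
  exact: measurable_bergman_weight.
- by move=> z _; rewrite lee_fin bergman_weight_ge0.
apply: is_cvg_ereal_nneg_natsum_cond => k _ _.
by apply: integral_ge0 => z _; rewrite lee_fin bergman_weight_ge0.
Qed.

HB.instance Definition _ := isMeasure.Build _ _ _ nu_alpha
  nu_alpha0 nu_alpha_ge0 nu_alpha_sigma_additive.

End bergman_measure.

Lemma sqr_normcE (R : realType) (x : R[i]) :
  normc x ^+ 2 = complex.Re x ^+ 2 + complex.Im x ^+ 2.
Proof. by case: x => a b; rewrite /= sqr_sqrtr ?addr_ge0 ?sqr_ge0. Qed.

Lemma sqr_normcD (R : realType) (a x y : R[i]) :
  normc (a * x + y) ^+ 2 <= 2 * normc a ^+ 2 * normc x ^+ 2 + 2 * normc y ^+ 2.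
Proof.
rewrite -mulrA -exprMn -ComplexField.Normc.normcM; move: (a * x) => {a}x.
rewrite !sqr_normcE; case: x y => [x1 x2] [y1 y2] /=.
rewrite -subr_ge0 (_ : _ - _ = (x1 - y1) ^+ 2 + (x2 - y2) ^+ 2); last by ring.
by rewrite addr_ge0 ?sqr_ge0.
Qed.

Lemma complex_ReMD (R : realType) (a x y : R[i]) : complex.Re (a * x + y) =
  complex.Re a * complex.Re x - complex.Im a * complex.Im x + complex.Re y.
Proof. by case: a x y => [? ?] [? ?] [? ?]. Qed.

Lemma complex_ImMD (R : realType) (a x y : R[i]) : complex.Im (a * x + y) =
  complex.Re a * complex.Im x + complex.Im a * complex.Re x + complex.Im y.
Proof. by case: a x y => [? ?] [? ?] [? ?]. Qed.

Section bergman_space.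
Variables (R : realType) (n : nat) (alpha : R).
Local Notation Cn := 'rV[R[i]]_n.
Local Notation B := (@unit_ball R n).
Local Notation mu := (@nu_alpha R n alpha).

Definition cmeasurable (f : Cn -> R[i]) : Prop :=
  measurable_fun B (fun z => complex.Re (f z)) /\
  measurable_fun B (fun z => complex.Im (f z)).

(* [differentiable] over the field R[i]: complex Frechet differentiability. *)
Definition analytic (f : Cn -> R[i]) : Prop :=
  forall z, B z -> differentiable f z.

(* Functions rather than classes modulo equality almost everywhere. *)
Definition L2 : set (Cn -> R[i]) :=
  [set f | cmeasurable f /\
    (\int[mu]_(z in B) (normc (f z) ^+ 2)%:E < +oo)%E].

Definition Linf : set (Cn -> R[i]) :=
  [set g | cmeasurable g /\
    exists M : R, {ae @nu R n, forall z, B z -> normc (g z) <= M}].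

Definition inner (f g : Cn -> R[i]) : R[i] :=
  (\int[mu]_(z in B) complex.Re (f z * conjc (g z))) +i*
  (\int[mu]_(z in B) complex.Im (f z * conjc (g z))).

(* A class in L^2 has at most one analytic representative on the ball, which is
   extended by 0 to C^n so that equality in the Bergman space is Leibniz
   equality. *)
Definition bergman : {pred Cn -> R[i]} :=
  mem [set f | [/\ L2 f, analytic f & forall z, ~ B z -> f z = 0]].

Lemma measurable_sqr_normc (f : Cn -> R[i]) :
  cmeasurable f -> measurable_fun B (fun z => normc (f z) ^+ 2).
Proof.
move=> [mRe mIm]; rewrite (_ : (fun _ => _) =
  (fun z => complex.Re (f z) ^+ 2 + complex.Im (f z) ^+ 2)).
  by apply: measurable_funD; exact: measurable_funX.
by apply/funext => z; rewrite sqr_normcE.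
Qed.

Lemma bergman_submod_closed : submod_closed bergman.
Proof.
have mB : measurable B := @measurable_unit_ball R n.
split=> [|a f g].
  rewrite inE; split => //.
  split; first by split; exact: measurable_cst.
  by rewrite integral0_eq ?ltry// => z _; rewrite sqr_normcE /= expr0n addr0.
rewrite !inE => -[[mf foo] df f0] [[mg goo] dg g0].
have E z : (a *: f + g) z = a * f z + g z by [].
have mafg : cmeasurable (a *: f + g).
  have [mf1 mf2] := mf; have [mg1 mg2] := mg.
  pose a1 := complex.Re a; pose a2 := complex.Im a; split.
    rewrite (_ : (fun _ => _) = (fun z =>
      a1 * complex.Re (f z) - a2 * complex.Im (f z) + complex.Re (g z))).
      apply: measurable_funD => //.
      by apply: measurable_funB; apply: measurable_funM.
    by apply/funext => z; rewrite E complex_ReMD.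
  rewrite (_ : (fun _ => _) = (fun z =>
    a1 * complex.Im (f z) + a2 * complex.Re (f z) + complex.Im (g z))).
    apply: measurable_funD => //.
    by apply: measurable_funD; apply: measurable_funM.
  by apply/funext => z; rewrite E complex_ImMD.
split.
- split=> //.
  apply: (@le_lt_trans _ _ (\int[mu]_(z in B)
    ((2 * normc a ^+ 2)%:E * (normc (f z) ^+ 2)%:E +
     2%:E * (normc (g z) ^+ 2)%:E))%E).
    apply: ge0_le_integral => //.
    - by move=> z _; rewrite lee_fin sqr_ge0.
    - by apply/measurable_EFinP; exact: measurable_sqr_normc.
    - apply: emeasurable_funD; apply: measurable_funeM; apply/measurable_EFinP;
        exact: measurable_sqr_normc.
    - by move=> z _; rewrite -!EFinM -EFinD lee_fin E sqr_normcD.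
  have c0 : 0 <= 2 * normc a ^+ 2 by rewrite mulr_ge0 ?sqr_ge0.
  rewrite ge0_integralD//; first last.
  - apply: measurable_funeM; apply/measurable_EFinP.
    exact: measurable_sqr_normc.
  - by move=> z _; rewrite -EFinM lee_fin mulr_ge0 ?sqr_ge0.
  - apply: measurable_funeM; apply/measurable_EFinP.
    exact: measurable_sqr_normc.
  - by move=> z _; rewrite -EFinM lee_fin mulr_ge0 ?sqr_ge0.
  rewrite !ge0_integralZl//; first last.
  - by move=> z _; rewrite lee_fin sqr_ge0.
  - by apply/measurable_EFinP; exact: measurable_sqr_normc.
  - by move=> z _; rewrite lee_fin sqr_ge0.
  - by apply/measurable_EFinP; exact: measurable_sqr_normc.
  by rewrite lte_add_pinfty// lte_mul_pinfty.
- move=> z Bz; apply: differentiableD; last exact: dg.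
  by apply: differentiableZ; exact: df.
- by move=> z Bz; rewrite E f0// g0// mulr0 addr0.
Qed.

HB.instance Definition _ := GRing.isSubmodClosed.Build R[i] (Cn -> R[i]) bergman
  bergman_submod_closed.

Record bergman_space := BergmanSpace {
  bergman_val :> Cn -> R[i];
  bergman_valP : bergman_val \in bergman }.

HB.instance Definition _ := [isSub for bergman_val].
HB.instance Definition _ := [Choice of bergman_space by <:].
HB.instance Definition _ := [SubChoice_isSubLmodule of bergman_space by <:].

Local Notation A2 := bergman_space.

(* The element [h] is unique when it exists, which is the case for [f] in L2;
   [0] is a dummy value. *)
Definition bergman_proj (f : Cn -> R[i]) : A2 :=
  xget 0 [set h : A2 | forall k : A2, inner (f - h) k = 0].

Definition toeplitz (g : Cn -> R[i]) (phi : A2) : A2 :=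
  bergman_proj (g * (phi : Cn -> R[i])).

Definition norm2 (f : Cn -> R[i]) : R :=
  Num.sqrt (\int[mu]_(z in B) normc (f z) ^+ 2).

Definition opnorm_le (S : A2 -> A2) (c : R) : Prop :=
  forall phi : A2, norm2 (S phi) <= c * norm2 phi.

Definition bounded_operator (S : A2 -> A2) : Prop :=
  linear S /\ exists c : R, opnorm_le S c.

Definition is_adjoint (S S' : A2 -> A2) : Prop :=
  forall phi psi : A2, inner (S phi) psi = inner phi (S' psi).

Record Cstar_subalgebra (A : set (A2 -> A2)) : Prop := {
  Cstar_bounded : A `<=` bounded_operator;
  Cstar_0 : A 0;
  Cstar_add : forall S T, A S -> A T -> A (S + T);
  Cstar_scale : forall (a : R[i]) S, A S -> A (a *: S);
  Cstar_comp : forall S T, A S -> A T -> A (S \o T);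
  Cstar_adjoint : forall S S',
    A S -> bounded_operator S' -> is_adjoint S S' -> A S';
  Cstar_closed : forall S, bounded_operator S ->
    (forall e : R, 0 < e -> exists2 T, A T & opnorm_le (S - T) e) -> A S }.

Definition toeplitz_algebra : set (A2 -> A2) :=
  smallest Cstar_subalgebra [set toeplitz g | g in Linf].

End bergman_space.

Definition monomial (R : realType) (n : nat) (L : 'I_n -> nat)
    (z : 'rV[R[i]]_n) : R[i] :=
  \prod_j z ord0 j ^+ L j.

Definition bounded_on_ball (R : realType) (n : nat)
    (f : 'rV[R[i]]_n -> R[i]) : Prop :=
  exists M : R, forall z, unit_ball z -> normc (f z) <= M.

(* Main.v *)
(* For an operator [S] of the Toeplitz algebra all the commutators [S, T_{z_j}] and
   [S, T_{conj z_j}] are compact: this holds for [T_g] since the Hankel operator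
   [f |-> conj z_j f - P (conj z_j f)] is compact, its value at [z^m] having squared norm
   at most [||z^m||^2 / (n + |m| + alpha + 1)], and the operators with this property form
   a C*-algebra. If [S] commutes with [T_p], [p = z^L], so does [K = [S, T_{z_j}]], hence
   [K (p^k z^m) = p^k K (z^m)]. The normalised [p^k z^m] tend weakly to 0, so
   [||p^k K (z^m)||] is negligible with respect to [||p^k z^m||]; pairing with [p^k z^l],
   of comparable norm, shows that the coefficients of [K (z^m)] vanish. Thus [S] commutes
   with every [T_{z_j}], so [S phi = f phi] for [f = S 1], and [f] is bounded because
   [f^k = S^k 1] for all [k].
   Totality of the monomials, which all this relies on, is obtained by averaging an
   analytic function over tori of roots of unity (Goursat's lemma) and summing the
   averages with the Fejer kernel. *)
From HB Require Import structures.
Require Import Defs.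
From mathcomp Require Import all_boot all_order all_algebra.
From mathcomp Require Import complex.
From mathcomp Require Import all_classical all_reals all_analysis.
From mathcomp Require Import measurable_realfun.
From mathcomp Require Import ring lra.
Import Order.TTheory GRing.Theory Num.Theory.
Import numFieldNormedType.Exports.
Set Implicit Arguments.
Unset Strict Implicit.
Unset Printing Implicit Defensive.
Local Open Scope classical_set_scope.
Local Open Scope ring_scope.
Local Open Scope complex_scope.
Local Notation normc := ComplexField.Normc.normc.

(** * Rotations and moments of the weighted measure *)

(** [analytic] only asks for complex differentiability at each point, so power series have to be
    earned: Goursat's lemma is proved by quadrisection, with no continuity of the derivative. Finite
    averages over roots of unity replace torus integrals, so that several variables reduce to one
    coordinate at a time; the price is that homogeneity of an average holds only in the limit of
    many roots. All norms come from one Dirichlet integral; later estimates rest on its closed form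
    and on ratios of consecutive values. For T_g the commutator with T_{conj z_j} is -P g H_j, with
    H_j the Hankel operator, and the commutator with T_{z_j} is reached by adjunction; this is why
    both are tracked. That every L_j is at least 1 makes all exponents of p^k z^m grow as fast as
    its degree, so that the norms of p^k z^m and p^k z^l have bounded ratios. The bound on f comes
    from |f(z)|^k <= E_z c^k ||1||, where c bounds S: the point-dependent constant E_z disappears
    after taking k-th roots. *)

Definition preserves d (T : measurableType d) (R : realType)
    (m : set T -> \bar R) (f : T -> T) : Prop :=
  measurable_fun setT f /\ forall A, measurable A -> m (f @^-1` A) = m A.

Section preserves.
Context d (T : measurableType d) (R : realType).

Lemma preserves_id (m : set T -> \bar R) : preserves m id.
Proof. by split; [exact: measurable_id|]. Qed.

Lemma preserves_comp (m : set T -> \bar R) f g :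
  preserves m f -> preserves m g -> preserves m (f \o g).
Proof.
move=> [mf pf] [mg pg]; split; first exact: measurableT_comp.
move=> A mA; rewrite comp_preimage pg ?pf//.
by rewrite -[X in measurable X]setTI; exact: mf.
Qed.

Lemma ge0_integral_preserves (m : {measure set T -> \bar R}) f D
    (F : T -> \bar R) :
  preserves m f -> measurable D -> measurable_fun D F ->
  {in D, forall y, (0 <= F y)%E} ->
  (\int[m]_(x in f @^-1` D) F (f x) = \int[m]_(x in D) F x)%E.
Proof.
move=> [mf pf] mD mF F0.
rewrite -(ge0_integral_pushforward mf)//.
by apply: eq_measure_integral => A mA _; exact: pf.
Qed.

End preserves.

(** The existential hides the canonical structure of the pushforward: the scaling arguments below
    only need a bundled measure and its values. *)
Lemma pushforward_measure d1 d2 (T1 : measurableType d1)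
    (T2 : measurableType d2) (R : realType) (m : {measure set T1 -> \bar R})
    (f : T1 -> T2) :
  measurable_fun setT f ->
  exists m' : {measure set T2 -> \bar R}, forall A, m' A = m (f @^-1` A).
Proof.
move=> mf.
by exists (measure_function_pushforward__canonical__measure_function_Measure m mf).
Qed.

(** * Translations, shears and rotations preserve Lebesgue measure *)

Section plane.
Variable R : realType.
Local Notation leb := (@lebesgue_measure R).
Local Notation leb2 := (prod_measure leb leb).

(** Lebesgue measure is determined by its values on half-open intervals, and the pushforward under a
    translation has the same values there. *)
Lemma lebesgue_measure_shift (a : R) (A : set (measurableTypeR R)) :
  measurable A -> leb ((fun y => y + a) @^-1` A) = leb A.
Proof.
move=> mA.
have mf : measurable_fun setT ((fun y => y + a) : measurableTypeR R -> measurableTypeR R).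
  exact: measurable_funD.
apply/esym.
rewrite -[RHS]/(pushforward leb (fun y : measurableTypeR R => y + a : measurableTypeR R) A).
apply: lebesgue_measure_unique => //= _ [[b c]] _ <-.
rewrite /pushforward.
rewrite (_ : _ @^-1` _ = `]b - a, c - a]%classic); last first.
  by apply/seteqP; split => x /=; rewrite !in_itv/= ltrBlDr lerBrDr.
rewrite !lebesgue_measure_itv /= !lte_fin ltrD2r; case: ifP => // _.
by rewrite -!EFinD; congr EFin; ring.
Qed.

(** On each vertical section the shear is a translation, so the integral of the section measures is
    unchanged. *)
Lemma preserves_shear_snd (a : R) :
  preserves leb2 (fun p : measurableTypeR R * measurableTypeR R =>
    (p.1, p.2 + a * p.1) : measurableTypeR R * measurableTypeR R).
Proof.
have mf : measurable_fun setT
  (fun p : measurableTypeR R * measurableTypeR R =>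
    (p.1, p.2 + a * p.1) : measurableTypeR R * measurableTypeR R).
  apply: measurable_fun_pair => //.
  by apply: measurable_funD => //; apply: measurable_funM.
split=> // A mA.
rewrite /prod_measure /product_measure1 /=; apply: eq_integral => x _ /=.
rewrite (_ : xsection _ x = (fun y => y + a * x) @^-1` (xsection A x)).
  by rewrite lebesgue_measure_shift//; exact: measurable_xsection.
by apply/seteqP; split => y; rewrite /xsection/= !inE.
Qed.

Lemma preserves_swap :
  preserves leb2 (fun p : measurableTypeR R * measurableTypeR R =>
    (p.2, p.1) : measurableTypeR R * measurableTypeR R).
Proof.
have mf : measurable_fun setT
    (fun p : measurableTypeR R * measurableTypeR R =>
    (p.2, p.1) : measurableTypeR R * measurableTypeR R).
  exact: measurable_fun_pair.
split=> // A mA.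
apply/esym; rewrite -[RHS]/(pushforward leb2 (fun p : measurableTypeR R * measurableTypeR R =>
    (p.2, p.1) : measurableTypeR R * measurableTypeR R) A).
apply: product_measure_unique => // B C mB mC.
transitivity (leb2 (C `*` B)).
  by congr (leb2 _); apply/seteqP; split => -[x y] /= [].
by rewrite /prod_measure product_measure1E// muleC.
Qed.

Lemma preserves_shear_fst (a : R) :
  preserves leb2 (fun p : measurableTypeR R * measurableTypeR R =>
    (p.1 + a * p.2, p.2) : measurableTypeR R * measurableTypeR R).
Proof.
exact: (preserves_comp preserves_swap
  (preserves_comp (preserves_shear_snd a) preserves_swap)).
Qed.

Lemma preserves_rotation (c s : R) : c ^+ 2 + s ^+ 2 = 1 ->
  preserves leb2 (fun p : measurableTypeR R * measurableTypeR R =>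
    (c * p.1 - s * p.2, s * p.1 + c * p.2)
     : measurableTypeR R * measurableTypeR R).
Proof.
move=> cs1.
(* A rotation with nonzero sine is a product of three shears. *)
have rot s' c' : s' != 0 -> c' ^+ 2 + s' ^+ 2 = 1 ->
    preserves leb2 (fun p : measurableTypeR R * measurableTypeR R =>
    (c' * p.1 - s' * p.2, s' * p.1 + c' * p.2)
     : measurableTypeR R * measurableTypeR R).
  (* For c' = cos t and s' = sin t this is a = - tan (t / 2); [as1] and [as2] are the half-angle
     relations that the product of shears requires. *)
  move=> s0 h; pose a := (c' - 1) / s'.
  have as1 : a * s' = c' - 1 by rewrite /a divfK.
  have as2 : a * (c' + 1) = - s'.
    apply: (mulIf s0); rewrite mulrAC as1.
    by rewrite !expr2 in h *; lra.
  have := preserves_comp (preserves_shear_fst a)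
    (preserves_comp (preserves_shear_snd s') (preserves_shear_fst a)).
  congr (preserves _ _); apply/funext => -[x y] /=; congr pair.
    transitivity ((1 + a * s') * x + (a * s' * a + 2 * a) * y); first by ring.
    rewrite as1; transitivity (c' * x + a * (c' + 1) * y); first by ring.
    by rewrite as2; ring.
  transitivity (s' * x + (1 + a * s') * y); first by ring.
  by rewrite as1; ring.
have [s0|s0] := eqVneq s 0; last exact: rot.
have [->|->] : c = 1 \/ c = -1.
  have : (c - 1) * (c + 1) = 0 by rewrite s0 in cs1; lra.
  by move/eqP; rewrite mulf_eq0 => /orP[]/eqP ?; [left|right]; lra.
  have := @preserves_id _ _ R leb2; congr (preserves _ _).
  by apply/funext => -[x y] /=; rewrite s0; congr pair; ring.
(* The rotation by pi has zero sine; it is the square of the quarter turn. *)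
have r1 := @rot 1 0 (oner_neq0 _) ltac:(ring).
have := preserves_comp r1 r1; congr (preserves _ _).
by apply/funext => -[x y] /=; rewrite s0; congr pair; ring.
Qed.

End plane.

(** * Coordinatewise maps on tuple measures *)

Section tuple.
Context d (T : measurableType d) (R : realType).
Variable m : {sigma_finite_measure set T -> \bar R}.
Local Open Scope ereal_scope.

Lemma ge0_integral_tuple_measure n (F : n.+1.-tuple T -> \bar R) :
  measurable_fun setT F -> (forall t, 0 <= F t) ->
  \int[tuple_measure m n.+1]_t F t =
  \int[m]_x \int[tuple_measure m n]_t F [tuple of x :: t].
Proof.
move=> mF F0 /=; rewrite /cons_measure.
rewrite (ge0_integral_pushforward (@measurable_cons_pair _ _ n))//.
rewrite preimage_setT /prod_measure fubini_tonelli1//.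
  by apply: measurableT_comp => //; exact: measurable_cons_pair.
by move=> x; exact: F0.
Qed.

Definition map_coord n (f : 'I_n -> T -> T) (t : n.-tuple T) : n.-tuple T :=
  [tuple f i (tnth t i) | i < n].

(** Induction on the length: with the measure of a set written as an iterated integral of its
    indicator, the head map is absorbed by the outer integral and the tail map, by induction, by the
    inner one. *)
Lemma preserves_tuple n (f : 'I_n -> T -> T) :
  (forall i, preserves m (f i)) -> preserves (tuple_measure m n) (map_coord f).
Proof.
move=> pf; have mf k (g : 'I_k -> T -> T) : (forall i, preserves m (g i)) ->
    measurable_fun setT (map_coord g).
  move=> pg; apply/measurable_fun_tnthP => i.
  rewrite (_ : _ \o _ = g i \o (fun t => tnth t i)).
    by apply: measurableT_comp; [exact: (pg i).1|exact: measurable_tnth].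
  by apply/funext => t /=; rewrite tnth_mktuple.
split=> [|A mA]; first exact: mf.
elim: n f pf A mA => [|n IH] f pf A mA.
  congr (_ _); apply/seteqP.
  by split => t /=; rewrite (tuple0 t) (tuple0 (map_coord _ _)).
have mfA : measurable (map_coord f @^-1` A).
  by rewrite -[X in measurable X]setTI; exact: mf.
pose f' (i : 'I_n) := f (lift ord0 i).
have pf' : preserves (tuple_measure m n) (map_coord f').
  by split; [apply: mf => i; exact: pf|move=> B mB; apply: IH => // i; exact: pf].
have mcons x : measurable_fun setT (fun t : n.-tuple T => [tuple of x :: t]).
  apply: (@measurableT_comp _ _ _ _ _ _ _ _ (pair x) (@measurable_cons_pair _ _ n)).
  exact: measurable_pair1.
have int1 B : measurable B ->
    tuple_measure m n.+1 B = \int[tuple_measure m n.+1]_t (\1_B t : R)%:E.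
  by move=> mB; rewrite integral_indic// setIT.
rewrite (int1 _ mA) (int1 _ mfA).
have tm B : measurable B -> \int[tuple_measure m n.+1]_t (\1_B t : R)%:E =
    \int[m]_x \int[tuple_measure m n]_t (\1_B [tuple of x :: t] : R)%:E.
  move=> mB; apply: (@ge0_integral_tuple_measure n (fun t => (\1_B t : R)%:E)).
    by apply/measurable_EFinP; exact: measurable_indic.
  by move=> t; rewrite lee_fin.
rewrite (tm _ mA) (tm _ mfA).
pose G x := \int[tuple_measure m n]_t (\1_A [tuple of x :: t] : R)%:E.
rewrite -[RHS]/(\int[m]_x G x).
have mG : measurable_fun setT G.
  apply: (@measurable_fun_fubini_tonelli_F _ _ _ _ _ (tuple_measure m n)
    (fun p => (\1_A (cons_pair p) : R)%:E)) => //.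
  apply/measurable_EFinP; apply: measurableT_comp; first exact: measurable_indic.
  exact: measurable_cons_pair.
rewrite -(ge0_integral_preserves (pf ord0) measurableT mG); last first.
  by move=> x _; apply: integral_ge0 => t _; rewrite lee_fin.
rewrite preimage_setT; apply: eq_integral => x _; rewrite /G.
rewrite -(ge0_integral_preserves (F := fun t : n.-tuple T => (\1_A [tuple of f ord0 x :: t] : R)%:E)
  pf' measurableT); last 2 first.
  - by apply/measurable_EFinP; apply: measurableT_comp.
  - by move=> t _; rewrite lee_fin.
rewrite preimage_setT; apply: eq_integral => t _; congr EFin.
rewrite !indicE; congr (_%:R); congr (nat_of_bool _).
apply/idP/idP; rewrite !inE /=; congr A; apply: eq_from_tnth => i;
  rewrite tnth_mktuple; case: (unliftP ord0 i) => [j|] ->;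
  rewrite ?tnth0 ?tnthS ?tnth_mktuple//.
Qed.

End tuple.

(** * Convolutions of truncated powers *)

Section convolution.
Variable R : realType.
Local Notation leb := (@lebesgue_measure R).

(* [t `^ beta] cut to 0 on the negative half-line; without the cut, [powR] would
   give 1 there. *)
Definition ppow (beta t : R) : R := if 0 < t then t `^ beta else 0.

Lemma ppow_ge0 beta t : 0 <= ppow beta t.
Proof. by rewrite /ppow; case: ifP => // _; exact: powR_ge0. Qed.

Lemma measurable_ppow beta : measurable_fun setT (ppow beta).
Proof.
apply: measurable_fun_if => //.
- exact: measurable_fun_ltr.
- by apply: measurable_funTS; exact: measurable_powR.
Qed.

Lemma preserves_subr (r : R) :
  preserves leb (fun u => r - u : measurableTypeR R).
Proof.
have mN : preserves leb (fun u => - u : measurableTypeR R).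
  by split; [exact: oppr_measurable|exact: lebesgue_measureN].
have mS : preserves leb (fun u => u + r : measurableTypeR R).
  by split; [exact: measurable_funD|exact: lebesgue_measure_shift].
have := preserves_comp mS mN; congr preserves.
by apply/funext => u /=; rewrite addrC.
Qed.

Lemma ge0_integral_subr (r : R) (F : R -> \bar R) :
  measurable_fun setT F -> (forall x, 0 <= F x)%E ->
  (\int[leb]_u F (r - u)%R = \int[leb]_u F u)%E.
Proof.
move=> mF F0.
by rewrite -(ge0_integral_preserves (preserves_subr r) measurableT mF).
Qed.

Lemma integral_powR (beta r : R) : -1 < beta -> 0 < r ->
  (\int[leb]_(u in `]0%R, r]) (u `^ beta)%:E =
   (r `^ (beta + 1) / (beta + 1))%:E)%E.
Proof.
move=> b1 r0; have b0 : 0 < beta + 1 by lra.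
(* The integrand may be singular at 0, so the fundamental theorem of calculus is applied on these
   intervals and the limit taken by monotone convergence; [i.+2] makes the interval nondegenerate
   already for [i = 0]. *)
pose F i : set R := `[r / i.+2%:R, r]%classic.
have UF : `]0, r]%classic = \bigcup_i F i.
  apply/seteqP; split => [x /=|x [i _]]; rewrite /F /= !in_itv/=.
    move=> /andP[x0 xr]; exists (Num.truncn (r / x)) => //=; rewrite in_itv/= xr andbT.
    rewrite ler_pdivrMr// mulrC -ler_pdivrMr//.
    rewrite (le_trans (ltW (truncnS_gt _)))// ler_nat//.
  by move=> /andP[h ->]; rewrite andbT (lt_le_trans _ h)// divr_gt0.
rewrite UF.
have mp : measurable_fun (\bigcup_i F i) (fun u => (u `^ beta)%:E).
  by apply: measurable_funTS; apply/measurable_EFinP; exact: measurable_powR.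
have cv : (\int[leb]_(u in F i) (u `^ beta)%:E)%E @[i --> \oo] -->
    (\int[leb]_(u in \bigcup_i F i) (u `^ beta)%:E)%E.
  apply: ge0_nondecreasing_set_cvg_integral => //.
  - apply/nondecreasing_seqP => i; apply/subsetPset => x; rewrite /F/= !in_itv/=.
    move=> /andP[h ->]; rewrite andbT (le_trans _ h)//.
    by rewrite ler_pM2l// lef_pV2 ?posrE// ler_nat.
  - by move=> i; exact: measurable_itv.
  - by move=> i; apply: measurable_funTS; apply/measurable_EFinP; exact: measurable_powR.
  - by move=> i x _; rewrite lee_fin powR_ge0.
pose G (u : R) := (u `^ (beta + 1) / (beta + 1)).
have FE i : (\int[leb]_(u in F i) (u `^ beta)%:E = (G r - G (r / i.+2%:R))%:E)%E.
  have ri : 0 < r / i.+2%:R by rewrite divr_gt0.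
  rewrite EFinB /F; apply: continuous_FTC2.
  - by rewrite ltr_pdivrMr// ltr_pMr// ltr1n.
  - apply: continuous_in_subspaceT => x; rewrite inE/= in_itv/= => /andP[xr _].
    apply: differentiable_continuous; apply/derivable1_diffP.
    by apply: derivable_powR; rewrite in_itv/= andbT (lt_le_trans ri).
  - have dG x : 0 < x -> derivable G x 1.
      move=> x0; apply: derivableM; last exact: derivable_cst.
      by apply: derivable_powR; rewrite in_itv/= andbT.
    have cG x : 0 < x -> {for x, continuous G}.
      move=> x0; apply: differentiable_continuous; apply/derivable1_diffP.
      exact: dG.
    split.
    + by move=> x; rewrite in_itv/= => /andP[h _]; apply: dG; exact: lt_trans h.
    + by apply: cvg_at_right_filter; exact: cG.
    + by apply: cvg_at_left_filter; exact: cG.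
  - move=> x; rewrite in_itv/= => /andP[h _]; have x0 := lt_trans ri h.
    rewrite /G derive1Mr; last by apply: derivable_powR; rewrite in_itv/= andbT.
    rewrite powR_derive1 ?in_itv/= ?andbT// addrK.
    by rewrite mulrAC divff ?mul1r// gt_eqF.
have cv2 : (\int[leb]_(u in F i) (u `^ beta)%:E)%E @[i --> \oo] --> (G r)%:E.
  under eq_fun do rewrite FE.
  apply: cvg_EFin; first by near=> i.
  rewrite /comp/= -[X in _ --> X]subr0; apply: cvgB; first exact: cvg_cst.
  rewrite -[X in _ --> X](mul0r (beta + 1)^-1); apply: cvgMl.
  apply: (@cvg_comp _ _ _ (fun i => r / i.+2%:R) (fun u => u `^ (beta + 1)) _ (0^'+)).
    move=> A [e /= e0 Ae]; near=> i; apply: Ae => /=; last by rewrite divr_gt0.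
    rewrite sub0r normrN gtr0_norm ?divr_gt0// ltr_pdivrMr// mulrC -ltr_pdivrMr//.
    rewrite (@lt_trans _ _ i%:R)// ?ltr_nat//.
    by near: i; exact: nbhs_infty_gtr.
  exact: powR_cvg0.
exact: (cvg_unique _ cv cv2).
Unshelve. all: by end_near.
Qed.

Lemma ppow_conv0 (beta r : R) : -1 < beta ->
  (\int[leb]_u (ppow 0 (r - u) * ppow beta u)%:E =
   (ppow (beta + 1) r / (beta + 1))%:E)%E.
Proof.
move=> b1.
transitivity (\int[leb]_(u in `]0%R, r[) (u `^ beta)%:E)%E.
  rewrite [RHS]integral_mkcond; apply: eq_integral => u _.
  rewrite patchE mem_setE in_itv/= /ppow subr_gt0 powRr0.
  by case: (0 < u); case: (u < r) => /=; rewrite ?mul1r ?mul0r ?mulr0.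
rewrite {1}/ppow; case: ltP => r0; last first.
  by rewrite set_itv_ge ?integral_set0 ?mul0r// bnd_simp -leNgt.
rewrite integral_itv_bndo_bndc; first exact: integral_powR.
by apply: measurable_funTS; apply/measurable_EFinP; exact: measurable_powR.
Qed.

(** The Beta value B(k + 1, beta + 1), with the quotient of Gamma values written as a finite
    product. *)
Definition beta_cst (k : nat) (beta : R) : R :=
  k`!%:R / \prod_(l < k.+1) (beta + l.+1%:R).

Lemma measurable_ppowM a b (f g : R -> R) :
  measurable_fun setT f -> measurable_fun setT g ->
  measurable_fun setT (fun t => (ppow a (f t) * ppow b (g t))%:E).
Proof.
move=> mf mg; apply/measurable_EFinP; apply: measurable_funM.
  exact: measurableT_comp (measurable_ppow a) mf.
exact: measurableT_comp (measurable_ppow b) mg.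
Qed.

(** Induction on [k]: the truncated power of exponent k + 1 is k + 1 times the convolution of those
    of exponents 0 and k, and Tonelli gives associativity. Convolving with exponent 0 only
    integrates, which raises [beta] by 1. *)
Lemma ppow_conv (k : nat) (beta r : R) : -1 < beta ->
  (\int[leb]_t (ppow k%:R t * ppow beta (r - t))%:E =
   (beta_cst k beta * ppow (k%:R + beta + 1) r)%:E)%E.
Proof.
elim: k beta r => [|k IH] beta r b1.
  have -> : beta_cst 0 beta * ppow (0 + beta + 1) r =
      ppow (beta + 1) r / (beta + 1).
    by rewrite /beta_cst big_ord1 fact0 !add0r [LHS]mulrC mul1r.
  rewrite -(ppow_conv0 _ b1).
  rewrite -(ge0_integral_subr r); last 2 first.
  - apply: measurable_ppowM => //; exact: measurable_funB.
  - by move=> x; rewrite lee_fin mulr_ge0 ?ppow_ge0.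
  by apply: eq_integral => t _; congr (_ * _)%:E; congr (ppow _ _); ring.
have k1 : -1 < k%:R :> R by rewrite (lt_le_trans _ (ler0n _ _))// ltrN10.
pose f (p : measurableTypeR R * measurableTypeR R) :=
  (ppow 0 (p.1 - p.2) * ppow k%:R p.2 * ppow beta (r - p.1))%:E.
have mf : measurable_fun setT f.
  have m1 : measurable_fun setT
      (fun p : measurableTypeR R * measurableTypeR R => ppow 0 (p.1 - p.2)).
    apply: (measurableT_comp (measurable_ppow 0)).
    exact: measurable_funB.
  have m2 : measurable_fun setT
      (fun p : measurableTypeR R * measurableTypeR R => ppow k%:R p.2).
    exact: (measurableT_comp (measurable_ppow _)).
  have m3 : measurable_fun setT
      (fun p : measurableTypeR R * measurableTypeR R => ppow beta (r - p.1)).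
    apply: (measurableT_comp (measurable_ppow _)).
    exact: measurable_funB.
  apply/measurable_EFinP; apply: measurable_funM => //.
  exact: measurable_funM.
have f0 p : (0 <= f p)%E by rewrite lee_fin !mulr_ge0 ?ppow_ge0.
transitivity (k.+1%:R%:E * \int[leb]_t \int[leb]_s f (t, s))%E.
  rewrite -ge0_integralZl//; last 2 first.
  - exact: (@measurable_fun_fubini_tonelli_F _ _ _ _ _ _ f).
  - by move=> t _; apply: integral_ge0.
  apply: eq_integral => t _; rewrite /f.
  transitivity (k.+1%:R%:E * (\int[leb]_s ((ppow 0 (t - s) * ppow k%:R s)%:E *
      (ppow beta (r - t))%:E)))%E; last first.
    by congr (_ * _)%E; apply: eq_integral.
  rewrite ge0_integralZr//; last 3 first.
  - by apply: measurable_ppowM => //; exact: measurable_funB.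
  - by move=> s _; rewrite lee_fin mulr_ge0 ?ppow_ge0.
  - by rewrite lee_fin ppow_ge0.
  rewrite (ppow_conv0 _ k1) natr1 -!EFinM; congr EFin.
  by rewrite mulrA mulrCA divff ?mulr1// pnatr_eq0.
rewrite (@fubini_tonelli _ _ _ _ _ _ _ f mf f0).
transitivity (k.+1%:R%:E * \int[leb]_s
    ((ppow k%:R s * ppow (beta + 1) (r - s))%:E * ((beta + 1)^-1)%:E))%E.
  congr (_ * _)%E; apply: eq_integral => s _; rewrite /f.
  transitivity (\int[leb]_t ((ppow k%:R s)%:E *
       (ppow 0 (t - s) * ppow beta (r - t))%:E))%E.
    by apply: eq_integral => t _; rewrite -EFinM; congr EFin; ring.
  rewrite ge0_integralZl//; last 3 first.
  - by apply: measurable_ppowM => //; exact: measurable_funB.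
  - by move=> t _; rewrite lee_fin mulr_ge0 ?ppow_ge0.
  - by rewrite lee_fin ppow_ge0.
  rewrite -EFinM -mulrA EFinM; congr (_ * _)%E.
  rewrite -(ppow_conv0 _ b1) -(ge0_integral_subr r); last 2 first.
  - by apply: measurable_ppowM => //; exact: measurable_funB.
  - by move=> x; rewrite lee_fin mulr_ge0 ?ppow_ge0.
  by apply: eq_integral => t _; congr (ppow _ _ * ppow _ _)%:E; ring.
rewrite ge0_integralZr//; last 3 first.
- by apply: measurable_ppowM => //; exact: measurable_funB.
- by move=> s _; rewrite lee_fin mulr_ge0 ?ppow_ge0.
- by rewrite lee_fin invr_ge0; lra.
rewrite IH; last by lra.
rewrite -!EFinM; congr EFin.
rewrite (_ : k%:R + (beta + 1) + 1 = k.+1%:R + beta + 1); last by rewrite -natr1; ring.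
rewrite !mulrA mulrAC; congr (_ * _).
rewrite /beta_cst [in RHS]big_ord_recl/= factS natrM.
rewrite [in LHS](eq_bigr (fun i : 'I_k.+1 => beta + (bump 0 i).+1%:R)); last first.
  by move=> i _; rewrite /bump add1n -addrA -[i.+2%:R]natr1 [1 + _]addrC.
by rewrite invfM -!mulrA [_^-1 * (_ + 1)^-1]mulrC.
Qed.
End convolution.

(** * Polar coordinates: the image of planar Lebesgue measure under the squared norm *)

Section disc.
Variable R : realType.
Local Notation leb := (@lebesgue_measure R).
Local Notation leb2 := (prod_measure leb leb).
Local Notation plane := (measurableTypeR R * measurableTypeR R)%type.

Lemma leb_oc (b c : R) : leb `]b, c]%classic = (if b < c then c - b else 0)%:E.
Proof.
by have := lebesgue_measure_itv `]b, c]; rewrite /= lte_fin; case: ifP.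
Qed.

Lemma leb_cc (b c : R) : leb `[b, c]%classic = (if b < c then c - b else 0)%:E.
Proof.
by have := lebesgue_measure_itv `[b, c]; rewrite /= lte_fin; case: ifP.
Qed.

Definition qnorm (p : plane) : R := p.1 ^+ 2 + p.2 ^+ 2.

Lemma measurable_qnorm : measurable_fun setT qnorm.
Proof. by apply: measurable_funD; apply: measurable_funX. Qed.

Lemma qnorm_ge0 p : 0 <= qnorm p.
Proof. by rewrite addr_ge0 ?sqr_ge0. Qed.

Lemma qnormZ a x y : qnorm (a * x, a * y) = a ^+ 2 * qnorm (x, y).
Proof. by rewrite /qnorm/= !exprMn mulrDr. Qed.

Lemma lebesgue_measure_scale (a : R) (A : set (measurableTypeR R)) :
  0 < a -> measurable A ->
  (a%:E * leb ((fun y => a * y)%R @^-1` A) = leb A)%E.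
Proof.
move=> a0 mA.
have mf : measurable_fun setT ((fun y => a * y) : measurableTypeR R -> measurableTypeR R).
  exact: measurable_funM.
have a00 : 0 <= a by exact: ltW.
have [m1 m1E] := pushforward_measure leb mf.
rewrite -m1E; apply/esym; rewrite -[RHS]/(mscale (NngNum a00) m1 A).
apply: lebesgue_measure_unique => //= _ [[b c]] _ <-.
rewrite /mscale/= m1E.
rewrite (_ : _ @^-1` _ = `]b / a, c / a]%classic); last first.
  by apply/seteqP; split => x /=; rewrite !in_itv/= ltr_pdivrMr// ler_pdivlMr// [x * a]mulrC.
transitivity ((if b < c then c - b else 0)%:E); first exact: leb_oc.
transitivity (a%:E * (if b / a < c / a then c / a - b / a else 0)%:E)%E; last first.
  by congr (_ * _)%E; apply/esym; exact: leb_oc.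
rewrite ltr_pM2r ?invr_gt0// -EFinM; congr EFin; case: ifP => _.
  by rewrite mulrBr ![a * _]mulrC !divfK ?gt_eqF.
by rewrite mulr0.
Qed.

Lemma leb2X (B C : set (measurableTypeR R)) : measurable B -> measurable C ->
  leb2 (B `*` C) = (leb B * leb C)%E.
Proof. by move=> mB mC; rewrite /prod_measure product_measure1E. Qed.

Lemma leb2_scale (a : R) (A : set plane) : 0 < a -> measurable A ->
  ((a ^+ 2)%:E * leb2 ((fun p => (a * p.1, a * p.2)%R) @^-1` A) = leb2 A)%E.
Proof.
move=> a0 mA.
have mf : measurable_fun setT ((fun p => (a * p.1, a * p.2)) : plane -> plane).
  by apply: measurable_fun_pair; apply: measurable_funM.
have a00 : 0 <= a ^+ 2 by exact: sqr_ge0.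
have [m1 m1E] := pushforward_measure leb2 mf.
rewrite -m1E; apply/esym; rewrite -[RHS]/(mscale (NngNum a00) m1 A).
apply: product_measure_unique => // B C mB mC.
rewrite -[LHS]/((a ^+ 2)%:E * m1 (B `*` C))%E m1E.
rewrite (_ : _ @^-1` _ = (fun y => a * y) @^-1` B `*` (fun y => a * y) @^-1` C); last first.
  by apply/seteqP; split => -[x y] /=.
have mfa : measurable_fun setT ((fun y => a * y) : measurableTypeR R -> measurableTypeR R).
  exact: measurable_funM.
have mp D : measurable D -> measurable ((fun y : measurableTypeR R => a * y : measurableTypeR R) @^-1` D).
  by move=> mD; rewrite -[X in measurable X]setTI; exact: mfa.
transitivity ((a ^+ 2)%:E * (leb ((fun y => a * y)%R @^-1` B) *
    leb ((fun y => a * y)%R @^-1` C)))%E.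
  by congr (_ * _)%E; apply: leb2X; exact: mp.
transitivity ((a%:E * leb ((fun y => a * y)%R @^-1` B)) *
   (a%:E * leb ((fun y => a * y)%R @^-1` C)))%E; last first.
  by congr (_ * _)%E; exact: lebesgue_measure_scale.
by rewrite expr2 EFinM muleACA.
Qed.

(** The constant is kept symbolic; a square inside the disc and a square around it show that it is
    positive and finite. *)
Definition disc_area : \bar R := leb2 [set p | qnorm p <= 1].

Lemma measurable_qnorm_le t : measurable [set p | qnorm p <= t].
Proof.
rewrite -[X in measurable X]setTI.
rewrite (_ : [set p | _] = qnorm @^-1` `]-oo, t]%classic).
  by apply: measurable_qnorm => //; exact: measurable_itv.
by apply/seteqP; split => x /=; rewrite in_itv.
Qed.

Lemma leb2_rect (a b : R) : 0 <= b - a ->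
  leb2 (`[a, b]%classic `*` `[a, b]%classic) = ((b - a) ^+ 2)%:E.
Proof.
move=> ab; rewrite /prod_measure product_measure1E; try exact: measurable_itv.
transitivity ((if a < b then b - a else 0)%:E * (if a < b then b - a else 0)%:E)%E.
  by congr (_ * _)%E; exact: leb_cc.
rewrite -EFinM; congr EFin; case: ltP => h; first by rewrite expr2.
by rewrite mulr0 (_ : b - a = 0) ?expr0n//; lra.
Qed.

Lemma disc_area_fin : (disc_area < +oo)%E.
Proof.
apply: (@le_lt_trans _ _ (leb2 (`[-1, 1]%classic `*` `[-1, 1]%classic))); last first.
  by rewrite leb2_rect ?ltry//; lra.
apply: le_measure; rewrite ?inE; first exact: measurable_qnorm_le.
  by apply: measurableX; exact: measurable_itv.
move=> [x y] /=; rewrite /qnorm/= !in_itv/= => h.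
by split; rewrite -ler_norml -(@expr_le1 _ 2)// real_normK ?num_real//;
  have := sqr_ge0 x; have := sqr_ge0 y; lra.
Qed.

Lemma disc_area_gt0 : (0 < disc_area)%E.
Proof.
apply: (@lt_le_trans _ _ (leb2 (`[0, 2^-1]%classic `*` `[0, 2^-1]%classic))).
  by rewrite leb2_rect ?lte_fin ?exprn_gt0//; lra.
apply: le_measure; rewrite ?inE; last 2 first.
  exact: measurable_qnorm_le.
  move=> [x y] /=; rewrite /qnorm/= !in_itv/= => -[/andP[x0 x1] /andP[y0 y1]].
  have : x ^+ 2 <= 2^-1 ^+ 2 by rewrite lerXn2r ?nnegrE//; lra.
  have : y ^+ 2 <= 2^-1 ^+ 2 by rewrite lerXn2r ?nnegrE//; lra.
  lra.
by apply: measurableX; exact: measurable_itv.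
Qed.

Definition disc_cst : R := fine disc_area.

Lemma disc_areaE : disc_area = disc_cst%:E.
Proof. by rewrite fineK// ge0_fin_numE ?disc_area_fin ?ltW ?disc_area_gt0. Qed.

Lemma disc_cst_gt0 : 0 < disc_cst.
Proof. by rewrite -lte_fin -disc_areaE disc_area_gt0. Qed.

(** Dilation by the square root of [t] reduces to the unit disc; the maximum covers negative [t],
    where the set is empty. *)
Lemma leb2_disc t : leb2 [set p | qnorm p <= t] = (disc_cst * Num.max 0 t)%:E.
Proof.
have [t0|t0|t0] := ltgtP 0 t.
- have s0 : 0 < Num.sqrt t by rewrite sqrtr_gt0.
  rewrite -(leb2_scale s0 (measurable_qnorm_le t)) sqr_sqrtr ?ltW//.
  rewrite EFinM muleC -disc_areaE; congr (leb2 _ * _)%E.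
  have E p : (qnorm (Num.sqrt t * p.1, Num.sqrt t * p.2) <= t) = (qnorm p <= 1).
    case: p => x y; rewrite qnormZ sqr_sqrtr; last exact: ltW.
    by rewrite -[X in _ <= X]mulr1 ler_pM2l.
  by apply/seteqP; split => p /=; rewrite E.
- rewrite mulr0 (_ : [set p | _] = set0) ?measure0//.
  apply/seteqP; split => p //= h; have := qnorm_ge0 p; lra.
- rewrite -t0 mulr0 (_ : [set p | _] = [set 0] `*` [set 0]).
    transitivity (leb [set 0%R] * leb [set 0%R])%E; first exact: leb2X.
    have -> : leb [set 0] = 0%E := lebesgue_measure_set1 (0 : R).
    by rewrite mule0.
  apply/seteqP; split => -[x y] /=; rewrite /qnorm/=.
    move=> h; have := sqr_ge0 x; have := sqr_ge0 y => hy hx.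
    by split; apply/eqP; rewrite -sqrf_eq0; apply/eqP; lra.
  by move=> [-> ->]; rewrite expr0n addr0.
Qed.

Lemma pushforward_qnorm (A : set (measurableTypeR R)) :
  measurable A -> A `<=` `]0, +oo[%classic ->
  leb2 (qnorm @^-1` A) = (disc_cst%:E * leb A)%E.
Proof.
move=> mA A0.
have mq : measurable_fun setT (qnorm : plane -> measurableTypeR R).
  exact: measurable_qnorm.
have c0 := disc_cst_gt0.
have ic0 : 0 <= disc_cst^-1 by rewrite invr_ge0 ltW.
have [nq nqE] := pushforward_measure leb2 mq.
(* Uniqueness of Lebesgue measure is a statement about the whole line, whereas [qnorm] is
   nonnegative: the missing half-line is filled with Lebesgue measure itself, and it drops out for
   sets of positive numbers. *)
pose m' : {measure set (measurableTypeR R) -> \bar R} :=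
  measure_add (mscale (NngNum ic0) nq) (mrestr leb (measurable_itv `]-oo, (0:R)])).
have m'E X : m' X = (disc_cst^-1%:E * nq X + leb (X `&` `]-oo, 0%R]))%E.
  exact: measure_addE.
have E : leb A = m' A.
  apply: lebesgue_measure_unique => //= _ [[a b]] _ <-.
  rewrite m'E nqE leb_oc /=.
  case: ltP => ab; last first.
    by rewrite set_itv_ge ?preimage_set0 ?set0I ?measure0 ?mule0 ?adde0// bnd_simp -leNgt.
  have -> : leb2 (qnorm @^-1` `]a, b]%classic) =
      (disc_cst * (Num.max 0 b - Num.max 0 a))%:E.
    rewrite (_ : _ @^-1` _ = [set p | qnorm p <= b] `\` [set p | qnorm p <= a]); last first.
      apply/seteqP; split => p /=; rewrite in_itv/=.
        by move=> /andP[h ->]; split => //; apply/negP; rewrite -ltNge.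
      by move=> [-> /negP]; rewrite -ltNge andbT.
    have hb : (leb2 [set p | (qnorm p <= b)%R] < +oo)%E by rewrite leb2_disc ltry.
    transitivity (leb2 [set p | (qnorm p <= b)%R] -
        leb2 ([set p | (qnorm p <= b)%R] `&` [set p | (qnorm p <= a)%R]))%E.
      by apply: measureD => //; exact: measurable_qnorm_le.
    rewrite (_ : _ `&` _ = [set p | qnorm p <= a]); last first.
      by apply/seteqP; split => p /=; [case|move=> h; split => //; lra].
    by rewrite !leb2_disc -EFinB mulrBr.
  rewrite -EFinM mulKf ?gt_eqF//.
  rewrite (_ : _ `&` _ = `]a, (Num.min b 0)]%classic); last first.
    apply/seteqP; split => x /=; rewrite !in_itv/= le_min.
      by move=> [/andP[-> ->] ->].
    by move=> /andP[-> /andP[-> ->]].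
  rewrite leb_oc lt_min ab/= /Num.max /Num.min.
  rewrite -EFinD; congr EFin; clear -ab.
  by case: (ltP 0 b) => b0; case: (ltP 0 a) => a0; case: (ltP b 0) => b0';
    case: (ltP a 0) => a0'; lra.
rewrite E m'E nqE (_ : _ `&` _ = set0) ?measure0 ?adde0; last first.
  apply/seteqP; split => x //= -[/A0]; rewrite /= !in_itv/= andbT => x0 x0'; lra.
by rewrite muleA -EFinM divff ?mul1e// gt_eqF.
Qed.

Lemma ge0_integral_qnorm (F : R -> \bar R) : measurable_fun setT F ->
  (forall x, 0 <= F x)%E ->
  (\int[leb2]_p F (qnorm p) = disc_cst%:E * \int[leb]_(t in `]0%R, +oo[) F t)%E.
Proof.
move=> mF F0.
have mq := measurable_qnorm.
have c0 : 0 <= disc_cst by rewrite ltW ?disc_cst_gt0.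
have m1 : measurable (qnorm @^-1` `]0, +oo[%classic).
  by rewrite -[X in measurable X]setTI; apply: mq.
have mFq : measurable_fun setT (fun p => F (qnorm p)) by exact: measurableT_comp.
have N0 : leb2 [set p | qnorm p <= 0] = 0%E by rewrite leb2_disc maxxx mulr0.
rewrite (ge0_negligible_integral _ _ _ _ N0)//; last exact: measurable_qnorm_le.
rewrite (_ : setT `\` _ = qnorm @^-1` `]0, +oo[%classic); last first.
  apply/seteqP; split => p /=; rewrite in_itv/= andbT.
    by move=> [_ /negP]; rewrite -ltNge.
  by move=> h; split => //; apply/negP; rewrite -ltNge.
have mq' : measurable_fun setT (qnorm : plane -> measurableTypeR R) by [].
rewrite -(ge0_integral_pushforward mq')//; last exact: measurable_funTS.
rewrite -[disc_cst]/((NngNum c0)%:num) -ge0_integral_mscale//; last first.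
  exact: measurable_funTS.
apply: eq_measure_integral => A mA A0.
exact: pushforward_qnorm.
Qed.

Lemma ge0_integral_ppow_qnorm (k : nat) (beta r : R) : -1 < beta ->
  (\int[leb2]_p (qnorm p ^+ k * ppow beta (r - qnorm p))%:E =
   (disc_cst * beta_cst k beta * ppow (k%:R + beta + 1) r)%:E)%E.
Proof.
move=> b1.
have m1 : measurable_fun setT (fun t : R => ppow beta (r - t)).
  by apply: measurableT_comp (measurable_ppow _) _; exact: measurable_funB.
(* The factor [ppow 0] cuts off the negative half-line, so that F is nonnegative everywhere and its
   integral becomes the convolution of [ppow_conv]. *)
pose F (t : R) := (ppow 0 t * t ^+ k * ppow beta (r - t))%:E.
have mF : measurable_fun setT F.
  apply/measurable_EFinP; apply: measurable_funM => //; apply: measurable_funM => //.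
  exact: measurable_ppow.
have F0 t : (0 <= F t)%E.
  rewrite lee_fin /ppow; case: ifP => t0; rewrite ?mul0r// powRr0 mul1r.
  by rewrite mulr_ge0 ?ppow_ge0// exprn_ge0// ltW.
transitivity (\int[leb2]_p F (qnorm p))%E.
  have N0 : leb2 [set p | qnorm p <= 0] = 0%E by rewrite leb2_disc maxxx mulr0.
  rewrite (ge0_negligible_integral _ _ _ _ N0)//; last 3 first.
  - exact: measurable_qnorm_le.
  - apply/measurable_EFinP; apply: measurable_funM.
      by apply: measurable_funX; exact: measurable_qnorm.
    by apply: measurableT_comp m1 _; exact: measurable_qnorm.
  - by move=> p _; rewrite lee_fin mulr_ge0 ?ppow_ge0 ?exprn_ge0 ?qnorm_ge0.
  rewrite [RHS](ge0_negligible_integral _ _ _ _ N0)//; last 2 first.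
  - exact: measurable_qnorm_le.
  - by apply: measurableT_comp mF _; exact: measurable_qnorm.
  apply: eq_integral => p; rewrite inE => -[_ /negP]; rewrite -ltNge => p0.
  by rewrite /F /ppow p0 powRr0 mul1r.
rewrite (ge0_integral_qnorm mF F0) -mulrA EFinM -(ppow_conv _ _ b1).
rewrite integral_mkcond; congr (_ * _)%E.
apply: eq_integral => t _; rewrite patchE mem_setE in_itv/= andbT /F /ppow.
case: (ltP 0 t) => t0; last by rewrite mul0r.
by rewrite powR_mulrn ?powRr0 ?mul1r// ltW.
Qed.

End disc.

(** * Dirichlet integrals *)

Section dirichlet.
Variable R : realType.
Local Notation leb := (@lebesgue_measure R).
Local Notation leb2 := (prod_measure leb leb).

(** The denominator is Gamma(beta + n + |m| + 1) / Gamma(beta + 1), so this is the classical value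
    of the Dirichlet integral with the symbolic disc area in the place of pi. *)
Definition dirichlet_cst n (m : 'I_n -> nat) (beta : R) : R :=
  disc_cst R ^+ n * (\prod_i (m i)`!)%:R /
  \prod_(l < n + \sum_i m i) (beta + l.+1%:R).

Lemma measurable_dirichlet n (m : 'I_n -> nat) (beta r : R) :
  measurable_fun setT (fun t : n.-tuple (measurableTypeR R * measurableTypeR R) =>
    (\prod_i qnorm (tnth t i) ^+ m i * ppow beta (r - \sum_i qnorm (tnth t i)))%:E).
Proof.
have mq i : measurable_fun setT
    (fun t : n.-tuple (measurableTypeR R * measurableTypeR R) => qnorm (tnth t i)).
  by apply: measurableT_comp; [exact: measurable_qnorm|exact: measurable_tnth].
apply/measurable_EFinP; apply: measurable_funM.
  by apply: measurable_prod => i _; exact: measurable_funX.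
apply: (measurableT_comp (measurable_ppow beta)).
by apply: measurable_funB => //; exact: measurable_sum.
Qed.

Lemma dirichlet_ge0 n (m : 'I_n -> nat) (beta r : R)
    (t : n.-tuple (measurableTypeR R * measurableTypeR R)) :
  (0 <= (\prod_i qnorm (tnth t i) ^+ m i *
     ppow beta (r - \sum_i qnorm (tnth t i)))%:E)%E.
Proof.
rewrite lee_fin mulr_ge0 ?ppow_ge0// prodr_ge0// => i _.
by rewrite exprn_ge0 ?qnorm_ge0.
Qed.

Lemma dirichlet_cst_recl n (m : 'I_n.+1 -> nat) (beta : R) :
  dirichlet_cst (fun i => m (lift ord0 i)) beta *
    (disc_cst R * beta_cst (m ord0)
      ((n + \sum_i m (lift ord0 i))%:R + beta)) = dirichlet_cst m beta.
Proof.
rewrite /dirichlet_cst /beta_cst.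
rewrite [in RHS](big_ord_recl n (fun i => (m i)`!)) natrM.
rewrite [in RHS](big_ord_recl n m).
rewrite (_ : (n.+1 + (m ord0 + \sum_i m (lift ord0 i)) =
  (n + \sum_i m (lift ord0 i)) + (m ord0).+1)%N); last by ring.
rewrite [in RHS]big_split_ord/= exprS invfM.
rewrite (eq_bigr (fun i : 'I_(m ord0).+1 =>
  beta + (n + \sum_i0 m (lift ord0 i0) + i).+1%:R)); last first.
  by move=> i _; rewrite -addnS [(_ + i.+1)%:R]natrD addrA [beta + _]addrC.
by ring.
Qed.

(** The radius [r] is general because fixing the first coordinate x leaves the same integral with
    [r - qnorm x]; by induction this is a power of that difference, and one integral over the plane
    remains. *)
Lemma integral_dirichlet n (m : 'I_n -> nat) (beta r : R) : -1 < beta ->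
  (\int[tuple_measure leb2 n]_t
     (\prod_i qnorm (tnth t i) ^+ m i * ppow beta (r - \sum_i qnorm (tnth t i)))%:E
   = (dirichlet_cst m beta * ppow ((n + \sum_i m i)%:R + beta) r)%:E)%E.
Proof.
move=> b1; elim: n m r => [|n IH] m r.
  rewrite /= integral_dirac//; last exact: measurable_dirichlet.
  rewrite diracE mem_setT mul1e /dirichlet_cst !big_ord0 add0r subr0.
  by rewrite expr0 !mul1r invr1 mul1r.
rewrite (ge0_integral_tuple_measure leb2 (@measurable_dirichlet _ m beta r)); last first.
  exact: dirichlet_ge0.
set N := (n + \sum_i m (lift ord0 i))%N.
have b2 : -1 < N%:R + beta by rewrite ltr_wpDl.
transitivity (\int[leb2]_x ((dirichlet_cst (fun i => m (lift ord0 i)) beta)%:E *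
   (qnorm x ^+ m ord0 * ppow (N%:R + beta) (r - qnorm x))%:E))%E.
  apply: eq_integral => x _.
  transitivity (\int[tuple_measure leb2 n]_t ((qnorm x ^+ m ord0)%:E *
    (\prod_i qnorm (tnth t i) ^+ m (lift ord0 i) *
      ppow beta ((r - qnorm x) - \sum_i qnorm (tnth t i)))%:E))%E.
    apply: eq_integral => t _; rewrite -EFinM; congr EFin.
    rewrite !big_ord_recl !tnth0 -!mulrA opprD addrA; congr (_ * (_ * ppow _ _)).
      by apply: eq_bigr => i _; rewrite tnthS.
    by congr (_ - _); apply: eq_bigr => i _; rewrite tnthS.
  rewrite ge0_integralZl//; last 3 first.
  - exact: measurable_dirichlet.
  - by move=> t _; exact: dirichlet_ge0.
  - by rewrite lee_fin exprn_ge0 ?qnorm_ge0.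
  by rewrite IH -!EFinM; congr EFin; rewrite mulrCA.
rewrite ge0_integralZl//; last 3 first.
- apply/measurable_EFinP; apply: measurable_funM.
    by apply: measurable_funX; exact: measurable_qnorm.
  apply: (measurableT_comp (measurable_ppow _)).
  by apply: measurable_funB => //; exact: measurable_qnorm.
- by move=> x _; rewrite lee_fin mulr_ge0 ?ppow_ge0 ?exprn_ge0 ?qnorm_ge0.
- rewrite lee_fin /dirichlet_cst divr_ge0//.
    by rewrite mulr_ge0 ?exprn_ge0 ?ler0n// ltW// disc_cst_gt0.
  apply: prodr_ge0 => i _; rewrite -natr1 addrCA addr_ge0 ?ler0n//.
  by rewrite -lerBlDr sub0r ltW.
rewrite (ge0_integral_ppow_qnorm _ _ b2) -EFinM; congr EFin.
rewrite mulrA dirichlet_cst_recl; congr (_ * ppow _ _).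
rewrite big_ord_recl /N -addrA addrAC addrA; congr (_ + _).
by rewrite natr1 -natrD; congr (_%:R); ring.
Qed.

End dirichlet.

(** * Integration against a measure given by a density *)

Section density.
Context d (T : measurableType d) (R : realType).
Variables (m m' : {measure set T -> \bar R}) (g : T -> R).
Hypotheses (mg : measurable_fun setT g) (g0 : forall x, 0 <= g x).
Hypothesis m'E : forall A, measurable A -> m' A = (\int[m]_(x in A) (g x)%:E)%E.
Local Open Scope ereal_scope.
Import HBNNSimple.

Lemma ge0_integral_density D (F : T -> \bar R) :
  measurable D -> measurable_fun D F -> (forall x, D x -> 0 <= F x) ->
  \int[m']_(x in D) F x = \int[m]_(x in D) (F x * (g x)%:E).
Proof.
move=> mD mF F0; pose h := nnsfun_approx mD mF.
have mgD : measurable_fun D (EFin \o g).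
  by apply: measurable_funTS; apply/measurable_EFinP.
have nd x : D x -> {homo (fun n => h n x) : a b / (a <= b)%N >-> (a <= b)%R}.
  by move=> Dx a b ab; exact/lefP/nd_nnsfun_approx.
transitivity (limn (fun n => \int[m']_(x in D) (h n x)%:E)).
  rewrite -monotone_convergence//.
  - by apply: eq_integral => x /[!inE] Dx; apply/esym/cvg_lim => //; exact: cvg_nnsfun_approx.
  - by move=> n; exact/measurable_EFinP/measurable_funTS.
  - by move=> n x _; rewrite lee_fin.
transitivity (limn (fun n => \int[m]_(x in D) ((h n x)%:E * (g x)%:E))); last first.
  rewrite -monotone_convergence//.
  - apply: eq_integral => x /[!inE] Dx; apply/cvg_lim => //.
    by apply: cvgeZr => //; exact: cvg_nnsfun_approx.
  - move=> n; apply: emeasurable_funM => //.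
    exact/measurable_EFinP/measurable_funTS.
  - by move=> n x _; rewrite mule_ge0// lee_fin.
  - by move=> x Dx a b ab; rewrite lee_wpmul2r// ?lee_fin//; exact: nd.
congr (limn _); apply/funext => n.
have mi r : measurable_fun D (fun x => (r * \1_(h n @^-1` [set r]) x)%:E).
  by apply: measurable_funTS; apply/measurable_EFinP; exact: measurable_funM.
transitivity (\int[m']_(x in D)
   (\sum_(y \in range (h n)) (y * \1_(h n @^-1` [set y]) x)%:E)).
  by apply: eq_integral => t tE; rewrite fimfunE -fsumEFin.
rewrite ge0_integral_fsum//; last by move=> r x _; exact: nnfun_muleindic_ge0.
transitivity (\int[m]_(x in D)
   (\sum_(y \in range (h n)) (y * \1_(h n @^-1` [set y]) x * g x)%:E)); last first.
  apply: eq_integral => t tE; rewrite fsumEFin// -EFinM fimfunE; congr EFin.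
  by rewrite !fsbig_finite//= mulr_suml.
rewrite ge0_integral_fsum//; last 2 first.
- move=> r; apply: measurable_funTS; apply/measurable_EFinP; apply: measurable_funM => //.
  exact: measurable_funM.
- by move=> r x _; rewrite EFinM mule_ge0 ?lee_fin//; exact: nnfun_muleindic_ge0.
apply: eq_fsbigr => r _.
rewrite integralZl_indic_nnsfun// integral_indic//.
have [r0|r0] := ltP r 0%R.
  rewrite preimage_nnfun0// set0I measure0 mule0 integral0_eq// => x _.
  by rewrite indic0 mulr0 mul0r.
rewrite m'E; last exact: measurableI.
rewrite setIC integral_mkcondr -ge0_integralZl//; last 2 first.
- apply/(measurable_restrict _ _ _) => //; apply: measurable_funTS.
  exact/measurable_EFinP.
- by move=> x Dx; rewrite erestrict_ge0// => y _; rewrite lee_fin.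
apply: eq_integral => x _; rewrite patchE indicE -mulrA EFinM; congr (_ * _).
by case: ifP => _; rewrite ?mul1r ?mul0r.
Qed.

End density.

(** * Gamma is positive and finite *)

Section gamma.
Variable R : realType.
Local Notation leb := (@lebesgue_measure R).

Let gam (s t : R) : R := t `^ (s - 1) * expR (- t).

Let gam_ge0 s t : 0 <= gam s t.
Proof. by rewrite mulr_ge0 ?powR_ge0 ?expR_ge0. Qed.

Let measurable_gam s : measurable_fun setT (fun t => (gam s t)%:E).
Proof.
apply/measurable_EFinP; apply: measurable_funM; first exact: measurable_powR.
by apply: measurableT_comp => //; exact: measurable_funN.
Qed.

(** With a = max(1, s - 1), the inequality ln x <= x at x = t / (2 a) gives a ln t <= t / 2 + a ln
    (2 a), whence the constant. *)
Lemma powR_le_expR (s : R) : exists2 C, 0 <= C &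
  forall t, 1 <= t -> t `^ (s - 1) <= C * expR (t / 2).
Proof.
pose a := Num.max 1 (s - 1).
have a1 : 1 <= a by rewrite le_max lexx.
have a0 : 0 < a by exact: lt_le_trans a1.
exists (expR (a * ln (2 * a))) => [|t t1]; first exact: expR_ge0.
have t0 : 0 < t by exact: lt_le_trans t1.
rewrite (@le_trans _ _ (t `^ a))//; first by rewrite ler_powR// le_max lexx orbT.
rewrite /powR gt_eqF// -expRD ler_expR.
have -> : t = (t / (2 * a)) * (2 * a) by rewrite divfK// gt_eqF// mulr_gt0.
have ta : 0 < t / (2 * a) by rewrite divr_gt0// mulr_gt0.
rewrite lnM ?posrE ?mulr_gt0//.
have : ln (t / (2 * a)) <= t / (2 * a).
  by rewrite ltW// ln_sublinear.
have -> : t / (2 * a) * (2 * a) / 2 = a * (t / (2 * a)).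
  by rewrite -mulrA (_ : 2 * a / 2 = a) 1?mulrC//; field.
  by move=> h; rewrite mulrDr addrC lerD2l ler_pM2l.
by rewrite invr_gt0 mulr_gt0.
Qed.

(** [Gamma] is the real value of an extended integral and would read 0 for a divergent one, so
    finiteness is proved along with positivity: near 0 by comparison with a power, beyond 1 with an
    exponential density. *)
Lemma Gamma_gt0 (s : R) : 0 < s -> 0 < Gamma s.
Proof.
move=> s0; rewrite /Gamma /Rintegral; apply: fine_gt0.
have mg D := measurable_funTS (D := D) (measurable_gam s).
have s1 : -1 < s - 1 by rewrite ltrBDr addNr.
apply/andP; split.
  (* On [1, 2] both t and ln t are at most 2, so this constant is a lower bound of the integrand
     there. *)
  have h1 : (0 < \int[leb]_(t in `[1%R, 2%R]) (expR (- (2 * `|s - 1| + 2)))%:E)%E.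
    rewrite integral_cst//= lebesgue_measure_itv/= lte_fin ltr1n -EFinD.
    by rewrite -EFinM lte_fin mulr_gt0 ?expR_gt0//; lra.
  apply: (lt_le_trans h1).
  have h2 : (\int[leb]_(t in `[1%R, 2%R]) (expR (- (2 * `|s - 1| + 2)))%:E <=
      \int[leb]_(t in `[1%R, 2%R]) (gam s t)%:E)%E.
    apply: ge0_le_integral => //; first exact: mg.
    - move=> t; rewrite /= in_itv/= => /andP[t1 t2].
      have t0 : 0 < t by exact: lt_le_trans t1.
      rewrite lee_fin /gam /powR gt_eqF// -expRD ler_expR opprD.
      apply: lerD; last by rewrite lerN2.
      rewrite -lerN2 opprK -mulNr (le_trans (ler_norm _))// normrM normrN mulrC.
      rewrite ler_wpM2r// ger0_norm ?ln_ge0//.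
      by rewrite (le_trans _ t2)// ltW// ln_sublinear.
  apply: (le_trans h2).
  apply: ge0_subset_integral => //; first exact: mg.
  - by move=> t _; rewrite lee_fin.
  - by move=> t; rewrite /= !in_itv/= andbT => /andP[t1 _]; exact: lt_le_trans t1.
rewrite -[X in (X < _)%E]/(\int[leb]_(t in `]0%R, +oo[) (gam s t)%:E)%E.
rewrite (_ : `]0, +oo[%classic = `]0, 1]%classic `|` `]1, +oo[%classic); last first.
  apply/seteqP; split => t /=; rewrite !in_itv/= ?andbT.
    by move=> t0; rewrite t0/=; case: (leP t 1) => h; [left|right].
  by move=> [/andP[]//|t1]; exact: lt_trans t1.
rewrite ge0_integral_setU//; last 3 first.
- exact: mg.
- by move=> t _; rewrite lee_fin.
- apply/disj_setPS => t []; rewrite /= !in_itv/= andbT => /andP[_ t1] t1'; lra.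
apply: lte_add_pinfty.
  have h : (\int[leb]_(t in `]0%R, 1%R]) (gam s t)%:E <=
      \int[leb]_(t in `]0%R, 1%R]) (t `^ (s - 1))%:E)%E.
    apply: ge0_le_integral => //.
    - by move=> t _; rewrite lee_fin.
    - exact: mg.
    - by apply: measurable_funTS; apply/measurable_EFinP; exact: measurable_powR.
    - move=> t; rewrite /= in_itv/= => /andP[t0 _]; rewrite lee_fin /gam.
      by rewrite ler_piMr ?powR_ge0// -expR0 ler_expR oppr_le0 ltW.
  by apply: (le_lt_trans h); rewrite integral_powR// ltry.
have [C C0 hC] := powR_le_expR s.
have mpdf : measurable_fun setT (fun t : R => (2 * C * exponential_pdf 2^-1 t)%:E).
  by apply/measurable_EFinP; apply: measurable_funM => //; exact: measurable_exponential_pdf.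
have h1 : (\int[leb]_(t in `]1%R, +oo[) (gam s t)%:E <=
   \int[leb]_(t in `]1%R, +oo[) (2 * C * exponential_pdf 2^-1 t)%:E)%E.
  apply: ge0_le_integral => //.
  - by move=> t _; rewrite lee_fin.
  - exact: mg.
  - exact: measurable_funTS.
  - move=> t; rewrite /= in_itv/= andbT => /ltW t1; rewrite lee_fin /gam.
    have t0 : 0 <= t by exact: le_trans t1.
    rewrite exponential_pdfE// (_ : - t = t / 2 * -1 + (- t / 2)); last by field.
    have -> : - 2^-1 * t = - t / 2 by field.
    rewrite expRD mulrN1 expRN mulrA.
    rewrite (_ : 2 * C * _ = C * expR (- t / 2)); last by field.
    rewrite ler_wpM2r ?expR_ge0//.
    by rewrite ler_pdivrMr ?expR_gt0// hC.
apply: (le_lt_trans h1).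
have p0 t : 0 <= 2 * C * exponential_pdf 2^-1 t :> R.
  by rewrite mulr_ge0 ?mulr_ge0// exponential_pdf_ge0.
have h2 : (\int[leb]_(t in `]1%R, +oo[) (2 * C * exponential_pdf 2^-1 t)%:E <=
    \int[leb]_t (2 * C * exponential_pdf 2^-1 t)%:E)%E.
  by apply: ge0_subset_integral => // t _; rewrite lee_fin.
apply: (le_lt_trans h2).
under eq_integral do rewrite EFinM.
rewrite ge0_integralZl//; last 3 first.
- by apply/measurable_EFinP; exact: measurable_exponential_pdf.
- by move=> t _; rewrite lee_fin exponential_pdf_ge0.
- by rewrite lee_fin mulr_ge0.
by rewrite integral_exponential_pdf ?invr_gt0// mule1 ltry.
Qed.

End gamma.

(** * Squared norms of monomials and rotation invariance of the weighted measure *)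

Section moments.
Variables (R : realType) (n : nat).
Local Notation leb := (@lebesgue_measure R).
Local Notation leb2 := (prod_measure leb leb).
Local Notation cl := (@complex_lebesgue R n).
Local Notation B := (@unit_ball R n).
Local Notation Cn := 'rV[R[i]]_n.

Lemma qnorm_normc (t : n.-tuple (measurableTypeR R * measurableTypeR R)) j :
  normc (pairs_to_row t ord0 j) ^+ 2 = qnorm (tnth t j).
Proof. by rewrite sqr_normcE mxE. Qed.

Lemma enormE (z : Cn) : enorm z ^+ 2 = sqr_enorm z.
Proof. by rewrite sqr_sqrtr// sumr_ge0// => i _; rewrite sqr_ge0. Qed.

Lemma unit_ballE (z : Cn) : unit_ball z = (sqr_enorm z < 1) :> Prop.
Proof.
rewrite /unit_ball/= -enormE; congr is_true.
by rewrite expr_lt1// sqrtr_ge0.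
Qed.

Lemma row_measurable_funP d (T : measurableType d) (f : Cn -> T) :
  measurable_fun setT f <->
  measurable_fun setT (f \o (@pairs_to_row R n)).
Proof.
split=> mf; first exact: measurableT_comp (@measurable_pairs_to_row R n).
move=> _ A mA; rewrite setTI; have := mf measurableT A mA.
by rewrite setTI.
Qed.

Lemma ge0_integral_complex_lebesgue (F : Cn -> \bar R) :
  measurable_fun setT F -> (forall z, 0 <= F z)%E ->
  (\int[cl]_z F z = \int[tuple_measure leb2 n]_t F (pairs_to_row t))%E.
Proof.
move=> mF F0; rewrite /complex_lebesgue.
have mp : measurable_fun setT (@pairs_to_row R n :
    n.-tuple (measurableTypeR R * measurableTypeR R) -> Cn).
  exact: measurable_pairs_to_row.
by rewrite (ge0_integral_pushforward mp).
Qed.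

Lemma measurable_normc_coord j :
  measurable_fun setT (fun z : Cn => normc (z ord0 j) ^+ 2).
Proof.
apply/row_measurable_funP.
rewrite (_ : _ \o _ = (fun t => qnorm (tnth t j))).
  by apply: measurableT_comp; [exact: measurable_qnorm|exact: measurable_tnth].
by apply/funext => t /=; rewrite qnorm_normc.
Qed.

Definition moment (m : 'I_n -> nat) (z : Cn) : R :=
  \prod_j (normc (z ord0 j) ^+ 2) ^+ m j.

Lemma moment_ge0 m z : 0 <= moment m z.
Proof. by apply: prodr_ge0 => j _; rewrite exprn_ge0// sqr_ge0. Qed.

Lemma measurable_moment m : measurable_fun setT (moment m).
Proof.
by apply: measurable_prod => j _; apply: measurable_funX; exact: measurable_normc_coord.
Qed.

Lemma integral_moment (m : 'I_n -> nat) (beta : R) : -1 < beta ->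
  (\int[cl]_(z in B) (moment m z * (1 - enorm z ^+ 2) `^ beta)%:E =
   (dirichlet_cst m beta)%:E)%E.
Proof.
move=> b1; rewrite integral_mkcond.
transitivity (\int[cl]_z (moment m z * ppow beta (1 - sqr_enorm z))%:E)%E.
  apply: eq_integral => z _; rewrite patchE enormE.
  rewrite /ppow subr_gt0.
  have -> : (z \in B) = (sqr_enorm z < 1).
    by apply/idP/idP; rewrite inE unit_ballE.
  by case: ifP => // _; rewrite mulr0.
rewrite ge0_integral_complex_lebesgue; last 2 first.
- apply/measurable_EFinP; apply: measurable_funM; first exact: measurable_moment.
  apply: measurableT_comp; first exact: measurable_ppow.
  by apply: measurable_funB => //; exact: measurable_sqr_enorm.
- by move=> z; rewrite lee_fin mulr_ge0 ?moment_ge0 ?ppow_ge0.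
transitivity (dirichlet_cst m beta *
   ppow ((n + \sum_i m i)%:R + beta) 1)%:E; last first.
  by rewrite /ppow ltr01 powR1 mulr1.
rewrite -(integral_dirichlet m 1 b1); apply: eq_integral => t _; congr (_ * ppow _ _)%:E.
  by apply: eq_bigr => j _; rewrite qnorm_normc.
by congr (_ - _); apply: eq_bigr => j _; rewrite qnorm_normc.
Qed.

Lemma dirichlet_cst_gt0 (m : 'I_n -> nat) (beta : R) : -1 < beta ->
  0 < dirichlet_cst m beta.
Proof.
move=> b1; rewrite /dirichlet_cst divr_gt0//.
  rewrite mulr_gt0 ?exprn_gt0 ?disc_cst_gt0// ltr0n prodn_gt0// => i.
  exact: fact_gt0.
apply: prodr_gt0 => i _; rewrite -natr1 addrCA ltr_wpDl// -ltrBlDr sub0r//.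
Qed.

Definition nu_cst : R := (dirichlet_cst (fun _ : 'I_n => 0%N) (0 : R))^-1.

Lemma nu_cst_gt0 : 0 < nu_cst.
Proof. by rewrite invr_gt0 dirichlet_cst_gt0// ltrN10. Qed.

Lemma complex_lebesgue_ball : cl B = (nu_cst^-1)%:E.
Proof.
rewrite /nu_cst invrK -integral_moment; last by rewrite ltrN10.
rewrite (eq_integral (cst 1%E)); last first.
  move=> z _; rewrite powRr0 mulr1 /moment big1// => j _; exact: expr0.
by rewrite integral_cst ?mul1e//; exact: measurable_unit_ball.
Qed.

Local Notation nu := (@nu R n).

Lemma nuE A : measurable A ->
  nu A = (\int[cl]_(z in A) (nu_cst * \1_B z)%:E)%E.
Proof.
move=> mA; have mB := @measurable_unit_ball R n.
have c0 := nu_cst_gt0.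
rewrite -[LHS]/(mnormalize (mrestr cl (@measurable_unit_ball R n))
  (\d_(0 : Cn)) A).
(* The volume of the ball is positive and finite, so [mnormalize] divides by it and does not take
   its fallback. *)
have E : mrestr cl (@measurable_unit_ball R n) setT = (nu_cst^-1)%:E.
  by rewrite /mrestr setTI complex_lebesgue_ball.
rewrite /mnormalize /= E /mrestr eqe invr_eq0 gt_eqF//= invrK muleC.
under eq_integral do rewrite EFinM.
rewrite ge0_integralZl//; last 2 first.
- by apply: measurable_funTS; apply/measurable_EFinP; exact: measurable_indic.
- by rewrite lee_fin ltW.
by rewrite integral_indic// setIC.
Qed.

Lemma ge0_integral_nu D (F : Cn -> \bar R) :
  measurable D -> measurable_fun D F -> (forall x, D x -> 0 <= F x)%E ->
  (\int[nu]_(x in D) F x = \int[cl]_(x in D) (F x * (nu_cst * \1_B x)%:E))%E.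
Proof.
move=> mD mF F0; apply: ge0_integral_density => //.
- apply: measurable_funM => //; apply: measurable_indic.
  exact: measurable_unit_ball.
- by move=> x; rewrite mulr_ge0// ltW// nu_cst_gt0.
- exact: nuE.
Qed.

Variable alpha : R.
Hypothesis alpha_gt : -1 < alpha.
Local Notation mu := (@nu_alpha R n alpha).

Lemma ge0_integral_nu_alpha D (F : Cn -> \bar R) :
  measurable D -> measurable_fun D F -> (forall x, D x -> 0 <= F x)%E ->
  (\int[mu]_(x in D) F x = \int[nu]_(x in D) (F x * (bergman_weight alpha x)%:E))%E.
Proof.
move=> mD mF F0; apply: ge0_integral_density => //.
- exact: measurable_bergman_weight.
- by move=> x; exact: bergman_weight_ge0.
Qed.

Lemma bergman_cst_gt0 : 0 < bergman_cst n alpha.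
Proof.
have a1 : 0 < alpha + 1 by rewrite -ltrBlDr sub0r.
have n1 : 0 < n%:R + 1 :> R by rewrite ltr_wpDl.
by rewrite /bergman_cst divr_gt0// ?mulr_gt0// Gamma_gt0// -addrA ltr_wpDl.
Qed.

(** The squared norm of z^m; the first two factors do not depend on [m] and cancel in ratios. *)
Definition moment_cst (m : 'I_n -> nat) : R :=
  bergman_cst n alpha * nu_cst * dirichlet_cst m alpha.

Lemma moment_cst_gt0 m : 0 < moment_cst m.
Proof.
rewrite /moment_cst mulr_gt0 ?dirichlet_cst_gt0//.
by rewrite mulr_gt0 ?bergman_cst_gt0 ?nu_cst_gt0.
Qed.

Lemma integral_moment_nu_alpha m :
  (\int[mu]_(z in B) (moment m z)%:E = (moment_cst m)%:E)%E.
Proof.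
have mB := @measurable_unit_ball R n.
have mm : measurable_fun B (fun z => (moment m z)%:E).
  by apply: measurable_funTS; apply/measurable_EFinP; exact: measurable_moment.
have k0 : 0 <= bergman_cst n alpha * nu_cst.
  by rewrite mulr_ge0// ltW ?bergman_cst_gt0 ?nu_cst_gt0.
rewrite ge0_integral_nu_alpha//; last by move=> z _; rewrite lee_fin moment_ge0.
rewrite ge0_integral_nu//; last 2 first.
- apply: emeasurable_funM => //; apply: measurable_funTS.
  by apply/measurable_EFinP; exact: measurable_bergman_weight.
- by move=> z _; rewrite mule_ge0// lee_fin ?moment_ge0// bergman_weight_ge0.
rewrite /moment_cst EFinM -(integral_moment _ alpha_gt) -ge0_integralZl//; last 2 first.
- apply: measurable_funTS; apply/measurable_EFinP; apply: measurable_funM.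
    exact: measurable_moment.
  apply: (measurableT_comp (measurable_powR alpha)).
  by apply: measurable_funB => //; apply: measurable_funX; exact: measurable_enorm.
- by move=> z _; rewrite lee_fin mulr_ge0 ?moment_ge0 ?powR_ge0.
apply: eq_integral => z zB; rewrite -!EFinM; congr EFin.
by rewrite indicE zB mulr1 /bergman_weight; ring.
Qed.

Lemma nu_alpha_null (N : set Cn) : measurable N -> nu N = 0%E -> mu N = 0%E.
Proof.
move=> mN N0; rewrite /nu_alpha; apply: null_set_integral => //.
by apply: measurable_funTS; apply/measurable_EFinP; exact: measurable_bergman_weight.
Qed.

Definition rot (u : 'I_n -> R[i]) (z : Cn) : Cn := \row_j (u j * z ord0 j).

Lemma sqr_enorm_rot u z : (forall j, normc (u j) = 1) ->
  sqr_enorm (rot u z) = sqr_enorm z.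
Proof.
move=> u1; apply: eq_bigr => j _.
by rewrite mxE ComplexField.Normc.normcM u1 mul1r.
Qed.

Lemma rot_ball u : (forall j, normc (u j) = 1) -> rot u @^-1` B = B.
Proof.
by move=> u1; apply/seteqP; split => z /=; rewrite !unit_ballE sqr_enorm_rot.
Qed.

Lemma preserves_rot_cl u : (forall j, normc (u j) = 1) -> preserves cl (rot u).
Proof.
move=> u1.
pose f j (p : measurableTypeR R * measurableTypeR R) :=
  (complex.Re (u j) * p.1 - complex.Im (u j) * p.2,
   complex.Im (u j) * p.1 + complex.Re (u j) * p.2)
   : measurableTypeR R * measurableTypeR R.
have pf : preserves (tuple_measure leb2 n) (map_coord f).
  apply: preserves_tuple => j; apply: preserves_rotation.
  by rewrite -sqr_normcE u1 expr1n.
have rE t : rot u (pairs_to_row t) = pairs_to_row (map_coord f t).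
  apply/rowP => j; rewrite !mxE tnth_mktuple /f.
  by case: (u j) => a b; case: (tnth t j) => x y /=; congr Complex; ring.
have mr : measurable_fun setT (rot u).
  move=> _ A mA; rewrite setTI /=.
  rewrite -[measurable _]/(measurable (@pairs_to_row R n @^-1` (rot u @^-1` A))).
  rewrite (_ : _ @^-1` _ = map_coord f @^-1` (@pairs_to_row R n @^-1` A)).
    by rewrite -[X in measurable X]setTI; apply: pf.1.
  by apply/seteqP; split => t /=; rewrite rE.
split=> // A mA; rewrite /complex_lebesgue /pushforward.
rewrite (_ : _ @^-1` _ = map_coord f @^-1` (@pairs_to_row R n @^-1` A)).
  by rewrite pf.2.
by apply/seteqP; split => t /=; rewrite rE.
Qed.

Lemma preserves_rot_nu u : (forall j, normc (u j) = 1) -> preserves nu (rot u).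
Proof.
move=> u1; have [mr pr] := preserves_rot_cl u1; split=> // A mA.
have mrA : measurable (rot u @^-1` A) by rewrite -[X in measurable X]setTI; exact: mr.
have mB := @measurable_unit_ball R n.
rewrite (nuE mA) (nuE mrA).
pose F z := (nu_cst * \1_B z)%:E.
have mF : measurable_fun A F.
  apply: measurable_funTS; apply/measurable_EFinP; exact: measurable_funM.
have F0 : {in A, forall z, (0 <= F z)%E}.
  by move=> z _; rewrite lee_fin mulr_ge0// ltW// nu_cst_gt0.
apply: etrans (ge0_integral_preserves (preserves_rot_cl u1) mA mF F0).
apply: eq_integral => z _; rewrite /F; congr (_ * _)%:E.
rewrite !indicE; congr (_%:R); congr nat_of_bool; rewrite -[in LHS](rot_ball u1).
by apply/idP/idP; rewrite !inE.
Qed.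

Lemma preserves_rot u : (forall j, normc (u j) = 1) -> preserves mu (rot u).
Proof.
move=> u1; have [mr pr] := preserves_rot_nu u1; split=> // A mA.
have mrA : measurable (rot u @^-1` A) by rewrite -[X in measurable X]setTI; exact: mr.
pose F (z : Cn) := (bergman_weight alpha z)%:E.
have mF : measurable_fun A F.
  by apply: measurable_funTS; apply/measurable_EFinP; exact: measurable_bergman_weight.
have F0 : {in A, forall z, (0 <= F z)%E}.
  by move=> z _; rewrite lee_fin bergman_weight_ge0.
rewrite /nu_alpha.
apply: etrans (ge0_integral_preserves (preserves_rot_nu u1) mA mF F0).
by apply: eq_integral => z _; rewrite /F /bergman_weight !enormE sqr_enorm_rot.
Qed.

End moments.

(** * Goursat's lemma and averages over circles *)

Section quadrisection.
Variable R : realType.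

Record box := Box { bxl : R ; bxr : R ; byl : R ; byr : R }.

Implicit Types q : box.

Definition xmid q := (bxl q + bxr q) / 2.
Definition ymid q := (byl q + byr q) / 2.
Definition quarter (k : bool * bool) q : box :=
  Box (if k.1 then xmid q else bxl q) (if k.1 then bxr q else xmid q)
      (if k.2 then ymid q else byl q) (if k.2 then byr q else ymid q).

Definition subbox q q' : Prop :=
  [/\ bxl q' <= bxl q, bxl q <= bxr q & bxr q <= bxr q'] /\
  [/\ byl q' <= byl q, byl q <= byr q & byr q <= byr q'].

Lemma subbox_trans q2 q1 q3 : subbox q1 q2 -> subbox q2 q3 -> subbox q1 q3.
Proof. by move=> [[? ? ?] [? ? ?]] [[? ? ?] [? ? ?]]; do 2?split; lra. Qed.

Lemma subbox_quarter k q : bxl q <= bxr q -> byl q <= byr q ->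
  subbox (quarter k q) q.
Proof.
by case: k => -[] [] h1 h2; rewrite /subbox/= /xmid /ymid; do 2?split; lra.
Qed.

Definition bmem q (x y : R) := (bxl q <= x <= bxr q) && (byl q <= y <= byr q).

Variables (I : box -> R) (q0 : box).
Hypotheses (x0 : bxl q0 <= bxr q0) (y0 : byl q0 <= byr q0).
Hypothesis I_quarter : forall q, subbox q q0 ->
  I q = I (quarter (false, false) q) + I (quarter (false, true) q) +
        (I (quarter (true, false) q) + I (quarter (true, true) q)).
Hypothesis I_local : forall x y, bmem q0 x y -> forall e, 0 < e ->
  exists2 d, 0 < d & forall q, subbox q q0 -> bmem q x y ->
    bxr q - bxl q < d -> byr q - byl q < d ->
    `|I q| <= e * ((bxr q - bxl q) + (byr q - byl q)) ^+ 2.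

Let big_quarter q : subbox q q0 -> exists k, `|I q| <= 4 * `|I (quarter k q)|.
Proof.
move=> qq0; apply: contrapT => /forallNP h.
have {}h k : 4 * `|I (quarter k q)| < `|I q| by rewrite ltNge; apply/negP; exact: h.
have := h (false, false); have := h (false, true); have := h (true, false).
have := h (true, true).
have := ler_normD (I (quarter (false, false) q) + I (quarter (false, true) q))
  (I (quarter (true, false) q) + I (quarter (true, true) q)).
have := ler_normD (I (quarter (false, false) q)) (I (quarter (false, true) q)).
have := ler_normD (I (quarter (true, false) q)) (I (quarter (true, true) q)).
rewrite -(I_quarter qq0); lra.
Qed.

(** A heavy quarter can be chosen only for boxes inside [q0]; [bsP] shows that the iteration stays
    there. *)
Let next q := if pselect (subbox q q0) is left h
  then quarter (projT1 (cid (big_quarter h))) q else q.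

Let bs n := iter n next q0.

Let bsP n : subbox (bs n) q0 /\ `|I q0| <= 4 ^+ n * `|I (bs n)| /\
  (bxr (bs n) - bxl (bs n) = (bxr q0 - bxl q0) / 2 ^+ n /\
   byr (bs n) - byl (bs n) = (byr q0 - byl q0) / 2 ^+ n).
Proof.
elim: n => [|n [s [i [w h]]]].
  rewrite /= !expr0 !divr1 mul1r; do 3?[split=> //].
rewrite /= /next -/(bs n); case: pselect => // s'.
case: cid => k /= hk.
have [? ?] : bxl (bs n) <= bxr (bs n) /\ byl (bs n) <= byr (bs n).
  by case: s => -[? ? ?] [].
split; first by apply: subbox_trans s; exact: subbox_quarter.
split.
  by rewrite exprSr -mulrA (le_trans i)// ler_wpM2l// exprn_ge0.
rewrite !exprSr !invfM !mulrA -w -h.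
by case: k hk => -[] [] _; rewrite /= /xmid /ymid; split; field.
Qed.

Let bs_sub n m : (n <= m)%N -> subbox (bs m) (bs n).
Proof.
elim: m => [|m IH].
  by rewrite leqn0 => /eqP ->; case: (bsP 0) => -[[? ? ?] [? ? ?]] _; do 2?split.
rewrite leq_eqVlt => /predU1P[->|]; first by case: (bsP m.+1) => -[[? ? ?] [? ? ?]] _; do 2?split.
rewrite ltnS => /IH; apply: subbox_trans.
rewrite /= /next -/(bs m); have [[[? ? ?] [? ? ?]] _] := bsP m.
by case: pselect => // s'; exact: subbox_quarter.
Qed.

Let bs_lr n m : bxl (bs n) <= bxr (bs m) /\ byl (bs n) <= byr (bs m).
Proof.
have [[? ? ?] [? ? ?]] := bs_sub (leq_maxl n m).
by have [[? ? ?] [? ? ?]] := bs_sub (leq_maxr n m); split; lra.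
Qed.

(** Some quarter always carries at least a quarter of |I|. The nested quarters shrink to a point (x,
    y), the suprema of the left and lower ends, and the local estimate there gives |I q0| <= 4^n e
    (W / 2^n)^2 = e W^2 for every e > 0. *)
Lemma quadrisection_eq0 : I q0 = 0.
Proof.
pose x := sup (range (bxl \o bs)); pose y := sup (range (byl \o bs)).
have hx n : bxl (bs n) <= x <= bxr (bs n).
  apply/andP; split.
    apply: ub_le_sup; last by exists n.
    by exists (bxr q0) => _ [m _ <-]; exact: (bs_lr m 0).1.
  apply: ge_sup; first by exists (bxl q0), 0%N.
  by move=> _ [m _ <-]; exact: (bs_lr m n).1.
have hy n : byl (bs n) <= y <= byr (bs n).
  apply/andP; split.
    apply: ub_le_sup; last by exists n.
    by exists (byr q0) => _ [m _ <-]; exact: (bs_lr m 0).2.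
  apply: ge_sup; first by exists (byl q0), 0%N.
  by move=> _ [m _ <-]; exact: (bs_lr m n).2.
have xy n : bmem (bs n) x y by rewrite /bmem hx hy.
set W := (bxr q0 - bxl q0) + (byr q0 - byl q0).
suff h e : 0 < e -> `|I q0| <= e * W ^+ 2.
  apply/normr0_eq0/eqP; rewrite eq_le normr_ge0 andbT.
  apply/ler_addgt0Pl => e e0; rewrite addr0.
  have W0 : 0 < W ^+ 2 + 1 by rewrite ltr_wpDl ?sqr_ge0.
  rewrite (le_trans (h (e / (W ^+ 2 + 1)) _)) ?divr_gt0//.
  by rewrite mulrAC ler_pdivrMr// ler_pM2l// lerDl.
move=> e0; have [d d0 hd] := I_local (xy 0%N) e0.
have [n [n1 n2]] : exists n, (bxr q0 - bxl q0) / 2 ^+ n < d /\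
    (byr q0 - byl q0) / 2 ^+ n < d.
  have W0 : 0 <= W by rewrite /W addr_ge0 ?subr_ge0.
  have [n hn] : exists n, W / 2 ^+ n < d.
    exists (Num.truncn (W / d)).+1; rewrite ltr_pdivrMr ?exprn_gt0// mulrC -ltr_pdivrMr//.
    rewrite (lt_le_trans (truncnS_gt _))// -natrX ler_nat ltnW// ltn_expl//.
  have p2 : 0 < 2 ^+ n :> R by rewrite exprn_gt0.
  by exists n; split; apply: le_lt_trans hn; rewrite ler_pM2r ?invr_gt0//
    ?lerDl ?lerDr subr_ge0.
have [s [i [w h]]] := bsP n.
have := hd _ s (xy n); rewrite w h => /(_ n1 n2) hI.
rewrite (le_trans i)// (le_trans (ler_wpM2l _ hI)) ?exprn_ge0//.
rewrite -mulrDl -/W expr_div_n mulrCA -exprM mulnC exprM (_ : 2 ^+ 2 = 4); last by ring.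
by rewrite [4 ^+ n * _]mulrC divfK// expf_neq0.
Qed.

End quadrisection.

(** * Goursat's lemma for closed forms on rectangles *)

Section goursat.
Variable R : realType.
Local Notation leb := (@lebesgue_measure R).
Implicit Types f g u v : R -> R.

Definition itvint f (a b : R) : R := \int[leb]_(t in `[a, b]) f t.

Definition cont_on f (a b : R) := {in `[a, b], continuous f}.

Lemma cont_on_sub f a b a' b' : a <= a' -> b' <= b -> cont_on f a b -> cont_on f a' b'.
Proof.
move=> aa bb h x; rewrite in_itv/= => /andP[x1 x2]; apply: h.
by rewrite in_itv/= (le_trans aa x1) (le_trans x2 bb).
Qed.

Lemma cont_on_integrable f a b : cont_on f a b ->
  leb.-integrable `[a, b]%classic (EFin \o f).
Proof.
move=> h; apply: continuous_compact_integrable; first exact: segment_compact.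
apply: continuous_in_subspaceT => x; rewrite inE; exact: h.
Qed.

Lemma itvint_split f a m b : a <= m -> m <= b -> cont_on f a b ->
  itvint f a b = itvint f a m + itvint f m b.
Proof.
move=> am mb h; have hi := cont_on_integrable h.
apply/eqP; rewrite addrC -subr_eq; apply/eqP.
rewrite /itvint Rintegral_itvB//.
apply: Rintegral_itv_obnd_cbnd; apply: integrableS hi => //.
by apply: subset_itvr.
Qed.

Lemma cont_onB f g a b : cont_on f a b -> cont_on g a b ->
  cont_on (fun t => f t - g t) a b.
Proof. by move=> hf hg t ht; apply: continuousB; [exact: hf|exact: hg]. Qed.

Lemma itvintB f g a b : cont_on f a b -> cont_on g a b ->
  itvint (fun t => f t - g t) a b = itvint f a b - itvint g a b.
Proof.
by move=> hf hg; rewrite /itvint RintegralB//; exact: cont_on_integrable.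
Qed.

Lemma itvint_cst (c a b : R) : a <= b -> itvint (fun=> c) a b = c * (b - a).
Proof.
move=> ab; rewrite /itvint Rintegral_cst//.
have E : leb `[a, b]%classic = (b - a)%:E.
  have := lebesgue_measure_itv `[a, b]; rewrite /= lte_fin => ->.
  by case: ltP => h; rewrite -?EFinD//; congr EFin; lra.
by congr (_ * _); exact: (congr1 fine E).
Qed.

Lemma itvint_le f a b M : a <= b -> cont_on f a b ->
  (forall t, a <= t <= b -> `|f t| <= M) -> `|itvint f a b| <= M * (b - a).
Proof.
move=> ab hf hM; rewrite -itvint_cst//.
apply: le_trans (le_normr_Rintegral _ _) _ => //; first exact: cont_on_integrable.
apply: le_Rintegral => //.
- apply: (@cont_on_integrable (fun t => `|f t|)) => x xab.
  by apply: continuous_comp (hf x xab) _; exact: norm_continuous.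
- by apply: (@cont_on_integrable (fun=> M)) => x _; exact: cst_continuous.
Qed.

Lemma lip_continuous f x C d : 0 < d ->
  (forall t, `|t - x| < d -> `|f t - f x| <= C * `|t - x|) ->
  {for x, continuous f}.
Proof.
move=> d0 h; apply/cvgrPdist_lt => e e0.
have C1 : 0 < `|C| + 1 by rewrite ltr_wpDl.
have e1 : 0 < e / (`|C| + 1) by rewrite divr_gt0.
near=> t.
have td : `|t - x| < d by rewrite distrC; near: t; exact: cvgr_dist_lt.
rewrite distrC (le_lt_trans (h _ td))//.
rewrite (@le_lt_trans _ _ ((`|C| + 1) * `|t - x|))//.
  by rewrite ler_wpM2r// (le_trans (ler_norm _))// lerDl.
by rewrite mulrC -ltr_pdivlMr// distrC; near: t; exact: cvgr_dist_lt.
Unshelve. all: by end_near.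
Qed.

(* Differentiability at [(x, y)] of the form [u dx + v dy], with closedness
   [du/dy = dv/dx = w] at that point. *)
Definition closed_at (u v : R -> R -> R) (x y : R) := exists u1 v2 w : R,
  forall e, 0 < e -> exists2 d, 0 < d & forall x' y',
    `|x' - x| < d -> `|y' - y| < d ->
    `|u x' y' - u x y - (u1 * (x' - x) + w * (y' - y))| <=
      e * (`|x' - x| + `|y' - y|) /\
    `|v x' y' - v x y - (w * (x' - x) + v2 * (y' - y))| <=
      e * (`|x' - x| + `|y' - y|).

Lemma closed_at_continuous (u v : R -> R -> R) x y : closed_at u v x y ->
  {for x, continuous (u ^~ y)} /\ {for y, continuous (v x)}.
Proof.
move=> [u1 [v2 [w /(_ 1 ltr01) [d d0 h]]]]; split.
  apply: (@lip_continuous _ _ (`|u1| + 1) d) => // t td.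
  have [+ _] := h t y td ltac:(by rewrite subrr normr0).
  rewrite subrr mulr0 addr0 normr0 addr0 mul1r => h1.
  rewrite mulrDl mul1r -normrM.
  have := ler_normD (u t y - u x y - u1 * (t - x)) (u1 * (t - x)).
  by rewrite subrK => /le_trans; apply; rewrite addrC lerD2l.
apply: (@lip_continuous _ _ (`|v2| + 1) d) => // t td.
have [_ +] := h x t ltac:(by rewrite subrr normr0) td.
rewrite subrr mulr0 add0r normr0 add0r mul1r => h1.
rewrite mulrDl mul1r -normrM.
have := ler_normD (v x t - v x y - v2 * (t - y)) (v2 * (t - y)).
by rewrite subrK => /le_trans; apply; rewrite addrC lerD2l.
Qed.

Lemma dist_in_itv (a b x t r : R) : a <= x <= b -> b - a < r ->
  a <= t <= b -> `|t - x| < r /\ `|t - x| <= b - a.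
Proof.
move=> /andP[x1 x2] ab /andP[t1 t2]; rewrite ler_norml ltr_norml.
by split; apply/andP; split; lra.
Qed.

(** Quadrisection of the boundary integral. At a point the affine parts of u and v contribute w W Y
    to each of the two pairs of opposite sides and cancel, by closedness; what remains is of order e
    (W + Y)^2. *)
Lemma goursat (u v : R -> R -> R) a b c d : a <= b -> c <= d ->
  (forall x y, a <= x <= b -> c <= y <= d -> closed_at u v x y) ->
  itvint (v b) c d - itvint (v a) c d = itvint (u ^~ d) a b - itvint (u ^~ c) a b.
Proof.
move=> ab cd H.
pose I q := itvint (v (bxr q)) (byl q) (byr q) - itvint (v (bxl q)) (byl q) (byr q) -
  (itvint (u ^~ (byr q)) (bxl q) (bxr q) - itvint (u ^~ (byl q)) (bxl q) (bxr q)).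
pose q0 := Box a b c d.
have cu y : c <= y <= d -> cont_on (u ^~ y) a b.
  by move=> hy x; rewrite in_itv/= => hx; apply: (closed_at_continuous (H x y hx hy)).1.
have cv x : a <= x <= b -> cont_on (v x) c d.
  by move=> hx y; rewrite in_itv/= => hy; apply: (closed_at_continuous (H x y hx hy)).2.
suff : I q0 = 0 by rewrite /I /= => /eqP; rewrite subr_eq0 => /eqP.
apply: quadrisection_eq0 => // [q [[/= h1 h2 h3] [/= h4 h5 h6]]|x y /andP[/= hx hy] e e0].
  have m1 : bxl q <= xmid q by rewrite /xmid; lra.
  have m2 : xmid q <= bxr q by rewrite /xmid; lra.
  have k1 : byl q <= ymid q by rewrite /ymid; lra.
  have k2 : ymid q <= byr q by rewrite /ymid; lra.
  have su y : c <= y <= d -> itvint (u ^~ y) (bxl q) (bxr q) =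
      itvint (u ^~ y) (bxl q) (xmid q) + itvint (u ^~ y) (xmid q) (bxr q).
    by move=> hy; apply: itvint_split => //; exact: cont_on_sub (cu y hy).
  have sv x : a <= x <= b -> itvint (v x) (byl q) (byr q) =
      itvint (v x) (byl q) (ymid q) + itvint (v x) (ymid q) (byr q).
    by move=> hx; apply: itvint_split => //; exact: cont_on_sub (cv x hx).
  rewrite /I /= !su ?sv; first ring; apply/andP; split; lra.
have [u1 [v2 [w H1]]] := H x y hx hy.
have e2 : 0 < e / 2 / 2 by rewrite !divr_gt0.
have [r r0 hr] := H1 _ e2; exists r => // q [[/= h1 h2 h3] [/= h4 h5 h6]].
move=> /andP[/andP[x1 x2] /andP[y1 y2]] wr hr'.
set W := bxr q - bxl q; set Y := byr q - byl q.
have W0 : 0 <= W by rewrite subr_ge0.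
have Y0 : 0 <= Y by rewrite subr_ge0.
have bnd (s t s' t' : R) : `|s| <= W -> `|t| <= Y -> `|s'| <= W -> `|t'| <= Y ->
    e / 2 / 2 * (`|s| + `|t|) + e / 2 / 2 * (`|s'| + `|t'|) <= e / 2 * (W + Y).
  move=> ? ? ? ?; rewrite -mulrDr -mulrA; rewrite ler_pM2l//; last by rewrite divr_gt0.
  by lra.
have ex t : bxl q <= t <= bxr q -> `|t - x| < r /\ `|t - x| <= W.
  by apply: dist_in_itv => //; apply/andP.
have ey t : byl q <= t <= byr q -> `|t - y| < r /\ `|t - y| <= Y.
  by apply: dist_in_itv => //; apply/andP.
have xr_in : bxl q <= bxr q <= bxr q by rewrite h2 lexx.
have xl_in : bxl q <= bxl q <= bxr q by rewrite h2 lexx.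
have yr_in : byl q <= byr q <= byr q by rewrite h5 lexx.
have yl_in : byl q <= byl q <= byr q by rewrite h5 lexx.
have xr_ab : a <= bxr q <= b by rewrite h3 (le_trans h1).
have xl_ab : a <= bxl q <= b by rewrite h1 (le_trans h2).
have yr_cd : c <= byr q <= d by rewrite h6 (le_trans h4).
have yl_cd : c <= byl q <= d by rewrite h4 (le_trans h5).
have Ev : `|itvint (v (bxr q)) (byl q) (byr q) - itvint (v (bxl q)) (byl q) (byr q)
    - w * W * Y| <= e / 2 * (W + Y) * Y.
  have c1 : cont_on (v (bxr q)) (byl q) (byr q).
    exact: cont_on_sub (cv _ _).
  have c2 : cont_on (v (bxl q)) (byl q) (byr q).
    exact: cont_on_sub (cv _ _).
  have c3 : cont_on (fun t => v (bxr q) t - v (bxl q) t) (byl q) (byr q).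
    exact: cont_onB.
  have c4 : cont_on (fun _ : R => w * W) (byl q) (byr q).
    by move=> t ht; exact: cst_continuous.
  rewrite -(itvint_cst (w * W) h5) -itvintB// -itvintB//.
  apply: itvint_le => //; first exact: cont_onB.
  move=> t ht; have [t1 t2] := ey t ht.
  have [p1 p2] := ex (bxr q) xr_in.
  have [p3 p4] := ex (bxl q) xl_in.
  have [_ g1] := hr _ _ p1 t1; have [_ g2] := hr _ _ p3 t1.
  apply: le_trans (bnd _ _ _ _ p2 t2 p4 t2).
  apply: le_trans (lerD g1 g2).
  apply: le_trans (ler_normB _ _); rewrite /W le_eqVlt; apply/orP; left; apply/eqP.
  by congr (`| _ |); ring.
have Eu : `|itvint (u ^~ (byr q)) (bxl q) (bxr q) - itvint (u ^~ (byl q)) (bxl q) (bxr q)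
    - w * Y * W| <= e / 2 * (W + Y) * W.
  have c1 : cont_on (u ^~ (byr q)) (bxl q) (bxr q).
    exact: cont_on_sub (cu _ _).
  have c2 : cont_on (u ^~ (byl q)) (bxl q) (bxr q).
    exact: cont_on_sub (cu _ _).
  have c3 : cont_on (fun t => u t (byr q) - u t (byl q)) (bxl q) (bxr q).
    exact: cont_onB.
  have c4 : cont_on (fun _ : R => w * Y) (bxl q) (bxr q).
    by move=> t ht; exact: cst_continuous.
  rewrite -(itvint_cst (w * Y) h2) -itvintB// -itvintB//.
  apply: itvint_le => //; first exact: cont_onB.
  move=> t ht; have [t1 t2] := ex t ht.
  have [p1 p2] := ey (byr q) yr_in.
  have [p3 p4] := ey (byl q) yl_in.
  have [g1 _] := hr _ _ t1 p1; have [g2 _] := hr _ _ t1 p3.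
  apply: le_trans (bnd _ _ _ _ t2 p2 t2 p4).
  apply: le_trans (lerD g1 g2).
  apply: le_trans (ler_normB _ _); rewrite /Y le_eqVlt; apply/orP; left; apply/eqP.
  by congr (`| _ |); ring.
have -> : I q = (itvint (v (bxr q)) (byl q) (byr q) - itvint (v (bxl q)) (byl q) (byr q)
    - w * W * Y) - (itvint (u ^~ (byr q)) (bxl q) (bxr q) -
       itvint (u ^~ (byl q)) (bxl q) (bxr q) - w * Y * W) by rewrite /I; ring.
apply: le_trans (ler_normB _ _) _; apply: le_trans (lerD Ev Eu) _.
rewrite (_ : _ + _ = e / 2 * (W + Y) ^+ 2); last by ring.
rewrite ler_wpM2r ?sqr_ge0//.
by rewrite ler_pdivrMr// ler_peMr// ?ler1n// ltW.
Qed.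

End goursat.

(** * Moduli of complex numbers and limits in epsilon form *)

Section complex_eps.
Variable R : realType.
Local Notation C := R[i].

Lemma normC (x : C) : `|x| = (normc x)%:C.
Proof. by []. Qed.

Lemma normc_ge0 (x : C) : 0 <= normc x.
Proof. by case: x => a b; exact: sqrtr_ge0. Qed.

Lemma normcD (x y : C) : normc (x + y) <= normc x + normc y.
Proof. exact: le_normcD. Qed.

Lemma normcN (x : C) : normc (- x) = normc x.
Proof. by case: x => a b /=; rewrite !sqrrN. Qed.

Lemma normcB (x y : C) : normc (x - y) <= normc x + normc y.
Proof. by rewrite (le_trans (normcD _ _))// normcN. Qed.

Lemma normc_distC (x y : C) : normc (x - y) = normc (y - x).
Proof. by rewrite -normcN opprB. Qed.

Lemma normcM (x y : C) : normc (x * y) = normc x * normc y.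
Proof. exact: ComplexField.Normc.normcM. Qed.

Lemma normcX (x : C) k : normc (x ^+ k) = normc x ^+ k.
Proof.
elim: k => [|k IH]; first by rewrite !expr0 ComplexField.Normc.normc1.
by rewrite !exprS normcM IH.
Qed.

Lemma normc_prod I (r : seq I) (P : pred I) (F : I -> C) :
  normc (\prod_(i <- r | P i) F i) = \prod_(i <- r | P i) normc (F i).
Proof.
elim/big_rec2: _ => [|i x y _ <-]; first exact: ComplexField.Normc.normc1.
by rewrite normcM.
Qed.

Lemma normc_sum I (r : seq I) (P : pred I) (F : I -> C) :
  normc (\sum_(i <- r | P i) F i) <= \sum_(i <- r | P i) normc (F i).
Proof.
elim/big_rec2: _ => [|i x y _ h]; first by rewrite ComplexField.Normc.normc0.
by rewrite (le_trans (normcD _ _))// lerD2l.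
Qed.

Lemma normc_real (a : R) : normc a%:C = `|a|.
Proof. by rewrite /= expr0n addr0 sqrtr_sqr. Qed.

Lemma normc_eq0 (x : C) : normc x = 0 -> x = 0.
Proof. exact: ComplexField.Normc.eq0_normc. Qed.

Lemma normcJ (x : C) : normc (conjc x) = normc x.
Proof. by case: x => a b /=; rewrite sqrrN. Qed.

Lemma mul_conjc (x : C) : x * conjc x = (normc x ^+ 2)%:C.
Proof. by rewrite sqr_normcE; case: x => a b /=; congr Complex; ring. Qed.

Lemma Re_le_normc (x : C) : `|complex.Re x| <= normc x.
Proof.
case: x => a b /=; rewrite -(sqrtr_sqr a) ler_wsqrtr// lerDl sqr_ge0//.
Qed.

Lemma Im_le_normc (x : C) : `|complex.Im x| <= normc x.
Proof.
case: x => a b /=; rewrite -(sqrtr_sqr b) ler_wsqrtr// lerDr sqr_ge0//.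
Qed.

Lemma normc_le_ReIm (x : C) : normc x <= `|complex.Re x| + `|complex.Im x|.
Proof.
rewrite -(@ler_pXn2r _ 2) ?nnegrE ?normc_ge0 ?addr_ge0// sqr_normcE.
rewrite sqrrD !real_normK ?num_real//.
by rewrite addrAC lerDl mulrn_wge0// mulr_ge0.
Qed.

Lemma lt0C (e : C) : 0 < e -> exists2 d : R, 0 < d & e = d%:C.
Proof. by case: e => a b; rewrite ltcE/= => /andP[/eqP -> a0]; exists a. Qed.

(** Radii of neighbourhoods are themselves complex; a positive complex number is real, which turns
    them into real radii. *)
Lemma nbhsC (x : C) (P : set C) :
  (\forall t \near x, P t) <->
  exists2 d : R, 0 < d & forall t, normc (x - t) < d -> P t.
Proof.
split.
  move=> /nbhs_ballP[e /= /lt0C[d d0 ->] h]; exists d => // t td.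
  by apply: h; rewrite /ball/= normC ltcR.
move=> [d d0 h]; apply/nbhs_ballP; exists d%:C; first by rewrite /= ltcR.
by move=> t; rewrite /ball/= normC ltcR; exact: h.
Qed.

Lemma nbhs_rowC n (x : 'rV[C]_n) (P : set 'rV[C]_n) :
  (\forall t \near x, P t) <->
  exists2 d : R, 0 < d & forall t : 'rV[C]_n,
    (forall j, normc (x ord0 j - t ord0 j) < d) -> P t.
Proof.
split.
  move=> /nbhs_ballP[e /= /lt0C[d d0 ->] h]; exists d => // t td.
  apply: h; split; first by rewrite ltcR.
  by move=> i j; rewrite (ord1 i) /ball/= normC ltcR.
move=> [d d0 h]; apply/nbhs_ballP; exists d%:C; first by rewrite /= ltcR.
by move=> t xt; apply: h => j; have := xt.2 ord0 j; rewrite /ball/= normC ltcR.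
Qed.

Lemma continuousC_rowP n (f : 'rV[C]_n -> C) x : {for x, continuous f} ->
  forall e : R, 0 < e -> exists2 d : R, 0 < d &
    forall t : 'rV[C]_n, (forall j, normc ((x : 'rV[C]_n) ord0 j - t ord0 j) < d) ->
      normc (f x - f t) < e.
Proof.
move=> /cvgrPdist_lt h e e0.
have /h/nbhs_rowC[d d0 hd] : (0 : C) < e%:C by rewrite ltcR.
by exists d => // t /hd; rewrite normC ltcR.
Qed.

(** Multiplied out by t, the estimate for the difference quotient also covers t = 0. *)
Lemma derivableC_rowP n (f : 'rV[C]_n -> C) x v : derivable f x v ->
  exists D : C, forall e : R, 0 < e -> exists2 d : R, 0 < d &
    forall t : C, normc t < d -> normc (f (x + t *: v) - f x - t * D) <= e * normc t.
Proof.
move=> /cvgrPdist_le h; exists ('D_v f x) => e e0.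
have /h : (0 : C) < e%:C by rewrite ltcR.
rewrite near_withinE => /nbhsC[d d0 hd]; exists d => // t td.
have [->|t0] := eqVneq t 0.
  by rewrite scale0r addr0 subrr mul0r subrr ComplexField.Normc.normc0 mulr0.
have := hd t; rewrite sub0r normcN => /(_ td t0).
rewrite normC lecR => ht.
have hE : (f \o shift x) (t *: v) = f (x + t *: v) by rewrite /= addrC.
rewrite hE -[t^-1 *: _]/(t^-1 * _) in ht.
rewrite (_ : _ - _ = t * (t^-1 * (f (x + t *: v) - f x) - 'D_v f x)); last first.
  by rewrite mulrBr mulrA divff// mul1r.
by rewrite normcM mulrC ler_wpM2r ?normc_ge0// normc_distC.
Qed.

End complex_eps.

(** * The complex exponential and complex differentiability in real coordinates *)

Section expi.
Variable R : realType.
Local Notation C := R[i].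

Definition expi (t : R) : C := cos t +i* sin t.

Lemma normc_expi t : normc (expi t) = 1.
Proof. by rewrite /= cos2Dsin2 sqrtr1. Qed.

Lemma expiD s t : expi (s + t) = expi s * expi t.
Proof.
rewrite /expi cosD sinD; apply/eqP; rewrite eq_complex /= eqxx/=.
by rewrite addrC.
Qed.

Lemma expi0 : expi 0 = 1.
Proof. by rewrite /expi cos0 sin0. Qed.

Lemma expiMn t k : expi (t *+ k) = expi t ^+ k.
Proof.
by elim: k => [|k IH]; rewrite ?mulr0n ?expi0 ?expr0// mulrS expiD IH exprS.
Qed.

Lemma expi_pi2 : expi (pi *+ 2) = 1.
Proof. by rewrite expiMn /expi cospi sinpi expr2; apply/eqP; rewrite eq_complex/=; apply/andP; split; apply/eqP; ring. Qed.

Definition cexp (a b : R) : C := (expR a)%:C * expi b.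

Lemma cexpD a b a' b' : cexp (a + a') (b + b') = cexp a b * cexp a' b'.
Proof. by rewrite /cexp expRD expiD rmorphM/=; ring. Qed.

Lemma normc_cexp a b : normc (cexp a b) = expR a.
Proof. by rewrite /cexp normcM normc_real normc_expi mulr1 ger0_norm ?expR_ge0. Qed.

Lemma is_derive_eps (f : R -> R) D : is_derive (0 : R) 1 f D -> forall e, 0 < e ->
  exists2 d, 0 < d & forall t, `|t| < d -> `|f t - f 0 - D * t| <= e * `|t|.
Proof.
move=> [df <-] e e0; have /cvgrPdist_le /(_ e e0) := df.
rewrite near_withinE => /nbhs_ballP[d /= d0 hd]; exists d => // t td.
have [->|t0] := eqVneq t 0; first by rewrite subrr mulr0 subrr normr0 mulr0.
have := hd t; rewrite /ball/= sub0r normrN => /(_ td t0).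
rewrite /shift /= addr0 -[_ *: _]/(_ * _) -[t *: 1]/(t * 1) mulr1 => h.
rewrite (_ : _ - _ = t * (t^-1 * (f t - f 0) - 'D_1 f 0)); last first.
  by rewrite mulrBr mulrA divff// mul1r [t * _]mulrC.
by rewrite normrM mulrC ler_wpM2r// distrC.
Qed.

(** This is exp'(0) = 1; all other points follow from the functional equation [cexpD]. *)
Lemma cexp_deriv0 e : 0 < e -> exists2 d : R, 0 < d & forall a b,
  `|a| < d -> `|b| < d ->
  normc (cexp a b - 1 - (a +i* b)) <= e * (`|a| + `|b|).
Proof.
(* The bounds [H1], [H2] and [H3] below add up to 2 + 2 + 1 times [e / 5] in front of |b|. *)
move=> e0; have e5 : 0 < e / 5 by rewrite divr_gt0.
have [d1 d10 h1] := is_derive_eps (is_derive_expR 0) e5.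
have [d2 d20 h2] := is_derive_eps (is_derive_expR 0) (@ltr01 R).
have [d3 d30 h3] := is_derive_eps (is_derive_sin 0) e5.
have [d4 d40 h4] := is_derive_eps (is_derive_cos 0) e5.
rewrite expR0 in h1 h2; rewrite sin0 cos0 in h3 h4.
exists (Num.min (Num.min (Num.min d1 d2) (Num.min d3 d4)) (Num.min 2^-1 (e / 5 / 2))).
  by rewrite !lt_min d10 d20 d30 d40 invr_gt0 ltr0n/= divr_gt0.
move=> a b; rewrite !lt_min => /andP[/andP[/andP[a1 a2] _] /andP[a3 a4]].
move=> /andP[/andP[_ /andP[b1 b2]] _].
have {h1} := h1 a a1; have {h2} := h2 a a2; have {h3} := h3 b b1; have {h4} := h4 b b2.
rewrite oppr0 mul0r !subr0 !addr0 !mul1r => hc hs h2 h1.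
have ha : `|expR a - 1| <= 2 * `|a|.
  have := ler_normD (expR a - 1 - a) a; rewrite subrK => /le_trans; apply.
  by rewrite mulr2n mulrDl mul1r lerD2r.
have ea : `|expR a| <= 2.
  have := ler_normD (expR a - 1) 1; rewrite subrK normr1 => /le_trans; apply.
  by move: ha a3; clear; lra.
apply: le_trans (normc_le_ReIm _) _.
rewrite /cexp /expi /= !mul0r !subr0 !addr0.
rewrite (_ : expR a * cos b - 1 - a = (expR a - 1 - a) + expR a * (cos b - 1)); last by ring.
rewrite (_ : expR a * sin b - b = expR a * (sin b - b) + b * (expR a - 1)); last by ring.
have H1 : `|expR a * (cos b - 1)| <= 2 * (e / 5 * `|b|).
  by rewrite normrM ler_pM.
have H2 : `|expR a * (sin b - b)| <= 2 * (e / 5 * `|b|).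
  by rewrite normrM ler_pM.
have H3 : `|b * (expR a - 1)| <= `|b| * (e / 5).
  by rewrite normrM ler_wpM2l// (le_trans ha)// mulrC -ler_pdivlMr// ltW.
apply: le_trans (lerD (ler_normD _ _) (ler_normD _ _)) _.
apply: le_trans (lerD (lerD h1 H1) (lerD H2 H3)) _.
have : 0 <= e / 5 * `|a| by rewrite mulr_ge0// ltW.
rewrite mulrDr; move: (`|a|) (`|b|) => A Bb; clear.
have -> : e * A = 5 * (e / 5 * A) by field.
have -> : e * Bb = 5 * (e / 5 * Bb) by field.
rewrite [Bb * _]mulrC; lra.
Qed.

(* [F] is read as a function of [x + i y]. *)
Definition cdiff (F : R -> R -> C) (x y : R) := exists D : C,
  forall e, 0 < e -> exists2 d, 0 < d & forall x' y',
    `|x' - x| < d -> `|y' - y| < d ->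
    normc (F x' y' - F x y - D * ((x' - x) +i* (y' - y))) <=
      e * (`|x' - x| + `|y' - y|).

Lemma normc_pair (a b : R) : normc (a +i* b) <= `|a| + `|b|.
Proof. exact: normc_le_ReIm. Qed.

Lemma cdiff_cexp (k x y : R) : cdiff (fun s t => cexp (k * s) (k * t)) x y.
Proof.
exists (k%:C * cexp (k * x) (k * y)) => e e0.
pose K := (`|k| + 1) * expR (k * x).
have K0 : 0 < K by rewrite mulr_gt0 ?expR_gt0// ltr_wpDl.
have [d d0 hd] := cexp_deriv0 (divr_gt0 e0 K0).
have k1 : 0 < `|k| + 1 by rewrite ltr_wpDl.
exists (d / (`|k| + 1)); first by rewrite divr_gt0.
have bd t : `|t| < d / (`|k| + 1) -> `|k * t| < d.
  rewrite ltr_pdivlMr// mulrC => h; apply: le_lt_trans h.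
  by rewrite normrM ler_wpM2r// lerDl.
move=> x' y' /bd hx /bd hy.
have -> : cexp (k * x') (k * y') =
    cexp (k * x) (k * y) * cexp (k * (x' - x)) (k * (y' - y)).
  by rewrite -cexpD; congr cexp; ring.
rewrite (_ : _ - _ - _ = cexp (k * x) (k * y) *
  (cexp (k * (x' - x)) (k * (y' - y)) - 1 - ((k * (x' - x)) +i* (k * (y' - y))))); last first.
  have -> : (k * (x' - x) +i* (k * (y' - y))) = k%:C * ((x' - x) +i* (y' - y)).
    by apply/eqP; rewrite eq_complex /=; apply/andP; split; apply/eqP; ring.
  by ring.
rewrite normcM normc_cexp (le_trans (ler_wpM2l _ (hd _ _ hx hy))) ?expR_ge0//.
rewrite !normrM -mulrDr /K invfM !mulrA.
have E0 := expR_gt0 (k * x).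
rewrite (_ : expR (k * x) * e / (`|k| + 1) / expR (k * x) * `|k| =
   e * (`|k| / (`|k| + 1))); last by field; rewrite !gt_eqF.
rewrite -mulrA ler_wpM2l ?(ltW e0)//.
rewrite ler_piMl ?addr_ge0// ler_pdivrMr// mul1r lerDl ler01//.
Qed.

Lemma cdiff_lip F x y : cdiff F x y -> exists2 K, 0 < K & exists2 d, 0 < d &
  forall x' y', `|x' - x| < d -> `|y' - y| < d ->
    normc (F x' y' - F x y) <= K * (`|x' - x| + `|y' - y|).
Proof.
move=> [D /(_ 1 ltr01)[d d0 hd]]; exists (normc D + 1); first by rewrite ltr_wpDl ?normc_ge0.
exists d => // x' y' hx hy.
have := normcD (F x' y' - F x y - D * ((x' - x) +i* (y' - y))) (D * ((x' - x) +i* (y' - y))).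
rewrite subrK => /le_trans; apply.
rewrite mulrDl addrC lerD ?hd// normcM ler_wpM2l ?normc_ge0//.
exact: normc_pair.
Qed.

Lemma cdiff_mul F G x y : cdiff F x y -> cdiff G x y ->
  cdiff (fun s t => F s t * G s t) x y.
Proof.
move=> hF hG; have [K1 K10 [r1 r10 l1]] := cdiff_lip hF.
have [K2 K20 [r2 r20 l2]] := cdiff_lip hG.
case: hF => D1 h1; case: hG => D2 h2.
exists (D1 * G x y + F x y * D2) => e e0.
have e3 : 0 < e / 3 by rewrite divr_gt0.
have f0 : 0 < normc (F x y) + 1 by rewrite ltr_wpDl ?normc_ge0.
have g0 : 0 < normc (G x y) + 1 by rewrite ltr_wpDl ?normc_ge0.
have [d1 d10 {}h1] := h1 _ (divr_gt0 e3 g0).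
have [d2 d20 {}h2] := h2 _ (divr_gt0 e3 f0).
pose d3 := e / 3 / (K1 * K2) / 2.
have d30 : 0 < d3 by rewrite !divr_gt0// mulr_gt0.
exists (Num.min (Num.min d1 d2) (Num.min d3 (Num.min r1 r2))).
  by rewrite !lt_min d10 d20 d30 r10 r20.
move=> x' y'; rewrite !lt_min => /andP[/andP[x1 x2] /and3P[x3 x4 x5]].
move=> /andP[/andP[y1 y2] /and3P[y3 y4 y5]].
have {}h1 := h1 _ _ x1 y1; have {}h2 := h2 _ _ x2 y2.
have {}l1 := l1 _ _ x4 y4; have {}l2 := l2 _ _ x5 y5.
set h := _ +i* _ in h1 h2 *; set N := `|_| + `|_| in h1 h2 l1 l2 *.
have N0 : 0 <= N by rewrite addr_ge0.
rewrite (_ : _ - _ - _ = (F x' y' - F x y - D1 * h) * G x y +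
   (F x y * (G x' y' - G x y - D2 * h) + (F x' y' - F x y) * (G x' y' - G x y))); last by ring.
have {h1} H1 : normc ((F x' y' - F x y - D1 * h) * G x y) <= e / 3 * N.
  rewrite normcM (le_trans (ler_wpM2r _ h1)) ?normc_ge0//.
  rewrite mulrAC ler_wpM2r// mulrAC ler_pdivrMr// ler_wpM2l ?(ltW e3)// lerDl ler01//.
have {h2} H2 : normc (F x y * (G x' y' - G x y - D2 * h)) <= e / 3 * N.
  rewrite normcM (le_trans (ler_wpM2l _ h2)) ?normc_ge0//.
  rewrite mulrA ler_wpM2r// mulrCA ler_piMr ?(ltW e3)//.
  by rewrite ler_pdivrMr// mul1r lerDl.
have H3 : normc ((F x' y' - F x y) * (G x' y' - G x y)) <= e / 3 * N.
  rewrite normcM (le_trans (ler_pM _ _ l1 l2)) ?normc_ge0//.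
  rewrite (_ : K1 * N * (K2 * N) = K1 * K2 * N * N); last by ring.
  rewrite ler_wpM2r// mulrC -ler_pdivlMr ?mulr_gt0//.
  have -> : e / 3 / (K1 * K2) = d3 + d3 by rewrite /d3; field; rewrite !gt_eqF.
  by rewrite /N lerD// ltW.
apply: le_trans (normcD _ _) _; apply: le_trans (lerD (lexx _) (normcD _ _)) _.
apply: le_trans (lerD H1 (lerD H2 H3)) _.
by rewrite le_eqVlt; apply/orP; left; apply/eqP; field.
Qed.

Definition cderiv (g : C -> C) (w : C) := exists D : C,
  forall e : R, 0 < e -> exists2 d : R, 0 < d &
  forall t : C, normc t < d -> normc (g (w + t) - g w - t * D) <= e * normc t.

Lemma cdiff_comp g F x y : cdiff F x y -> cderiv g (F x y) ->
  cdiff (fun s t => g (F s t)) x y.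
Proof.
move=> hF; have [K K0 [r r0 l]] := cdiff_lip hF.
case: hF => E hE [D hD]; exists (D * E) => e e0.
have D0 : 0 < normc D + 1 by rewrite ltr_wpDl ?normc_ge0.
have e2 : 0 < e / 2 by rewrite divr_gt0.
have [d1 d10 {}hE] := hE _ (divr_gt0 e2 D0).
have [d2 d20 {}hD] := hD _ (divr_gt0 e2 K0).
pose d3 := d2 / K / 2.
have d30 : 0 < d3 by rewrite !divr_gt0.
exists (Num.min (Num.min d1 d3) r); first by rewrite !lt_min d10 d30 r0.
move=> x' y'; rewrite !lt_min => /andP[/andP[x1 x2] x3] /andP[/andP[y1 y2] y3].
have {}hE := hE _ _ x1 y1; have {}l := l _ _ x3 y3.
set h := _ +i* _ in hE *; set N := `|_| + `|_| in hE l *.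
have N0 : 0 <= N by rewrite addr_ge0.
set t := F x' y' - F x y in hE l *.
have td : normc t < d2.
  rewrite (le_lt_trans l)// mulrC -ltr_pdivlMr//.
  have -> : d2 / K = d3 + d3 by rewrite /d3; field; rewrite !gt_eqF.
  exact: ltrD.
have {}hD := hD _ td.
rewrite [F x y + t]addrC subrK in hD.
rewrite (_ : _ - _ - _ = (g (F x' y') - g (F x y) - t * D) + D * (t - E * h)); last by ring.
apply: le_trans (normcD _ _) _.
have -> : e * N = e / 2 * N + e / 2 * N by field.
apply: lerD.
  apply: le_trans hD _; apply: le_trans (ler_wpM2l _ l) _.
    by rewrite divr_ge0 ?(ltW K0) ?(ltW e2).
  by rewrite mulrA divfK ?gt_eqF.
rewrite normcM (le_trans (ler_wpM2l _ hE)) ?normc_ge0//.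
rewrite mulrA ler_wpM2r// mulrCA ler_piMr ?(ltW e2)//.
by rewrite ler_pdivrMr// mul1r lerDl.
Qed.

(* Closedness of [F (x + i y) d(x + i y)] pulled back along
   [(x, y) |-> x (a + i b) + i y], split into real and imaginary parts. *)
Lemma cdiff_closed F (a b x y : R) : cdiff F (x * a) (x * b + y) ->
  closed_at (fun s t => b * complex.Re (F (s * a) (s * b + t)) +
                        a * complex.Im (F (s * a) (s * b + t)))
            (fun s t => complex.Re (F (s * a) (s * b + t))) x y /\
  closed_at (fun s t => b * complex.Im (F (s * a) (s * b + t)) -
                        a * complex.Re (F (s * a) (s * b + t)))
            (fun s t => complex.Im (F (s * a) (s * b + t))) x y.
Proof.
move=> [[p q] h].
(* [K] controls the linear map (x, y) -> (a x, b x + y) as well as the combinations of real and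
   imaginary parts in the two forms. *)
pose K := `|a| + `|b| + 1.
have K1 : 1 <= K by rewrite lerDr addr_ge0.
have K0 : 0 < K by exact: lt_le_trans K1.
have aK : `|a| <= K by rewrite /K -addrA lerDl addr_ge0.
have bK : `|b| <= K by rewrite /K addrAC lerDr addr_ge0.
have key e : 0 < e -> exists2 d, 0 < d & forall x' y',
    `|x' - x| < d -> `|y' - y| < d -> exists2 z : C,
    F (x' * a) (x' * b + y') = F (x * a) (x * b + y) +
      (p +i* q) * ((a * (x' - x)) +i* (b * (x' - x) + (y' - y))) + z &
    K * normc z <= e * (`|x' - x| + `|y' - y|).
  move=> e0; have [d d0 hd] := h _ (divr_gt0 e0 (mulr_gt0 K0 (mulr_gt0 (@ltr0Sn R 1) K0))).
  exists (d / (2 * K)); first by rewrite divr_gt0// mulr_gt0.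
  move=> x' y'; rewrite !ltr_pdivlMr ?mulr_gt0// => hx hy.
  have e1 : `|x' * a - x * a| <= K * `|x' - x|.
    by rewrite -mulrBl normrM mulrC ler_wpM2r.
  have e2 : `|x' * b + y' - (x * b + y)| <= K * (`|x' - x| + `|y' - y|).
    rewrite (_ : _ - _ = (x' - x) * b + (y' - y)); last by ring.
    rewrite (le_trans (ler_normD _ _))// mulrDr lerD//.
      by rewrite normrM mulrC ler_wpM2r.
    by rewrite ler_peMl.
  have h1 : `|x' * a - x * a| < d.
    apply: le_lt_trans e1 _; apply: le_lt_trans hx.
    by rewrite mulrC ler_wpM2l// ler_peMl ?ler1n// ltW.
  have h2 : `|x' * b + y' - (x * b + y)| < d.
    apply: le_lt_trans e2 _; rewrite mulrC mulrDl.
    by rewrite [X in _ < X](splitr d) ltrD// ltr_pdivlMr// -mulrA [K * 2]mulrC.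
  have {}hd := hd _ _ h1 h2.
  exists (F (x' * a) (x' * b + y') - F (x * a) (x * b + y) -
    (p +i* q) * ((x' * a - x * a) +i* (x' * b + y' - (x * b + y)))).
    rewrite (_ : (x' * a - x * a) +i* _ = (a * (x' - x)) +i* (b * (x' - x) + (y' - y))).
      by ring.
    by congr Complex; ring.
  rewrite -ler_pdivlMl// (le_trans hd)//.
  have e3 := lerD e1 e2.
  have e4 : K * `|x' - x| + K * (`|x' - x| + `|y' - y|) <= 2 * K * (`|x' - x| + `|y' - y|).
    by rewrite -mulrDr -mulrA [2 * _]mulrC -mulrA ler_pM2l// mulr2n mulrDr mulr1 lerD2r lerDl.
  have c0 : 0 <= e / (K * (2 * K)) by rewrite divr_ge0 ?(ltW e0)// ltW// mulr_gt0// mulr_gt0.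
  apply: le_trans (ler_wpM2l c0 (le_trans e3 e4)) _.
  by rewrite le_eqVlt; apply/orP; left; apply/eqP; field; rewrite gt_eqF.
have fin (z : C) (A N : R) : K * normc z <= N ->
    [\/ A = complex.Re z, A = complex.Im z,
       A = b * complex.Re z + a * complex.Im z |
       A = b * complex.Im z - a * complex.Re z] -> `|A| <= N.
  have z0 := normc_ge0 z.
  have R0 := Re_le_normc z; have I0 := Im_le_normc z.
  have zK : normc z <= K * normc z by rewrite ler_peMl.
  have abK : (`|a| + `|b|) * normc z <= K * normc z by rewrite ler_wpM2r// lerDl.
  move=> zN [] ->; apply: le_trans zN.
  - exact: le_trans zK.
  - exact: le_trans zK.
  - apply: le_trans (ler_normD _ _) _; apply: le_trans abK.
    by rewrite !normrM mulrDl addrC lerD// ler_wpM2l.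
  - apply: le_trans (ler_normB _ _) _; apply: le_trans abK.
    by rewrite !normrM mulrDl addrC lerD// ler_wpM2l.
split.
  exists (b * (p * a - q * b) + a * (q * a + p * b)), (- q), (p * a - q * b) => e e0.
  have [d d0 hd] := key e e0; exists d => // x' y' hx hy.
  have [z -> hz] := hd x' y' hx hy; move: (F _ _) => [a' b'].
  split; apply: (fin _ _ _ hz); [apply: Or43|apply: Or41]; case: (z) => z1 z2 /=; ring.
exists (b * (q * a + p * b) - a * (p * a - q * b)), p, (q * a + p * b) => e e0.
have [d d0 hd] := key e e0; exists d => // x' y' hx hy.
have [z -> hz] := hd x' y' hx hy; move: (F _ _) => [a' b'].
split; apply: (fin _ _ _ hz); [apply: Or44|apply: Or42]; case: (z) => z1 z2 /=; ring.
Qed.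

End expi.

(** * Circle integrals and their Riemann sums *)

Section circle.
Variable R : realType.
Local Notation C := R[i].
Local Notation tpi := (pi *+ 2 : R).

Lemma pi2_gt0 : 0 < tpi. Proof. by rewrite pmulrn_lgt0 ?pi_gt0. Qed.

Definition cint (F : R -> C) : C :=
  itvint (fun t => complex.Re (F t)) 0 tpi +i* itvint (fun t => complex.Im (F t)) 0 tpi.

(** Goursat on [0, 1] x [0, 2 pi], mapped by x (a + i b) + i y: by periodicity the sides y = 0 and y
    = 2 pi cancel, and the sides x = 0 and x = 1 are the two integrals. *)
Lemma cint_cdiff (F : R -> R -> C) (a b : R) :
  (forall x y, 0 <= x <= 1 -> 0 <= y <= tpi -> cdiff F (x * a) (x * b + y)) ->
  (forall x y, F x (y + tpi) = F x y) ->
  cint (fun t => F a (b + t)) = cint (F 0).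
Proof.
move=> hF per.
have h1 := goursat ler01 (ltW pi2_gt0) (fun x y hx hy => (cdiff_closed (hF x y hx hy)).1).
have h2 := goursat ler01 (ltW pi2_gt0) (fun x y hx hy => (cdiff_closed (hF x y hx hy)).2).
have P s : F (s * a) (s * b + tpi) = F (s * a) (s * b + 0) by rewrite per addr0.
have fin (f g k l : R -> R) : k = l -> itvint f 0 tpi - itvint g 0 tpi =
    itvint k 0 1 - itvint l 0 1 -> itvint f 0 tpi = itvint g 0 tpi.
  by move=> ->; rewrite subrr => /eqP; rewrite subr_eq0 => /eqP.
have {}h1 := fin _ _ _ _ _ h1; have {}h2 := fin _ _ _ _ _ h2.
rewrite /cint; congr Complex.
  rewrite -[RHS](_ : itvint (fun t => complex.Re (F (0 * a) (0 * b + t))) 0 tpi = _).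
    rewrite -h1; last by apply/funext => s; rewrite P.
    by congr itvint; apply/funext => t; rewrite !mul1r.
  by congr itvint; apply/funext => t; rewrite !mul0r add0r.
rewrite -[RHS](_ : itvint (fun t => complex.Im (F (0 * a) (0 * b + t))) 0 tpi = _).
  rewrite -h2; last by apply/funext => s; rewrite P.
  by congr itvint; apply/funext => t; rewrite !mul1r.
by congr itvint; apply/funext => t; rewrite !mul0r add0r.
Qed.

Lemma riemann_sum (f : R -> R) (M : nat) (e : R) : (0 < M)%N ->
  cont_on f 0 tpi ->
  (forall s t, 0 <= s <= tpi -> 0 <= t <= tpi -> `|s - t| <= tpi / M%:R ->
    `|f s - f t| <= e) ->
  `|itvint f 0 tpi - tpi / M%:R * \sum_(l < M) f (tpi * l%:R / M%:R)| <= tpi * e.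
Proof.
move=> M0 cf he; have M0' : 0 < M%:R :> R by rewrite ltr0n.
have p0 := pi2_gt0.
pose x (l : nat) : R := tpi * l%:R / M%:R.
have dx l : x l.+1 - x l = tpi / M%:R by rewrite /x -natr1; field; rewrite gt_eqF.
have dx0 : 0 < tpi / M%:R by rewrite divr_gt0.
have x0 l : 0 <= x l by rewrite /x divr_ge0 ?mulr_ge0// ltW.
have xM l : (l <= M)%N -> x l <= tpi.
  by move=> lM; rewrite /x ler_pdivrMr// ler_pM2l// ler_nat.
suff H k : (k <= M)%N ->
    `|itvint f 0 (x k) - tpi / M%:R * \sum_(l < k) f (x l)| <= x k * e.
  have := H M (leqnn _); rewrite {1 3}/x mulfK ?gt_eqF//.
elim: k => [|k IH] kM.
  rewrite big_ord0 mulr0 subr0 /x mulr0 mul0r mul0r.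
  by rewrite /itvint set_itv1 Rintegral_set1 normr0.
have kM' := ltnW kM.
have xk : x k <= x k.+1 by rewrite -subr_ge0 dx ltW.
rewrite big_ord_recr/= (@itvint_split _ _ _ (x k))//; last first.
  by apply: cont_on_sub cf => //; exact: xM.
rewrite mulrDr (_ : _ - _ = (itvint f 0 (x k) - tpi / M%:R * \sum_(l < k) f (x l)) +
  (itvint f (x k) (x k.+1) - f (x k) * (x k.+1 - x k))); last by rewrite dx; ring.
have -> : x k.+1 * e = x k * e + e * (x k.+1 - x k) by ring.
apply: le_trans (ler_normD _ _) _; apply: lerD; first exact: IH.
have cf' : cont_on f (x k) (x k.+1) by apply: cont_on_sub cf => //; exact: xM.
rewrite -itvint_cst// -itvintB//; last by move=> t _; exact: cst_continuous.
apply: itvint_le => //; first by apply: cont_onB => // t _; exact: cst_continuous.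
move=> t /andP[t1 t2]; apply: he.
- by rewrite (le_trans (x0 k) t1) (le_trans t2)// xM.
- by rewrite x0 xM.
- by rewrite ger0_norm ?subr_ge0// -(dx k) lerD2r.
Qed.

End circle.

(** * Uniform estimates on closed balls *)

Section compactness.
Variables (R : realType) (n : nat).
Local Notation C := R[i].
Local Notation Cn := 'rV[C]_n.

Lemma normc_dist (x y : C) : `|normc x - normc y| <= normc (x - y).
Proof.
have h1 := normcD (x - y) y; have h2 := normcD (y - x) x.
rewrite !subrK (normc_distC y) in h1 h2.
by rewrite ler_norml; apply/andP; split; lra.
Qed.

Lemma compact_disc (r : R) : compact [set x : C | normc x <= r].
Proof.
pose f (p : R * R) : C := p.1 +i* p.2.
have cf : continuous f.
  move=> p; apply/cvgrPdist_lt => e /lt0C[d d0 ->].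
  have d2 : 0 < d / 2 by rewrite divr_gt0.
  exists (ball p.1 (d / 2), ball p.2 (d / 2)).
    by split; exact: nbhsx_ballx.
  move=> q [h1 h2]; rewrite normC ltcR; apply: le_lt_trans (normc_pair _ _) _.
  by rewrite (splitr d) ltrD.
have cp : compact (f @` (`[-r, r]%classic `*` `[-r, r]%classic)).
  apply: continuous_compact; first exact: continuous_subspaceT.
  by apply: compact_setX; exact: segment_compact.
apply: subclosed_compact cp _.
  rewrite -openC openE => x /= /negP; rewrite -ltNge => rx.
  apply/nbhsC; exists (normc x - r); first by rewrite subr_gt0.
  move=> t; have := normc_dist x t; rewrite ler_norml => /andP[_ h] xt /= tr.
  have := le_lt_trans h xt; rewrite ltrD2l ltrN2 ltNge.
  by rewrite tr.
move=> x /= xr; exists (complex.Re x, complex.Im x); last by case: x {xr}.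
split => /=; rewrite in_itv/= -ler_norml.
  exact: le_trans (Re_le_normc _) xr.
exact: le_trans (Im_le_normc _) xr.
Qed.

Lemma cvg_normc_coord j (x : Cn) : {for x, continuous (fun z : Cn => normc (z ord0 j))}.
Proof.
have FF : Filter (nbhs x) := @nbhs_filter Cn x.
apply/cvgrPdist_lt => e e0; apply/nbhs_rowC; exists e => // t h.
by apply: le_lt_trans (normc_dist _ _) (h j).
Qed.

Lemma continuous_sqr_enorm (x : Cn) : {for x, continuous (@sqr_enorm R n)}.
Proof.
have FF : Filter (nbhs x) := @nbhs_filter Cn x.
rewrite /sqr_enorm /prop_for /continuous_at; elim: (index_enum _) => [|j s IH].
  by rewrite big_nil; under eq_fun do rewrite big_nil; exact: cvg_cst.
rewrite big_cons; under eq_fun do rewrite big_cons.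
apply: cvgD IH; rewrite expr2; under eq_fun do rewrite expr2.
by apply: cvgM; exact: cvg_normc_coord.
Qed.

(** The parameter is the square of the Euclidean radius. *)
Definition cball (r : R) : set Cn := [set z | sqr_enorm z <= r].

Lemma compact_cball r : compact (cball r).
Proof.
pose K := [set z : Cn | forall j, [set x : C | normc x <= Num.sqrt r] (z ord0 j)].
have cK : compact K by apply: (@rV_compact C n (fun=> [set x : C | normc x <= Num.sqrt r])) => j; exact: compact_disc.
apply: subclosed_compact cK _.
  rewrite (_ : cball r = (@sqr_enorm R n) @^-1` [set x | x <= r])//.
  apply: closed_comp; last exact: closed_le.
  by move=> z _; exact: continuous_sqr_enorm.
move=> z /= zr j /=; rewrite -[leLHS](ger0_norm (normc_ge0 _)) -sqrtr_sqr ler_wsqrtr//.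
apply: le_trans zr; rewrite /sqr_enorm (bigD1 j)//= lerDl sumr_ge0// => k _.
by rewrite sqr_ge0.
Qed.

Lemma near_covering_cball (r : R) (I : Type) (F : set_system I) (P : I -> Cn -> Prop) :
  Filter F -> (forall x, cball r x -> \forall x' \near x & i \near F, P i x') ->
  \near F, cball r `<=` P F.
Proof.
move=> FF; have /(@compact_near_coveringP Cn) h := @compact_cball r.
exact: h.
Qed.

Lemma bounded_cball (f : Cn -> C) (r : R) : (forall x, cball r x -> {for x, continuous f}) ->
  exists c, forall x, cball r x -> normc (f x) <= c.
Proof.
move=> cf; have [] := @near_covering_cball r R (pinfty_nbhs R) (fun M x => normc (f x) <= M) _.
  move=> x /cf/continuousC_rowP/(_ 1 ltr01)[d d0 hd].
  exists ([set t : Cn | forall j, normc (x ord0 j - t ord0 j) < d], [set M | normc (f x) + 1 <= M]).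
    split => /=; first by apply/nbhs_rowC; exists d.
    by apply: nbhs_pinfty_ge; exact: num_real.
  move=> [t M] [/= ht hM]; apply: le_trans hM.
  have := normcD (f t - f x) (f x); rewrite subrK addrC => /le_trans; apply.
  by rewrite lerD2l normc_distC ltW// hd.
move=> M [_ hM]; exists (M + 1); apply: hM.
by rewrite ltrDl.
Qed.

Lemma unif_cball (f : Cn -> C) (r : R) : (forall x, cball r x -> {for x, continuous f}) ->
  forall e, 0 < e -> exists2 d : R, 0 < d & forall x y : Cn, cball r x ->
    (forall j, normc (x ord0 j - y ord0 j) < d) -> normc (f x - f y) < e.
Proof.
move=> cf e e0; have e2 : 0 < e / 2 by rewrite divr_gt0.
have := @near_covering_cball r R (0^'+) (fun d x => forall y : Cn,
  (forall j, normc (x ord0 j - y ord0 j) < d) -> normc (f x - f y) < e) _.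
case.
  move=> x /cf/continuousC_rowP/(_ _ e2)[d d0 hd].
  have d2 : 0 < d / 2 by rewrite divr_gt0.
  exists ([set t : Cn | forall j, normc (x ord0 j - t ord0 j) < d / 2], [set s | s < d / 2]).
    split => /=; first by apply/nbhs_rowC; exists (d / 2).
    exact: nbhs_right_lt.
  move=> [t s] [/= ht hs] y hy.
  have -> : f t - f y = (f x - f y) - (f x - f t) by ring.
  apply: le_lt_trans (normcB _ _) _; rewrite (splitr e) ltrD ?hd// => j; last first.
    by rewrite (lt_trans (ht j))// ltr_pdivrMr// ltr_pMr// ltr1n.
  have -> : x ord0 j - y ord0 j = (x ord0 j - t ord0 j) + (t ord0 j - y ord0 j) by ring.
  apply: le_lt_trans (normcD _ _) _; rewrite (splitr d) ltrD//.
  exact: lt_trans hs.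
move=> d /= d0 hd; exists (d / 2); first by rewrite divr_gt0.
move=> x y hx hy; apply: (hd (d / 2) _ _ x hx y hy); last by rewrite divr_gt0.
by rewrite /= sub0r normrN gtr0_norm ?divr_gt0// ltr_pdivrMr// ltr_pMr// ltr1n.
Qed.

End compactness.

(** * Roots of unity and homogeneity of Cauchy integrals *)

Section roots.
Variable R : realType.
Local Notation C := R[i].
Local Notation tpi := (pi *+ 2 : R).

Lemma cexp_exists (c : C) : c != 0 -> exists a b, c = cexp a b.
Proof.
case: c => x y c0.
have r0 : 0 < normc (x +i* y).
  rewrite lt_neqAle normc_ge0 andbT eq_sym; apply: contra c0 => /eqP/normc_eq0 ->.
  by rewrite eqxx.
pose r := normc (x +i* y).
have xr : -1 <= x / r <= 1.
  rewrite -ler_norml normrM normrV ?unitfE ?gt_eqF// (gtr0_norm r0).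
  by rewrite ler_pdivrMr// mul1r; exact: (Re_le_normc (x +i* y)).
have xyr : x ^+ 2 + y ^+ 2 = r ^+ 2 by rewrite /r sqr_normcE.
have r2 : r != 0 by rewrite gt_eqF.
have sy : Num.sqrt (1 - (x / r) ^+ 2) = `|y| / r.
  rewrite -[RHS]ger0_norm; last by rewrite divr_ge0// ltW.
  rewrite -[RHS]sqrtr_sqr; congr Num.sqrt; rewrite exprMn [in RHS]exprMn real_normK ?num_real//.
  rewrite (_ : y ^+ 2 = r ^+ 2 - x ^+ 2); last by rewrite -xyr; ring.
  by field.
have ca : cos (acos (x / r)) = x / r by rewrite acosK// in_itv.
have [y0|y0] := leP 0 y.
  exists (ln r), (acos (x / r)); rewrite /cexp /expi lnK// ca sin_acos// sy ger0_norm//.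
  by apply/eqP; rewrite eq_complex/=; apply/andP; split; apply/eqP; field.
exists (ln r), (- acos (x / r)); rewrite /cexp /expi lnK// cosN sinN ca sin_acos// sy ltr0_norm//.
by apply/eqP; rewrite eq_complex/=; apply/andP; split; apply/eqP; field.
Qed.

Lemma expi_lip : exists2 d : R, 0 < d & forall s t : R, `|s - t| < d ->
  normc (expi s - expi t) <= 2 * `|s - t|.
Proof.
have [d d0 h] := cexp_deriv0 (@ltr01 R); exists d => // s t std.
have -> : expi s - expi t = expi t * (expi (s - t) - 1).
  by rewrite mulrBr -expiD mulr1; congr (expi _ - _); ring.
rewrite normcM normc_expi mul1r.
have := h 0 (s - t); rewrite normr0 d0 std add0r mul1r => /(_ isT isT).
rewrite /cexp expR0 mul1r => hh.
have := normcD (expi (s - t) - 1 - (0 +i* (s - t))) (0 +i* (s - t)); rewrite subrK => /le_trans; apply.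
rewrite mulr2n mulrDl mul1r lerD// (le_trans (normc_pair _ _))//.
by rewrite normr0 add0r.
Qed.

(** On the unit circle this is x^(p - q); the two exponents stay separate because such products come
    from expanding the Fejer kernel. *)
Definition conj_pow (p q : nat) (x : C) : C := x ^+ p * conjc x ^+ q.

Lemma normc_conj_pow p q x : normc (conj_pow p q x) = normc x ^+ (p + q).
Proof. by rewrite normcM !normcX normcJ exprD. Qed.

Lemma normc_conj_pow1 p q x : normc x = 1 -> normc (conj_pow p q x) = 1.
Proof. by move=> x1; rewrite normc_conj_pow x1 expr1n. Qed.

Lemma normc_subX k (x y : C) : normc x <= 1 -> normc y <= 1 ->
  normc (x ^+ k - y ^+ k) <= k%:R * normc (x - y).
Proof.
move=> x1 y1; elim: k => [|k IH]; first by rewrite !expr0 subrr mul0r ComplexField.Normc.normc0.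
rewrite !exprS (_ : _ - _ = x * (x ^+ k - y ^+ k) + (x - y) * y ^+ k); last by ring.
rewrite (le_trans (normcD _ _))// !normcM -natr1 mulrDl mul1r lerD//.
  by rewrite (le_trans _ IH)// ler_piMl ?normc_ge0.
by rewrite ler_piMr ?normc_ge0// normcX exprn_ile1 ?normc_ge0.
Qed.

Lemma conj_pow_lip p q (x y : C) : normc x <= 1 -> normc y <= 1 ->
  normc (conj_pow p q x - conj_pow p q y) <= (p + q)%:R * normc (x - y).
Proof.
move=> x1 y1; rewrite /conj_pow.
rewrite (_ : _ - _ = (x ^+ p - y ^+ p) * conjc x ^+ q +
   y ^+ p * (conjc x ^+ q - conjc y ^+ q)); last by ring.
rewrite (le_trans (normcD _ _))// !normcM natrD mulrDl lerD//.
  rewrite (le_trans _ (normc_subX p x1 y1))// ler_piMr ?normc_ge0//.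
  by rewrite normcX normcJ exprn_ile1 ?normc_ge0.
have -> : normc (x - y) = normc (conjc x - conjc y) by rewrite -rmorphB normcJ.
rewrite (le_trans _ (normc_subX q _ _)) ?normcJ// ler_piMl ?normc_ge0//.
by rewrite normcX exprn_ile1 ?normc_ge0.
Qed.

Definition zeta (M l : nat) : C := expi (tpi * l%:R / M%:R).

Lemma normc_zeta M l : normc (zeta M l) = 1. Proof. exact: normc_expi. Qed.

Lemma zetaX M l : zeta M l = zeta M 1 ^+ l.
Proof. by rewrite /zeta -expiMn; congr expi; rewrite -mulr_natr; ring. Qed.

Lemma zetaM M : (0 < M)%N -> zeta M 1 ^+ M = 1.
Proof.
move=> M0; rewrite -zetaX /zeta mulfK ?expi_pi2// pnatr_eq0 -lt0n//.
Qed.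

Lemma zetaD M k l : zeta M (k + l) = zeta M k * zeta M l.
Proof. by rewrite zetaX exprD -!zetaX. Qed.

Lemma zeta_mod M l : (0 < M)%N -> zeta M (l %% M) = zeta M l.
Proof.
by move=> M0; rewrite [in RHS](divn_eq l M) zetaD [zeta M (_ * _)]zetaX mulnC exprM zetaM// expr1n mul1r.
Qed.

Definition mavg M (F : C -> C) : C := (M%:R^-1 : R)%:C * \sum_(l < M) F (zeta M l).

Lemma half_eq (e x : R) : x != 0 -> e = x * (e / x / 2) * 2.
Proof. by move=> x0; field. Qed.

Lemma mavgB M F G : mavg M F - mavg M G = mavg M (fun x => F x - G x).
Proof. by rewrite /mavg -mulrBr sumrB. Qed.

Lemma mavgZ M k F : mavg M (fun x => k * F x) = k * mavg M F.
Proof. by rewrite /mavg [RHS]mulrCA [in RHS]mulr_sumr. Qed.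

Lemma normc_mavg M F (K : R) : (0 < M)%N -> (forall x, normc x = 1 -> normc (F x) <= K) ->
  normc (mavg M F) <= K.
Proof.
move=> M0 FK; rewrite /mavg normcM normc_real ger0_norm ?invr_ge0// mulrC ler_pdivrMr ?ltr0n//.
apply: le_trans (normc_sum _ _ _) _.
apply: (@le_trans _ _ (\sum_(l < M) K)); last by rewrite sumr_const card_ord mulr_natr.
by apply: ler_sum => l _; apply: FK; exact: normc_zeta.
Qed.

Lemma Re_sum I (r : seq I) (F : I -> C) :
  complex.Re (\sum_(i <- r) F i) = \sum_(i <- r) complex.Re (F i).
Proof. by elim/big_rec2: _ => // i x y _ <-; case: (F i) y => [? ?] []. Qed.

Lemma Im_sum I (r : seq I) (F : I -> C) :
  complex.Im (\sum_(i <- r) F i) = \sum_(i <- r) complex.Im (F i).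
Proof. by elim/big_rec2: _ => // i x y _ <-; case: (F i) y => [? ?] []. Qed.

Lemma riemann_cint (F : R -> C) (M : nat) (e : R) : (0 < M)%N ->
  (forall y, 0 <= y <= tpi -> {for y, continuous (fun t => complex.Re (F t))}) ->
  (forall y, 0 <= y <= tpi -> {for y, continuous (fun t => complex.Im (F t))}) ->
  (forall s t, `|s - t| <= tpi / M%:R -> normc (F s - F t) <= e) ->
  normc (cint F - (tpi / M%:R)%:C * \sum_(l < M) F (tpi * l%:R / M%:R)) <= tpi * e *+ 2.
Proof.
move=> M0 c1 c2 he.
have c1' : cont_on (fun t => complex.Re (F t)) 0 tpi by move=> y; rewrite in_itv/=; exact: c1.
have c2' : cont_on (fun t => complex.Im (F t)) 0 tpi by move=> y; rewrite in_itv/=; exact: c2.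
have ReB (x y : C) : complex.Re (x - y) = complex.Re x - complex.Re y by case: x y => [? ?] [].
have ImB (x y : C) : complex.Im (x - y) = complex.Im x - complex.Im y by case: x y => [? ?] [].
have h1 := riemann_sum M0 c1' (fun s t _ _ st =>
  le_trans (eq_ind _ (fun z => `|z| <= _) (Re_le_normc (F s - F t)) _ (ReB _ _)) (he s t st)).
have h2 := riemann_sum M0 c2' (fun s t _ _ st =>
  le_trans (eq_ind _ (fun z => `|z| <= _) (Im_le_normc (F s - F t)) _ (ImB _ _)) (he s t st)).
apply: le_trans (normc_le_ReIm _) _; rewrite [leRHS]mulr2n lerD//.
  have ReZ (x : R) (y : C) : complex.Re (x%:C * y) = x * complex.Re y by case: y => a b /=; ring.
  by rewrite ReB ReZ Re_sum.
have ImZ (x : R) (y : C) : complex.Im (x%:C * y) = x * complex.Im y by case: y => a b /=; ring.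
by rewrite ImB ImZ Im_sum.
Qed.

(** For a power series G this is 2 pi times its term of degree q - p at c. *)
Definition cauchy (G : C -> C) p q (c : C) : C :=
  cint (fun t => G (c * expi t) * conj_pow p q (expi t)).

Lemma cexpX a b k : cexp (k%:R * a) (k%:R * b) = cexp a b ^+ k :> C.
Proof.
elim: k => [|k IH]; first by rewrite !mul0r /cexp expR0 expi0 mulr1 expr0.
by rewrite exprS -IH -cexpD; congr cexp; rewrite -natr1; ring.
Qed.

Lemma cexpN a b : cexp (- a) (- b) = (cexp a b)^-1 :> C.
Proof.
have c0 : cexp a b != 0 :> C.
  apply/eqP => h; have := normc_cexp a b; rewrite h ComplexField.Normc.normc0.
  by move=> /esym/eqP; rewrite gt_eqF ?expR_gt0.
by apply: (mulfI c0); rewrite -cexpD !subrr /cexp expR0 expi0 mulr1 -/(cexp a b) mulfV.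
Qed.

Lemma conj_expi t : conjc (expi t) = expi (- t) :> C.
Proof. by rewrite /expi cosN sinN. Qed.

Lemma continuous_ReIm (F : R -> C) y :
  (forall e, 0 < e -> exists2 d, 0 < d & forall t, `|y - t| < d -> normc (F y - F t) <= e) ->
  {for y, continuous (fun t => complex.Re (F t))} /\
  {for y, continuous (fun t => complex.Im (F t))}.
Proof.
move=> h; split; apply/cvgrPdist_le => e /h[d d0 hd]; apply/nbhs_ballP; exists d => // t /hd;
  apply: le_trans; [apply: le_trans (Re_le_normc _)|apply: le_trans (Im_le_normc _)];
  by case: (F y) (F t) => [? ?] [].
Qed.

Lemma cintZ (k : C) (F : R -> C) : cont_on (fun t => complex.Re (F t)) 0 tpi ->
  cont_on (fun t => complex.Im (F t)) 0 tpi -> cint (fun t => k * F t) = k * cint F.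
Proof.
case: k => a b h1 h2.
have i1 := cont_on_integrable h1; have i2 := cont_on_integrable h2.
have m s : measurable `[s, tpi]%classic by [].
rewrite /cint /itvint; apply/eqP; rewrite eq_complex/=; apply/andP; split; apply/eqP.
  rewrite -RintegralZl// -RintegralZl// -RintegralB//; last 2 first.
  - exact: (integrableZl _ a i1).
  - exact: (integrableZl _ b i2).
  by apply: eq_Rintegral => t _; case: (F t).
rewrite -RintegralZl// -RintegralZl// -RintegralD//; last 2 first.
- exact: (integrableZl _ a i2).
- exact: (integrableZl _ b i1).
by apply: eq_Rintegral => t _; case: (F t).
Qed.

(** * Fejer means over the torus *)

Section uniform.
Variables (I : Type) (G : I -> C -> C) (K : R).
Hypothesis Gd : forall i w, normc w <= 1 -> cderiv (G i) w.
Hypothesis GK : forall i w, normc w <= 1 -> normc (G i w) <= K.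
Hypothesis Gu : forall e, 0 < e -> exists2 d : R, 0 < d & forall i w w',
  normc w <= 1 -> normc w' <= 1 -> normc (w - w') < d -> normc (G i w - G i w') <= e.

(** With w = s + i t this is G(e^w) e^((p - q) w); it is complex differentiable for s <= 0, where
    e^w stays in the closed unit disc. *)
Let F i p q s t : C :=
  G i (cexp (1 * s) (1 * t)) * cexp (p%:R * s) (p%:R * t) * cexp (- q%:R * s) (- q%:R * t).

Let FE i p q a b t : F i p q a (b + t) = cexp a b ^+ p / cexp a b ^+ q *
  (G i (cexp a b * expi t) * conj_pow p q (expi t)).
Proof.
rewrite /F !mul1r !mulNr cexpN !cexpX -[a in cexp a (b + t)]addr0 cexpD.
have -> : cexp 0 t = expi t by rewrite /cexp expR0 mul1r.
rewrite /conj_pow conj_expi.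
have -> : expi (- t) = (expi t)^-1 :> C.
  by have := cexpN 0 t; rewrite oppr0 /cexp expR0 !mul1r.
by rewrite !exprMn invfM exprVn; ring.
Qed.

Let Fd i p q x y : x <= 0 -> cdiff (F i p q) x y.
Proof.
move=> x0; apply: cdiff_mul; first apply: cdiff_mul.
- apply: (cdiff_comp (cdiff_cexp 1 x y)); apply: Gd; rewrite normc_cexp mul1r -expR0.
  by rewrite ler_expR.
- exact: cdiff_cexp.
- exact: cdiff_cexp.
Qed.

Let integrand i p q c t := G i (c * expi t) * conj_pow p q (expi t).

Let unif p q e : 0 < e -> exists2 d, 0 < d & forall i c s t, normc c <= 1 ->
  `|s - t| < d -> normc (integrand i p q c s - integrand i p q c t) <= e.
Proof.
move=> e0; have [d1 d10 h1] := expi_lip; have e2 : 0 < e / 2 by rewrite divr_gt0.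
have [d2 d20 h2] := Gu e2.
(* A bound of G times the Lipschitz constant p + q of [conj_pow] times that of [expi]; the last 1
   makes it positive. *)
pose L := (`|K| + 1) * (p + q)%:R * 2 + 1; have L0 : 0 < L.
  by rewrite ltr_wpDl// mulr_ge0// mulr_ge0// addr_ge0.
exists (Num.min d1 (Num.min (d2 / 2) (e / 2 / L))).
  by rewrite !lt_min d10 !divr_gt0.
move=> i c s t c1; rewrite !lt_min => /and3P[/h1 st1 st2 st3].
have cs u : normc (c * expi u) <= 1 by rewrite normcM normc_expi mulr1.
rewrite /integrand (_ : _ - _ =
    (G i (c * expi s) - G i (c * expi t)) * conj_pow p q (expi s) +
    G i (c * expi t) * (conj_pow p q (expi s) - conj_pow p q (expi t))); last by ring.
apply: le_trans (normcD _ _) _.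
rewrite (normcM _ (conj_pow p q (expi s))) (normcM (G i (c * expi t))) (splitr e) lerD//.
  rewrite normc_conj_pow1 ?normc_expi// mulr1; apply: h2 => //.
  rewrite -mulrBr normcM (le_lt_trans (ler_piMl _ c1)) ?normc_ge0//.
  by rewrite (le_lt_trans st1)// mulrC -ltr_pdivlMr.
have h3 : normc (conj_pow p q (expi s) - conj_pow p q (expi t)) <= (p + q)%:R * (2 * `|s - t|).
  by rewrite (le_trans (conj_pow_lip _ _ _ _)) ?normc_expi// ler_wpM2l.
have h4 : normc (G i (c * expi t)) <= `|K| + 1.
  by rewrite (le_trans (GK _ (cs t)))// (le_trans (ler_norm _))// lerDl.
apply: le_trans (ler_pM (normc_ge0 _) (normc_ge0 _) h4 h3) _.
apply: (@le_trans _ _ (L * `|s - t|)).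
  by rewrite /L [leRHS]mulrDl mul1r !mulrA lerDl.
by rewrite mulrC -ler_pdivlMr// ltW.
Qed.

Let cont i p q c y : normc c <= 1 ->
  {for y, continuous (fun t => complex.Re (integrand i p q c t))} /\
  {for y, continuous (fun t => complex.Im (integrand i p q c t))}.
Proof.
move=> c1; apply: continuous_ReIm => e e0; have [d d0 hd] := unif p q e0.
by exists d => // t yt; exact: hd.
Qed.

(** In the coordinate log c = a + i b, [cint_cdiff] moves the circle of radius |c| to the unit
    circle; |c| <= 1 means a <= 0, so the path stays where G is differentiable. *)
Lemma cauchy_hom i p q c : c != 0 -> normc c <= 1 ->
  c ^+ p * cauchy (G i) p q c = c ^+ q * cauchy (G i) p q 1.
Proof.
move=> c0 c1; have [a [b cE]] := cexp_exists c0.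
have a0 : a <= 0 by rewrite -ler_expR expR0 -(normc_cexp a b) -cE.
have per x y : F i p q x (y + tpi) = F i p q x y.
  rewrite -[in RHS](addr0 y) !FE.
  by rewrite expi0 expi_pi2.
have h : cint (fun t => F i p q a (b + t)) = cint (F i p q 0).
  apply: cint_cdiff => // x y /andP[x0 _] _; apply: Fd.
  by rewrite mulr_ge0_le0.
have E1 : cint (fun t => F i p q a (b + t)) = c ^+ p / c ^+ q * cauchy (G i) p q c.
  rewrite -cintZ; first last.
  - by move=> y _; have [_] := cont i p q y c1.
  - by move=> y _; have [] := cont i p q y c1.
  by congr cint; apply/funext => t; rewrite FE -cE.
have E2 : cint (F i p q 0) = cauchy (G i) p q 1.
  congr cint; apply/funext => t; rewrite -[t in LHS]add0r FE.
  by rewrite /cexp expR0 expi0 mulr1 !expr1n divr1 !mul1r.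
move: h; rewrite E1 E2 => <-; rewrite [in RHS]mulrA [c ^+ q * _]mulrC mulfVK//.
by rewrite expf_neq0.
Qed.

(** The index [i] will be a point of the torus fixing the remaining coordinates, so the error of the
    Riemann sum must not depend on it. *)
Lemma cauchy_mavg p q e : 0 < e -> exists M0, forall M, (M0 <= M)%N -> (0 < M)%N /\
  forall i c, normc c <= 1 -> normc (cauchy (G i) p q c -
    tpi%:C * mavg M (fun x => G i (c * x) * conj_pow p q x)) <= e.
Proof.
move=> e0; pose e' := e / tpi / 2.
have e'0 : 0 < e' by rewrite !divr_gt0// pi2_gt0.
have [d d0 hd] := unif p q e'0.
have [M0 hM0] : exists M0 : nat, tpi / d < M0%:R.
  by exists (Num.trunc (tpi / d)).+1; exact: truncnS_gt.
exists M0.+1 => M M0M; have M1 : (0 < M)%N by exact: leq_trans M0M.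
split=> // i c c1.
have M2 : tpi / M%:R < d.
  rewrite ltr_pdivrMr ?ltr0n// mulrC -ltr_pdivrMr//; apply: lt_trans hM0 _.
  by rewrite ltr_nat.
have h := @riemann_cint (integrand i p q c) M e' M1.
rewrite (_ : e = tpi * e' *+ 2); last first.
  by rewrite -mulr_natr; apply: half_eq; rewrite gt_eqF ?pi2_gt0.
have E : tpi%:C * mavg M (fun x => G i (c * x) * conj_pow p q x) =
    (tpi / M%:R)%:C * \sum_(l < M) integrand i p q c (tpi * l%:R / M%:R).
  by rewrite /mavg mulrA -rmorphM.
rewrite E; apply: h => [y _|y _|s t st].
- by have [] := cont i p q y c1.
- by have [_] := cont i p q y c1.
- exact: hd c1 (le_lt_trans st M2).
Qed.

Lemma cauchy_le p q : exists2 B : R, 0 < B & forall i c, normc c <= 1 ->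
  normc (cauchy (G i) p q c) <= B.
Proof.
have [M0 /(_ _ (leqnn M0)) [M1 h]] := cauchy_mavg p q ltr01.
exists (tpi * `|K| + 1); first by rewrite ltr_wpDl// mulr_ge0// ltW// pi2_gt0.
move=> i c c1; have := h i c c1; set m := mavg _ _ => h1.
have := normcD (cauchy (G i) p q c - tpi%:C * m) (tpi%:C * m); rewrite subrK => /le_trans; apply.
rewrite addrC lerD// normcM normc_real gtr0_norm ?pi2_gt0// ler_wpM2l ?(ltW (pi2_gt0 R))//.
apply: normc_mavg => // x x1; rewrite normcM normc_conj_pow1// mulr1.
by rewrite (le_trans (GK _ _))//; [rewrite normcM x1 mulr1|exact: ler_norm].
Qed.

(** Gives access to c = 0, which logarithmic coordinates do not reach. *)
Lemma cauchy_cont0 p q e : 0 < e -> exists2 r : R, 0 < r <= e /\ r <= 1 & forall i,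
  normc (cauchy (G i) p q 0 - cauchy (G i) p q r%:C) <= e.
Proof.
move=> e0; have e4 : 0 < e / 3 by rewrite divr_gt0.
have [M0 /(_ _ (leqnn M0)) [M1 h]] := cauchy_mavg p q e4.
have p0 := pi2_gt0 R.
have [d d0 hd] := Gu (divr_gt0 e4 p0).
exists (Num.min (Num.min e (d / 2)) 1).
  by rewrite !ge_min !lexx !lt_min e0 ltr01 divr_gt0// !orbT.
set r := Num.min _ _; have r0 : 0 < r by rewrite !lt_min e0 ltr01 divr_gt0.
have r1 : normc r%:C <= 1 by rewrite normc_real gtr0_norm// ge_min lexx orbT.
have rd : r < d.
  by rewrite !gt_min ltr_pdivrMr// ltr_pMr// ltr1n orbT.
have z1 : normc (0 : C) <= 1 by rewrite ComplexField.Normc.normc0.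
move=> i; have := h i _ z1; have := h i _ r1.
set m := mavg _ _; set m' := mavg _ _ => h1 h2.
have h3 : normc (tpi%:C * (m' - m)) <= e / 3.
  rewrite normcM normc_real gtr0_norm// mulrC -ler_pdivlMr// mavgB.
  apply: normc_mavg => // x x1; rewrite -mulrBl normcM normc_conj_pow1// mulr1.
  apply: hd; rewrite ?normcM ?x1 ?mulr1//.
  by rewrite -mulrBl normcM x1 mulr1 sub0r normcN normc_real gtr0_norm.
rewrite (_ : _ - _ = (cauchy (G i) p q 0 - tpi%:C * m') - (cauchy (G i) p q r%:C - tpi%:C * m) +
  tpi%:C * (m' - m)); last by ring.
apply: le_trans (normcD _ _) _; rewrite (_ : e = e / 3 + e / 3 + e / 3); last by field.
by rewrite lerD// (le_trans (normcB _ _))// lerD.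
Qed.

Lemma normc_le0_eq (x y : C) : (forall e : R, 0 < e -> normc (x - y) <= e) -> x = y.
Proof.
move=> h; apply/eqP; rewrite -subr_eq0; apply/eqP/normc_eq0/le_anti.
by rewrite normc_ge0 andbT; apply/ler_addgt0Pl => e e0; rewrite addr0 h.
Qed.

(** For p <= q this is [cauchy_hom] after cancelling c^p. For q < p it gives cauchy(1) = r^(p - q)
    cauchy(r), which tends to 0 with r since cauchy is bounded: negative powers do not occur. The
    value at 0 follows by continuity. *)
Lemma cauchyE i p q c : normc c <= 1 -> cauchy (G i) p q c =
  if (p <= q)%N then c ^+ (q - p) * cauchy (G i) p q 1 else 0.
Proof.
have [B B0 hB] := cauchy_le p q.
have n0 (r : R) : 0 < r -> r%:C != 0 :> C by move=> r0; rewrite fmorph_eq0 gt_eqF.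
have nr (r : R) : 0 < r -> r <= 1 -> normc r%:C <= 1 by move=> r0; rewrite normc_real gtr0_norm.
have H d : d != 0 -> normc d <= 1 -> cauchy (G i) p q d =
    if (p <= q)%N then d ^+ (q - p) * cauchy (G i) p q 1 else 0.
  move=> d0 d1; have hd := cauchy_hom i p q d0 d1.
  have dp k : d ^+ k != 0 by rewrite expf_neq0.
  case: leqP => [pq|qp].
    by apply: (mulfI (dp p)); rewrite hd mulrA -exprD subnKC.
  suff h1 : cauchy (G i) p q 1 = 0.
    by move: hd; rewrite h1 mulr0 => /eqP; rewrite mulf_eq0 (negbTE (dp p)) => /eqP.
  apply: normc_le0_eq => e e0; rewrite subr0.
  pose r := Num.min 1 (e / B); have r0 : 0 < r by rewrite lt_min ltr01 divr_gt0.
  have r1 : r <= 1 by rewrite ge_min lexx.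
  have hr := cauchy_hom i p q (n0 _ r0) (nr _ r0 r1).
  have -> : cauchy (G i) p q 1 = r%:C ^+ (p - q) * cauchy (G i) p q r%:C.
    apply: (mulfI (expf_neq0 q (n0 _ r0))).
    by rewrite -hr [in RHS]mulrA -exprD subnKC// ltnW.
  rewrite normcM normcX normc_real gtr0_norm//.
  apply: (@le_trans _ _ (r * B)); last by rewrite -ler_pdivlMr// ge_min lexx orbT.
  apply: ler_pM; rewrite ?normc_ge0 ?exprn_ge0 ?(ltW r0)//; last exact: hB (nr _ r0 r1).
  by rewrite -[leRHS]expr1 ler_wiXn2l ?(ltW r0)// subn_gt0.
move=> c1; have [->|c0] := eqVneq c 0; last exact: H.
apply: normc_le0_eq => e e0.
have e2 : 0 < e / (1 + B) by rewrite divr_gt0// addr_gt0.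
have [r [/andP[r0 re] r1] hr] := cauchy_cont0 p q e2.
set X := if _ then _ else _.
rewrite -(subrK (cauchy (G i) p q r%:C) (cauchy (G i) p q 0)) -addrA /X.
apply: le_trans (normcD _ _) _.
rewrite (_ : e = e / (1 + B) + e / (1 + B) * B); last by field; rewrite gt_eqF// addr_gt0.
apply: lerD; first exact: hr.
rewrite (H _ (n0 _ r0) (nr _ r0 r1)).
case: leqP => [_|_]; last by rewrite subrr ComplexField.Normc.normc0 mulr_ge0// ltW.
rewrite -mulrBl normcM; apply: ler_pM; rewrite ?normc_ge0//; last first.
  by apply: hB; rewrite ComplexField.Normc.normc1.
case: (q - p)%N => [|k]; first by rewrite !expr0 subrr ComplexField.Normc.normc0 ltW.
rewrite expr0n subr0 normcX normc_real gtr0_norm//; apply: le_trans re.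
by rewrite -[leRHS]expr1 ler_wiXn2l ?(ltW r0).
Qed.

(** [cauchyE] carried over to averages over roots of unity, where it holds up to an error uniform in
    [i] and [c]. *)
Lemma mavg_shift p q e : 0 < e -> exists M0, forall M, (M0 <= M)%N -> (0 < M)%N /\
  forall i c, normc c <= 1 -> normc (mavg M (fun x => G i (c * x) * conj_pow p q x) -
    (if (p <= q)%N then c ^+ (q - p) * mavg M (fun x => G i x * conj_pow p q x) else 0)) <= e.
Proof.
move=> e0; have p0 := pi2_gt0 R.
have e2 : 0 < tpi * e / 2 by rewrite divr_gt0// mulr_gt0.
have [M0 hM] := cauchy_mavg p q e2; exists M0 => M /hM[M1 {}hM]; split=> // i c c1.
have h1 := hM i c c1.
have h2 : normc (cauchy (G i) p q 1 - tpi%:C * mavg M (fun x => G i x * conj_pow p q x)) <= tpi * e / 2.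
  have := hM i 1; rewrite ComplexField.Normc.normc1 => /(_ (lexx _)).
  by under eq_fun do rewrite mul1r.
rewrite cauchyE// in h1; move: h1 h2; set m := mavg _ _; set m' := mavg _ _ => h1 h2.
rewrite -(ler_pM2l p0) -[X in X * normc _](gtr0_norm p0) -normc_real -normcM.
rewrite (_ : tpi * e = tpi * e / 2 + tpi * e / 2); last by field.
case: leqP h1 => [_|_] h1; last first.
  rewrite subr0 -normcN; rewrite sub0r in h1; rewrite (le_trans h1)// lerDl ltW//.
rewrite (_ : tpi%:C * (m - c ^+ (q - p) * m') = c ^+ (q - p) * (cauchy (G i) p q 1 - tpi%:C * m') -
  (c ^+ (q - p) * cauchy (G i) p q 1 - tpi%:C * m)); last by ring.
apply: le_trans (normcB _ _) _; apply: lerD => //.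
rewrite normcM (le_trans _ h2)// ler_piMl ?normc_ge0//.
by rewrite normcX exprn_ile1 ?normc_ge0.
Qed.

End uniform.

End roots.

(** * Null sequences of complex numbers *)

Section null.
Variable R : realType.
Local Notation C := R[i].

Lemma normcV (x : C) : normc x^-1 = (normc x)^-1.
Proof.
have [->|x0] := eqVneq x 0; first by rewrite invr0 ComplexField.Normc.normc0 invr0.
have n0 : normc x != 0 by apply: contra x0 => /eqP/normc_eq0 ->.
by apply: (mulfI n0); rewrite -normcM !mulfV// ComplexField.Normc.normc1.
Qed.

Definition null (u : nat -> C) := forall e : R, 0 < e ->
  exists k0, forall k, (k0 <= k)%N -> normc (u k) <= e.

Lemma null_cst0 : null (fun=> 0).
Proof. by move=> e e0; exists 0%N => k _; rewrite ComplexField.Normc.normc0 ltW. Qed.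

Lemma nullD u v : null u -> null v -> null (fun k => u k + v k).
Proof.
move=> hu hv e e0; have e2 : 0 < e / 2 by rewrite divr_gt0.
have [k1 h1] := hu _ e2; have [k2 h2] := hv _ e2.
exists (maxn k1 k2) => k; rewrite geq_max => /andP[/h1 {}h1 /h2 {}h2].
by rewrite (le_trans (normcD _ _))// (splitr e) lerD.
Qed.

Lemma nullZ c u : null u -> null (fun k => c * u k).
Proof.
move=> hu e e0; have c0 : 0 < normc c + 1 by rewrite ltr_wpDl ?normc_ge0.
have [k0 h] := hu _ (divr_gt0 e0 c0); exists k0 => k /h hk.
rewrite normcM (le_trans (ler_wpM2l (normc_ge0 _) hk))// mulrCA ler_piMr ?(ltW e0)//.
by rewrite ler_pdivrMr// mul1r lerDl.
Qed.

Lemma nullB u v : null u -> null v -> null (fun k => u k - v k).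
Proof.
move=> hu hv; have := nullD hu (nullZ (-1) hv).
by congr null; apply/funext => k; rewrite mulN1r.
Qed.

Lemma null_sum I (r : seq I) (u : I -> nat -> C) : (forall i, null (u i)) ->
  null (fun k => \sum_(i <- r) u i k).
Proof.
move=> hu; elim: r => [|i r IH].
  by under eq_fun do rewrite big_nil; exact: null_cst0.
by under eq_fun do rewrite big_cons; exact: nullD.
Qed.

End null.

(** * Averages over tori of roots of unity *)

Section torus.
Variables (R : realType) (n : nat).
Local Notation C := R[i].
Local Notation Cn := 'rV[C]_n.
Local Notation B := (@unit_ball R n).

Definition root_pt M (f : {ffun 'I_n -> 'I_M}) (j : 'I_n) : C := zeta R M (f j).

Definition tavg M (F : ('I_n -> C) -> C) : C :=
  ((M%:R ^- n) : R)%:C * \sum_(f : {ffun 'I_n -> 'I_M}) F (root_pt f).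

Lemma tavgB M F G : tavg M F - tavg M G = tavg M (fun u => F u - G u).
Proof. by rewrite /tavg -mulrBr sumrB. Qed.

Lemma tavgZ M k F : tavg M (fun x => k * F x) = k * tavg M F.
Proof. by rewrite /tavg [RHS]mulrCA [in RHS]mulr_sumr. Qed.

Lemma normc_tavg M F (K : R) : (0 < M)%N ->
  (forall u, (forall j, normc (u j) = 1) -> normc (F u) <= K) ->
  normc (tavg M F) <= K.
Proof.
move=> M0 FK; rewrite /tavg normcM normc_real ger0_norm ?invr_ge0 ?exprn_ge0//.
rewrite mulrC ler_pdivrMr ?exprn_gt0 ?ltr0n//.
apply: le_trans (normc_sum _ _ _) _.
apply: (@le_trans _ _ (\sum_(f : {ffun 'I_n -> 'I_M}) K)).
  by apply: ler_sum => f _; apply: FK => j; exact: normc_zeta.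
by rewrite sumr_const card_ffun !card_ord -[_ *+ _]mulr_natr natrX.
Qed.

Definition mul_at (j : 'I_n) (x : C) (u : 'I_n -> C) (k : 'I_n) : C :=
  if k == j then u k * x else u k.

(** Multiplying coordinate [j] by an M-th root of unity permutes the torus points, so averaging over
    these factors as well changes nothing; this exposes an average in one variable. *)
Lemma tavg_coord j M F : (0 < M)%N ->
  tavg M F = tavg M (fun u => mavg M (fun x => F (mul_at j x u))).
Proof.
case: M => // M _; rewrite /tavg /mavg; congr (_ * _).
rewrite -mulr_sumr exchange_big/=.
pose sh (l : 'I_M.+1) (f : {ffun 'I_n -> 'I_M.+1}) : {ffun 'I_n -> 'I_M.+1} :=
  [ffun k => if k == j then f k + l else f k].
have shK l : cancel (sh l) (sh (- l)).
  by move=> f; apply/ffunP => k; rewrite !ffunE; case: eqP => // _; rewrite addrK.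
have E (l : 'I_M.+1) : \sum_(f : {ffun 'I_n -> 'I_M.+1}) F (root_pt f) =
    \sum_(f : {ffun 'I_n -> 'I_M.+1}) F (mul_at j (zeta R M.+1 l) (root_pt f)).
  rewrite (reindex_inj (can_inj (shK l))); apply: eq_bigr => f _; congr F.
  apply/funext => k; rewrite /root_pt /mul_at ffunE; case: eqP => // _.
  by rewrite [nat_of_ord (_ + _)]/= zeta_mod// zetaD.
under [in RHS]eq_bigr do rewrite -E.
set S := \sum_f F (root_pt f).
have -> : \sum_(l < M.+1) S = (M.+1%:R : R)%:C * S.
  by rewrite sumr_const card_ord rmorph_nat mulr_natl.
by rewrite mulrA -rmorphM mulVf ?mul1r// pnatr_eq0.
Qed.

Variable h : Cn -> C.
Hypothesis ha : analytic h.

(** As M grows this tends to the term of [h] of multidegree q - p, and to 0 when some p j exceeds q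
    j. *)
Definition favg M (p q : 'I_n -> nat) (z : Cn) : C :=
  tavg M (fun u => (\prod_j conj_pow (p j) (q j) (u j)) * h (rot u z)).

Definition put (j : 'I_n) (c : C) (k : 'I_n) : C := if k == j then c else 1.

Lemma sqr_enorm_rot_le (u : 'I_n -> C) (z : Cn) :
  (forall j, normc (u j) <= 1) -> sqr_enorm (rot u z) <= sqr_enorm z.
Proof.
move=> u1; apply: ler_sum => j _; rewrite mxE normcM exprMn.
by rewrite ler_piMl ?sqr_ge0// exprn_ile1 ?normc_ge0.
Qed.

Lemma ball_rot u z : (forall j, normc (u j) <= 1) -> B z -> B (rot u z).
Proof. by rewrite !unit_ballE => u1; apply: le_lt_trans; exact: sqr_enorm_rot_le. Qed.

Lemma rot_rot u v (z : Cn) : rot u (rot v z) = rot (fun j => u j * v j) z.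
Proof. by apply/rowP => j; rewrite !mxE mulrA. Qed.

Lemma ball_coord (z : Cn) j : B z -> normc (z ord0 j) <= 1.
Proof.
rewrite unit_ballE /sqr_enorm (bigD1 j)//= => z1.
have : normc (z ord0 j) ^+ 2 <= 1.
  by apply: ltW; apply: le_lt_trans z1; rewrite lerDl sumr_ge0// => k _; rewrite sqr_ge0.
by rewrite -[X in _ <= X](expr1n _ 2) ler_pXn2r// ?nnegrE ?normc_ge0.
Qed.

Lemma analytic_cball (z x : Cn) : B z -> cball (sqr_enorm z) x -> {for x, continuous h}.
Proof.
rewrite unit_ballE => z1 xz; apply: differentiable_continuous; apply: ha.
by rewrite unit_ballE; exact: le_lt_trans xz z1.
Qed.

Lemma put_le1 j c k : normc c <= 1 -> normc (put j c k) <= 1.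
Proof. by rewrite /put; case: eqP => // _ _; rewrite ComplexField.Normc.normc1. Qed.

Let unit_pt := {u : 'I_n -> C | forall j, normc (u j) = 1}.

(** [mavg_shift] in coordinate [j], with the torus point as the index of the family; the closed ball
    through z supplies the uniform bound and the uniform continuity. *)
Lemma favg_put j (z : Cn) p q e : B z -> 0 < e -> exists M0, forall M, (M0 <= M)%N ->
  forall c, normc c <= 1 -> normc (favg M p q (rot (put j c) z) -
    (if (p j <= q j)%N then c ^+ (q j - p j) * favg M p q z else 0)) <= e.
Proof.
move=> Bz e0; pose G (u : unit_pt) c := h (rot (put j c) (rot (sval u) z)).
have u1 (u : unit_pt) k : normc (sval u k) <= 1 by rewrite (svalP u).
have inK (u : unit_pt) w : normc w <= 1 -> cball (sqr_enorm z) (rot (put j w) (rot (sval u) z)).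
  move=> w1; apply: le_trans (sqr_enorm_rot_le _ _) (sqr_enorm_rot_le _ _) => // k.
  exact: put_le1.
have Gd u w : normc w <= 1 -> cderiv (G u) w.
  move=> w1; have Bx : B (rot (put j w) (rot (sval u) z)).
    by apply: ball_rot; [move=> k; exact: put_le1|exact: ball_rot].
  have hd : derivable h (rot (put j w) (rot (sval u) z))
     ((rot (sval u) z) ord0 j *: delta_mx ord0 j : Cn) := diff_derivable (ha Bx).
  have [D hD] := derivableC_rowP hd; exists D => d /hD[r r0 hr]; exists r => // t /hr.
  congr (normc (h _ - _ - _) <= _); apply/rowP => k; rewrite !mxE !eqxx/= /put.
  by case: eqP => [->|_]; rewrite ?mulr1 ?mulr0 ?addr0// mulrDl.
have [K hK] := bounded_cball (fun x => @analytic_cball z x Bz).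
have GK u w : normc w <= 1 -> normc (G u w) <= K by move=> w1; apply: hK; exact: inK.
have Gu d : 0 < d -> exists2 r : R, 0 < r & forall u w w', normc w <= 1 -> normc w' <= 1 ->
    normc (w - w') < r -> normc (G u w - G u w') <= d.
  move=> d0; have [r r0 hr] := unif_cball (fun x => @analytic_cball z x Bz) d0.
  exists r => // u w w' w1 w'1 ww; apply/ltW/hr; first exact: inK.
  move=> k; rewrite !mxE -mulrBl normcM /put; case: eqP => _; last first.
    by rewrite subrr ComplexField.Normc.normc0 mul0r.
  apply: le_lt_trans ww; rewrite ler_piMr ?normc_ge0//.
  rewrite normcM -[leRHS]mulr1; apply: ler_pM; rewrite ?normc_ge0//.
  exact: ball_coord.
have [M0 hM] := mavg_shift Gd GK Gu (p j) (q j) e0.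
exists M0 => M /hM[M1 {}hM] c c1.
have cpM a b (x y : C) : conj_pow a b (x * y) = conj_pow a b x * conj_pow a b y.
  by rewrite /conj_pow rmorphM !exprMn; ring.
have E d : favg M p q (rot (put j d) z) = tavg M (fun u => (\prod_k conj_pow (p k) (q k) (u k)) *
    mavg M (fun x => h (rot (put j (d * x)) (rot u z)) * conj_pow (p j) (q j) x)).
  rewrite /favg (tavg_coord j)//; congr tavg; apply/funext => u; rewrite -mavgZ; congr mavg.
  apply/funext => x; rewrite [_ * conj_pow _ _ _]mulrC mulrA; congr (_ * h _); last first.
    rewrite !rot_rot; congr rot; apply/funext => k; rewrite /mul_at /put.
    by case: eqP => _; ring.
  rewrite [LHS](bigD1 j)//= [in RHS](bigD1 j)//= {1}/mul_at eqxx cpM.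
  rewrite [RHS]mulrAC; congr (_ * _); apply: eq_bigr => k kj.
  by rewrite /mul_at (negbTE kj).
have rot1 (y : Cn) : rot (put j 1) y = y.
  by apply/rowP => k; rewrite mxE /put; case: eqP => _; rewrite mul1r.
have E1 : favg M p q z = tavg M (fun u => (\prod_k conj_pow (p k) (q k) (u k)) *
    mavg M (fun x => h (rot (put j x) (rot u z)) * conj_pow (p j) (q j) x)).
  rewrite -[in LHS](rot1 z) E; congr tavg; apply/funext => u; congr (_ * mavg _ _).
  by apply/funext => x; rewrite mul1r.
rewrite E.
have -> : (if (p j <= q j)%N then c ^+ (q j - p j) * favg M p q z else 0) =
   tavg M (fun u => (\prod_k conj_pow (p k) (q k) (u k)) *
     (if (p j <= q j)%N then c ^+ (q j - p j) *
     mavg M (fun x => h (rot (put j x) (rot u z)) * conj_pow (p j) (q j) x) else 0)).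
  case: leqP => _; last first.
    by rewrite /tavg; under eq_bigr do rewrite mulr0; rewrite big1 ?mulr0.
  by rewrite E1 -tavgZ; congr tavg; apply/funext => u; rewrite mulrCA.
rewrite tavgB; apply: normc_tavg => // u hu.
rewrite -mulrBr normcM normc_prod big1 ?mul1r; last by move=> k _; rewrite normc_conj_pow1.
exact: (hM (exist _ u hu) c c1).
Qed.

Lemma favg_rot_null (z : Cn) p q (l : 'I_n -> C) : B z -> (forall j, normc (l j) <= 1) ->
  null (fun M => favg M p q (rot l z) -
    (if [forall j, p j <= q j]%N then (\prod_j l j ^+ (q j - p j)) * favg M p q z else 0)).
Proof.
move=> Bz l1; have shift1 j y : B y -> null (fun M => favg M p q (rot (put j (l j)) y) -
    (if (p j <= q j)%N then l j ^+ (q j - p j) * favg M p q y else 0)).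
  move=> By e e0; have [M0 hM] := favg_put j p q By e0.
  by exists M0 => M /hM; exact.
have one y : rot (fun=> 1) y = y :> Cn by apply/rowP => k; rewrite mxE mul1r.
case: (boolP [forall j, p j <= q j]%N) => [/forallP pq|]; last first.
  rewrite negb_forall => /existsP[j]; rewrite -ltnNge => qp.
  move=> e e0; have [M0 hM] := favg_put j p q (ball_rot l1 Bz) e0.
  exists M0 => M /hM/(_ 1); rewrite ComplexField.Normc.normc1 => /(_ (lexx _)).
  rewrite leqNgt qp /= (_ : rot (put j 1) _ = rot l z)//.
  by apply/rowP => k; rewrite mxE /put; case: eqP => _; rewrite mul1r.
pose ls (s : seq 'I_n) k := if k \in s then l k else 1.
have ls1 s k : normc (ls s k) <= 1 by rewrite /ls; case: ifP; rewrite ?ComplexField.Normc.normc1.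
suff H s : uniq s -> null (fun M => favg M p q (rot (ls s) z) -
    (\prod_(j <- s) l j ^+ (q j - p j)) * favg M p q z).
  have := H (index_enum _) (index_enum_uniq _); congr null; apply/funext => M.
  by congr (favg _ _ _ (rot _ _) - _); apply/funext => k; rewrite /ls mem_index_enum.
elim: s => [_|j s IH /= /andP[js us]].
  have -> : ls [::] = fun=> 1 by [].
  rewrite one; under eq_fun do rewrite big_nil mul1r subrr.
  exact: null_cst0.
have -> : rot (ls (j :: s)) z = rot (put j (l j)) (rot (ls s) z).
  rewrite rot_rot; congr rot; apply/funext => k; rewrite /ls /put inE.
  by case: eqP => [->|_] /=; rewrite ?(negbTE js) ?mulr1 ?mul1r.
have := nullD (shift1 j _ (ball_rot (ls1 s) Bz)) (nullZ (l j ^+ (q j - p j)) (IH us)).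
by congr null; apply/funext => M; rewrite pq big_cons; ring.
Qed.

Lemma favg_null_of_gt (z : Cn) p q : B z -> ~~ [forall j, p j <= q j]%N -> null (fun M => favg M p q z).
Proof.
move=> Bz pq; have := @favg_rot_null z p q (fun=> 1) Bz _.
rewrite (negbTE pq) (_ : rot _ z = z); last by apply/rowP => k; rewrite mxE mul1r.
have -> : (fun M => favg M p q z - 0) = (fun M => favg M p q z) by apply/funext => M; rewrite subr0.
by apply => j; rewrite ComplexField.Normc.normc1.
Qed.

Lemma ball_max (z : Cn) : B z -> exists2 s0 : R, 0 < s0 & forall s, 0 < s -> s <= s0 ->
  B (\row_j (Num.max (normc (z ord0 j)) s)%:C).
Proof.
(* The bound 1 gives s^2 <= s0 for s <= s0, and the other one keeps n s0 below 1 - |z|^2. *)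
rewrite unit_ballE => z1; pose s0 := Num.min 1 ((1 - sqr_enorm z) / (n%:R + 1)).
have n1 : 0 < n%:R + 1 :> R by rewrite ltr_wpDl.
have s00 : 0 < s0 by rewrite lt_min ltr01 divr_gt0// subr_gt0.
exists s0 => // s sp ss; rewrite unit_ballE.
apply: (@le_lt_trans _ _ (\sum_j (normc (z ord0 j) ^+ 2 + s0))).
  apply: ler_sum => j _; rewrite mxE normc_real ger0_norm; last by rewrite le_max normc_ge0.
  have ss0 : s ^+ 2 <= s0.
    have s1 : s <= 1 by rewrite (le_trans ss)// ge_min lexx.
    by rewrite (le_trans _ ss)// expr2 ler_piMl// ltW.
  have [_|_] := leP (normc (z ord0 j)) s; last by rewrite lerDl ltW.
  by rewrite (le_trans ss0)// lerDr sqr_ge0.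
rewrite big_split/= sumr_const card_ord -[X in X + _]/(sqr_enorm z) addrC -ltrBrDr.
rewrite -[_ *+ _]mulr_natr; apply: (@lt_le_trans _ _ (s0 * (n%:R + 1))).
  by rewrite ltr_pM2l// ltrDl.
by rewrite -ler_pdivlMr// ge_min lexx orbT.
Qed.

(** Both z and the constant vector s arise from y, with y_j = max(|z_j|, s), by multiplying
    coordinates with factors in the closed disc; unlike z, y has no zero coordinate to divide by. *)
Let favg_small (z : Cn) p q : B z -> [forall j, p j <= q j]%N ->
  exists2 s0 : R, 0 < s0 & forall s, 0 < s -> s <= s0 ->
  null (fun M => (s%:C) ^+ (\sum_j (q j - p j)) * favg M p q z -
     (\prod_j z ord0 j ^+ (q j - p j)) * favg M p q (const_mx s%:C)).
Proof.
move=> Bz pq; have [s0 s00 hs0] := ball_max Bz; exists s0 => // s sp ss.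
have By := hs0 s sp ss; set y := \row_j _ in By.
pose m j := Num.max (normc (z ord0 j)) s.
have m0 j : 0 < m j by rewrite lt_max sp orbT.
have mn j : (m j)%:C != 0 :> C by rewrite fmorph_eq0 gt_eqF.
have nm j : normc (m j)%:C = m j by rewrite normc_real gtr0_norm.
have le1 x j : normc x <= m j -> normc (x / (m j)%:C) <= 1.
  by move=> xm; rewrite normcM normcV nm ler_pdivrMr// mul1r.
have h1 : null (fun M => favg M p q z -
    (\prod_j (z ord0 j / (m j)%:C) ^+ (q j - p j)) * favg M p q y).
  have := @favg_rot_null y p q (fun j => z ord0 j / (m j)%:C) By.
  rewrite pq (_ : rot _ y = z); last by apply/rowP => j; rewrite !mxE divfK.
  by apply => j; apply: le1; rewrite le_max lexx.
have h2 : null (fun M => favg M p q (const_mx s%:C) -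
    (\prod_j (s%:C / (m j)%:C) ^+ (q j - p j)) * favg M p q y).
  have := @favg_rot_null y p q (fun j => s%:C / (m j)%:C) By.
  rewrite pq (_ : rot _ y = const_mx s%:C); last by apply/rowP => j; rewrite !mxE divfK.
  by apply => j; apply: le1; rewrite normc_real gtr0_norm// le_max lexx orbT.
have := nullB (nullZ (s%:C ^+ (\sum_j (q j - p j))) h1) (nullZ (\prod_j z ord0 j ^+ (q j - p j)) h2).
congr null; apply/funext => M; rewrite expr_sum.
have E (x : 'I_n -> C) : \prod_j (x j / (m j)%:C) ^+ (q j - p j) =
    (\prod_j x j ^+ (q j - p j)) / \prod_j (m j)%:C ^+ (q j - p j).
  by rewrite -prodf_div; apply: eq_bigr => j _; rewrite expr_div_n.
by rewrite !E; ring.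
Qed.

(** Both points are compared with the same small constant vector. The cross-multiplied form admits
    points where the monomial vanishes. *)
Lemma favg_ratio (z z' : Cn) p q : B z -> B z' -> [forall j, p j <= q j]%N ->
  null (fun M => (\prod_j z' ord0 j ^+ (q j - p j)) * favg M p q z -
                 (\prod_j z ord0 j ^+ (q j - p j)) * favg M p q z').
Proof.
move=> Bz Bz' pq; have [s1 s10 h1] := favg_small Bz pq.
have [s2 s20 h2] := favg_small Bz' pq.
pose s := Num.min s1 s2; have s0 : 0 < s by rewrite lt_min s10.
have s0' : s%:C != 0 :> C by rewrite fmorph_eq0 gt_eqF.
have ss1 : s <= s1 by rewrite ge_min lexx.
have ss2 : s <= s2 by rewrite ge_min lexx orbT.
have {}h1 := h1 s s0 ss1; have {}h2 := h2 s s0 ss2.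
set K := (\sum_j _)%N in h1 h2.
have := nullZ (s%:C ^- K) (nullB (nullZ (\prod_j z' ord0 j ^+ (q j - p j)) h1)
  (nullZ (\prod_j z ord0 j ^+ (q j - p j)) h2)).
congr null; apply/funext => M; have : s%:C ^+ K != 0 by rewrite expf_neq0.
move: (s%:C ^+ K) (favg M p q z) (favg M p q z') (favg _ _ _ _) (\prod_j _) (\prod_j _).
by move=> a b c d u v a0; field.
Qed.

Section fejer.

Definition fejer N (x : C) : C :=
  ((N%:R^-1) : R)%:C * \sum_(k : 'I_N * 'I_N) conj_pow k.1 k.2 x.

Definition fejer_mean N M (z : Cn) : C :=
  tavg M (fun u => (\prod_j fejer N (u j)) * h (rot u z)).

Lemma fejerE N x : fejer N x = ((N%:R^-1) * normc (\sum_(k < N) x ^+ k) ^+ 2)%:C.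
Proof.
rewrite /fejer [in RHS]rmorphM/=; congr (_ * _).
transitivity (\sum_(k < N) \sum_(l < N) x ^+ k * conjc (x ^+ l)).
  by rewrite pair_bigA/=; apply: eq_bigr => k _; rewrite /conj_pow rmorphXn.
by rewrite -mul_conjc rmorph_sum big_distrlr.
Qed.

Lemma fejer_meanE N M z : fejer_mean N M z = ((N%:R ^- n) : R)%:C *
  \sum_(k : {ffun 'I_n -> 'I_N * 'I_N}) favg M (fun j => (k j).1) (fun j => (k j).2) z.
Proof.
have H u : (\prod_j fejer N (u j)) = ((N%:R ^- n) : R)%:C *
    \sum_(k : {ffun 'I_n -> 'I_N * 'I_N}) \prod_j conj_pow (k j).1 (k j).2 (u j).
  rewrite /fejer big_split/= prodr_const card_ord bigA_distr_bigA/=; congr (_ * _).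
  by rewrite -rmorphXn exprVn.
rewrite /fejer_mean /favg; under eq_fun do rewrite H -mulrA.
rewrite tavgZ; congr (_ * _); rewrite /tavg -mulr_sumr exchange_big/=; congr (_ * _).
by apply: eq_bigr => f _; rewrite mulr_suml.
Qed.

Lemma mavg_conj_pow M p q : (p < M)%N -> (q < M)%N ->
  mavg M (conj_pow p q) = (p == q)%:R :> C.
Proof.
have wlog_lt a b : (a < b)%N -> (b < M)%N -> mavg M (conj_pow b a) = 0 :> C.
  move=> ab bM; have M0 : (0 < M)%N by apply: leq_ltn_trans bM.
  have E x : normc x = 1 -> conj_pow b a x = x ^+ (b - a) :> C.
    move=> x1; rewrite /conj_pow -(subnK (ltnW ab)) exprD -mulrA -exprMn mul_conjc x1 expr1n.
    by rewrite expr1n mulr1 subnK// ltnW.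
  pose k := (b - a)%N; have k0 : (0 < k)%N by rewrite subn_gt0.
  have kM : (k < M)%N by rewrite (leq_ltn_trans _ bM)// leq_subr.
  pose r := zeta R M k.
  have r1 : r != 1.
    have M0' : 0 < M%:R :> R by rewrite ltr0n.
    have P0 := pi_gt0 R.
    apply/eqP => /(congr1 (@complex.Re R)) /=; rewrite (_ : _ / _ = (pi * k%:R / M%:R) *+ 2); last by rewrite !mulrnAl.
    rewrite mulr2n cosD -!expr2 => hcos.
    (* The real part of r is 1 - 2 sin^2 (pi k / M), and the sine is positive as 0 < k < M. *)
    have s0 : 0 < sin ((pi : R) * k%:R / M%:R).
      apply: sin_gt0_pi => //; apply/andP; split; first by rewrite divr_gt0// mulr_gt0// ltr0n.
      by rewrite ltr_pdivrMr// ltr_pM2l// ltr_nat.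

    have : 0 < sin ((pi : R) * k%:R / M%:R) ^+ 2 by rewrite exprn_gt0.
    have := cos2Dsin2 ((pi : R) * k%:R / M%:R); lra.
  have rM : r ^+ M = 1 by rewrite /r zetaX -exprM mulnC exprM zetaM// expr1n.
  rewrite /mavg (_ : \sum_(l < M) _ = \sum_(l < M) r ^+ l); last first.
    apply: eq_bigr => l _; rewrite E ?normc_zeta// /r zetaX (zetaX _ _ k) -!exprM mulnC//.
  have := subrX1 r M; rewrite rM subrr => /esym/eqP; rewrite mulf_eq0 subr_eq0 (negbTE r1) => /eqP ->.
  by rewrite mulr0.
move=> pM qM; have M0 : (0 < M)%N by apply: leq_ltn_trans pM.
case: ltngtP => [pq|qp|->].
- have E : mavg M (conj_pow p q) = conjc (mavg M (conj_pow q p)) :> C.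
    rewrite /mavg rmorphM rmorph_sum; congr (_ * _); first by rewrite [RHS]conjc_real.
    apply: eq_bigr => l _; rewrite /conj_pow -[conjc _ ^+ p]rmorphXn [RHS]rmorphM mulrC.
    by congr (_ * _); [rewrite rmorphXn|exact/esym/conjcK].
  by rewrite E wlog_lt// rmorph0.
- exact: wlog_lt.
rewrite /mavg; under eq_bigr do rewrite /conj_pow -exprMn mul_conjc normc_zeta !expr1n.
rewrite sumr_const card_ord -mulr_natr mul1r -(rmorph_nat (real_complex R)) -rmorphM/=.
by rewrite mulVf// pnatr_eq0 -lt0n.
Qed.

Lemma mavg_fejer N M : (0 < N)%N -> (N <= M)%N -> mavg M (fejer N) = 1.
Proof.
move=> N0 NM; have -> : mavg M (fejer N) = ((N%:R^-1) : R)%:C *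
    \sum_(k : 'I_N * 'I_N) mavg M (conj_pow k.1 k.2).
  by rewrite /mavg /fejer -!mulr_sumr mulrCA exchange_big.
rewrite -(pair_bigA _ (fun k l : 'I_N => mavg M (conj_pow k l)))/=.
rewrite (eq_bigr (fun=> 1)); last first.
  move=> k _; rewrite (bigD1 k)//= mavg_conj_pow ?(leq_trans (ltn_ord _) NM)// eqxx.
  rewrite big1 ?addr0// => l lk; rewrite mavg_conj_pow ?(leq_trans (ltn_ord _) NM)//.
  by rewrite eq_sym -val_eqE in lk; rewrite (negbTE lk).
rewrite sumr_const card_ord -(rmorph_nat (real_complex R)) -rmorphM/=.
by rewrite mulVf// pnatr_eq0 -lt0n.
Qed.

Definition fejer_re N (x : C) : R := N%:R^-1 * normc (\sum_(k < N) x ^+ k) ^+ 2.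

Lemma fejer_re_ge0 N x : 0 <= fejer_re N x.
Proof. by rewrite mulr_ge0 ?invr_ge0 ?sqr_ge0. Qed.

Lemma avg_fejer_re N M : (0 < N)%N -> (N <= M)%N ->
  M%:R^-1 * \sum_(l < M) fejer_re N (zeta R M l) = 1.
Proof.
move=> N0 NM; apply: (@complexI R); rewrite -[RHS](mavg_fejer N0 NM).
rewrite /mavg rmorphM rmorph_sum/=; congr (_ * _).
by apply: eq_bigr => l _; rewrite fejerE.
Qed.

(** The factor x - 1 collapses the geometric sum to x^N - 1, of modulus at most 2. *)
Lemma fejer_re_moment N x : normc x = 1 -> fejer_re N x * normc (x - 1) ^+ 2 <= 4 / N%:R.
Proof.
move=> x1; rewrite /fejer_re -mulrA -exprMn -normcM mulrC ler_wpM2r ?invr_ge0//.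
rewrite [_ * (x - 1)]mulrC -subrX1.
have : normc (x ^+ N - 1) <= 2.
  by rewrite (le_trans (normcB _ _))// normcX x1 expr1n ComplexField.Normc.normc1 -natr1.
rewrite (_ : 4 = 2 ^+ 2 :> R); last by rewrite -natrX.
by move=> ?; rewrite ler_pXn2r// ?nnegrE ?normc_ge0.
Qed.

Lemma torus_avg_prod M (F : 'I_n -> C -> R) :
  M%:R ^- n * \sum_(f : {ffun 'I_n -> 'I_M}) \prod_j F j (root_pt f j) =
  \prod_j (M%:R^-1 * \sum_(l < M) F j (zeta R M l)).
Proof.
by rewrite big_split/= prodr_const card_ord exprVn bigA_distr_bigA.
Qed.

(** For N <= M the Fejer weights are a probability on the torus points. Near 1 uniform continuity of
    [h] applies; the rest is a Chebyshev estimate with the second moment [fejer_re_moment]. *)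
Lemma fejer_mean_cvg z e : B z -> 0 < e -> exists2 N0, (0 < N0)%N &
  forall N M, (N0 <= N)%N -> (N <= M)%N -> normc (h z - fejer_mean N M z) <= e.
Proof.
move=> Bz e0; have e2 : 0 < e / 2 by rewrite divr_gt0.
have [K hK] := bounded_cball (fun x => @analytic_cball z x Bz).
have [d d0 hd] := unif_cball (fun x => @analytic_cball z x Bz) e2.
have Kz : cball (sqr_enorm z) z by exact: lexx.
have K0 : 0 <= K by exact: le_trans (normc_ge0 _) (hK z Kz).
(* As soon as one |u_j - 1| is at least d, the crude bound 2 K is at most c |u_j - 1|^2. *)
pose c := 2 * K / d ^+ 2; have c0 : 0 <= c by rewrite divr_ge0 ?sqr_ge0// mulr_ge0.
have [N0 hN0] : exists N0 : nat, (c * n%:R * 4) / (e / 2) < N0%:R.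
  by exists (Num.trunc ((c * n%:R * 4) / (e / 2))).+1; exact: truncnS_gt.
exists N0.+1 => // N M N0N NM; have NP : (0 < N)%N by exact: leq_trans N0N.
have MP : (0 < M)%N by exact: leq_trans NM.
pose W (u : 'I_n -> C) : R := \prod_j fejer_re N (u j).
have W0 u : 0 <= W u by apply: prodr_ge0 => j _; exact: fejer_re_ge0.
have WE u : \prod_j fejer N (u j) = (W u)%:C.
  by rewrite /W rmorph_prod; apply: eq_bigr => j _; rewrite fejerE.
have W1 : M%:R ^- n * \sum_(f : {ffun 'I_n -> 'I_M}) W (root_pt f) = 1.
  by rewrite (torus_avg_prod M (fun=> fejer_re N)) big1// => j _; rewrite avg_fejer_re.
have Wj j : M%:R ^- n * \sum_(f : {ffun 'I_n -> 'I_M}) W (root_pt f) * normc (root_pt f j - 1) ^+ 2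
    <= 4 / N%:R.
  pose F k x := if k == j then fejer_re N x * normc (x - 1) ^+ 2 else fejer_re N x.
  rewrite (_ : \sum_f _ = \sum_(f : {ffun 'I_n -> 'I_M}) \prod_k F k (root_pt f k)); last first.
    apply: eq_bigr => f _; rewrite /W [in LHS](bigD1 j)//= [in RHS](bigD1 j)//= {1}/F eqxx mulrAC.
    by congr (_ * _); apply: eq_bigr => k kj; rewrite /F (negbTE kj).
  rewrite torus_avg_prod (bigD1 j)//= [X in _ * X]big1 ?mulr1; last first.
    by move=> k kj; rewrite /F (negbTE kj) avg_fejer_re.
  rewrite /F eqxx mulrC ler_pdivrMr ?ltr0n//.
  apply: (@le_trans _ _ (\sum_(l < M) (4 / N%:R : R))); last by rewrite sumr_const card_ord mulr_natr.
  by apply: ler_sum => l _; apply: fejer_re_moment; exact: normc_zeta.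
have bound u : (forall j, normc (u j) = 1) ->
    normc (h z - h (rot u z)) <= e / 2 + c * \sum_j normc (u j - 1) ^+ 2.
  move=> u1; have [small|] := boolP [forall j, normc (u j - 1) < d].
    apply: (@le_trans _ _ (e / 2)); last by rewrite lerDl mulr_ge0// sumr_ge0// => j _; rewrite sqr_ge0.
    apply/ltW/hd => // j; rewrite mxE -[z ord0 j in X in X - _]mul1r -mulrBl normcM.
    apply: le_lt_trans (forallP small j); rewrite normc_distC ler_piMr ?normc_ge0//.
    exact: ball_coord.
  rewrite negb_forall => /existsP[j]; rewrite -leNgt => dj.
  apply: (@le_trans _ _ (2 * K)).
    rewrite (le_trans (normcB _ _))// mulr2n mulrDl mul1r lerD//; apply: hK => //.
    by apply: sqr_enorm_rot_le => k; rewrite u1.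
  apply: (@le_trans _ _ (c * normc (u j - 1) ^+ 2)).
    rewrite /c mulrAC ler_pdivlMr ?exprn_gt0// ler_wpM2l ?mulr_ge0//.
    by rewrite ler_pXn2r// nnegrE ?normc_ge0// ltW.
  rewrite (bigD1 j)//= mulrDr addrCA lerDl addr_ge0 ?(ltW e2)// mulr_ge0// sumr_ge0// => k _.
  by rewrite sqr_ge0.
have -> : h z - fejer_mean N M z = tavg M (fun u => (W u)%:C * (h z - h (rot u z))).
  have hz : h z = tavg M (fun u => (W u)%:C * h z).
    rewrite /tavg -mulr_suml mulrA -rmorph_sum -rmorphM/= -[X in X%:C * _]/(M%:R ^- n * \sum_f W (root_pt f)) W1.
    by rewrite mul1r.
  rewrite [X in X - _ = _]hz /fejer_mean tavgB; congr tavg; apply/funext => u.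
  by rewrite WE mulrBr.
have Mn0 : 0 <= M%:R ^- n :> R by rewrite invr_ge0 exprn_ge0.
rewrite /tavg normcM normc_real ger0_norm//.
apply: (@le_trans _ _ (M%:R ^- n * \sum_(f : {ffun 'I_n -> 'I_M})
   (W (root_pt f) * (e / 2) + c * \sum_j W (root_pt f) * normc (root_pt f j - 1) ^+ 2))).
  rewrite ler_wpM2l// (le_trans (normc_sum _ _ _))// ler_sum// => f _.
  rewrite normcM normc_real ger0_norm// -mulr_sumr [c * (W _ * _)]mulrCA -mulrDr ler_wpM2l//.
  by apply: bound => j; exact: normc_zeta.
rewrite big_split/= -mulr_suml mulrDr mulrA W1 mul1r -mulr_sumr exchange_big/=.
rewrite [X in _ <= X](splitr e) lerD2l mulrCA mulr_sumr.
apply: (@le_trans _ _ (c * \sum_(j < n) 4 / N%:R)).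
  by apply: ler_wpM2l => //; apply: ler_sum => j _; exact: Wj.
rewrite sumr_const card_ord -[_ *+ n]mulr_natr.
rewrite (_ : c * (4 / N%:R * n%:R) = c * n%:R * 4 / N%:R); last by ring.
rewrite ler_pdivrMr ?ltr0n// [e / 2 * _]mulrC -ler_pdivrMr//.
by rewrite ltW// (lt_trans hN0)// ltr_nat.
Qed.

End fejer.

End torus.

(** * The Hilbert space structure *)

Section cintegral.
Variables (R : realType) (n : nat) (alpha : R).

Local Notation C := R[i].
Local Notation Cn := 'rV[C]_n.
Local Notation B := (@unit_ball R n).
Local Notation mu := (@nu_alpha R n alpha).
Local Notation cmeas := (@cmeasurable R n).
Let mB : measurable B := @measurable_unit_ball R n.

Lemma ReD (x y : C) : complex.Re (x + y) = complex.Re x + complex.Re y.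
Proof. by case: x y => [? ?] []. Qed.
Lemma ImD (x y : C) : complex.Im (x + y) = complex.Im x + complex.Im y.
Proof. by case: x y => [? ?] []. Qed.
Lemma ReM (x y : C) : complex.Re (x * y) = complex.Re x * complex.Re y - complex.Im x * complex.Im y.
Proof. by case: x y => [? ?] []. Qed.
Lemma ImM (x y : C) : complex.Im (x * y) = complex.Re x * complex.Im y + complex.Im x * complex.Re y.
Proof. by case: x y => [? ?] []. Qed.

Lemma conjcD (x y : C) : conjc (x + y) = conjc x + conjc y. Proof. exact: rmorphD. Qed.
Lemma conjcM (x y : C) : conjc (x * y) = conjc x * conjc y. Proof. exact: rmorphM. Qed.
Lemma conjcN (x : C) : conjc (- x) = - conjc x. Proof. exact: rmorphN. Qed.
Lemma conjcX (x : C) k : conjc (x ^+ k) = conjc x ^+ k. Proof. exact: rmorphXn. Qed.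
Lemma conjc_prod I (r : seq I) (F : I -> C) : conjc (\prod_(i <- r) F i) = \prod_(i <- r) conjc (F i).
Proof. exact: rmorph_prod. Qed.
Lemma conjc_sum I (r : seq I) (F : I -> C) : conjc (\sum_(i <- r) F i) = \sum_(i <- r) conjc (F i).
Proof. exact: rmorph_sum. Qed.

Lemma cmeasurable_cst c : cmeas (fun=> c). Proof. by split; exact: measurable_cst. Qed.

Lemma cmeasurableD f g : cmeas f -> cmeas g -> cmeas (fun z => f z + g z).
Proof.
move=> [f1 f2] [g1 g2]; split.
  by under eq_fun do rewrite ReD; exact: measurable_funD.
by under eq_fun do rewrite ImD; exact: measurable_funD.
Qed.

Lemma cmeasurableM f g : cmeas f -> cmeas g -> cmeas (fun z => f z * g z).
Proof.
move=> [f1 f2] [g1 g2]; split.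
  by under eq_fun do rewrite ReM; apply: measurable_funB; exact: measurable_funM.
by under eq_fun do rewrite ImM; apply: measurable_funD; exact: measurable_funM.
Qed.

Lemma cmeasurableJ f : cmeas f -> cmeas (fun z => conjc (f z)).
Proof.
move=> [f1 f2]; split; first by move: f1; congr measurable_fun; apply/funext => z; case: (f z).
have : measurable_fun B (fun z => - complex.Im (f z)) by exact: measurableT_comp.
by congr measurable_fun; apply/funext => z; case: (f z).
Qed.

Lemma cmeasurableN f : cmeas f -> cmeas (fun z => - f z).
Proof.
move=> mf; have := cmeasurableM (cmeasurable_cst (-1)) mf.
by congr cmeasurable; apply/funext => z; rewrite mulN1r.
Qed.

Lemma cmeasurable_sum I (r : seq I) (f : I -> Cn -> C) : (forall i, cmeas (f i)) ->
  cmeas (fun z => \sum_(i <- r) f i z).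
Proof.
move=> mf; elim: r => [|i r IH]; first by under eq_fun do rewrite big_nil; exact: cmeasurable_cst.
by under eq_fun do rewrite big_cons; exact: cmeasurableD.
Qed.

Lemma cmeasurable_prod I (r : seq I) (f : I -> Cn -> C) : (forall i, cmeas (f i)) ->
  cmeas (fun z => \prod_(i <- r) f i z).
Proof.
move=> mf; elim: r => [|i r IH]; first by under eq_fun do rewrite big_nil; exact: cmeasurable_cst.
by under eq_fun do rewrite big_cons; exact: cmeasurableM.
Qed.

Lemma cmeasurable_coord j : cmeas (fun z => z ord0 j).
Proof.
have H (F : C -> R) (G : R * R -> R) : measurable_fun setT G -> (forall x y, F (x +i* y) = G (x, y)) ->
    measurable_fun B (fun z : Cn => F (z ord0 j)).
  move=> mG FG; apply: measurable_funTS; apply/row_measurable_funP.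
  rewrite (_ : _ \o _ = (fun t => G (tnth t j))).
    by apply: (measurableT_comp mG); exact: measurable_tnth.
  by apply/funext => t /=; rewrite mxE FG; case: (tnth t j).
by split; [apply: H (@measurable_fst _ _ _ _) _|apply: H (@measurable_snd _ _ _ _) _].
Qed.

Lemma cmeasurableX f k : cmeas f -> cmeas (fun z => f z ^+ k).
Proof.
move=> mf; elim: k => [|k IH]; first by under eq_fun do rewrite expr0; exact: cmeasurable_cst.
by under eq_fun do rewrite exprS; exact: cmeasurableM.
Qed.

Lemma cmeasurable_monomial m : cmeas (monomial m).
Proof. by apply: cmeasurable_prod => j; apply: cmeasurableX; exact: cmeasurable_coord. Qed.

Lemma cmeasurable_rot u f : (forall j, normc (u j) = 1) -> cmeas f -> cmeas (fun z => f (rot u z)).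
Proof.
move=> u1 [f1 f2]; have [mr _] := preserves_rot alpha u1.
have sB : rot u @` B `<=` B by move=> _ [z Bz <-]; rewrite -[B (rot u z)]/((rot u @^-1` B) z) rot_ball.
have mrB : measurable_fun B (@rot R n u) by exact: measurable_funTS.
by split; [exact: (measurable_comp mB sB f1 mrB)|exact: (measurable_comp mB sB f2 mrB)].
Qed.

Lemma cmeasurable_indic (A : set Cn) : measurable A -> cmeas (fun z => (\1_A z)%:C).
Proof.
move=> mA; split => /=; last exact: measurable_cst.
exact: measurable_indic.
Qed.

Definition cintegrable (f : Cn -> C) :=
  mu.-integrable B (fun z => (complex.Re (f z))%:E) /\
  mu.-integrable B (fun z => (complex.Im (f z))%:E).

Definition cI (f : Cn -> C) : C :=
  (\int[mu]_(z in B) complex.Re (f z)) +i* (\int[mu]_(z in B) complex.Im (f z)).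

Lemma cI0 : cI (fun=> 0) = 0.
Proof. by rewrite /cI /= !Rintegral_cst// !mul0r. Qed.

Lemma cintegrable_le f (G : Cn -> R) : cmeas f -> mu.-integrable B (EFin \o G) ->
  (forall z, B z -> normc (f z) <= G z) -> cintegrable f.
Proof.
move=> [f1 f2] iG fG; split.
  apply: (le_integrable mB _ _ iG) => [|z Bz]; first exact/measurable_EFinP.
  by rewrite /= lee_fin (le_trans (Re_le_normc _))// (le_trans (fG z Bz))// ler_norm.
apply: (le_integrable mB _ _ iG) => [|z Bz]; first exact/measurable_EFinP.
by rewrite /= lee_fin (le_trans (Im_le_normc _))// (le_trans (fG z Bz))// ler_norm.
Qed.

Lemma cintegrableD f g : cintegrable f -> cintegrable g -> cintegrable (fun z => f z + g z).
Proof.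
move=> [f1 f2] [g1 g2]; split.
  by have := integrableD mB f1 g1; congr integrable; apply/funext => z; rewrite /= -EFinD ReD.
by have := integrableD mB f2 g2; congr integrable; apply/funext => z; rewrite /= -EFinD ImD.
Qed.

Lemma cintegrableZ c f : cintegrable f -> cintegrable (fun z => c * f z).
Proof.
move=> [f1 f2]; have i1 a := integrableZl mB a f1; have i2 a := integrableZl mB a f2; split.
  have := integrableB mB (i1 (complex.Re c)) (i2 (complex.Im c)).
  by congr integrable; apply/funext => z; rewrite /= -!EFinM -EFinB ReM.
have := integrableD mB (i2 (complex.Re c)) (i1 (complex.Im c)).
by congr integrable; apply/funext => z; rewrite /= -!EFinM -EFinD ImM.
Qed.

Lemma cID f g : cintegrable f -> cintegrable g -> cI (fun z => f z + g z) = cI f + cI g.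
Proof.
move=> [f1 f2] [g1 g2]; rewrite /cI; apply/eqP; rewrite eq_complex/= -!RintegralD//.
by apply/andP; split; apply/eqP; apply: eq_Rintegral => z _; rewrite ?ReD ?ImD.
Qed.

Lemma cIZ c f : cintegrable f -> cI (fun z => c * f z) = c * cI f.
Proof.
move=> [f1 f2]; have i1 a := integrableZl mB a f1; have i2 a := integrableZl mB a f2.
rewrite /cI; case: c => a b; apply/eqP; rewrite eq_complex/= -!RintegralZl//.
rewrite -RintegralB//; [|exact: i1|exact: i2].
rewrite -RintegralD//; [|exact: i2|exact: i1].
by apply/andP; split; apply/eqP; apply: eq_Rintegral => z _; rewrite ?ReM ?ImM.
Qed.

Lemma cIJ f : cintegrable f -> cI (fun z => conjc (f z)) = conjc (cI f).
Proof.
move=> [f1 f2]; rewrite /cI; apply/eqP; rewrite eq_complex/=; apply/andP; split; apply/eqP.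
  by apply: eq_Rintegral => z _; case: (f z).
rewrite -mulN1r -RintegralZl//; apply: eq_Rintegral => z _.
by rewrite mulN1r; case: (f z).
Qed.

Lemma eq_cI f g : (forall z, B z -> f z = g z) -> cI f = cI g.
Proof.
by move=> fg; congr Complex; apply: eq_Rintegral => z /[!inE] Bz; rewrite fg.
Qed.

Lemma cI_rot u f : (forall j, normc (u j) = 1) -> cmeas f -> cI (fun z => f (rot u z)) = cI f.
Proof.
move=> u1 [f1 f2]; have pr := preserves_rot alpha u1.
have H (F : Cn -> R) : measurable_fun B F -> (\int[mu]_(z in B) (F (rot u z))%:E = \int[mu]_(z in B) (F z)%:E)%E.
  move=> mF; have mE : measurable_fun B (EFin \o F) by exact/measurable_EFinP.
  rewrite [LHS]integralE [RHS]integralE; congr (_ - _)%E.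
    have := @ge0_integral_preserves _ _ R mu _ B ((EFin \o F)^\+)%E pr mB (measurable_funepos mE).
    rewrite rot_ball// => E; apply: etrans (E _); first by apply: eq_integral => z _; rewrite (funeposE, funenegE) (funeposE, funenegE).
    by move=> z _; exact: funepos_ge0.
  have := @ge0_integral_preserves _ _ R mu _ B ((EFin \o F)^\-)%E pr mB (measurable_funeneg mE).
  rewrite rot_ball// => E; apply: etrans (E _); first by apply: eq_integral => z _; rewrite (funeposE, funenegE) (funeposE, funenegE).
  by move=> z _; exact: funeneg_ge0.
by congr Complex; congr fine; [exact: H f1|exact: H f2].
Qed.

Lemma null_Re_cvg (u : nat -> C) l : null (fun k => u k - l) ->
  (fun k => complex.Re (u k)) @ \oo --> complex.Re l /\
  (fun k => complex.Im (u k)) @ \oo --> complex.Im l.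
Proof.
move=> h; split; apply/cvgrPdist_le => e e0; have [k0 hk] := h e e0; exists k0 => //= k /hk;
  apply: le_trans; rewrite distrC; [apply: le_trans (Re_le_normc _)|apply: le_trans (Im_le_normc _)];
  by case: (u k) (l) => [? ?] [].
Qed.

Lemma cvg_null (u : nat -> C) (l : C) : (fun k => complex.Re (u k)) @ \oo --> complex.Re l ->
  (fun k => complex.Im (u k)) @ \oo --> complex.Im l -> null (fun k => u k - l).
Proof.
move=> /cvgrPdist_le h1 /cvgrPdist_le h2 e e0; have e2 : 0 < e / 2 by rewrite divr_gt0.
have [k1 _ {}h1] := h1 _ e2; have [k2 _ {}h2] := h2 _ e2.
exists (maxn k1 k2) => k; rewrite geq_max => /andP[/h1 /= {}h1 /h2 /= {}h2].
apply: le_trans (normc_le_ReIm _) _; rewrite (splitr e).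
by move: h1 h2; rewrite distrC [in X in _ -> X -> _]distrC; case: (u k) (l) => [? ?] [? ?] /= *; exact: lerD.
Qed.

Lemma cI_dct (f_ : nat -> Cn -> C) f (G : Cn -> R) : (forall k, cmeas (f_ k)) -> cmeas f ->
  mu.-integrable B (EFin \o G) -> (forall k z, B z -> normc (f_ k z) <= G z) ->
  (forall z, B z -> null (fun k => f_ k z - f z)) -> null (fun k => cI (f_ k) - cI f).
Proof.
move=> mf_ mf iG fG cf.
have H (p : C -> R) : (forall k, measurable_fun B (fun z => p (f_ k z))) ->
    measurable_fun B (fun z => p (f z)) ->
    (forall x, `|p x| <= normc x) ->
    (forall z, B z -> (fun k => p (f_ k z)) @ \oo --> p (f z)) ->
    (fun k => \int[mu]_(z in B) p (f_ k z)) @ \oo --> \int[mu]_(z in B) p (f z).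
  move=> m1 m2 pn cp.
  have [] := @dominated_convergence _ _ _ mu B mB (fun k => EFin \o (fun z => p (f_ k z)))
      (EFin \o (fun z => p (f z))) (EFin \o G) _ _ _ iG _.
  - by move=> k; exact/measurable_EFinP.
  - exact/measurable_EFinP.
  - by apply: aeW => z Bz; apply: cvg_EFin; [near=> k|exact: cp].
  - by apply: aeW => z k Bz /=; rewrite lee_fin (le_trans (pn _))// fG.
  move=> /integrable_fin_num ifin _ h; apply: fine_cvg.
  by rewrite fineK//; exact: ifin.
have hc z : B z -> _ := fun Bz => null_Re_cvg (cf z Bz).
apply: cvg_null.
  by apply: (H (@complex.Re R)) => [k||x|z /hc[]//]; [case: (mf_ k)|case: mf|exact: Re_le_normc].
by apply: (H (@complex.Im R)) => [k||x|z /hc[]//]; [case: (mf_ k)|case: mf|exact: Im_le_normc].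
Unshelve. all: by end_near. Qed.

End cintegral.

(** * The inner product and the orthogonality of monomials *)

Section L2.
Variables (R : realType) (n : nat) (alpha : R).
Hypothesis alpha_gt : -1 < alpha.
Local Notation C := R[i].
Local Notation Cn := 'rV[C]_n.
Local Notation B := (@unit_ball R n).
Local Notation mu := (@nu_alpha R n alpha).
Local Notation cmeas := (@cmeasurable R n).
Local Notation L2 := (@L2 R n alpha).
Local Notation inner := (@inner R n alpha).
Local Notation norm2 := (@norm2 R n alpha).
Let mB : measurable B := @measurable_unit_ball R n.

Lemma L2_sq_integrable f : L2 f -> mu.-integrable B (fun z => (normc (f z) ^+ 2)%:E).
Proof.
move=> [mf foo]; apply/integrableP; split; first by apply/measurable_EFinP; exact: measurable_sqr_normc.
by apply: le_lt_trans foo; rewrite le_eqVlt; apply/orP; left; apply/eqP/eq_integral => z _;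
  rewrite /= ger0_norm ?sqr_ge0.
Qed.

Lemma L2_le f (G : Cn -> R) : cmeas f -> mu.-integrable B (EFin \o G) ->
  (forall z, B z -> normc (f z) ^+ 2 <= G z) -> L2 f.
Proof.
move=> mf iG fG; split => //.
have /integrableP[mG Goo] := iG; apply: le_lt_trans Goo.
apply: ge0_le_integral => //.
- by move=> z _; rewrite lee_fin sqr_ge0.
- by apply/measurable_EFinP; exact: measurable_sqr_normc.
- exact: measurableT_comp.
- by move=> z Bz; rewrite /= lee_fin (le_trans (fG z Bz))// ler_norm.
Qed.

Lemma L2D f g : L2 f -> L2 g -> L2 (f + g).
Proof.
move=> hf hg; have if2 := L2_sq_integrable hf; have ig2 := L2_sq_integrable hg.
apply: (@L2_le _ (fun z => 2 * normc (f z) ^+ 2 + 2 * normc (g z) ^+ 2)).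
- exact: cmeasurableD hf.1 hg.1.
- by have := integrableD mB (integrableZl mB 2 if2) (integrableZl mB 2 ig2).
- move=> z _; have := sqr_normcD 1 (f z) (g z).
  by rewrite ComplexField.Normc.normc1 expr1n mulr1 mul1r.
Qed.

Lemma L2Z c f : L2 f -> L2 (c *: f).
Proof.
move=> hf; have if2 := L2_sq_integrable hf.
apply: (@L2_le _ (fun z => normc c ^+ 2 * normc (f z) ^+ 2)).
- exact: cmeasurableM (cmeasurable_cst _ _) hf.1.
- by have := integrableZl mB (normc c ^+ 2) if2.
- by move=> z _; rewrite -exprMn -normcM.
Qed.

Lemma L2N f : L2 f -> L2 (- f).
Proof. by move=> hf; rewrite -scaleN1r; exact: L2Z. Qed.

Lemma L2B f g : L2 f -> L2 g -> L2 (f - g).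
Proof. by move=> hf hg; apply: L2D => //; exact: L2N. Qed.

Lemma inner_cintegrable f g : L2 f -> L2 g -> cintegrable alpha (fun z => f z * conjc (g z)).
Proof.
move=> hf hg; have if2 := L2_sq_integrable hf; have ig2 := L2_sq_integrable hg.
apply: (@cintegrable_le _ _ _ _ (fun z => normc (f z) ^+ 2 + normc (g z) ^+ 2)).
- by apply: cmeasurableM hf.1 _; apply: cmeasurableJ; exact: hg.1.
- by have := integrableD mB if2 ig2.
- move=> z _; rewrite normcM normcJ; have := sqr_ge0 (normc (f z) - normc (g z)).
  have : 0 <= normc (f z) * normc (g z) by rewrite mulr_ge0 ?normc_ge0.
  by move: (normc (f z)) (normc (g z)) => x y; rewrite sqrrB; lra.
Qed.

Lemma innerDl f g k : L2 f -> L2 g -> L2 k -> inner (f + g) k = inner f k + inner g k.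
Proof.
move=> hf hg hk; rewrite -[RHS](cID (inner_cintegrable hf hk) (inner_cintegrable hg hk)).
by apply: eq_cI => z _; rewrite -mulrDl.
Qed.

Lemma innerZl c f k : L2 f -> L2 k -> inner (c *: f) k = c * inner f k.
Proof.
move=> hf hk; rewrite -[RHS](cIZ _ (inner_cintegrable hf hk)).
by apply: eq_cI => z _; rewrite mulrA.
Qed.

Lemma innerJ f g : L2 f -> L2 g -> inner g f = conjc (inner f g).
Proof.
move=> hf hg; rewrite -[RHS](cIJ (inner_cintegrable hf hg)).
by apply: eq_cI => z _; rewrite conjcM conjcK mulrC.
Qed.

Lemma innerNl f k : L2 f -> L2 k -> inner (- f) k = - inner f k.
Proof. by move=> hf hk; rewrite -scaleN1r innerZl// mulN1r. Qed.

Lemma innerBl f g k : L2 f -> L2 g -> L2 k -> inner (f - g) k = inner f k - inner g k.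
Proof. by move=> hf hg hk; rewrite innerDl ?innerNl//; exact: L2N. Qed.

Lemma innerDr f g k : L2 f -> L2 g -> L2 k -> inner k (f + g) = inner k f + inner k g.
Proof.
move=> hf hg hk; rewrite (innerJ (L2D hf hg) hk) innerDl// conjcD.
by rewrite -(innerJ hf hk) -(innerJ hg hk).
Qed.

Lemma innerZr c f k : L2 f -> L2 k -> inner k (c *: f) = conjc c * inner k f.
Proof. by move=> hf hk; rewrite (innerJ (L2Z c hf) hk) innerZl// conjcM -(innerJ hf hk). Qed.

Lemma innerBr f g k : L2 f -> L2 g -> L2 k -> inner k (f - g) = inner k f - inner k g.
Proof.
move=> hf hg hk; rewrite innerDr//; last exact: L2N.
by rewrite -scaleN1r innerZr// conjcN conjc1 mulN1r.
Qed.

Lemma norm2_ge0 f : 0 <= norm2 f. Proof. exact: sqrtr_ge0. Qed.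

Lemma sqr_norm2 f : norm2 f ^+ 2 = \int[mu]_(z in B) normc (f z) ^+ 2.
Proof. by rewrite sqr_sqrtr// Rintegral_ge0// => z _; rewrite sqr_ge0. Qed.

Lemma inner_ff f : inner f f = (norm2 f ^+ 2)%:C.
Proof.
rewrite sqr_norm2 /inner /=; congr Complex.
  by apply: eq_Rintegral => z _; rewrite mul_conjc.
rewrite [LHS](_ : _ = \int[mu]_(z in B) 0); last by apply: eq_Rintegral => z _; rewrite mul_conjc.
by rewrite Rintegral_cst// mul0r.
Qed.

Lemma sqr_norm2D f g : L2 f -> L2 g ->
  norm2 (f + g) ^+ 2 = norm2 f ^+ 2 + norm2 g ^+ 2 + complex.Re (inner f g) *+ 2.
Proof.
move=> hf hg; apply: (@complexI R); rewrite -inner_ff innerDl ?innerDr//; last exact: L2D.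
rewrite !inner_ff (innerJ hf hg); case: (inner f g) => a b.
by apply/eqP; rewrite eq_complex/=; apply/andP; split; apply/eqP; rewrite ?mulr2n; ring.
Qed.

Lemma norm2Z c f : L2 f -> norm2 (c *: f) = normc c * norm2 f.
Proof.
move=> hf; apply/eqP; rewrite -(@eqrXn2 _ 2)// ?mulr_ge0 ?normc_ge0 ?norm2_ge0//; apply/eqP.
apply: (@complexI R); rewrite -inner_ff innerZl//; last exact: L2Z.
rewrite innerZr// mulrA mul_conjc inner_ff exprMn.
by rewrite -rmorphM.
Qed.

Lemma cauchy_schwarz f g : L2 f -> L2 g -> normc (inner f g) <= norm2 f * norm2 g.
Proof.
move=> hf hg; set a := inner f g.
(* The expansion of the squared norm of f - t <f, g> g for real t. *)
have key (t : R) : 0 <= norm2 f ^+ 2 - (t * normc a ^+ 2) *+ 2 + t ^+ 2 * normc a ^+ 2 * norm2 g ^+ 2.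
  have hk : L2 ((- (t%:C * a)) *: g) by exact: L2Z.
  have := sqr_ge0 (norm2 (f + (- (t%:C * a)) *: g)).
  rewrite (sqr_norm2D hf hk) (norm2Z _ hg) (innerZr _ hg hf) -/a conjcN conjcM conjc_real mulNr.
  have -> : t%:C * conjc a * a = (t * normc a ^+ 2)%:C.
    by rewrite -mulrA [conjc a * a]mulrC mul_conjc -rmorphM.
  rewrite normcN normcM normc_real !exprMn real_normK ?num_real//.
  by rewrite raddfN /= => /le_trans; apply; rewrite le_eqVlt; apply/orP; left; apply/eqP; ring.
rewrite -(@ler_pXn2r _ 2)// ?nnegrE ?normc_ge0// ?mulr_ge0 ?norm2_ge0// exprMn.
have [g0|g0] := eqVneq (norm2 g ^+ 2) 0.
  rewrite g0 mulr0 leNgt; apply/negP => a0.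
  (* When g has norm 0 the expansion is affine in t, and this t would make it -1. *)
  have := key ((norm2 f ^+ 2 + 1) / (normc a ^+ 2) / 2).
  rewrite g0 mulr0 addr0 (_ : _ *+ 2 = norm2 f ^+ 2 + 1); last by move: (normc a ^+ 2) a0 => A A0; field; rewrite gt_eqF.
  by rewrite opprD addrA subrr sub0r oppr_ge0 ler10.
have G0 : 0 < norm2 g ^+ 2 by rewrite lt_neqAle eq_sym g0 sqr_ge0.
have := key (norm2 g ^- 2).
rewrite (_ : _ + _ * _ * _ = norm2 f ^+ 2 - normc a ^+ 2 / norm2 g ^+ 2); last first.
  by move: (normc a ^+ 2) (norm2 g ^+ 2) (norm2 f ^+ 2) g0 => A G F G1; rewrite mulr2n; field.
by rewrite subr_ge0 ler_pdivrMr.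
Qed.

Lemma norm2D f g : L2 f -> L2 g -> norm2 (f + g) <= norm2 f + norm2 g.
Proof.
move=> hf hg; rewrite -(@ler_pXn2r _ 2)// ?nnegrE ?norm2_ge0 ?addr_ge0 ?norm2_ge0//.
rewrite sqr_norm2D// sqrrD -addrA [X in _ + X]addrC addrA lerD2r lerD2l lerMn2r.
apply: le_trans (cauchy_schwarz hf hg); exact: le_trans (ler_norm _) (Re_le_normc _).
Qed.

Lemma measure_ball_fin : (mu B < +oo)%E.
Proof.
have := @integral_moment_nu_alpha R n alpha alpha_gt (fun=> 0%N).
rewrite (eq_integral (fun=> 1%:E)); last first.
  by move=> z _; rewrite /moment big1// => j _; rewrite expr0.
by rewrite integral_cst// mul1e => ->; rewrite ltry.
Qed.

Lemma bounded_integrable (c : R) : mu.-integrable B (EFin \o (fun=> c)).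
Proof.
apply: measurable_bounded_integrable => //; first exact: measure_ball_fin.
by exists `|c|; split; [exact: num_real|move=> x /ltW cx z _ /=].
Qed.

Lemma L2_bounded f (c : R) : cmeas f -> (forall z, B z -> normc (f z) <= c) -> L2 f.
Proof.
move=> mf fc; apply: (L2_le mf (bounded_integrable (c ^+ 2))) => z Bz.
have := fc z Bz => h; rewrite ler_pXn2r// nnegrE ?normc_ge0//; exact: le_trans (normc_ge0 _) h.
Qed.

Lemma L2_bddM g f (c : R) : cmeas g -> (forall z, B z -> normc (g z) <= c) -> L2 f -> L2 (g * f).
Proof.
move=> mg gc hf; have if2 := L2_sq_integrable hf.
apply: (@L2_le _ (fun z => c ^+ 2 * normc (f z) ^+ 2)).
- exact: cmeasurableM mg hf.1.
- by have := integrableZl mB (c ^+ 2) if2.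
- move=> z Bz; rewrite -[(g * f) z]/(g z * f z) normcM exprMn ler_wpM2r ?sqr_ge0//.
  have h := gc z Bz; rewrite ler_pXn2r// nnegrE ?normc_ge0//; exact: le_trans (normc_ge0 _) h.
Qed.

Local Notation om m := (@moment_cst R n alpha m).

Lemma monomial_le1 m z : B z -> normc (monomial m z) <= 1.
Proof.
move=> Bz; rewrite normc_prod.
suff /andP[] : 0 <= \prod_j normc (z ord0 j ^+ m j) <= 1 by [].
elim/big_ind: _ => [|x y /andP[x0 x1] /andP[y0 y1]|j _]; first by rewrite ler01 lexx.
  by rewrite mulr_ge0//= mulr_ile1.
by rewrite normcX exprn_ge0 ?normc_ge0//= exprn_ile1 ?normc_ge0// ball_coord.
Qed.

Lemma L2_monomial m : L2 (monomial m).
Proof. by apply: (L2_bounded (c := 1)); [exact: cmeasurable_monomial|exact: monomial_le1]. Qed.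

Lemma sqr_normc_monomial (m : 'I_n -> nat) (z : Cn) : normc (monomial m z) ^+ 2 = moment m z.
Proof.
rewrite /moment /monomial normc_prod -prodrXl; apply: eq_bigr => j _.
by rewrite normcX exprAC.
Qed.

Lemma inner_monomial m : inner (monomial m) (monomial m) = (om m)%:C.
Proof.
rewrite inner_ff sqr_norm2; congr (_%:C); rewrite /Rintegral.
by under eq_integral do rewrite sqr_normc_monomial; rewrite integral_moment_nu_alpha.
Qed.

Lemma monomial_rot (m : 'I_n -> nat) u (z : Cn) : monomial m (rot u z) = (\prod_j u j ^+ m j) * monomial m z.
Proof. by rewrite /monomial -big_split/=; apply: eq_bigr => j _; rewrite mxE exprMn. Qed.

(** Rotating coordinate [j] by exp(i pi / d), with d the difference of the two exponents, preserves
    the measure and changes the sign of the integrand. *)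
Lemma inner_monomial_neq m m' j : m j != m' j -> inner (monomial m) (monomial m') = 0.
Proof.
wlog lt_m : m m' / (m j < m' j)%N => [H mm|_].
  have := mm; rewrite neq_ltn => /orP[h|h]; first exact: H.
  rewrite (innerJ (L2_monomial m') (L2_monomial m)) H ?conjc0// eq_sym//.
pose d := (m' j - m j)%N; have d0 : (0 < d)%N by rewrite subn_gt0.
pose w : C := expi (pi / d%:R).
have w1 : normc w = 1 by exact: normc_expi.
have wd : w ^+ d = -1.
  rewrite -expiMn -[pi / _ *+ d]mulr_natr divfK ?pnatr_eq0 -?lt0n//.
  by rewrite /expi cospi sinpi; apply/eqP; rewrite eq_complex/= oppr0 !eqxx.
have u1 k : normc (put j w k) = 1 by rewrite /put; case: eqP => _ //; rewrite ComplexField.Normc.normc1.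
have pE k : \prod_i put j w i ^+ k i = w ^+ k j.
  rewrite (bigD1 j)//= /put eqxx big1 ?mulr1// => i /negbTE ->; exact: expr1n.
set a := inner _ _; suff : a = - a.
  move=> /eqP; rewrite -subr_eq0 opprK -mulr2n -mulr_natr mulf_eq0 pnatr_eq0 orbF.
  by move=> /eqP.
have cm : cmeas (fun z => monomial m z * conjc (monomial m' z)).
  apply: cmeasurableM; first exact: cmeasurable_monomial.
  by apply: cmeasurableJ; exact: cmeasurable_monomial.
rewrite -{1}[a](cI_rot alpha u1 cm) -mulN1r -(cIZ _ (inner_cintegrable (L2_monomial m) (L2_monomial m'))).
apply: eq_cI => z _; rewrite !monomial_rot !pE conjcM mulrACA; congr (_ * _).
have -> : m' j = (m j + d)%N by rewrite subnKC// ltnW.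
rewrite exprD conjcM mulrA mul_conjc normcX w1 !expr1n mul1r wd.
by rewrite conjcN conjc1.
Qed.

Lemma inner_monomialE m m' : inner (monomial m) (monomial m') =
  if [forall j, m j == m' j] then (om m)%:C else 0.
Proof.
case: (boolP [forall j, _]) => [/forallP h|]; last first.
  by rewrite negb_forall => /existsP[j]; exact: inner_monomial_neq.
have -> : m' = m by apply/funext => j; rewrite (eqP (h j)).
exact: inner_monomial.
Qed.

End L2.

(** * Coefficients of an analytic function and their Fejer sums *)

Section coefficients.
Variables (R : realType) (n : nat) (alpha : R).
Hypothesis alpha_gt : -1 < alpha.
Local Notation C := R[i].
Local Notation Cn := 'rV[C]_n.
Local Notation B := (@unit_ball R n).
Local Notation mu := (@nu_alpha R n alpha).
Local Notation cmeas := (@cmeasurable R n).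
Local Notation L2 := (@L2 R n alpha).
Local Notation inner := (@inner R n alpha).
Local Notation om m := (@moment_cst R n alpha m).
Local Notation cI := (@cI R n alpha).
Let mB : measurable B := @measurable_unit_ball R n.

Definition coef (h : Cn -> C) (m : 'I_n -> nat) : C := inner h (monomial m) / (om m)%:C.

Lemma coefE h m : coef h m = inner h (monomial m) / (om m)%:C.
Proof. by []. Qed.

Lemma om_neq0 m : (om m)%:C != 0 :> C.
Proof. by rewrite fmorph_eq0 gt_eqF// moment_cst_gt0. Qed.

Variable h : Cn -> C.
Hypotheses (ha : analytic h) (h2 : L2 h).

(** [h] need only be bounded on smaller balls, so integrals are cut off there and the radius is sent
    to 1 at the end. *)
Let ind (r : R) (z : Cn) : C := (\1_(cball r) z)%:C.

Lemma measurable_cball (r : R) : measurable (@cball R n r).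
Proof.
rewrite (_ : cball r = (@sqr_enorm R n) @^-1` `]-oo, r]%classic); last first.
  by apply/seteqP; split => z /=; rewrite /cball/= in_itv.
by rewrite -[X in measurable X]setTI; exact: measurable_sqr_enorm.
Qed.

Lemma cmeasurable_ind r : cmeas (ind r).
Proof. by apply: cmeasurable_indic; exact: measurable_cball. Qed.

Lemma cball_ball (r : R) (z : Cn) : r < 1 -> cball r z -> B z.
Proof. by move=> r1 zr; rewrite unit_ballE; exact: le_lt_trans r1. Qed.

Let favg_bound r : r < 1 -> exists2 K, 0 <= K & forall M p q z, (0 < M)%N -> cball r z ->
  normc (favg h M p q z) <= K.
Proof.
move=> r1; have [K hK] := @bounded_cball R n h r
  (fun x xr => differentiable_continuous (ha (cball_ball r1 xr))).
exists (Num.max K 0); first by rewrite le_max lexx orbT.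
move=> M p q z M0 zr; apply: normc_tavg => // u u1.
rewrite normcM normc_prod big1 ?mul1r; last by move=> j _; rewrite normc_conj_pow1.
by rewrite le_max hK// /cball/= sqr_enorm_rot.
Qed.

Let conj_pow_unit p q (x : C) : (p <= q)%N -> normc x = 1 -> conj_pow p q x = conjc x ^+ (q - p).
Proof.
move=> pq x1; rewrite /conj_pow -{1}(subnKC pq) exprD mulrA -exprMn mul_conjc x1.
by rewrite expr1n expr1n mul1r.
Qed.

Let cmeas_favg M p q : cmeas (favg h M p q).
Proof.
apply: cmeasurableM; first exact: cmeasurable_cst.
apply: cmeasurable_sum => f; apply: cmeasurableM; first exact: cmeasurable_cst.
by apply: (cmeasurable_rot alpha) h2.1 => j; exact: normc_zeta.
Qed.

Let ind_le1 r z : normc (ind r z) <= 1.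
Proof. by rewrite /ind normc_real indicE; case: (_ \in _); rewrite ?normr1 ?normr0. Qed.

Let conj_mono_le1 m z : B z -> normc (conjc (monomial m z)) <= 1.
Proof. by rewrite normcJ; exact: monomial_le1. Qed.

Let bounded_cintegrable f (c : R) : cmeas f -> (forall z, B z -> normc (f z) <= c) ->
  cintegrable alpha f.
Proof. by move=> mf fc; exact: (cintegrable_le mf (bounded_integrable n alpha_gt c) fc). Qed.

Let F r m z := ind r z * h z * conjc (monomial m z).

Let cmeas_F r m : cmeas (F r m).
Proof.
apply: cmeasurableM; first by apply: cmeasurableM; [exact: cmeasurable_ind|exact: h2.1].
by apply: cmeasurableJ; exact: cmeasurable_monomial.
Qed.

(* Rotating the variable turns each term of the average into the same integral. *)
Let favg_pairing r M p q : (0 < M)%N -> r < 1 -> (forall j, p j <= q j)%N ->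
  cI (fun z => ind r z * favg h M p q z * conjc (monomial (fun j => q j - p j)%N z)) =
  cI (F r (fun j => q j - p j)%N).
Proof.
move=> M0 r1 pq; set m := fun j => (q j - p j)%N.
have E u z : (forall j, normc (u j) = 1) ->
    ind r z * ((\prod_j conj_pow (p j) (q j) (u j)) * h (rot u z)) * conjc (monomial m z) =
    F r m (rot u z).
  move=> u1; rewrite /F monomial_rot conjcM /ind !indicE.
  have -> : (rot u z \in cball r) = (z \in cball r).
    by apply/idP/idP; rewrite !inE /cball /= sqr_enorm_rot.
  rewrite (eq_bigr (fun j => conjc (u j ^+ m j))); last by move=> j _; rewrite conj_pow_unit// conjcX.
  by rewrite -conjc_prod; ring.
have EE z : ind r z * favg h M p q z * conjc (monomial m z) =
    ((M%:R ^- n) : R)%:C * \sum_(f : {ffun 'I_n -> 'I_M}) F r m (rot (root_pt R f) z).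
  rewrite /favg /tavg mulrCA -mulrA; congr (_ * _); rewrite mulr_sumr mulr_suml.
  by apply: eq_bigr => f _; rewrite E// => j; exact: normc_zeta.
have Fi f : cintegrable alpha (fun z => F r m (rot (@root_pt R n M f) z)).
  have u1 j : normc (root_pt R f j) = 1 by exact: normc_zeta.
  have [K hK] := @bounded_cball R n h r
    (fun x xr => differentiable_continuous (ha (cball_ball r1 xr))).
  apply: (bounded_cintegrable (c := Num.max K 0)); first exact: (cmeasurable_rot alpha).
  move=> z Bz; have Bz' := ball_rot (fun j => eq_ind_r (fun x => is_true (x <= 1)) (lexx _) (u1 j)) Bz.
  rewrite /F /ind indicE; case: (boolP (_ \in cball r)) => [/set_mem zr|_].
    rewrite mul1r normcM -[leRHS]mulr1; apply: ler_pM; rewrite ?normc_ge0//.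
      by rewrite le_max hK.
    exact: conj_mono_le1.
  by rewrite !mul0r ComplexField.Normc.normc0 le_max lexx orbT.
rewrite (eq_cI alpha (fun z _ => EE z)).
have cI_sum (s : seq {ffun 'I_n -> 'I_M}) :
    cintegrable alpha (fun z => \sum_(f <- s) F r m (rot (root_pt R f) z)) /\
    cI (fun z => \sum_(f <- s) F r m (rot (root_pt R f) z)) = \sum_(f <- s) cI (F r m).
  elim: s => [|f s [IH1 IH2]].
    under eq_fun do rewrite big_nil; rewrite big_nil; split; last first.
      exact: cI0.
    by apply: (bounded_cintegrable (c := 0)); [exact: cmeasurable_cst|move=> z _; rewrite ComplexField.Normc.normc0].
  under eq_fun do rewrite big_cons; rewrite big_cons; split; first exact: cintegrableD.
  rewrite cID// IH2; congr (_ + _); apply: cI_rot => // j; exact: normc_zeta.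
have [i1 i2] := cI_sum (index_enum _).
rewrite (cIZ _ i1) i2 sumr_const card_ffun !card_ord; move: (cI _) => w.
rewrite -(mulr_natl w) mulrA -(rmorph_nat (real_complex R)) -rmorphM/= natrX mulVf ?mul1r//.
by rewrite expf_neq0// pnatr_eq0 -lt0n.
Qed.

Let omr r m := cI (fun z => ind r z * (monomial m z * conjc (monomial m z))).

Let omr_int r m : cintegrable alpha (fun z => ind r z * (monomial m z * conjc (monomial m z))).
Proof.
apply: (bounded_cintegrable (c := 1)).
  apply: cmeasurableM; first exact: cmeasurable_ind.
  by apply: cmeasurableM; [|apply: cmeasurableJ]; exact: cmeasurable_monomial.
move=> z Bz; rewrite normcM mulr_ile1 ?normc_ge0// normcM mulr_ile1 ?normc_ge0//.
  exact: monomial_le1.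
exact: conj_mono_le1.
Qed.

(** [favg_ratio] is integrated in z' against the conjugate monomial over the smaller ball, where the
    convergence is dominated; [favg_pairing] evaluates the result. [M.+1] keeps the order of the
    roots positive. *)
Let favg_coef_r r p q z : r < 1 -> B z -> (forall j, p j <= q j)%N ->
  let m := fun j => (q j - p j)%N in
  null (fun M => omr r m * favg h M.+1 p q z - monomial m z * cI (F r m)).
Proof.
move=> r1 Bz pq m; have [K K0 hK] := favg_bound r1.
have [K' hK'] : exists K', forall M, normc (favg h M.+1 p q z) <= K'.
  rewrite unit_ballE in Bz; have [K' _ h'] := favg_bound Bz; exists K' => M; apply: h' => //.
  exact: lexx.
pose f_ M z' := ind r z' * conjc (monomial m z') *
   (monomial m z' * favg h M.+1 p q z - monomial m z * favg h M.+1 p q z').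
have cf_ M : cmeas (f_ M).
  apply: cmeasurableM.
    apply: cmeasurableM; first exact: cmeasurable_ind.
    by apply: cmeasurableJ; exact: cmeasurable_monomial.
  apply: cmeasurableD.
    by apply: cmeasurableM; [exact: cmeasurable_monomial|exact: cmeasurable_cst].
  by apply: cmeasurableN; apply: cmeasurableM; [exact: cmeasurable_cst|exact: cmeas_favg].
have f_b M z' : B z' -> normc (f_ M z') <= K' + K.
  move=> Bz'; rewrite /f_ /ind indicE; case: (boolP (_ \in cball r)) => [/set_mem zr|_].
    rewrite mul1r normcM; apply: le_trans (ler_piMl (normc_ge0 _) (conj_mono_le1 m Bz')) _.
    have k1 := hK' M; have k2 := hK M.+1 p q z' isT zr.
    move: (favg h M.+1 p q z) (favg h M.+1 p q z') k1 k2 => x y k1 k2.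
    rewrite (le_trans (normcB _ _))// !normcM lerD//.
      by rewrite (le_trans _ k1)// ler_piMl ?normc_ge0// monomial_le1.
    by rewrite (le_trans _ k2)// ler_piMl ?normc_ge0// monomial_le1.
  by rewrite !mul0r ComplexField.Normc.normc0 addr_ge0// (le_trans _ (hK' 0%N))// normc_ge0.
have f_0 z' : B z' -> null (fun M => f_ M z' - 0).
  move=> Bz'; have pq' : [forall j, p j <= q j]%N by apply/forallP.
  have := nullZ (ind r z' * conjc (monomial m z')) (favg_ratio ha Bz Bz' pq').
  move=> hn e e0; have [M0 hM] := hn e e0; exists M0 => M M0M; rewrite subr0.
  exact: hM (leq_trans M0M (leqnSn _)).
have := cI_dct cf_ (cmeasurable_cst n 0) (bounded_integrable n alpha_gt (K' + K)) f_b f_0.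
congr null; apply/funext => M.
rewrite cI0 subr0.
have i2 : cintegrable alpha (fun z' => ind r z' * favg h M.+1 p q z' * conjc (monomial m z')).
  apply: (bounded_cintegrable (c := K)).
    apply: cmeasurableM; first by apply: cmeasurableM; [exact: cmeasurable_ind|exact: cmeas_favg].
    by apply: cmeasurableJ; exact: cmeasurable_monomial.
  move=> z' Bz'; rewrite /ind indicE; case: (boolP (_ \in cball r)) => [/set_mem zr|_].
    rewrite mul1r (normcM (favg _ _ _ _ _)) (le_trans _ (hK M.+1 p q z' isT zr))// ler_piMr ?normc_ge0//.
    exact: conj_mono_le1.
  by rewrite !mul0r ComplexField.Normc.normc0.
rewrite -(favg_pairing (ltn0Sn M) r1 pq) -/m -(cIZ _ i2) mulrC -(cIZ _ (omr_int r m)).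
rewrite -[X in _ = _ + X]mulN1r -(cIZ _ (cintegrableZ _ i2)) -cID; last 2 first.
- exact: cintegrableZ.
- by apply: cintegrableZ; exact: cintegrableZ.
by apply: eq_cI => z' _; rewrite /f_; ring.
Qed.

Let rk (k : nat) : R := 1 - k.+2%:R^-1.

Let rk1 k : rk k < 1. Proof. by rewrite /rk ltrBlDr ltrDl invr_gt0 ltr0n. Qed.

Let ind_null z : B z -> exists k0, forall k, (k0 <= k)%N -> ind (rk k) z = 1.
Proof.
rewrite unit_ballE => z1; have d0 : 0 < 1 - sqr_enorm z by rewrite subr_gt0.
exists (Num.trunc (1 - sqr_enorm z)^-1) => k kk; rewrite /ind indicE mem_set// /cball /rk /=.
rewrite lerBrDr addrC -lerBrDr invf_ple ?posrE ?ltr0n//.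
apply: le_trans (ltW (truncnS_gt _)) _; rewrite ler_nat ltnS.
by rewrite (leq_trans kk).
Qed.

Let cI_ind_null f (G : Cn -> R) : cmeas f -> mu.-integrable B (EFin \o G) ->
  (forall z, B z -> normc (f z) <= G z) ->
  null (fun k => cI (fun z => ind (rk k) z * f z) - cI f).
Proof.
move=> mf iG fG; apply: (cI_dct _ mf iG).
- by move=> k; apply: cmeasurableM => //; exact: cmeasurable_ind.
- by move=> k z Bz; rewrite normcM (le_trans _ (fG z Bz))// ler_piMl ?normc_ge0.
- move=> z Bz e e0; have [k0 hk] := ind_null Bz; exists k0 => k /hk ->.
  by rewrite mul1r subrr ComplexField.Normc.normc0 ltW.
Qed.

(** The cut-off is fixed first: its error is small uniformly in M because the averages at z are
    bounded by K'. Only then does M tend to infinity. *)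
Lemma favg_coef p q z : B z -> (forall j, p j <= q j)%N ->
  let m := fun j => (q j - p j)%N in
  null (fun M => favg h M.+1 p q z - coef h m * monomial m z).
Proof.
move=> Bz pq m.
have [K' hK'] : exists K', forall M, normc (favg h M.+1 p q z) <= K'.
  have z1 := Bz; rewrite unit_ballE in z1; have [K' _ h'] := favg_bound z1.
  by exists K' => M; apply: h' => //; exact: lexx.
have K0 : 0 <= K' by exact: le_trans (normc_ge0 _) (hK' 0%N).
have n1 : null (fun k => omr (rk k) m - (om m)%:C).
  rewrite -inner_monomial//; apply: (cI_ind_null (G := fun=> 1)).
  - by apply: cmeasurableM; [|apply: cmeasurableJ]; exact: cmeasurable_monomial.
  - exact: bounded_integrable.
  - move=> z' Bz'; rewrite normcM mulr_ile1 ?normc_ge0//; [exact: monomial_le1|exact: conj_mono_le1].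
have n2 : null (fun k => cI (F (rk k) m) - inner h (monomial m)).
  have := @cI_ind_null (fun z => h z * conjc (monomial m z)) (fun z => normc (h z) ^+ 2 + 1) _ _ _.
  have E k : cI (F (rk k) m) = cI (fun z => ind (rk k) z * (h z * conjc (monomial m z))).
    by apply: eq_cI => z' _; rewrite /F mulrA.
  under [X in _ -> null X]eq_fun do rewrite E; apply.
  - by apply: cmeasurableM h2.1 _; apply: cmeasurableJ; exact: cmeasurable_monomial.
  - by have := integrableD mB (L2_sq_integrable h2) (bounded_integrable n alpha_gt 1).
  - move=> z' Bz'; rewrite normcM (le_trans (ler_piMr (normc_ge0 _) (conj_mono_le1 m Bz')))//.
    by have := sqr_ge0 (normc (h z') - 1); have := normc_ge0 (h z'); move: (normc _) => x; rewrite sqrrB; lra.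
suff H : null (fun M => (om m)%:C * favg h M.+1 p q z - monomial m z * inner h (monomial m)).
  have := nullZ ((om m)%:C^-1) H; congr null; apply/funext => M.
  have := om_neq0 m; rewrite /coef; move: ((om m)%:C) (favg _ _ _ _ _) (inner _ _) => a x y a0.
  by field.
move=> e e0; have e3 : 0 < e / 3 by rewrite divr_gt0.
have K1 : 0 < K' + 1 by rewrite ltr_wpDl.
have [k1 h1] := n1 _ (divr_gt0 e3 K1); have [k2 hk2] := n2 _ e3.
pose k := maxn k1 k2; have {}h1 := h1 k (leq_maxl _ _); have {}hk2 := hk2 k (leq_maxr _ _).
have [M0 hM] := favg_coef_r (rk1 k) Bz pq e3; exists M0 => M /hM.
have := hK' M; rewrite -/m; move: (favg _ _ _ _ _) (inner _ _) h1 hk2 => x y h1 hk2 xK h3.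
rewrite (_ : _ - _ = (omr (rk k) m * x - monomial m z * cI (F (rk k) m)) -
   (omr (rk k) m - (om m)%:C) * x + monomial m z * (cI (F (rk k) m) - y)); last by ring.
apply: le_trans (normcD _ _) _; rewrite (_ : e = e / 3 + e / 3 + e / 3); last by field.
apply: lerD; last first.
  by rewrite normcM (le_trans _ hk2)// ler_piMl ?normc_ge0// monomial_le1.
apply: le_trans (normcB _ _) _; apply: lerD => //; rewrite normcM.
apply: le_trans (ler_pM (normc_ge0 _) (normc_ge0 _) h1 xK) _.
by rewrite mulrAC ler_pdivrMr// ler_wpM2l ?(ltW e3)// lerDl.
Qed.

(** In [fejer_meanE] let M tend to infinity with N fixed, which replaces each average by its limit.
    The values of [h] are thus recovered from its coefficients. *)
Lemma fejer_coef z e : B z -> 0 < e -> exists N0, forall N, (N0 <= N)%N ->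
  normc (h z - ((N%:R ^- n) : R)%:C * \sum_(k : {ffun 'I_n -> 'I_N * 'I_N})
    (if [forall j, (k j).1 <= (k j).2]%N then
       coef h (fun j => (k j).2 - (k j).1)%N * monomial (fun j => (k j).2 - (k j).1)%N z
     else 0)) <= e.
Proof.
move=> Bz e0; have e2 : 0 < e / 2 by rewrite divr_gt0.
have [N0 _ hN] := fejer_mean_cvg ha Bz e2; exists N0 => N N0N.
set S := \sum_k _.
have nS : null (fun M => \sum_(k : {ffun 'I_n -> 'I_N * 'I_N})
   (favg h M.+1 (fun j => (k j).1) (fun j => (k j).2) z -
    if [forall j, (k j).1 <= (k j).2]%N then
       coef h (fun j => (k j).2 - (k j).1)%N * monomial (fun j => (k j).2 - (k j).1)%N z
     else 0)).
  apply: null_sum => k; case: (boolP [forall j, _]) => [/forallP pq|pq].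
    exact: favg_coef.
  have := favg_null_of_gt ha Bz pq => hn d /hn[M0 hM]; exists M0 => M M0M.
  by rewrite subr0; apply: hM; exact: leq_trans (leqnSn _).
have [M0 hM] := nullZ (((N%:R ^- n) : R)%:C) nS e2.
pose M := maxn M0 N; have {}hM := hM M (leq_maxl _ _).
have {}hN := hN N M.+1 N0N (leq_trans (leq_maxr _ _) (leqnSn _)).
rewrite sumrB -/S mulrBr -fejer_meanE in hM.
move: (fejer_mean _ _ _ _) (_ * S) hM hN => x y hM hN.
rewrite (_ : h z - y = (h z - x) + (x - y)); last by ring.
by rewrite (le_trans (normcD _ _))// (splitr e) lerD.
Qed.

End coefficients.

Lemma frechet_differentiable (K : numFieldType) (V W : normedModType K) (f : V -> W)
    (x : V) (df : {linear V -> W}) : continuous df ->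
  (forall e, 0 < e -> \forall v \near (0 : V), `|f (x + v) - f x - df v| <= e * `|v|) ->
  differentiable f x.
Proof.
move=> cdf h; have E : f \o shift x = cst (f x) + df +o_ 0 id.
  apply/eqaddoP => e /h; apply: filterS => v.
  have -> : (f \o shift x - (cst (f x) + df)) v = f (x + v) - f x - df v.
    by rewrite [x + v]addrC -addrA -opprD.
  by [].
by apply/diff_locallyP; rewrite (diff_unique cdf E).
Qed.

(** * The Bergman space as a space of power series *)

Section jets.
Variables (R : realType) (n : nat).
Local Notation C := R[i].
Local Notation Cn := 'rV[C]_n.

Lemma normc_coord_lt (v : Cn) (e : R) j : `|v| < e%:C -> normc (v ord0 j) < e.
Proof.
move=> ve; have : ball_ (fun x => `|x|) (0 : Cn) e%:C v by rewrite /ball_ /= sub0r normrN.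
by rewrite -mx_norm_ball => -[_ /(_ ord0 j)]; rewrite /ball /= mxE sub0r normrN normC ltcR.
Qed.

Lemma norm_rowE (v : Cn) : `|v| = (complex.Re `|v|)%:C.
Proof.
have : 0 <= `|v| by [].
by case: `|v| => a b; rewrite lecE /= => /andP[/eqP -> _].
Qed.

Lemma Re_norm_row_ge0 (v : Cn) : 0 <= complex.Re `|v|.
Proof. by have : 0 <= `|v| by []; rewrite norm_rowE lecR. Qed.

Lemma normc_coord_le (v : Cn) j : normc (v ord0 j) <= complex.Re `|v|.
Proof.
apply/ler_addgt0Pr => e e0; apply/ltW/normc_coord_lt.
by rewrite norm_rowE ltcR ltrDl.
Qed.

(** The quadratic remainder is expressed through a common bound [t] of the coordinates of v, a form
    that survives termwise summation of a series. *)
Lemma jet_differentiable (f : Cn -> C) (z : Cn) (D : 'I_n -> C) (c t0 : R) : 0 < t0 -> 0 <= c ->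
  (forall (v : Cn) t, (forall j, normc (v ord0 j) <= t) -> 0 <= t -> t <= t0 ->
    normc (f (z + v) - f z - \sum_j D j * v ord0 j) <= c * t ^+ 2) ->
  differentiable f z.
Proof.
move=> t00 c0 hf; pose d (v : Cn) : C := \sum_j D j * v ord0 j.
have dZ a x y : d (a *: x + y) = a * d x + d y.
  rewrite /d mulr_sumr -big_split/=; apply: eq_bigr => j _.
  by rewrite !mxE; ring.
have lind : linear d by move=> a x y; exact: dZ.
pose dlM := GRing.isLinear.Build _ _ _ _ _ lind.
pose dL : {linear _ -> _} := HB.pack d dlM.
have dle (v : Cn) (t : R) : (forall j, normc (v ord0 j) <= t) -> normc (d v) <= (\sum_j normc (D j)) * t.
  move=> vt; rewrite mulr_suml (le_trans (normc_sum _ _ _))// ler_sum// => j _.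
  by rewrite normcM ler_wpM2l ?normc_ge0.
have S0 : 0 <= \sum_j normc (D j) by apply: sumr_ge0 => j _; exact: normc_ge0.
have cd : continuous (d : Cn -> C).
  move=> x; have FF : Filter (nbhs x) := @nbhs_filter Cn x.
  apply/cvgrPdist_lt => e /lt0C[r r0 ->]; apply/nbhs_rowC.
  pose S := \sum_j normc (D j) + 1; have S1 : 0 < S by rewrite ltr_wpDl.
  exists (r / S); first by rewrite divr_gt0.
  move=> t ht; rewrite normC ltcR.
  have -> : d x - d t = d ((x : Cn) - t).
    by have := dZ (-1) t x; rewrite scaleN1r mulN1r addrC [RHS]addrC.
  have := dle (x - t) (r / S) (fun j => _) => h.
  apply: le_lt_trans (h _) _; first by move=> j; rewrite !mxE ltW// ht.
  by rewrite mulrA ltr_pdivrMr// mulrC ltr_pM2l// ltrDl.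
apply: (@frechet_differentiable C _ _ f z dL cd) => e /lt0C[r r0 ->].
pose s := Num.min t0 (r / (c + 1)).
have c1 : 0 < c + 1 by rewrite ltr_wpDl.
have s0 : 0 < s by rewrite lt_min t00 divr_gt0.
have sC : (0 : C) < s%:C by rewrite ltcR.
apply: filterS (@nbhs0_lt C Cn _ sC) => v; rewrite norm_rowE ltcR => /ltW ts.
rewrite normC -rmorphM lecR; have t_0 := Re_norm_row_ge0 v; have tj := normc_coord_le v.
move: (complex.Re _) ts t_0 tj => t ts t_0 tj.
apply: le_trans (hf v t tj t_0 _) _.
  by rewrite (le_trans ts)// ge_min lexx.
rewrite expr2 mulrA ler_wpM2r//.
have : t <= r / (c + 1) by rewrite (le_trans ts)// ge_min lexx orbT.
rewrite ler_pdivlMr// => h; apply: le_trans h; rewrite mulrC ler_wpM2l// lerDl ler01//.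
Qed.

(** [G] is the monomial at the point with coordinates |z_j| + t0, so every constant is controlled by
    absolute convergence of a power series at that point. *)
Lemma monomial_jet (z : Cn) (t0 : R) (m : 'I_n -> nat) : 0 < t0 ->
  let G := \prod_j (normc (z ord0 j) + t0) ^+ m j in
  exists2 d : 'I_n -> C, (forall j, normc (d j) <= G / t0) &
    forall (v : Cn) t, (forall j, normc (v ord0 j) <= t) -> 0 <= t -> t <= t0 ->
    normc (monomial m (z + v) - monomial m z - \sum_j d j * v ord0 j) <= G * (t / t0) ^+ 2.
Proof.
move=> t00 G.
have r0 j : 0 <= normc (z ord0 j) + t0 by rewrite addr_ge0 ?normc_ge0// ltW.
(* The indices with multiplicity: the jet of the monomial is built one linear factor at a time. *)
pose s := flatten [seq nseq (m j) j | j <- index_enum 'I_n].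
have sE (F : 'I_n -> C) : \prod_j F j ^+ m j = \prod_(j <- s) F j.
  rewrite big_flatten big_map; apply: eq_bigr => j _.
  by elim: (m j) => [|k IH]; rewrite ?big_nil ?expr0// big_cons exprS IH.
have GE : G = \prod_(j <- s) (normc (z ord0 j) + t0).
  rewrite big_flatten big_map; apply: eq_bigr => j _.
  by elim: (m j) => [|k IH]; rewrite ?big_nil ?expr0// big_cons exprS IH.
suff H (l : seq 'I_n) : let P := \prod_(j <- l) (normc (z ord0 j) + t0) in
    exists2 d : 'I_n -> C, (forall j, normc (d j) <= P / t0) &
    forall (v : Cn) t, (forall j, normc (v ord0 j) <= t) -> 0 <= t -> t <= t0 ->
    [/\ normc (\prod_(j <- l) (z + v) ord0 j) <= P,
      normc (\prod_(j <- l) (z + v) ord0 j - \prod_(j <- l) z ord0 j) <= P * (t / t0) &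
      normc (\prod_(j <- l) (z + v) ord0 j - \prod_(j <- l) z ord0 j - \sum_j d j * v ord0 j) <= P * (t / t0) ^+ 2].
  have [d hd h] := H s; exists d; first by rewrite GE.
  by move=> v t vt tp tt; rewrite /monomial !sE GE; have [] := h v t vt tp tt.
elim: l => [|i l] /=.
  exists (fun=> 0) => [j|v t vt tp tt]; first by rewrite ComplexField.Normc.normc0 big_nil mul1r invr_ge0 ltW.
  rewrite !big_nil subrr ComplexField.Normc.normc0 ComplexField.Normc.normc1 !mul1r.
  rewrite big1 ?subrr ?ComplexField.Normc.normc0; last by move=> j _; rewrite mul0r.
  by rewrite sqr_ge0 divr_ge0// ltW.
rewrite big_cons; set P := \prod_(j <- l) _; set r := normc (z ord0 i) => -[d hd h].
have P0 : 0 <= P by apply: prodr_ge0 => j _.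
have hr : 0 <= r by exact: normc_ge0.
pose Q := \prod_(j <- l) z ord0 j.
have QP : normc Q <= P.
  have [] := h 0 0 _ (lexx _) (ltW t00); first by move=> j; rewrite mxE ComplexField.Normc.normc0.
  by rewrite addr0.
exists (fun j => z ord0 i * d j + (if j == i then Q else 0)) => [j|v t vt tp tt].
  apply: le_trans (normcD _ _) _; rewrite normcM -/r.
  have -> : (r + t0) * P / t0 = r * (P / t0) + P by field; rewrite gt_eqF.
  by rewrite lerD ?ler_wpM2l//; case: eqP => // _; rewrite ComplexField.Normc.normc0.
have [h1 h2 h3] := h v t vt tp tt; rewrite !big_cons.
have -> : \sum_j (z ord0 i * d j + (if j == i then Q else 0)) * v ord0 j =
    z ord0 i * (\sum_j d j * v ord0 j) + Q * v ord0 i.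
  under eq_bigr do rewrite mulrDl -mulrA; rewrite big_split/= -mulr_sumr; congr (_ + _).
  by rewrite (bigD1 i)//= eqxx big1 ?addr0// => j /negbTE ->; rewrite mul0r.
have -> : (z + v) ord0 i = z ord0 i + v ord0 i by rewrite mxE.
rewrite -/Q; move: (\prod_(j <- l) _) (\sum_j _) h1 h2 h3 => A S h1 h2 h3.
have vi := vt i; have v0 := normc_ge0 (v ord0 i).
have tt0 : 0 <= t / t0 by rewrite divr_ge0// ltW.
have tE : t = t0 * (t / t0) by field; rewrite gt_eqF.
split.
- rewrite normcM; apply: ler_pM; rewrite ?normc_ge0//.
  by rewrite (le_trans (normcD _ _))// lerD2l (le_trans vi).
- rewrite (_ : _ - _ = z ord0 i * (A - Q) + v ord0 i * A); last by ring.
  rewrite (le_trans (normcD _ _))// !normcM -/r !mulrDl lerD//.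
    by rewrite -mulrA ler_wpM2l.
  by rewrite mulrAC -tE ler_pM ?normc_ge0.
rewrite (_ : _ - _ = z ord0 i * (A - Q - S) + v ord0 i * (A - Q)); last by ring.
rewrite (le_trans (normcD _ _))// !normcM -/r !mulrDl lerD//.
  by rewrite -mulrA ler_wpM2l.
rewrite expr2 (_ : t0 * P * _ = t0 * (t / t0) * (P * (t / t0))); last by ring.
by rewrite -tE ler_pM ?normc_ge0.
Qed.

End jets.

(** * Estimates for multinomial and rising factorials *)

Section multinomial.
Variable R : realType.

(** One term of the multinomial expansion of the power on the right, obtained from one binomial term
    at each induction step. *)
Lemma multinomial_le n (s : seq 'I_n) (m : 'I_n -> nat) (y : 'I_n -> R) : (forall j, 0 <= y j) ->
  ((\sum_(j <- s) m j)`!)%:R * \prod_(j <- s) y j ^+ m j <=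
  (\prod_(j <- s) (m j)`!)%:R * (\sum_(j <- s) y j) ^+ (\sum_(j <- s) m j).
Proof.
move=> y0; elim: s => [|j s IH]; first by rewrite !big_nil fact0 expr0.
rewrite !big_cons; set K := (\sum_(i <- s) m i)%N; set Y := \sum_(i <- s) y i.
have Y0 : 0 <= Y by apply: sumr_ge0.
rewrite natrM.
have h1 : 'C(m j + K, m j)%:R * (y j ^+ m j * Y ^+ K) <= (y j + Y) ^+ (m j + K).
  rewrite exprDn; have hk : (K < (m j + K).+1)%N by rewrite ltnS leq_addl.
  rewrite (bigD1 (Ordinal hk))//=.
  rewrite addnK.
  have -> : 'C(m j + K, m j) = 'C(m j + K, K) by rewrite -(@bin_sub _ (m j)) ?leq_addr// addKn.
  rewrite mulr_natl lerDl.
  by apply: sumr_ge0 => i _; rewrite mulrn_wge0// mulr_ge0 ?exprn_ge0.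
have h2 := ler_wpM2l (ler0n R ((m j)`!)) h1.
have E : ((m j + K)`!)%:R = 'C(m j + K, m j)%:R * (m j)`!%:R * K`!%:R :> R.
  by rewrite -!natrM -mulnA -(@bin_fact (m j + K) (m j)) ?leq_addr// addKn.
rewrite E.
have := ler_wpM2l (mulr_ge0 (mulr_ge0 (ler0n R 'C(m j + K, m j)) (ler0n R (m j)`!)) (exprn_ge0 (m j) (y0 j))) IH.
rewrite -/K -/Y => h3.
apply: (@le_trans _ _ ('C(m j + K, m j)%:R * (m j)`!%:R * y j ^+ m j *
  ((\prod_(j0 <- s) (m j0)`!)%:R * Y ^+ K))).
  by move: h3; congr (_ <= _); ring.
apply: (@le_trans _ _ ((\prod_(j0 <- s) (m j0)`!)%:R * ((m j)`!%:R * ('C(m j + K, m j)%:R * (y j ^+ m j * Y ^+ K))))).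
  by rewrite le_eqVlt; apply/orP; left; apply/eqP; ring.
apply: le_trans (ler_wpM2l (ler0n _ _) h2) _.
by rewrite le_eqVlt; apply/orP; left; apply/eqP; ring.
Qed.

(** Divided by k!, consecutive left-hand sides have a ratio tending to s < 1, so they decrease from
    some k0 on; the sum of the values up to k0 bounds them all. *)
Lemma rising_le (a : R) (n : nat) (s : R) : -1 < a -> 0 < s -> s < 1 -> exists2 c, 0 < c &
  forall k, \prod_(l < n + k) (a + l.+1%:R) * s ^+ k <= c * k`!%:R.
Proof.
move=> a1 s0 s1; pose b k : R := \prod_(l < n + k) (a + l.+1%:R) * s ^+ k / k`!%:R.
have pos l : 0 < a + l.+1%:R by rewrite -natr1; have : 0 <= l%:R :> R by []; lra.
have b0 k : 0 < b k by rewrite divr_gt0 ?ltr0n ?fact_gt0// mulr_gt0 ?exprn_gt0// prodr_gt0.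
have bS k : b k.+1 = b k * ((a + (n + k).+1%:R) * s / k.+1%:R).
  rewrite /b addnS big_ord_recr/= exprS factS natrM; field.
  by rewrite addrC natr1 !pnatr_eq0 /= -lt0n fact_gt0.
have [k0 hk0] : exists k0 : nat, (a + n%:R + 1) * s / (1 - s) < k0%:R.
  by exists (Num.trunc ((a + n%:R + 1) * s / (1 - s))).+1; exact: truncnS_gt.
have step k : (k0 <= k)%N -> b k.+1 <= b k.
  move=> kk; rewrite bS ler_piMr ?(ltW (b0 k))// ler_pdivrMr ?ltr0n// mul1r.
  have : (a + n%:R + 1) * s < k%:R * (1 - s).
    by rewrite -ltr_pdivrMr ?subr_gt0//; apply: lt_le_trans hk0 _; rewrite ler_nat.
  by rewrite -!natr1 natrD; lra.
exists (\sum_(k < k0.+1) b k).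
  rewrite big_ord_recr/=; apply: ltr_wpDl => //; by apply: sumr_ge0 => k _; exact/ltW.
move=> k; rewrite -ler_pdivrMr ?ltr0n ?fact_gt0// -/(b k).
have small i : (i <= k0)%N -> b i <= \sum_(k < k0.+1) b k.
  move=> ik; have ik' : (i < k0.+1)%N by [].
  by rewrite (bigD1 (Ordinal ik'))//= lerDl; apply: sumr_ge0 => j _; exact/ltW.
have [kk|kk] := leqP k k0; first exact: small.
have := small k0 (leqnn _); apply: le_trans.
rewrite -(subnK (ltnW kk)); elim: (k - k0)%N => [|i IH]; first by rewrite add0n.
by rewrite addSn (le_trans _ IH)// step// leq_addl.
Qed.

End multinomial.

(** * Geometric decay of normalised monomials, and enumeration of multi-indices *)

Section moment_bound.
Variables (R : realType) (n : nat) (alpha : R).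
Hypothesis alpha_gt : -1 < alpha.
Local Notation C := R[i].
Local Notation Cn := 'rV[C]_n.
Local Notation om m := (@moment_cst R n alpha m).

(** [multinomial_le] bounds the monomial by r^|m| and [rising_le] the inverse moment by s^-|m|, up
    to factorials that cancel; with s halfway between r and 1 the ratio decays like t = r / s per
    degree. *)
Lemma moment_bound (r : R) : 0 <= r -> r < 1 -> exists c t : R, [/\ 0 <= c, 0 <= t < 1 &
  forall (m : 'I_n -> nat) (w : Cn), cball r w -> moment m w <= c * t ^+ (\sum_j m j) * om m].
Proof.
move=> r0 r1; pose s := (1 + r) / 2.
have s0 : 0 < s by rewrite divr_gt0// ltr_pwDl.
have s1 : s < 1 by rewrite /s; lra.
have [c c0 hc] := rising_le n alpha_gt s0 s1.
have A0 : 0 < bergman_cst n alpha * nu_cst R n * disc_cst R ^+ n.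
  apply: mulr_gt0; first by apply: mulr_gt0; [exact: bergman_cst_gt0|exact: nu_cst_gt0].
  by rewrite exprn_gt0// disc_cst_gt0.
exists (c / (bergman_cst n alpha * nu_cst R n * disc_cst R ^+ n)), (r / s); split.
- by rewrite divr_ge0// ltW.
- by apply/andP; split; [rewrite divr_ge0// ltW|rewrite ltr_pdivrMr// mul1r /s; lra].
move=> m w wr; set k := (\sum_j m j)%N.
pose x j := normc (w ord0 j) ^+ 2.
have x0 j : 0 <= x j by rewrite sqr_ge0.
have h1 := multinomial_le (index_enum 'I_n) m x0.
have h2 : (\sum_j x j) ^+ k <= r ^+ k by rewrite lerXn2r// nnegrE ?sumr_ge0.
have P0 : 0 < \prod_(l < n + k) (alpha + l.+1%:R).
  by apply: prodr_gt0 => l _; have := ler0n R l; have := alpha_gt; rewrite -natr1; move: (l%:R : R) => x'; lra.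
have sk0 : 0 < s ^+ k by rewrite exprn_gt0.
have M0 := moment_ge0 m w.
have h3 : moment m w * (\prod_(l < n + k) (alpha + l.+1%:R) * s ^+ k) <=
    c * ((\prod_j (m j)`!)%:R * r ^+ k).
  apply: le_trans (ler_wpM2l M0 (hc k)) _; rewrite mulrCA ler_pM2l// mulrC.
  by apply: le_trans h1 _; rewrite ler_wpM2l.
rewrite /moment_cst /dirichlet_cst -/k expr_div_n.
rewrite -(ler_pdivlMr _ _ (mulr_gt0 P0 sk0)) in h3; apply: le_trans h3 _.
rewrite le_eqVlt; apply/orP; left; apply/eqP.
have := A0; move: (bergman_cst _ _) (nu_cst _ _) (disc_cst _ ^+ n) (\prod_(l < _) _) (s ^+ k) P0 sk0 => a b d P S P0 S0 A1.
have : a * b * d != 0 by rewrite gt_eqF.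
rewrite !mulf_eq0 !negb_or => /andP[/andP[a0 b0] d0].
by field; rewrite ?a0 ?b0 ?d0 ?gt_eqF.
Qed.

Local Notation MI := {ffun 'I_n -> nat}.

(** The indices in [s] lie in a finite box, over which the sum factors into n geometric sums. *)
Lemma sum_pow_le (t : R) (s : seq MI) : 0 <= t < 1 -> uniq s ->
  \sum_(m <- s) t ^+ (\sum_j m j) <= (1 - t) ^- n.
Proof.
move=> /andP[t0 t1] us.
pose N := (\max_(m <- s) \max_j m j).+1.
have sN m j : m \in s -> (m j < N)%N.
  by move=> ms; rewrite ltnS (leq_trans (leq_bigmax j))//; apply: leq_bigmax_seq.
pose emb (f : {ffun 'I_n -> 'I_N}) : MI := [ffun j => f j : nat].
have embI : injective emb.
  by move=> f g /ffunP h; apply/ffunP => j; have := h j; rewrite !ffunE => /val_inj.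
have ps : perm_eq s [seq m <- [seq emb f | f <- index_enum {ffun 'I_n -> 'I_N}] | m \in s].
  apply: uniq_perm => //; first by rewrite filter_uniq// map_inj_uniq// index_enum_uniq.
  move=> m; rewrite mem_filter; case: (boolP (m \in s)) => //= ms; apply/esym/mapP.
  exists [ffun j => Ordinal (sN m j ms)]; first by rewrite mem_index_enum.
  by apply/ffunP => j; rewrite !ffunE.
rewrite (perm_big _ ps)/= big_filter big_map/=.
apply: (@le_trans _ _ (\sum_(f : {ffun 'I_n -> 'I_N}) \prod_j t ^+ f j)).
  rewrite big_mkcond/=; apply: ler_sum => f _; case: ifP => _.
    by rewrite expr_sum le_eqVlt; apply/orP; left; apply/eqP/eq_bigr => j _; rewrite ffunE.
  by apply: prodr_ge0 => j _; rewrite exprn_ge0.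
rewrite -(bigA_distr_bigA (fun (_ : 'I_n) (l : 'I_N) => t ^+ l)) prodr_const card_ord -exprVn.
have t1' : 0 < 1 - t by rewrite subr_gt0.
apply: lerXn2r; rewrite ?nnegrE ?invr_ge0 ?(ltW t1')//.
  by apply: sumr_ge0 => l _; rewrite exprn_ge0.
rewrite -(ler_pM2l t1') mulfV ?gt_eqF// -opprB mulNr -subrX1 opprB gerBl exprn_ge0//.
Qed.

(** Cantor-Bernstein, the constant indices embedding [nat] because n > 0. The bijection turns sums
    over multi-indices into ordinary series. *)
Lemma multi_index_enum : (0 < n)%N -> exists mi : nat -> MI, injective mi /\ forall m, exists k, mi k = m.
Proof.
move=> n0; pose f (k : nat) : MI := [ffun=> k].
have fI : injective f by move=> k l /ffunP/(_ (Ordinal n0)); rewrite !ffunE.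
have fE : (f @` [set: nat] #= [set: nat])%card by apply: inj_card_eq => k l _ _ /fI.
have le1 : ([set: nat] #<= [set: MI])%card.
  by rewrite -(card_le_eql fE); exact: subset_card_le.
have le2 : ([set: MI] #<= [set: nat])%card by exact: countableP.
have /card_set_bijP[g] := Cantor_Bernstein le2 le1.
rewrite setTT_bijective => -[g' gK g'K]; exists g'; split; first exact: can_inj g'K.
by move=> m; exists (g m).
Qed.

End moment_bound.

(** * Summable series and uniqueness of limits *)

Section series.
Variable R : realType.
Local Notation C := R[i].

Lemma bounded_series_tail (u : nat -> R) c : (forall k, 0 <= u k) ->
  (forall K, \sum_(k < K) u k <= c) -> forall e, 0 < e -> exists K, forall K',
  \sum_(K <= k < K') u k <= e.
Proof.
move=> u0 uc e e0; have nd : {homo series u : a b / (a <= b)%N >-> a <= b}.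
  by apply/nondecreasing_seqP => k; rewrite seriesSr lerDl.
have cv : cvgn (series u).
  apply: nondecreasing_is_cvgn => //; exists c => _ [K _ <-].
  by rewrite /series /= big_mkord.
have := cv => /cvgrPdist_le/(_ e e0)[K _ hK]; exists K => K'.
have [KK|KK] := leqP K K'; last by rewrite big_geq ?(ltW e0)// ltnW.
have E : \sum_(K <= k < K') u k = series u K' - series u K.
  by rewrite sub_series_geq.
rewrite E; have := hK K (leqnn K); rewrite ler_norml => /andP[_] /=.
apply: le_trans; rewrite lerD2r; exact: nondecreasing_cvgn_le.
Qed.

Lemma summable_null (x : nat -> C) c : (forall K, \sum_(k < K) normc (x k) <= c) ->
  exists l, null (fun K => \sum_(k < K) x k - l).
Proof.
move=> xc; have H (p : C -> R) : (forall y, `|p y| <= normc y) ->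
    cvgn (series (fun k => p (x k))).
  move=> pn; apply: normed_cvg; apply: nondecreasing_is_cvgn.
    by apply/nondecreasing_seqP => k /=; rewrite /series /= big_nat_recr//= lerDl.
  exists c => _ [K _ <-].
  rewrite -[X in X <= _]/(\sum_(0 <= k < K) `|p (x k)|) big_mkord; apply: le_trans (xc K).
  by apply: ler_sum => k _.
exists (limn (series (fun k => complex.Re (x k))) +i* limn (series (fun k => complex.Im (x k)))).
apply: cvg_null => /=.
  rewrite (_ : (fun K => _) = series (fun k => complex.Re (x k))).
    by apply: H; exact: Re_le_normc.
  by apply/funext => K; rewrite Re_sum /series /= big_mkord.
rewrite (_ : (fun K => _) = series (fun k => complex.Im (x k))).
  by apply: H; exact: Im_le_normc.
by apply/funext => K; rewrite Im_sum /series /= big_mkord.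
Qed.

Lemma null_le (u : nat -> C) (l : C) c : null (fun k => u k - l) ->
  (forall k, normc (u k) <= c) -> normc l <= c.
Proof.
move=> hu uc; apply/ler_addgt0Pr => e /hu[k /(_ k (leqnn k)) hk].
have := normcB (u k) (u k - l); rewrite opprB addrC subrK => /le_trans; apply.
exact: lerD.
Qed.

Lemma null_uniq (u : nat -> C) (l l' : C) : null (fun k => u k - l) ->
  null (fun k => u k - l') -> l = l'.
Proof.
move=> h h'; apply: normc_le0_eq => e e0; have [k0 hk] := nullB h' h e0.
by have := hk k0 (leqnn _); congr (normc _ <= _); ring.
Qed.

End series.

(** * Orthogonal expansions and the Bergman projection *)

Section orthogonal.
Variables (R : realType) (n : nat) (alpha : R).
Hypothesis alpha_gt : -1 < alpha.
Local Notation C := R[i].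
Local Notation Cn := 'rV[C]_n.
Local Notation B := (@unit_ball R n).
Local Notation mu := (@nu_alpha R n alpha).
Local Notation L2 := (@L2 R n alpha).
Local Notation inner := (@inner R n alpha).
Local Notation norm2 := (@norm2 R n alpha).
Local Notation om m := (@moment_cst R n alpha m).
Local Notation coef := (@coef R n alpha).
Local Notation MI := {ffun 'I_n -> nat}.
Let mB : measurable B := @measurable_unit_ball R n.

Lemma L2_0 : L2 0.
Proof.
by apply: (L2_bounded alpha_gt (c := 0)); [exact: (cmeasurable_cst _ 0)|move=> z _; rewrite ComplexField.Normc.normc0].
Qed.

Lemma L2_sum I (r : seq I) (f : I -> Cn -> C) : (forall i, L2 (f i)) -> L2 (\sum_(i <- r) f i).
Proof.
move=> hf; elim: r => [|i r IH]; first by rewrite big_nil; exact: L2_0.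
by rewrite big_cons; exact: L2D.
Qed.

Lemma inner0l g : L2 g -> inner 0 g = 0.
Proof. by move=> hg; rewrite -(scale0r g) innerZl// mul0r. Qed.

Lemma inner_suml I (r : seq I) (f : I -> Cn -> C) g : (forall i, L2 (f i)) -> L2 g ->
  inner (\sum_(i <- r) f i) g = \sum_(i <- r) inner (f i) g.
Proof.
move=> hf hg; elim: r => [|i r IH]; first by rewrite !big_nil inner0l.
by rewrite !big_cons innerDl// ?IH//; exact: L2_sum.
Qed.

Lemma norm2_eq f g : (forall z, B z -> f z = g z) -> norm2 f = norm2 g.
Proof. by move=> fg; rewrite /norm2; congr Num.sqrt; apply: eq_Rintegral => z /[!inE] Bz; rewrite fg. Qed.

(** Fatou's lemma plays the part of completeness: limits are constructed pointwise and this puts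
    them in L2 with a norm bound. *)
Lemma fatou_norm2 (f_ : nat -> Cn -> C) f (c : R) : (forall k, L2 (f_ k)) ->
  (forall z, B z -> null (fun k => f_ k z - f z)) -> (forall k, norm2 (f_ k) ^+ 2 <= c) ->
  L2 f /\ norm2 f ^+ 2 <= c.
Proof.
move=> hf_ cf hc.
have hc' z : B z -> _ := fun Bz => null_Re_cvg (cf z Bz).
have mf : cmeasurable f.
  split.
    by apply: (measurable_fun_cvg (h := fun k z => complex.Re (f_ k z))) => [k|z /hc'[]//]; case: (hf_ k) => -[].
  by apply: (measurable_fun_cvg (h := fun k z => complex.Im (f_ k z))) => [k|z /hc'[]//]; case: (hf_ k) => -[].
have msq k : measurable_fun B (fun z => (normc (f_ k z) ^+ 2)%:E).
  by apply/measurable_EFinP; apply: measurable_sqr_normc; case: (hf_ k).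
have intE k : (\int[mu]_(z in B) (normc (f_ k z) ^+ 2)%:E = (norm2 (f_ k) ^+ 2)%:E)%E.
  rewrite sqr_norm2 /Rintegral fineK//; apply: integrable_fin_num => //.
  exact: L2_sq_integrable.
have sqcvg z : B z -> (fun k => (normc (f_ k z) ^+ 2)%:E) @ \oo --> (normc (f z) ^+ 2)%:E.
  move=> /hc'[h1 h2]; apply: cvg_EFin; first by near=> k.
  rewrite sqr_normcE; under eq_fun do rewrite sqr_normcE.
  by apply: cvgD; rewrite expr2; under eq_fun do rewrite expr2; exact: cvgM.
have le : (\int[mu]_(z in B) (normc (f z) ^+ 2)%:E <= c%:E)%E.
  have sq0 k z : (0 <= (normc (f_ k z) ^+ 2)%:E)%E by rewrite lee_fin sqr_ge0.
  have h := @fatou _ _ _ mu B mB (fun k z => (normc (f_ k z) ^+ 2)%:E) msq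
    (fun k z _ => sq0 k z).
  rewrite (eq_integral (fun z => limn_einf (fun k => (normc (f_ k z) ^+ 2)%:E))); last first.
    by move=> z /[!inE] Bz; have [-> _] := cvg_limn_einf_sup (sqcvg z Bz).
  apply: le_trans h _.
  rewrite limn_einf_lim; apply: lime_le; first exact: is_cvg_einfs.
  near=> k; apply: (@le_trans _ _ (\int[mu]_(z in B) (normc (f_ k z) ^+ 2)%:E)%E).
    by apply: ereal_inf_lbound; exists k => /=.
  by rewrite intE lee_fin.
have hf : L2 f by split => //; apply: le_lt_trans le _; rewrite ltry.
split=> //; rewrite sqr_norm2 -lee_fin /Rintegral fineK//.
by apply: integrable_fin_num => //; exact: L2_sq_integrable.
Unshelve. all: by end_near. Qed.

Variable mi : nat -> MI.
Hypothesis mi_inj : injective mi.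

Let e k : Cn -> C := monomial (mi k).
Let w k : R := om (mi k).

Lemma w_gt0 k : 0 < w k. Proof. exact: moment_cst_gt0. Qed.

Lemma L2_basis k : L2 (e k). Proof. exact: L2_monomial. Qed.

Lemma inner_basis k l : inner (e k) (e l) = if k == l then (w k)%:C else 0.
Proof.
rewrite inner_monomialE// -(inj_eq mi_inj); congr (if _ then _ else _).
apply/forallP/eqP => [h|-> j]; last exact: eqxx.
by apply/ffunP => j; exact/eqP.
Qed.

Definition psum (b : nat -> C) (s : seq nat) : Cn -> C := \sum_(k <- s) b k *: e k.

Lemma psumE b s z : psum b s z = \sum_(k <- s) b k * e k z.
Proof. by rewrite /psum fct_sumE. Qed.

Lemma L2_psum b s : L2 (psum b s).
Proof. by apply: L2_sum => k; apply: L2Z; exact: L2_basis. Qed.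

Lemma inner_psum b s l : uniq s -> inner (psum b s) (e l) = if l \in s then b l * (w l)%:C else 0.
Proof.
move=> us; rewrite inner_suml; last 2 first.
- by move=> k; apply: L2Z; exact: L2_basis.
- exact: L2_basis.
rewrite (eq_bigr (fun k => if k == l then b l * (w l)%:C else 0)); last first.
  move=> k _; rewrite innerZl ?inner_basis//; [|exact: L2_basis..].
  by case: eqP => [->//|_]; rewrite mulr0.
rewrite -big_mkcond/=; case: ifP => ls; last first.
  by rewrite big1_seq// => k /andP[/eqP -> ks]; rewrite ks in ls.
by rewrite -big_filter filter_pred1_uniq// big_seq1.
Qed.

Lemma inner_psum_r f b s : L2 f ->
  inner f (psum b s) = \sum_(k <- s) conjc (b k) * inner f (e k).
Proof.
move=> hf; rewrite (innerJ (L2_psum b s) hf) inner_suml//; last first.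
  by move=> k; apply: L2Z; exact: L2_basis.
rewrite conjc_sum; apply: eq_bigr => k _; rewrite innerZl ?conjcM//; last exact: L2_basis.
by rewrite -(innerJ (L2_basis k) hf).
Qed.

Lemma norm2_psum b s : uniq s -> norm2 (psum b s) ^+ 2 = \sum_(k <- s) normc (b k) ^+ 2 * w k.
Proof.
move=> us; apply: (@complexI R); rewrite -inner_ff inner_psum_r; last exact: L2_psum.
rewrite rmorph_sum; apply: eq_big_seq => k ks /=.
by rewrite inner_psum// ks mulrA [conjc _ * _]mulrC mul_conjc -rmorphM.
Qed.

Lemma inner_coef f k : inner f (e k) = coef f (mi k) * (w k)%:C.
Proof. by rewrite coefE divfK// om_neq0. Qed.

Lemma bessel f s : L2 f -> uniq s ->
  \sum_(k <- s) normc (coef f (mi k)) ^+ 2 * w k <= norm2 f ^+ 2.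
Proof.
move=> hf us; set b := fun k => coef f (mi k).
have h : inner f (psum b s) = (norm2 (psum b s) ^+ 2)%:C.
  rewrite inner_psum_r// norm2_psum// rmorph_sum; apply: eq_bigr => k _.
  rewrite inner_coef -/(b k); move: (b k) => y.
  by rewrite mulrA [conjc _ * _]mulrC mul_conjc -rmorphM.
have := sqr_ge0 (norm2 (f + (-1) *: psum b s)).
rewrite sqr_norm2D//; last by apply: L2Z; exact: L2_psum.
rewrite innerZr//; [|exact: L2_psum..].
rewrite norm2Z; last exact: L2_psum.
rewrite h conjcN conjc1 mulN1r normcN ComplexField.Normc.normc1 mul1r -norm2_psum//.
by rewrite raddfN /= mulNrn mulr2n; lra.
Qed.

Lemma basis_bound (r : R) : 0 <= r -> r < 1 -> exists2 E, 0 < E & forall z s, cball r z -> uniq s ->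
  \sum_(k <- s) normc (e k z) ^+ 2 / w k <= E.
Proof.
move=> r0 r1; have [c [t [c0 t01 h]]] := moment_bound n alpha_gt r0 r1.
have t1 : 0 < 1 - t by case/andP: t01 => _; rewrite subr_gt0.
exists ((c + 1) * (1 - t) ^- n); first by rewrite mulr_gt0 ?ltr_wpDl// invr_gt0 exprn_gt0.
move=> z s zr us; apply: (@le_trans _ _ (\sum_(k <- s) (c + 1) * t ^+ (\sum_j mi k j))).
  apply: ler_sum => k _; rewrite ler_pdivrMr ?w_gt0// sqr_normc_monomial.
  apply: le_trans (h (mi k) z zr) _; rewrite ler_wpM2r ?(ltW (w_gt0 k))// ler_wpM2r ?lerDl//.
  by case/andP: t01 => t0 _; rewrite exprn_ge0.
have := @sum_pow_le R n t [seq mi k | k <- s] t01; rewrite map_inj_uniq// => /(_ us).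
rewrite big_map -mulr_sumr => hs; rewrite ler_wpM2l// addr_ge0//.
Qed.

(** On finitely many monomials, evaluation at z is the inner product with the truncated reproducing
    kernel [psum q s], whose squared norm is bounded by [basis_bound]. *)
Lemma psum_bound (r : R) : 0 <= r -> r < 1 -> exists2 E, 0 < E & forall z b s, cball r z -> uniq s ->
  normc (psum b s z) <= E * norm2 (psum b s).
Proof.
move=> r0 r1; have [E E0 hE] := basis_bound r0 r1.
exists (Num.sqrt E); first by rewrite sqrtr_gt0.
move=> z b s zr us; pose q k := conjc (e k z) / (w k)%:C.
have -> : psum b s z = inner (psum b s) (psum q s).
  rewrite inner_psum_r ?psumE; last exact: L2_psum.
  apply: eq_big_seq => k ks; rewrite inner_psum// ks /q conjcM conjcK conjc_inv conjc_real.
  have : (w k)%:C != 0 :> C by rewrite om_neq0.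
  by move: ((w k)%:C) (e k z) => x y x0; field.
apply: le_trans (cauchy_schwarz (L2_psum b s) (L2_psum q s)) _.
rewrite mulrC ler_wpM2r ?norm2_ge0// -(ger0_norm (norm2_ge0 _ _)) -sqrtr_sqr ler_wsqrtr//.
rewrite norm2_psum//; apply: le_trans (hE z s zr us); apply: ler_sum => k _.
rewrite /q normcM normcJ normcV normc_real (gtr0_norm (w_gt0 k)) exprMn.
by rewrite le_eqVlt; apply/orP; left; apply/eqP; field; rewrite gt_eqF// w_gt0.
Qed.

Section synthesis.
Variables (b : nat -> C) (c0 : R).
Hypothesis bnd : forall K, \sum_(k < K) normc (b k) ^+ 2 * w k <= c0.

Let partial K := psum b (iota 0 K).

Let iotaE (F : nat -> R) K : \sum_(k <- iota 0 K) F k = \sum_(k < K) F k.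
Proof. by rewrite -[RHS](big_mkord xpredT) /index_iota subn0. Qed.

Let partialE K z : partial K z = \sum_(k < K) b k * e k z.
Proof. by rewrite /partial psumE -[RHS](big_mkord xpredT (fun k => b k * e k z)) /index_iota subn0. Qed.

(* AM-GM splits each term between the bound on [b] and the kernel on the diagonal. *)
Lemma abs_bound (r : R) : 0 <= r -> r < 1 -> exists E, forall z K, cball r z ->
  \sum_(k < K) normc (b k) * normc (e k z) <= E.
Proof.
move=> r0 r1; have [E E0 hE] := basis_bound r0 r1.
exists (c0 + E) => z K zr; have := hE z (iota 0 K) zr (iota_uniq 0 K).
rewrite iotaE => h; apply: le_trans (lerD (bnd K) h); rewrite -big_split/=.
apply: ler_sum => k _; have w0 := w_gt0 k.
have h1 : 0 <= (normc (b k) * w k - normc (e k z)) ^+ 2 / w k by rewrite divr_ge0 ?sqr_ge0// ltW.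
rewrite (_ : _ / _ = normc (b k) ^+ 2 * w k - (normc (b k) * normc (e k z)) *+ 2 +
  normc (e k z) ^+ 2 / w k) in h1; last by rewrite mulr2n; field; rewrite gt_eqF.
have : 0 <= normc (b k) * normc (e k z) by rewrite mulr_ge0 ?normc_ge0.
by rewrite mulr2n in h1; lra.
Qed.

(** The sum of the power series, extended by 0 outside the ball as membership in [bergman]
    demands. *)
Definition syn (z : Cn) : C :=
  if pselect (B z) then xget 0 [set l | null (fun K => partial K z - l)] else 0.

Lemma syn_null z : B z -> null (fun K => partial K z - syn z).
Proof.
move=> Bz; have z1 := Bz; rewrite unit_ballE in z1.
have z0 : 0 <= sqr_enorm z by apply: sumr_ge0 => j _; rewrite sqr_ge0.
have [E hE] := abs_bound z0 z1.
have [l hl] : exists l, null (fun K => \sum_(k < K) b k * e k z - l).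
  apply: (@summable_null R (fun k => b k * e k z) E) => K.
  by under eq_bigr do rewrite normcM; apply: hE; exact: lexx.
have hp : [set l | null (fun K => partial K z - l)] l.
  by move: hl; congr null; apply/funext => K; rewrite partialE.
by rewrite /syn; case: pselect => // Bz'; exact: (xgetPex 0 (ex_intro _ l hp)).
Qed.

Lemma syn_out z : ~ B z -> syn z = 0.
Proof. by rewrite /syn; case: pselect. Qed.

Lemma ball_add (z : Cn) : B z -> exists2 t0 : R, 0 < t0 &
  B (\row_j (normc (z ord0 j) + t0)%:C).
Proof.
move=> Bz; have z1 := Bz; rewrite unit_ballE in z1.
(* Since |z_j| and t0 are at most 1, (|z_j| + t0)^2 <= |z_j|^2 + 3 t0; summing over j gives 3 n, and
   the extra 1 makes the inequality strict. *)
pose t0 := Num.min 1 ((1 - sqr_enorm z) / (n%:R * 3 + 1)).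
have n1 : 0 < n%:R * 3 + 1 :> R by rewrite ltr_wpDl// mulr_ge0.
have t00 : 0 < t0 by rewrite lt_min ltr01 divr_gt0// subr_gt0.
have t1 : t0 <= 1 by rewrite ge_min lexx.
exists t0 => //; rewrite unit_ballE.
apply: (@le_lt_trans _ _ (\sum_j (normc (z ord0 j) ^+ 2 + t0 * 3))).
  apply: ler_sum => j _; rewrite mxE normc_real ger0_norm ?addr_ge0 ?normc_ge0 ?(ltW t00)//.
  rewrite sqrrD -addrA lerD2l.
  have h1 : normc (z ord0 j) * t0 <= t0 by rewrite ler_piMl ?(ltW t00)// ball_coord.
  have h2 : t0 ^+ 2 <= t0 by rewrite expr2 ler_piMl// ltW.
  by rewrite mulr2n; lra.
rewrite big_split/= sumr_const card_ord -[X in X + _]/(sqr_enorm z) addrC -ltrBrDr.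
rewrite -[_ *+ _]mulr_natr; apply: (@lt_le_trans _ _ (t0 * (n%:R * 3 + 1))).
  by rewrite (_ : t0 * (n%:R * 3 + 1) = t0 * 3 * n%:R + t0); [rewrite ltrDl|ring].
by rewrite -ler_pdivlMr// ge_min lexx orbT.
Qed.

(** The jets of [monomial_jet] are summed termwise: their majorants are the moduli of the monomials
    at the point y of the ball with coordinates |z_j| + t0, where the series converges
    absolutely. *)
Lemma syn_analytic : analytic syn.
Proof.
move=> z Bz; have [t0 t00 By] := ball_add Bz; set y := \row_j _ in By.
have y1 := By; rewrite unit_ballE in y1.
have y0 : 0 <= sqr_enorm y by apply: sumr_ge0 => j _; rewrite sqr_ge0.
have [E hE] := abs_bound y0 y1; have {}hE K := hE y K (lexx _).
pose G k : R := \prod_j (normc (z ord0 j) + t0) ^+ mi k j.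
have GE k : normc (e k y) = G k.
  rewrite /e /monomial normc_prod; apply: eq_bigr => j _.
  by rewrite normcX mxE normc_real ger0_norm// addr_ge0 ?normc_ge0// ltW.
have E0 : 0 <= E by have := hE 0; rewrite big_ord0.
have hG K : \sum_(k < K) normc (b k) * G k <= E by apply: le_trans (hE K); apply: ler_sum => k _; rewrite GE.
have /choice[d hd] : forall k, exists d : 'I_n -> C, (forall j, normc (d j) <= G k / t0) /\
    forall (v : Cn) t, (forall j, normc (v ord0 j) <= t) -> 0 <= t -> t <= t0 ->
    normc (e k (z + v) - e k z - \sum_j d j * v ord0 j) <= G k * (t / t0) ^+ 2.
  by move=> k; have [d h1 h2] := monomial_jet z (mi k) t00; exists d.
have /choice[D hD] : forall j, exists l, null (fun K => \sum_(k < K) b k * d k j - l).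
  move=> j; apply: (@summable_null R (fun k => b k * d k j) (E / t0)) => K.
  apply: (@le_trans _ _ (\sum_(k < K) normc (b k) * G k / t0)).
    by apply: ler_sum => k _; rewrite normcM -mulrA ler_wpM2l ?normc_ge0//; case: (hd k).
  by rewrite -mulr_suml ler_wpM2r ?invr_ge0 ?(ltW t00).
apply: (@jet_differentiable R n syn z D (E / t0 ^+ 2) t0) => //.
  by rewrite divr_ge0// exprn_ge0// ltW.
move=> v t vt tp tt.
have Bv : B (z + v).
  rewrite unit_ballE; apply: le_lt_trans y1; apply: ler_sum => j _; rewrite !mxE.
  rewrite normc_real ger0_norm ?addr_ge0 ?normc_ge0 ?(ltW t00)//.
  rewrite lerXn2r ?nnegrE ?normc_ge0 ?addr_ge0 ?normc_ge0 ?(ltW t00)//.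
  by rewrite (le_trans (normcD _ _))// lerD2l (le_trans (vt j)).
apply: (@null_le R (fun K => partial K (z + v) - partial K z - \sum_j (\sum_(k < K) b k * d k j) * v ord0 j)).
  have h1 := nullB (nullB (syn_null Bv) (syn_null Bz)) (null_sum (index_enum 'I_n) (fun j => nullZ (v ord0 j) (hD j))).
  move: h1; congr null; apply/funext => K.
  have -> : \sum_j v ord0 j * (\sum_(k < K) b k * d k j - D j) =
     \sum_j (\sum_(k < K) b k * d k j) * v ord0 j - \sum_j D j * v ord0 j.
    by rewrite -sumrB; apply: eq_bigr => j _; ring.
  move: (partial K (z + v)) (partial K z) (syn (z + v)) (syn z) (\sum_j _) (\sum_j _) => x1 x2 x3 x4 x5 x6.
  by ring.
move=> K.
have -> : partial K (z + v) - partial K z - \sum_j (\sum_(k < K) b k * d k j) * v ord0 j =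
    \sum_(k < K) b k * (e k (z + v) - e k z - \sum_j d k j * v ord0 j).
  have -> : \sum_j (\sum_(k < K) b k * d k j) * v ord0 j = \sum_(k < K) b k * \sum_j d k j * v ord0 j.
    under eq_bigr do rewrite mulr_suml; rewrite exchange_big/=; apply: eq_bigr => k _.
    by rewrite mulr_sumr; apply: eq_bigr => j _; rewrite mulrA.
  by rewrite !partialE -!sumrB; apply: eq_bigr => k _; rewrite !mulrBr.
apply: le_trans (normc_sum _ _ _) _.
apply: (@le_trans _ _ (\sum_(k < K) normc (b k) * G k * (t / t0) ^+ 2)).
  apply: ler_sum => k _; rewrite normcM -mulrA ler_wpM2l ?normc_ge0//.
  by have [_] := hd k; apply.
rewrite -mulr_suml (_ : E / t0 ^+ 2 * t ^+ 2 = E * (t / t0) ^+ 2); last by field; rewrite gt_eqF.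
by rewrite ler_wpM2r// sqr_ge0.
Qed.

Lemma syn_L2 : L2 syn.
Proof.
have [] := @fatou_norm2 partial syn c0 => //.
- by move=> K; exact: L2_psum.
- by move=> z; exact: syn_null.
- by move=> K; rewrite norm2_psum ?iota_uniq// iotaE.
Qed.

Lemma psumB K K' : (K <= K')%N -> partial K' - partial K = psum b (index_iota K K').
Proof.
move=> KK; rewrite /partial /psum -{1}(subnKC KK) iotaD big_cat/= addrAC subrr add0r.
by rewrite add0n.
Qed.

(** The remainder after K terms is a pointwise limit of finite blocks of the series, so
    [fatou_norm2] bounds its norm by the tail of the coefficient sum. *)
Lemma syn_norm_cvg eps : 0 < eps -> exists K0, forall K, (K0 <= K)%N ->
  norm2 (syn - partial K) <= eps.
Proof.
move=> e0; have u0 k : 0 <= normc (b k) ^+ 2 * w k by rewrite mulr_ge0 ?sqr_ge0// ltW// w_gt0.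
have [K0 hK0] := bounded_series_tail u0 bnd (exprn_gt0 2 e0).
exists K0 => K KK.
rewrite -(@ler_pXn2r _ 2)// ?nnegrE ?norm2_ge0 ?(ltW e0)//.
have [] := @fatou_norm2 (fun k => partial (K + k) - partial K) (syn - partial K) (eps ^+ 2) => //.
- by move=> k; apply: L2B; exact: L2_psum.
- move=> z Bz d /(syn_null Bz)[k0 hk]; exists k0 => k kk.
  have := hk (K + k)%N (leq_trans kk (leq_addl _ _)); congr (normc _ <= _).
  rewrite -[(partial (K + k) - partial K) z]/(partial (K + k) z - partial K z).
  by rewrite -[(syn - partial K) z]/(syn z - partial K z); ring.
- move=> k; rewrite psumB ?leq_addr// norm2_psum ?iota_uniq//.
  apply: le_trans (hK0 (K + k)%N).
  rewrite [leRHS](@big_cat_nat _ _ _ K)//= ?leq_addr// lerDr; exact: sumr_ge0.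
Qed.

Lemma inner_syn k : inner syn (e k) = b k * (w k)%:C.
Proof.
apply: normc_le0_eq => d d0.
have n0 : 0 < norm2 (e k) + 1 by rewrite ltr_wpDl ?norm2_ge0.
have [K0 hK0] := syn_norm_cvg (divr_gt0 d0 n0).
pose K := maxn K0 k.+1; have {}hK0 := hK0 K (leq_maxl _ _).
have -> : b k * (w k)%:C = inner (partial K) (e k).
  by rewrite inner_psum ?iota_uniq// mem_iota/= add0n leq_max ltnSn orbT.
rewrite -innerBl; [|exact: syn_L2|exact: L2_psum|exact: L2_basis].
apply: le_trans (cauchy_schwarz (L2B syn_L2 (L2_psum _ _)) (L2_basis k)) _.
apply: le_trans (ler_wpM2r (norm2_ge0 _ _) hK0) _.
by rewrite mulrAC ler_pdivrMr// ler_wpM2l ?(ltW d0)// lerDl.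
Qed.

Lemma syn_bergman : syn \in @bergman R n alpha.
Proof. by rewrite inE; split; [exact: syn_L2|exact: syn_analytic|exact: syn_out]. Qed.

End synthesis.

Hypothesis mi_surj : forall m, exists k, mi k = m.

Local Notation A2 := (bergman_space n alpha).

Lemma bergmanP (phi : A2) : [/\ L2 phi, analytic phi & forall z, ~ B z -> phi z = 0].
Proof. by have := bergman_valP phi; rewrite inE. Qed.

Lemma bergman_eqP (phi psi : A2) : (forall z, B z -> phi z = psi z) -> phi = psi.
Proof.
move=> h; apply: val_inj; apply/funext => z.
have [Bz|nBz] := pselect (B z); first exact: h.
by have [_ _ h1] := bergmanP phi; have [_ _ h2] := bergmanP psi; rewrite /= h1// h2.
Qed.

(** All coefficients vanish, and by [fejer_coef] they determine the values of phi. *)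
Lemma bergman_total (phi : A2) : (forall k, inner phi (e k) = 0) -> phi = 0.
Proof.
move=> h; apply: bergman_eqP => z Bz; have [h2 ha _] := bergmanP phi.
apply: normc_le0_eq => d d0.
have [N0 /(_ N0 (leqnn _))] := fejer_coef alpha_gt ha h2 Bz d0.
rewrite big1 ?mulr0// => k _; case: ifP => // _.
have c0 (m : 'I_n -> nat) : coef phi m = 0.
  have [l hl] := mi_surj [ffun j => m j].
  have -> : m = mi l by rewrite hl; apply/funext => j; rewrite ffunE.
  by rewrite coefE [inner _ _]h mul0r.
by rewrite c0 mul0r.
Qed.

Section expansion.
Variable phi : A2.

Let b k := coef phi (mi k).

Lemma coef_bound K : \sum_(k < K) normc (b k) ^+ 2 * w k <= norm2 phi ^+ 2.
Proof.
have [h2 _ _] := bergmanP phi.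
have := bessel h2 (iota_uniq 0 K); rewrite -[\sum_(k < K) _](big_mkord xpredT (fun k => normc (b k) ^+ 2 * w k)).
by rewrite /index_iota subn0.
Qed.

(** The difference of the two sides is a Bergman function orthogonal to all monomials. *)
Lemma bergman_syn z : phi z = syn b z.
Proof.
have hs := syn_bergman coef_bound.
pose psi : A2 := BergmanSpace hs.
suff -> : phi = psi by [].
apply/eqP; rewrite -subr_eq0; apply/eqP/bergman_total => k.
have [h2 _ _] := bergmanP phi.
rewrite -[inner _ _]/(inner ((phi : Cn -> C) - syn b) (e k)) innerBl//.
- by rewrite (inner_syn coef_bound) inner_coef subrr.
- exact: syn_L2 coef_bound.
- exact: L2_basis.
Qed.

Lemma bergman_expand eps : 0 < eps -> exists K0, forall K, (K0 <= K)%N ->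
  norm2 ((phi : Cn -> C) - psum b (iota 0 K)) <= eps.
Proof.
move=> /(syn_norm_cvg coef_bound)[K0 h]; exists K0 => K /h.
by congr (_ <= _); apply: norm2_eq => z _; rewrite -[RHS]/(phi z - _) bergman_syn.
Qed.

End expansion.

Lemma point_evaluation (r : R) : 0 <= r -> r < 1 -> exists2 E, 0 < E &
  forall (phi : A2) z, cball r z -> normc (phi z) <= E * norm2 phi.
Proof.
move=> r0 r1; have [E E0 hE] := psum_bound r0 r1; exists E => // phi z zr.
have Bz : B z by exact: cball_ball zr.
rewrite bergman_syn; apply: null_le (syn_null (coef_bound phi) Bz) _ => K.
apply: le_trans (hE _ _ _ zr (iota_uniq 0 K)) _; rewrite ler_wpM2l ?(ltW E0)//.
rewrite -(@ler_pXn2r _ 2)// ?nnegrE ?norm2_ge0// norm2_psum ?iota_uniq//.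
by have [h2 _ _] := bergmanP phi; apply: bessel => //; exact: iota_uniq.
Qed.

Lemma norm2_eq0 (phi : A2) : norm2 phi = 0 -> phi = 0.
Proof.
move=> p0; apply: bergman_eqP => z Bz; have z1 := Bz; rewrite unit_ballE in z1.
have z0 : 0 <= sqr_enorm z by apply: sumr_ge0 => j _; rewrite sqr_ge0.
have [E E0 hE] := point_evaluation z0 z1.
apply/normc_eq0/le_anti; rewrite normc_ge0 andbT.
by have := hE phi z (lexx _); rewrite p0 mulr0.
Qed.

(** By Bessel the coefficients of f define a Bergman function through [syn]. The difference is
    orthogonal to partial sums, hence to every Bergman function by norm approximation. *)
Lemma bergman_projP (f : Cn -> C) : L2 f ->
  forall k : A2, inner (f - (bergman_proj alpha f : A2)) k = 0.
Proof.
move=> hf; suff [h hh] : exists h : A2, forall k : A2, inner (f - h) k = 0.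
  exact: (@xgetPex A2 0 [set h : A2 | forall k : A2, inner (f - h) k = 0] (ex_intro _ h hh)).
pose b k := coef f (mi k).
have bb K : \sum_(k < K) normc (b k) ^+ 2 * w k <= norm2 f ^+ 2.
  have := bessel hf (iota_uniq 0 K); rewrite -[\sum_(k < K) _](big_mkord xpredT (fun k => normc (b k) ^+ 2 * w k)).
  by rewrite /index_iota subn0.
exists (BergmanSpace (syn_bergman bb)) => k.
have hs := syn_L2 bb; have hd : L2 (f - syn b) by exact: L2B.
have [hk _ _] := bergmanP k.
have h0 (c : nat -> C) s : inner (f - syn b) (psum c s) = 0.
  rewrite inner_psum_r// big1// => l _; rewrite innerBl//; last exact: L2_basis.
  by rewrite (inner_syn bb) inner_coef subrr mulr0.
apply: normc_le0_eq => d d0; rewrite subr0.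
have n0 : 0 < norm2 (f - syn b) + 1 by rewrite ltr_wpDl ?norm2_ge0.
have [K0 /(_ K0 (leqnn _)) hK] := bergman_expand k (divr_gt0 d0 n0).
set p := psum _ _ in hK.
have hp : L2 p by exact: L2_psum.
rewrite -[inner _ _]/(inner (f - syn b) k) -[inner _ k]subr0 -(h0 (fun l => coef k (mi l)) (iota 0 K0)) -/p.
rewrite -innerBr//.
apply: le_trans (cauchy_schwarz hd (L2B hk hp)) _.
apply: le_trans (ler_wpM2l (norm2_ge0 _ _) hK) _.
by rewrite mulrCA ler_piMr ?(ltW d0)// ler_pdivrMr// mul1r lerDl.
Qed.

End orthogonal.

(** * Toeplitz operators *)

Section toeplitz.
Variables (R : realType) (n : nat) (alpha : R).
Hypothesis alpha_gt : -1 < alpha.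
Local Notation C := R[i].
Local Notation Cn := 'rV[C]_n.
Local Notation B := (@unit_ball R n).
Local Notation mu := (@nu_alpha R n alpha).
Local Notation L2 := (@L2 R n alpha).
Local Notation Linf := (@Linf R n).
Local Notation inner := (@inner R n alpha).
Local Notation norm2 := (@norm2 R n alpha).
Local Notation om m := (@moment_cst R n alpha m).
Local Notation MI := {ffun 'I_n -> nat}.
Local Notation A2 := (bergman_space n alpha).
Let mB : measurable B := @measurable_unit_ball R n.
Variable mi : nat -> MI.
Hypotheses (mi_inj : injective mi) (mi_surj : forall m, exists k, mi k = m).

Lemma A2_L2 (phi : A2) : L2 phi. Proof. by have [] := bergmanP phi. Qed.
Hint Resolve A2_L2 : core.

Lemma L2_Linf_mul g : Linf g -> exists2 M, 0 <= M &
  forall f, L2 f -> L2 (g * f) /\ norm2 (g * f) <= M * norm2 f.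
Proof.
move=> [mg [M [N [mN N0 hN]]]].
(* Essential bounds refer to [nu], integrals to the weighted measure; its null sets include those of
   [nu]. *)
have muN : mu N = 0%E by exact: nu_alpha_null.
exists (Num.max M 0); first by rewrite le_max lexx orbT.
move=> f hf; have mgf : cmeasurable (g * f) by exact: cmeasurableM mg hf.1.
set K := Num.max M 0.
have K0 : 0 <= K by rewrite /K le_max lexx orbT.
have le : (\int[mu]_(z in B) (normc ((g * f) z) ^+ 2)%:E <=
    \int[mu]_(z in B) ((K ^+ 2)%:E * (normc (f z) ^+ 2)%:E))%E.
  apply: ae_ge0_le_integral => //.
  - by move=> z _; rewrite lee_fin sqr_ge0.
  - by apply/measurable_EFinP; exact: measurable_sqr_normc.
  - by move=> z _; rewrite -EFinM lee_fin mulr_ge0 ?sqr_ge0.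
  - by apply: measurable_funeM; apply/measurable_EFinP; exact: measurable_sqr_normc hf.1.
  - exists N; split => // z /= h; apply: hN => /= gM; apply: h => Bz.
    rewrite -EFinM lee_fin -[(g * f) z]/(g z * f z) normcM exprMn ler_wpM2r ?sqr_ge0//.
    by rewrite ler_pXn2r ?nnegrE ?normc_ge0// le_max gM.
have fin : (\int[mu]_(z in B) (normc (f z) ^+ 2)%:E = (norm2 f ^+ 2)%:E)%E.
  rewrite sqr_norm2 /Rintegral fineK//; apply: integrable_fin_num => //; exact: L2_sq_integrable.
have KE : (\int[mu]_(z in B) ((K ^+ 2)%:E * (normc (f z) ^+ 2)%:E) =
    (K ^+ 2)%:E * \int[mu]_(z in B) (normc (f z) ^+ 2)%:E)%E.
  apply: ge0_integralZl => //.
  - by apply/measurable_EFinP; exact: measurable_sqr_normc hf.1.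
  - by move=> z _; rewrite lee_fin sqr_ge0.
  - by rewrite lee_fin sqr_ge0.
rewrite KE fin -EFinM in le.
have h2 : L2 (g * f) by split => //; apply: le_lt_trans le _; rewrite ltry.
split=> //; rewrite -(@ler_pXn2r _ 2)// ?nnegrE ?mulr_ge0 ?norm2_ge0// exprMn.
rewrite [X in X <= _]sqr_norm2 -lee_fin /Rintegral fineK//.
by apply: integrable_fin_num => //; exact: L2_sq_integrable.
Qed.

Lemma L2_LinfM g f : Linf g -> L2 f -> L2 (g * f).
Proof. by move=> /L2_Linf_mul[M _ h] /h[]. Qed.

Local Notation P := (@bergman_proj R n alpha).

Lemma inner_proj f (k : A2) : L2 f -> inner (P f) k = inner f k.
Proof.
move=> hf; have := bergman_projP alpha_gt mi_inj mi_surj hf k.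
by rewrite (innerBl hf (A2_L2 (P f)) (A2_L2 k)) => /eqP; rewrite subr_eq0 => /eqP.
Qed.

Lemma A2_eq (phi psi : A2) : (forall k : A2, inner phi k = inner psi k) -> phi = psi.
Proof.
move=> h; apply/eqP; rewrite -subr_eq0; apply/eqP/(norm2_eq0 alpha_gt mi_inj mi_surj).
apply/eqP; rewrite -sqrf_eq0; apply/eqP/(@complexI R); rewrite -inner_ff.
transitivity (inner ((phi : Cn -> C) - psi) (phi - psi : A2)); first by [].
by rewrite (innerBl (A2_L2 phi) (A2_L2 psi) (A2_L2 (phi - psi))) h subrr.
Qed.

Lemma proj_uniq f (h : A2) : L2 f -> (forall k : A2, inner h k = inner f k) -> P f = h.
Proof. by move=> hf hh; apply: A2_eq => k; rewrite inner_proj. Qed.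

Lemma proj_id (phi : A2) f : (forall z, B z -> f z = phi z) -> P f = phi.
Proof.
move=> fphi; have E g (k : A2) : (forall z, B z -> f z = g z) -> inner f k = inner g k.
  by move=> fg; apply: (@eq_cI R n alpha) => z Bz; rewrite fg.
have hf : L2 f.
  have [[m1 m2] foo] := A2_L2 phi; split.
    split; [move: m1|move: m2]; apply: eq_measurable_fun => z /[!inE] Bz; by rewrite fphi.
  apply: le_lt_trans foo; rewrite le_eqVlt; apply/orP; left; apply/eqP/eq_integral => z /[!inE] Bz.
  by rewrite fphi.
by apply: proj_uniq => // k; rewrite (E phi).
Qed.

Lemma projD f g : L2 f -> L2 g -> P (f + g) = P f + P g.
Proof.
move=> hf hg; apply: proj_uniq => [|k]; first exact: L2D.
by rewrite -[inner _ _]/(inner ((P f : Cn -> C) + P g) k) !innerDl// !inner_proj.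
Qed.

Lemma projZ a f : L2 f -> P (a *: f) = a *: P f.
Proof.
move=> hf; apply: proj_uniq => [|k]; first exact: L2Z.
by rewrite -[inner _ _]/(inner (a *: (P f : Cn -> C)) k) !innerZl// inner_proj.
Qed.

Lemma norm2_proj f : L2 f -> norm2 (P f) <= norm2 f.
Proof.
move=> hf; have [p0|p0] := eqVneq (norm2 (P f)) 0; first by rewrite p0 norm2_ge0.
have pp : 0 < norm2 (P f) by rewrite lt_neqAle eq_sym p0 norm2_ge0.
rewrite -(ler_pM2r pp); apply: le_trans (cauchy_schwarz hf (A2_L2 (P f))).
by rewrite -inner_proj// inner_ff normc_real ger0_norm ?sqr_ge0// expr2.
Qed.

Lemma toeplitz_linear g : Linf g -> linear (@toeplitz R n alpha g).
Proof.
move=> hg a phi psi; rewrite /toeplitz.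
have -> : g * ((a *: phi + psi : A2) : Cn -> C) = a *: (g * (phi : Cn -> C)) + g * (psi : Cn -> C).
  apply/funext => z; rewrite -[LHS]/(g z * (a * phi z + psi z)).
  by rewrite -[RHS]/(a * (g z * phi z) + g z * psi z); ring.
by rewrite projD ?projZ//; [exact: L2_LinfM|apply: L2Z; exact: L2_LinfM|exact: L2_LinfM].
Qed.

Lemma toeplitz_bounded g : Linf g -> bounded_operator (@toeplitz R n alpha g).
Proof.
move=> hg; split; first exact: toeplitz_linear.
have [M M0 h] := L2_Linf_mul hg; exists M => phi.
by have [h1 h2] := h _ (A2_L2 phi); exact: le_trans (norm2_proj h1) h2.
Qed.

Lemma Linf_conj g : Linf g -> Linf (fun z => conjc (g z)).
Proof.
move=> [mg [M [N [mN N0 hN]]]]; split; first exact: cmeasurableJ.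
exists M, N; split => // z /= h; apply: hN => /= gM; apply: h => Bz.
by rewrite normcJ gM.
Qed.

Lemma inner_mul_conj g f k : Linf g -> L2 f -> L2 k ->
  inner (g * f) k = inner f ((fun z => conjc (g z)) * k).
Proof.
move=> hg hf hk; apply: (@eq_cI R n alpha) => z _.
rewrite -[(g * f) z]/(g z * f z) -[((fun z0 => conjc (g z0)) * k) z]/(conjc (g z) * k z).
by rewrite conjcM conjcK; ring.
Qed.

Lemma toeplitz_adjoint g : Linf g ->
  is_adjoint (@toeplitz R n alpha g) (@toeplitz R n alpha (fun z => conjc (g z))).
Proof.
move=> hg phi psi; have hg' := Linf_conj hg.
rewrite /toeplitz inner_proj; last exact: L2_LinfM.
rewrite inner_mul_conj//.
have hx : L2 ((fun z => conjc (g z)) * (psi : Cn -> C)) by exact: L2_LinfM.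
by rewrite (innerJ hx (A2_L2 phi)) [RHS](innerJ (A2_L2 (P _)) (A2_L2 phi)) inner_proj.
Qed.

Lemma Linf_bounded g (c : R) : cmeasurable g -> (forall z, B z -> normc (g z) <= c) -> Linf g.
Proof. by move=> mg gc; split => //; exists c; apply: aeW => z; exact: gc. Qed.

Definition coordf (j : 'I_n) (z : Cn) : C := z ord0 j.

Lemma Linf_coord j : Linf (coordf j).
Proof.
by apply: (@Linf_bounded _ 1); [exact: cmeasurable_coord|move=> z Bz; exact: ball_coord].
Qed.

Lemma Linf_monomial m : Linf (monomial m).
Proof. by apply: (@Linf_bounded _ 1); [exact: cmeasurable_monomial|exact: monomial_le1]. Qed.

Lemma bergman_mul (f : Cn -> C) (c : R) (phi : A2) : cmeasurable f -> analytic f ->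
  (forall z, B z -> normc (f z) <= c) -> f * (phi : Cn -> C) \in @bergman R n alpha.
Proof.
move=> mf af fc; rewrite inE; have [h2 ha h0] := bergmanP phi; split.
- by apply: (L2_bddM (c := c)).
- move=> z Bz; have := differentiableM (af z Bz) (ha z Bz).
  exact.
- by move=> z Bz; rewrite -[LHS]/(f z * phi z) h0// mulr0.
Qed.

(** A power series with one term: [syn_bergman] then provides all membership conditions at once. *)
Lemma monomial_mem m : exists phi : A2, forall z, B z -> phi z = monomial m z.
Proof.
have [k hk] := mi_surj [ffun j => m j].
pose b l : C := (l == k)%:R.
have bb K : \sum_(l < K) normc (b l) ^+ 2 * om (mi l) <= om (mi k).
  have w0 : 0 <= om (mi k) by rewrite ltW// w_gt0.
  have [kK|Kk] := ltnP k K.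
    rewrite (bigD1 (Ordinal kK))//= big1 => [|l lk].
      by rewrite /b eqxx ComplexField.Normc.normc1 expr1n mul1r addr0.
    have {}lk : (val l == k) = false by apply: negbTE; apply: contra lk => /eqP lk; apply/eqP/val_inj.
    by rewrite /b lk ComplexField.Normc.normc0 expr0n mul0r.
  rewrite big1// => l _; rewrite /b (ltn_eqF (leq_trans (ltn_ord l) Kk)).
  by rewrite ComplexField.Normc.normc0 expr0n mul0r.
exists (BergmanSpace (syn_bergman alpha_gt mi_inj bb)) => z Bz.
have h1 := syn_null alpha_gt mi_inj bb Bz.
apply: (null_uniq h1) => e e0; exists k.+1 => K kK.
rewrite psumE (bigD1_seq k) ?iota_uniq ?mem_iota//= big1 => [|l lk].
  have -> : monomial (mi k) z = monomial m z.
    by rewrite hk; apply: eq_bigr => j _; rewrite ffunE.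
  by rewrite /b eqxx mul1r addr0 subrr ComplexField.Normc.normc0 ltW.
by rewrite /b (negbTE lk) mul0r.
Qed.

(** The projection only replaces the values outside the ball by 0. *)
Definition mono m : A2 := P (monomial m).

Lemma monoE m z : B z -> mono m z = monomial m z.
Proof.
move=> Bz; have [phi h] := monomial_mem m.
by rewrite /mono (@proj_id phi)// ?h// => y By; rewrite h.
Qed.

Lemma inner_mono f m : inner f (mono m) = inner f (monomial m).
Proof. by apply: (@eq_cI R n alpha) => z Bz; rewrite monoE. Qed.

Lemma mono_inner f m : inner (mono m) f = inner (monomial m) f.
Proof. by apply: (@eq_cI R n alpha) => z Bz; rewrite monoE. Qed.

Lemma toeplitz_mul (f phi : A2) (c : R) : (forall z, B z -> normc (f z) <= c) ->
  toeplitz f phi = (f : Cn -> C) * (phi : Cn -> C) :> (Cn -> C).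
Proof.
move=> fc; have [[mf _] af _] := bergmanP f.
by rewrite /toeplitz (@proj_id (BergmanSpace (bergman_mul phi mf af fc))).
Qed.

Lemma toeplitz_monomial m (phi : A2) z : toeplitz (monomial m) phi z = monomial m z * phi z.
Proof.
have c1 y : B y -> normc (mono m y) <= 1 by move=> By; rewrite monoE// monomial_le1.
have E : (mono m : Cn -> C) * (phi : Cn -> C) = monomial m * (phi : Cn -> C).
  apply/funext => y; have [By|nBy] := pselect (B y).
    by rewrite -[LHS]/(mono m y * phi y) monoE.
  have [_ _ h0] := bergmanP phi.
  by rewrite -[LHS]/(mono m y * phi y) -[RHS]/(monomial m y * phi y) h0// !mulr0.
by rewrite -[RHS]/((monomial m * (phi : Cn -> C)) z) -E -(toeplitz_mul phi c1) /toeplitz E.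
Qed.

Definition unit_index (j : 'I_n) (i : 'I_n) : nat := i == j.

Lemma monomial_unit j (z : Cn) : monomial (unit_index j) z = z ord0 j.
Proof.
rewrite /monomial (bigD1 j)//= big1 => [|i ij]; first by rewrite /unit_index eqxx expr1 mulr1.
by rewrite /unit_index (negbTE ij) expr0.
Qed.

Lemma toeplitz_coord j (phi : A2) z : toeplitz (coordf j) phi z = z ord0 j * phi z.
Proof.
rewrite -(monomial_unit j) -toeplitz_monomial; congr (toeplitz _ phi z).
by apply/funext => y; rewrite monomial_unit.
Qed.

End toeplitz.

(** * Ratios of consecutive moments *)

Section moment_ratio.
Variables (R : realType) (n : nat) (alpha : R).
Hypothesis alpha_gt : -1 < alpha.
Local Notation om m := (@moment_cst R n alpha m).
Local Notation deg m := (\sum_i m i)%N.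

Lemma moment_cst_ext (m m' : 'I_n -> nat) : m =1 m' -> om m = om m'.
Proof. by move=> /funext ->. Qed.

Lemma sum_unit (m : 'I_n -> nat) j : (\sum_i (m i + unit_index j i) = (\sum_i m i).+1)%N.
Proof.
rewrite big_split/= -addn1; congr addn; rewrite (bigD1 j)//= big1 => [|i ij].
  by rewrite /unit_index eqxx addn0.
by rewrite /unit_index (negbTE ij).
Qed.

Lemma deg_gt0 (m : 'I_n -> nat) : 0 < n%:R + (deg m)%:R + alpha + 1 :> R.
Proof.
have h : 0 <= n%:R + (deg m)%:R :> R by rewrite addr_ge0.
by move: (_ + _) h => x x0; move: alpha_gt; lra.
Qed.

Lemma moment_cst_unit (m : 'I_n -> nat) j :
  om (fun i => m i + unit_index j i)%N * (n%:R + (deg m)%:R + alpha + 1) =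
  om m * (m j).+1%:R.
Proof.
have d0 := deg_gt0 m; rewrite /moment_cst /dirichlet_cst sum_unit addnS big_ord_recr/=.
have -> : (\prod_i (m i + unit_index j i)`! = (\prod_i (m i)`!) * (m j).+1)%N.
  rewrite (bigD1 j)//= [in RHS](bigD1 j)//= {1}/unit_index eqxx addn1 factS.
  rewrite (eq_bigr (fun i => (m i)`!)); last first.
    by move=> i ij; rewrite /unit_index (negbTE ij) addn0.
  by rewrite [RHS]mulnC mulnA.
have -> : alpha + (n + \sum_i m i).+1%:R = n%:R + (deg m)%:R + alpha + 1 :> R.
  by rewrite -natr1 natrD; ring.
have : \prod_(i < n + \sum_i m i) (alpha + i.+1%:R) != 0 :> R.
  rewrite gt_eqF// prodr_gt0// => i _; rewrite -natr1 addrCA ltr_wpDl//.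
  by move: alpha_gt; lra.
rewrite natrM; move: (\prod_(i < _) _) (n%:R + _ + _ + 1) d0 (disc_cst R ^+ n) => x d d0 y x0.
by field; rewrite x0 gt_eqF.
Qed.

Lemma moment_cst_unitE (m : 'I_n -> nat) j : om (fun i => m i + unit_index j i)%N =
  om m * (m j).+1%:R / (n%:R + (deg m)%:R + alpha + 1).
Proof. by rewrite -moment_cst_unit mulfK// gt_eqF// deg_gt0. Qed.

(* The difference of the two consecutive ratios (m_j + 1) / (N + 1) and m_j / N, where
   N = n + |m| + alpha. *)
Lemma moment_defect (m : 'I_n -> nat) j :
  om (fun i => m i + unit_index j i)%N -
  (if (0 < m j)%N then om m ^+ 2 / om (fun i => m i - unit_index j i)%N else 0) <=
  om m / (n%:R + (deg m)%:R + alpha + 1).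
Proof.
have w0 := moment_cst_gt0 alpha_gt m; have d0 := deg_gt0 m.
rewrite moment_cst_unitE; case: ifP => [mj|/negbT]; last first.
  by rewrite -eqn0Ngt => /eqP ->; rewrite mulr1 subr0.
pose m' i := (m i - unit_index j i)%N.
have E i : (m' i + unit_index j i = m i)%N.
  by rewrite /m' /unit_index; case: eqP => [->|_]; rewrite ?subnK// subn0 addn0.
have w'0 := moment_cst_gt0 alpha_gt m'; have d'0 := deg_gt0 m'.
have Ew := moment_cst_unit m' j; rewrite (moment_cst_ext E) in Ew.
have Ed : deg m = (deg m').+1 by rewrite -(sum_unit m' j); apply: eq_bigr => i _; rewrite E.
have Ej : m j = (m' j).+1 by rewrite /m' /unit_index eqxx subn1 prednK.
have Ed' : n%:R + (deg m)%:R + alpha + 1 = (n%:R + (deg m')%:R + alpha + 1) + 1 :> R.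
  by rewrite Ed -natr1; ring.
rewrite -/m' Ed' -!natr1 Ej -!natr1 in Ew *; move: w0 w'0 d'0 Ew.
have a0 : 0 <= (m' j)%:R :> R by [].
move: a0; move: (om m) (om m') ((m' j)%:R) (n%:R + _ + _ + 1) => w w' a N a0 w0 w'0 N0 Ew.
have N1 : 0 < N + 1 by rewrite addr_gt0.
have -> : w ^+ 2 / w' = w * (a + 1) / N.
  have -> : w' = w * N / (a + 1) by rewrite Ew mulfK// gt_eqF// ltr_wpDl.
  by field; rewrite !gt_eqF// ltr_wpDl.
have h : w * (a + 1) / (N + 1) <= w * (a + 1) / N.
  rewrite ler_wpM2l//; first by rewrite mulr_ge0 ?addr_ge0// ltW.
  by rewrite lef_pV2 ?posrE// lerDl.
rewrite -subr_ge0; rewrite -subr_ge0 in h; apply: le_trans h _.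
by rewrite le_eqVlt; apply/orP; left; apply/eqP; field; rewrite !gt_eqF.
Qed.
End moment_ratio.

(** * Hankel operators with symbol conj z_j *)

Section hankel.
Variables (R : realType) (n : nat) (alpha : R).
Hypothesis alpha_gt : -1 < alpha.
Local Notation C := R[i].
Local Notation Cn := 'rV[C]_n.
Local Notation B := (@unit_ball R n).
Local Notation L2 := (@L2 R n alpha).
Local Notation inner := (@inner R n alpha).
Local Notation norm2 := (@norm2 R n alpha).
Local Notation om m := (@moment_cst R n alpha m).
Local Notation coef := (@coef R n alpha).
Local Notation MI := {ffun 'I_n -> nat}.
Local Notation A2 := (bergman_space n alpha).
Local Notation P := (@bergman_proj R n alpha).
Variable mi : nat -> MI.
Hypotheses (mi_inj : injective mi) (mi_surj : forall m, exists k, mi k = m).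
Let iproj := inner_proj alpha_gt mi_inj mi_surj.

Definition coord_conj (j : 'I_n) (z : Cn) : C := conjc (z ord0 j).

Lemma Linf_coord_conj j : Linf (coord_conj j).
Proof. exact: Linf_conj (Linf_coord R j). Qed.

Lemma coord_conj_le1 j z : B z -> normc (coord_conj j z) <= 1.
Proof. by move=> Bz; rewrite normcJ ball_coord. Qed.

Definition hankel j (f : Cn -> C) : Cn -> C := coord_conj j * f - (P (coord_conj j * f) : A2).

Lemma L2_coord_conj j f : L2 f -> L2 (coord_conj j * f).
Proof. by move=> hf; apply: L2_LinfM => //; exact: Linf_coord_conj. Qed.

Lemma L2_hankel j f : L2 f -> L2 (hankel j f).
Proof. by move=> hf; apply: L2B; [exact: L2_coord_conj|exact: A2_L2]. Qed.

Lemma hankelD j f g : L2 f -> L2 g -> hankel j (f + g) = hankel j f + hankel j g.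
Proof.
move=> hf hg; rewrite /hankel mulrDr (projD alpha_gt mi_inj mi_surj); try exact: L2_coord_conj.
by apply/funext => z; rewrite -[LHS]/(_ + _ - (_ + _)) -[RHS]/((_ - _) + (_ - _)); ring.
Qed.

Lemma pythagoras_proj f : L2 f -> norm2 f ^+ 2 = norm2 (P f) ^+ 2 + norm2 (f - (P f : A2)) ^+ 2.
Proof.
move=> hf; have hp := A2_L2 (P f); have hd := L2B hf hp.
have -> : norm2 f ^+ 2 = norm2 ((P f : Cn -> C) + (f - (P f : A2))) ^+ 2.
  by congr (norm2 _ ^+ 2); rewrite addrC subrK.
rewrite sqr_norm2D//.
have -> : inner (P f) (f - (P f : A2)) = 0.
  rewrite (innerJ hd hp) (innerBl hf hp hp) -[inner f (P f)]iproj// subrr; exact: conjc0.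
by rewrite -[complex.Re 0]/(0 : R) mul0rn addr0.
Qed.

Lemma norm2_coord_conj j f : norm2 (coord_conj j * f) = norm2 (@coordf R n j * f).
Proof.
rewrite /norm2; congr Num.sqrt; apply: eq_Rintegral => z _.
by rewrite -[(coord_conj j * f) z]/(_ * _) -[(coordf j * f) z]/(_ * _) !normcM normcJ.
Qed.

Lemma norm2_coord_conj_le j f : L2 f -> norm2 (coord_conj j * f) <= norm2 f.
Proof.
move=> hf; rewrite -(@ler_pXn2r _ 2)// ?nnegrE ?norm2_ge0// !sqr_norm2.
apply: le_Rintegral => //.
- exact: measurable_unit_ball.
- exact: L2_sq_integrable (L2_coord_conj j hf).
- exact: L2_sq_integrable hf.
- move=> z Bz; rewrite -[(coord_conj j * f) z]/(_ * _) normcM exprMn ler_piMl ?sqr_ge0//.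
  by rewrite exprn_ile1 ?normc_ge0// coord_conj_le1.
Qed.

Lemma norm2_hankel_le j f : L2 f -> norm2 (hankel j f) <= norm2 f.
Proof.
move=> hf; apply: le_trans (norm2_coord_conj_le j hf).
rewrite -(@ler_pXn2r _ 2)// ?nnegrE ?norm2_ge0// [leRHS]pythagoras_proj; last exact: L2_coord_conj.
by rewrite lerDr sqr_ge0.
Qed.

Let shift (m : MI) j : MI := [ffun i => m i + unit_index j i]%N.
Let unshift (m : MI) j : MI := [ffun i => m i - unit_index j i]%N.

Let shift_inj j : injective (shift^~ j).
Proof. by move=> m m' /ffunP h; apply/ffunP => i; have := h i; rewrite !ffunE => /addIn. Qed.

Let unshiftK (m : MI) j : (0 < m j)%N -> shift (unshift m j) j = m.
Proof.
move=> mj; apply/ffunP => i; rewrite !ffunE /unit_index.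
by case: eqP => [->|_]; rewrite ?subnK// subn0 addn0.
Qed.

Let monomial_shift m j (z : Cn) : monomial (shift m j) z = z ord0 j * monomial m z.
Proof.
rewrite -monomial_unit /monomial -big_split/=; apply: eq_bigr => i _.
by rewrite ffunE -exprD addnC.
Qed.

Let idx m := xget 0%N [set k | mi k = m].
Let idxK m : mi (idx m) = m.
Proof. by have [k hk] := mi_surj m; exact: (@xgetPex _ 0%N [set k | mi k = m] (ex_intro _ k hk)). Qed.

Lemma norm2_coord_psum j b s : uniq s ->
  norm2 (coord_conj j * psum mi b s) ^+ 2 =
  \sum_(k <- s) normc (b k) ^+ 2 * om (fun i => mi k i + unit_index j i)%N.
Proof.
move=> us; rewrite norm2_coord_conj.
(* [z_j f] is a partial sum for the shifted enumeration of the multi-indices. *)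
have inj' : injective (fun k => shift (mi k) j) by move=> k l /shift_inj /mi_inj.
have -> : @coordf R n j * psum mi b s = psum (fun k => shift (mi k) j) b s :> (Cn -> C).
  apply/funext => z; rewrite -[LHS]/(z ord0 j * psum mi b s z) !psumE mulr_sumr.
  by apply: eq_bigr => k _; rewrite monomial_shift mulrCA.
rewrite (norm2_psum alpha_gt inj')//; apply: eq_bigr => k _; congr (_ * _).
by apply: moment_cst_ext => i; rewrite ffunE.
Qed.

(** Bessel's inequality at the multi-indices m - e_j: the coefficient of P (conj z_j f) there is an
    inner product of f with z^m, so it involves a single term of f. *)
Lemma norm2_proj_psum j b s : uniq s ->
  \sum_(k <- s) normc (b k) ^+ 2 *
    (if (0 < mi k j)%N then om (mi k) ^+ 2 / om (fun i => mi k i - unit_index j i)%N else 0) <=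
  norm2 (P (coord_conj j * psum mi b s)) ^+ 2.
Proof.
move=> us; set f := psum mi b s; have hf : L2 f by exact: L2_psum.
pose s' := [seq k <- s | (0 < mi k j)%N].
have us' : uniq [seq idx (unshift (mi k) j) | k <- s'].
  rewrite map_inj_in_uniq ?filter_uniq// => k l; rewrite !mem_filter => /andP[k0 _] /andP[l0 _].
  by move=> /(congr1 mi); rewrite !idxK => /(congr1 (shift^~ j)); rewrite !unshiftK// => /mi_inj.
have := bessel alpha_gt mi_inj (A2_L2 (P (coord_conj j * f))) us'; apply: le_trans.
rewrite big_map big_filter [leRHS]big_mkcond [leRHS]big_seq [leLHS]big_seq.
apply: ler_sum => k ks; case: ifP => k0; last by rewrite mulr0.
rewrite idxK; set m' := unshift (mi k) j.
have E : inner (P (coord_conj j * f)) (monomial m') = b k * (om (mi k))%:C.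
  rewrite -(inner_mono alpha_gt mi_inj mi_surj) iproj; last exact: L2_coord_conj.
  rewrite (inner_mono alpha_gt mi_inj mi_surj).
  rewrite (inner_mul_conj (Linf_coord_conj j) hf (L2_monomial alpha_gt m')).
  have -> : (fun z => conjc (coord_conj j z)) * (monomial m' : Cn -> C) = monomial (mi k).
    apply/funext => z; rewrite -[LHS]/(conjc (conjc (z ord0 j)) * monomial m' z) conjcK.
    by rewrite -monomial_shift unshiftK.
  by rewrite (inner_psum alpha_gt mi_inj)// ks.
have w'0 := moment_cst_gt0 alpha_gt m'.
have Ew : om (fun i => mi k i - unit_index j i)%N = om m'.
  by apply: moment_cst_ext => i; rewrite ffunE.
rewrite coefE E Ew normcM normcM normcV !normc_real.
rewrite (gtr0_norm w'0) (gtr0_norm (moment_cst_gt0 alpha_gt (mi k))).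
move: (om m') w'0 (normc (b k)) (om (mi k)) => w' w'0 x w; rewrite !exprMn exprVn.
by rewrite le_eqVlt; apply/orP; left; apply/eqP; field; rewrite gt_eqF.
Qed.

(** Pythagoras expresses the left side through the norms of conj z_j f and of its projection;
    termwise the difference is bounded by [moment_defect]. *)
Lemma hankel_psum j b s : uniq s -> norm2 (hankel j (psum mi b s)) ^+ 2 <=
  \sum_(k <- s) normc (b k) ^+ 2 * om (mi k) / (n%:R + (\sum_i mi k i)%:R + alpha + 1).
Proof.
move=> us; have hf : L2 (coord_conj j * psum mi b s) by apply: L2_coord_conj; exact: L2_psum.
have := pythagoras_proj hf; rewrite -[_ - _]/(hankel j (psum mi b s)) norm2_coord_psum//.
have := norm2_proj_psum j b us => h1 h2.
apply: (@le_trans _ _ (\sum_(k <- s) normc (b k) ^+ 2 * om (fun i => mi k i + unit_index j i)%N -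
    norm2 (P (coord_conj j * psum mi b s)) ^+ 2)).
  by rewrite h2 addrAC subrr add0r.
apply: le_trans (lerB (lexx _) h1) _; rewrite -sumrB; apply: ler_sum => k _.
by rewrite -mulrBr -mulrA ler_wpM2l ?sqr_ge0// moment_defect.
Qed.

Lemma deg_cofinite (T : nat) : exists K0, forall k, (K0 <= k)%N -> (T <= \sum_i mi k i)%N.
Proof.
exists (\max_(f : {ffun 'I_n -> 'I_T}) (idx [ffun i => val (f i)]).+1)%N => k kK.
rewrite leqNgt; apply/negP => dk.
have lt i : (mi k i < T)%N by apply: leq_ltn_trans dk; rewrite (bigD1 i)//= leq_addr.
have E : mi k = [ffun i => val ([ffun i => Ordinal (lt i)] i)].
  by apply/ffunP => i; rewrite !ffunE.
pose F (f : {ffun 'I_n -> 'I_T}) := (idx [ffun i => val (f i)]).+1.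
have := leq_trans (leq_bigmax (F := F) [ffun i => Ordinal (lt i)]) kK.
rewrite /F.
rewrite -E -{2}(@mi_inj (idx (mi k)) k) ?ltnn//.
Qed.

(** The weights 1 / (n + |m| + alpha + 1) of [hankel_psum] are at most e for all but finitely many
    m: up to e, finitely many coefficients control the operator, which is compactness in
    quantitative form. *)
Lemma hankel_bound j (e : R) : 0 < e -> exists K0, forall phi : A2,
  norm2 (hankel j phi) ^+ 2 <=
  (alpha + 1)^-1 * (\sum_(k < K0) normc (coef phi (mi k)) ^+ 2 * om (mi k)) + e * norm2 phi ^+ 2.
Proof.
move=> e0; have [K0 hK0] := deg_cofinite (Num.truncn e^-1).+1.
have a1 : 0 < alpha + 1 by move: alpha_gt; lra.
have inv1 k : (n%:R + (\sum_i mi k i)%:R + alpha + 1)^-1 <= (alpha + 1)^-1 :> R.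
  by rewrite lef_pV2 ?posrE ?deg_gt0// -addrA lerDr addr_ge0.
have inve k : (K0 <= k)%N -> (n%:R + (\sum_i mi k i)%:R + alpha + 1)^-1 <= e.
  move=> /hK0; rewrite -(ler_nat R) => h; rewrite -[leRHS]invrK lef_pV2 ?posrE ?deg_gt0 ?invr_gt0//.
  have /andP[_ h2] := truncn_itv (ltW (eqbRL (invr_gt0 e) e0)).
  apply: le_trans (ltW h2) _; apply: le_trans h _.
  rewrite -[n%:R + _ + alpha + 1]addrA addrAC lerDr; have : 0 <= n%:R :> R by []. lra.
exists K0 => phi; have h2 := A2_L2 phi.
pose a k := normc (coef phi (mi k)) ^+ 2 * om (mi k).
have a0 k : 0 <= a k by rewrite mulr_ge0 ?sqr_ge0// ltW// moment_cst_gt0.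
set X := (X in _ <= X).
have X0 : 0 <= X.
  apply: addr_ge0; last by apply: mulr_ge0; [exact: ltW|exact: sqr_ge0].
  by apply: mulr_ge0; [rewrite invr_ge0 ltW|apply: sumr_ge0 => k _; exact: a0].
have hX K : (K0 <= K)%N -> norm2 (hankel j (psum mi (fun k => coef phi (mi k)) (iota 0 K))) <= Num.sqrt X.
  move=> KK; rewrite -(@ler_pXn2r _ 2)// ?nnegrE ?norm2_ge0 ?sqrtr_ge0// [leRHS]sqr_sqrtr//.
  apply: le_trans (hankel_psum _ _ (iota_uniq 0 K)) _.
  apply: (@le_trans _ _ (\sum_(k <- iota 0 K) ((alpha + 1)^-1 * (if (k < K0)%N then a k else 0) + e * a k))).
    apply: ler_sum => k _; rewrite -/(a k) mulrC.
    case: ltnP => kK; last by rewrite mulr0 add0r ler_wpM2r// inve.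
    by apply: (@le_trans _ _ ((alpha + 1)^-1 * a k)); [rewrite ler_wpM2r|rewrite lerDl mulr_ge0// ltW].
  rewrite big_split -!mulr_sumr; apply: lerD; last by rewrite ler_wpM2l ?(ltW e0)// bessel ?iota_uniq.
  rewrite ler_wpM2l ?invr_ge0 ?(ltW a1)// -big_mkcond (big_ord_widen _ a KK) -(big_mkord (fun k => k < K0)%N).
  by rewrite /index_iota subn0.
have hs : norm2 (hankel j phi) <= Num.sqrt X.
  apply/ler_addgt0Pr => d d0.
  have [K1 hK1] := bergman_expand alpha_gt mi_inj mi_surj phi d0.
  have := hK1 _ (leq_maxl K1 K0); have := hX _ (leq_maxr K1 K0).
  set p := psum _ _ _ => h3 h4; have hp : L2 p by exact: L2_psum.
  have hd := L2B h2 hp.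
  have -> : hankel j phi = hankel j p + hankel j ((phi : Cn -> C) - p).
    transitivity (hankel j (p + ((phi : Cn -> C) - p))); first by rewrite [p + _]addrC subrK.
    exact: hankelD.
  apply: le_trans (norm2D (L2_hankel j hp) (L2_hankel j hd)) _; apply: lerD => //.
  exact: le_trans (norm2_hankel_le j hd) h4.
by rewrite -[leRHS]sqr_sqrtr// ler_pXn2r// ?nnegrE ?norm2_ge0 ?sqrtr_ge0.
Qed.

End hankel.

(** * Commutation up to compact operators *)

Section essential_commutant.
Variables (R : realType) (n : nat) (alpha : R).
Hypothesis alpha_gt : -1 < alpha.
Local Notation C := R[i].
Local Notation Cn := 'rV[C]_n.
Local Notation L2 := (@L2 R n alpha).
Local Notation inner := (@inner R n alpha).
Local Notation norm2 := (@norm2 R n alpha).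
Local Notation om m := (@moment_cst R n alpha m).
Local Notation coef := (@coef R n alpha).
Local Notation MI := {ffun 'I_n -> nat}.
Local Notation A2 := (bergman_space n alpha).
Local Notation P := (@bergman_proj R n alpha).

Implicit Types S T U K : A2 -> A2.

Definition weak_null (u : nat -> A2) : Prop :=
  (exists c : R, forall k, norm2 (u k) <= c) /\ forall psi : A2, null (fun k => inner (u k) psi).

Definition norm_null (u : nat -> Cn -> C) : Prop :=
  forall e : R, 0 < e -> exists k0, forall k, (k0 <= k)%N -> norm2 (u k) <= e.

(** Follows from having an adjoint and passes to sums, compositions and norm limits; carrying it
    along avoids constructing adjoints of general elements of the algebra. *)
Definition weak_preserving (S : A2 -> A2) : Prop :=
  forall u, weak_null u -> weak_null (S \o u).

(* On a Hilbert space this sequential condition characterises compact operators. *)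
Definition compact_like (K : A2 -> A2) : Prop :=
  forall u, weak_null u -> norm_null (fun k => K (u k)).

Lemma opnorm_pos (S : A2 -> A2) : bounded_operator S -> exists2 c : R, 0 < c & opnorm_le S c.
Proof.
move=> [_ [c hc]]; exists (Num.max c 1); first by rewrite lt_max ltr01 orbT.
move=> phi; apply: le_trans (hc phi) _; rewrite ler_wpM2r ?norm2_ge0//.
by rewrite le_max lexx.
Qed.

Lemma norm2_A2D (phi psi : A2) : norm2 (phi + psi : A2) <= norm2 phi + norm2 psi.
Proof. exact: norm2D (A2_L2 phi) (A2_L2 psi). Qed.

Lemma norm2_A2Z a (phi : A2) : norm2 (a *: phi : A2) = normc a * norm2 phi.
Proof. exact: norm2Z (A2_L2 phi). Qed.

Lemma norm2_A20 : norm2 (0 : A2) = 0.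
Proof. by rewrite -(scale0r (0 : A2)) norm2_A2Z ComplexField.Normc.normc0 mul0r. Qed.

Lemma norm2_A2N (phi : A2) : norm2 (- phi : A2) = norm2 phi.
Proof. by rewrite -scaleN1r norm2_A2Z normcN ComplexField.Normc.normc1 mul1r. Qed.

Lemma inner_A2D (phi psi k : A2) : inner (phi + psi : A2) k = inner phi k + inner psi k.
Proof. exact: innerDl (A2_L2 phi) (A2_L2 psi) (A2_L2 k). Qed.

Lemma inner_A2Z a (phi k : A2) : inner (a *: phi : A2) k = a * inner phi k.
Proof. exact: innerZl (A2_L2 phi) (A2_L2 k). Qed.

Lemma inner_A2B (phi psi k : A2) : inner (phi - psi : A2) k = inner phi k - inner psi k.
Proof. exact: innerBl (A2_L2 phi) (A2_L2 psi) (A2_L2 k). Qed.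

Lemma inner_A2Br (phi psi k : A2) : inner k (phi - psi : A2) = inner k phi - inner k psi.
Proof. exact: innerBr (A2_L2 phi) (A2_L2 psi) (A2_L2 k). Qed.

Lemma inner_A2J (phi psi : A2) : inner psi phi = conjc (inner phi psi).
Proof. exact: innerJ (A2_L2 phi) (A2_L2 psi). Qed.

Lemma is_adjoint_sym (S S' : A2 -> A2) : is_adjoint S S' -> is_adjoint S' S.
Proof. by move=> h phi psi; rewrite inner_A2J -h -inner_A2J. Qed.

Lemma adjoint_weak_preserving (S S' : A2 -> A2) : bounded_operator S ->
  is_adjoint S S' -> weak_preserving S.
Proof.
move=> /opnorm_pos[c c0 hc] adj u [[d hd] hu]; split.
  by exists (c * d) => k; apply: le_trans (hc _) _; rewrite ler_wpM2l ?(ltW c0).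
by move=> psi; have := hu (S' psi); congr null; apply/funext => k; rewrite /= adj.
Qed.

Lemma normc_inner (phi psi : A2) : normc (inner phi psi) <= norm2 phi * norm2 psi.
Proof. exact: cauchy_schwarz (A2_L2 phi) (A2_L2 psi). Qed.

Lemma weak_preserving_closed (S : A2 -> A2) : bounded_operator S ->
  (forall e : R, 0 < e -> exists2 T, weak_preserving T & opnorm_le (S - T) e) ->
  weak_preserving S.
Proof.
move=> bS hT u hu; have [[d hd] _] := hu; split.
  have [c c0 hc] := opnorm_pos bS.
  by exists (c * d) => k; apply: le_trans (hc _) _; rewrite ler_wpM2l ?(ltW c0).
move=> psi e e0; have X0 : 0 < 2 * ((`|d| + 1) * (norm2 psi + 1)).
  by rewrite !mulr_gt0// ltr_wpDl// norm2_ge0.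
have [T wT ST] := hT _ (divr_gt0 e0 X0).
have [_ /(_ psi (e / 2))] := wT u hu; rewrite divr_gt0// => /(_ isT)[k0 hk]; exists k0 => k kk.
have -> : (S \o u) k = (S - T) (u k) + T (u k).
  by rewrite -[X in X + _]/(S (u k) - T (u k)) subrK.
rewrite inner_A2D.
apply: le_trans (normcD _ _) _; rewrite [leRHS](splitr e); apply: lerD; last exact: hk.
apply: le_trans (normc_inner _ _) _.
apply: (@le_trans _ _ (e / (2 * ((`|d| + 1) * (norm2 psi + 1))) * (`|d| + 1) * (norm2 psi + 1))).
  apply: ler_pM; rewrite ?norm2_ge0 ?lerDl//.
  apply: le_trans (ST _) _; rewrite ler_wpM2l ?divr_ge0 ?(ltW e0) ?(ltW X0)//.
  by apply: le_trans (hd k) _; apply: le_trans (ler_norm _) _; rewrite lerDl.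
rewrite le_eqVlt; apply/orP; left; apply/eqP; field.
by rewrite !gt_eqF// ltr_wpDl// norm2_ge0.
Qed.

Lemma norm_nullD (u v : nat -> A2) : norm_null (fun k => u k) -> norm_null (fun k => v k) ->
  norm_null (fun k => u k + v k : A2).
Proof.
move=> hu hv e e0; have e2 : 0 < e / 2 by rewrite divr_gt0.
have [k1 h1] := hu _ e2; have [k2 h2] := hv _ e2; exists (maxn k1 k2) => k.
rewrite geq_max => /andP[/h1 a1 /h2 a2]; apply: le_trans (norm2_A2D _ _) _.
by rewrite [leRHS]splitr lerD.
Qed.

Lemma norm_null_le (u v : nat -> Cn -> C) (c : R) : norm_null u ->
  (forall k, norm2 (v k) <= c * norm2 (u k)) -> norm_null v.
Proof.
move=> hu le e e0; have c0 : 0 < `|c| + 1 by rewrite ltr_wpDl.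
have [k0 hk] := hu _ (divr_gt0 e0 c0); exists k0 => k /hk h; apply: le_trans (le k) _.
apply: (@le_trans _ _ ((`|c| + 1) * norm2 (u k))).
  by rewrite ler_wpM2r ?norm2_ge0// (le_trans (ler_norm c))// lerDl.
by rewrite mulrC -ler_pdivlMr.
Qed.

Lemma compact_likeD K K' : compact_like K -> compact_like K' -> compact_like (K + K').
Proof. by move=> h h' u hu; apply: norm_nullD; [exact: h|exact: h']. Qed.

Lemma compact_likeZ a K : compact_like K -> compact_like (a *: K).
Proof.
by move=> h u hu; apply: (norm_null_le (c := normc a) (h u hu)) => k; rewrite norm2_A2Z.
Qed.

Lemma compact_like_compl S K : bounded_operator S -> compact_like K -> compact_like (S \o K).
Proof. by move=> [_ [c hc]] h u hu; apply: (norm_null_le (c := c) (h u hu)) => k; exact: hc. Qed.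

Lemma compact_like_compr S K : weak_preserving S -> compact_like K -> compact_like (K \o S).
Proof. by move=> wS h u /wS; exact: h. Qed.

Lemma compact_like_closed K : (forall e : R, 0 < e -> exists2 K', compact_like K' & opnorm_le (K - K') e) ->
  compact_like K.
Proof.
move=> h u hu e e0; have [[d hd] _] := hu.
have d0 : 0 < 2 * (`|d| + 1) by rewrite mulr_gt0// ltr_wpDl.
have [K' cK KK] := h _ (divr_gt0 e0 d0).
have [k0 hk] := cK u hu _ (divr_gt0 e0 (ltr0Sn R 1)); exists k0 => k /hk h1.
have -> : K (u k) = (K - K') (u k) + K' (u k) by rewrite -[X in X + _]/(K (u k) - K' (u k)) subrK.
apply: le_trans (norm2_A2D _ _) _; rewrite [leRHS]splitr; apply: lerD => //.
apply: (@le_trans _ _ (e / (2 * (`|d| + 1)) * (`|d| + 1))).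
  apply: le_trans (KK _) _; rewrite ler_wpM2l ?divr_ge0 ?(ltW e0) ?(ltW d0)//.
  by apply: le_trans (hd k) _; apply: le_trans (ler_norm _) _; rewrite lerDl.
rewrite le_eqVlt; apply/orP; left; apply/eqP; field.
by rewrite !gt_eqF// ltr_wpDl.
Qed.

(* ||K u_k||^2 = - <u_k, K' (K u_k)>, and K u_k is again weakly null. *)
Lemma compact_like_adjoint (K K' : A2 -> A2) : weak_preserving K -> compact_like K' ->
  (forall phi psi : A2, inner (K phi) psi = - inner phi (K' psi)) -> compact_like K.
Proof.
move=> wK cK adj u hu e e0; have [[d hd] _] := hu.
have d0 : 0 < `|d| + 1 by rewrite ltr_wpDl.
have [k0 hk] := cK _ (wK u hu) _ (divr_gt0 (exprn_gt0 2 e0) d0); exists k0 => k /hk h1.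
rewrite -(@ler_pXn2r _ 2)// ?nnegrE ?norm2_ge0 ?(ltW e0)//.
have -> : norm2 (K (u k)) ^+ 2 = normc (inner (K (u k)) (K (u k))).
  by rewrite inner_ff normc_real ger0_norm ?sqr_ge0.
rewrite adj normcN; apply: le_trans (normc_inner _ _) _.
apply: (@le_trans _ _ ((`|d| + 1) * (e ^+ 2 / (`|d| + 1)))).
  apply: ler_pM; rewrite ?norm2_ge0//.
  by apply: le_trans (hd k) _; apply: le_trans (ler_norm _) _; rewrite lerDl.
by rewrite mulrC divfK// gt_eqF.
Qed.

Definition commutator (S T : A2 -> A2) : A2 -> A2 := (S \o T) - (T \o S).

Lemma commutatorE S T phi : commutator S T phi = S (T phi) - T (S phi).
Proof. by []. Qed.

Lemma opB (S : A2 -> A2) : linear S -> forall x y, S (x - y) = S x - S y.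
Proof. by move=> lS x y; rewrite addrC -scaleN1r lS scaleN1r addrC. Qed.

Lemma opD (S : A2 -> A2) : linear S -> forall x y, S (x + y) = S x + S y.
Proof. by move=> lS x y; rewrite -[x]scale1r lS !scale1r. Qed.

Lemma op0 (S : A2 -> A2) : linear S -> S 0 = 0.
Proof. by move=> lS; have := opB lS 0 0; rewrite !subrr. Qed.

Lemma opZ (S : A2 -> A2) : linear S -> forall a x, S (a *: x) = a *: S x.
Proof. by move=> lS a x; rewrite -[a *: x]addr0 lS op0// addr0. Qed.

Lemma commutatorDl S T Q : linear Q -> commutator (S + T) Q = commutator S Q + commutator T Q.
Proof.
move=> lQ; apply/funext => x.
rewrite -[RHS]/((S (Q x) - Q (S x)) + (T (Q x) - Q (T x))).
rewrite -[LHS]/((S (Q x) + T (Q x)) - Q (S x + T x)) opD// opprD addrACA.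
exact: erefl.
Qed.

Lemma commutatorBl S T Q : linear Q -> commutator (S - T) Q = commutator S Q - commutator T Q.
Proof.
move=> lQ; apply/funext => x.
rewrite -[RHS]/((S (Q x) - Q (S x)) - (T (Q x) - Q (T x))).
rewrite -[LHS]/((S (Q x) - T (Q x)) - Q (S x - T x)) opB// !opprB.
by rewrite -!addrA; congr (_ + _); rewrite addrCA [RHS]addrCA; congr (_ + _); rewrite addrC.
Qed.

Lemma commutatorZl a S Q : linear Q -> commutator (a *: S) Q = a *: commutator S Q.
Proof.
move=> lQ; apply/funext => x.
rewrite -[RHS]/(a *: (S (Q x) - Q (S x))) -[LHS]/(a *: S (Q x) - Q (a *: S x)).
by rewrite opZ// scalerBr.
Qed.

Lemma commutator_comp S T Q : linear S ->
  commutator (S \o T) Q = (S \o commutator T Q) + (commutator S Q \o T).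
Proof.
move=> lS; apply/funext => x.
rewrite -[RHS]/(S (T (Q x) - Q (T x)) + (S (Q (T x)) - Q (S (T x)))) (opB lS).
by rewrite -[LHS]/(S (T (Q x)) - Q (S (T x))) addrA subrK.
Qed.

Lemma commutator_eq0 S T : commutator S T = 0 -> forall x, S (T x) = T (S x).
Proof.
move=> h x; have E : S (T x) - T (S x) = 0 by exact: (congr1 (fun U => U x) h).
by apply/eqP; rewrite -subr_eq0 E.
Qed.

Lemma commutator_commute S T U : linear U -> (forall x, S (U x) = U (S x)) ->
  (forall x, T (U x) = U (T x)) -> forall x, commutator S T (U x) = U (commutator S T x).
Proof. by move=> lU hS hT x; rewrite !commutatorE hT !hS hT opB. Qed.

Lemma weak_nullD u v : weak_null u -> weak_null v -> weak_null (fun k => u k + v k).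
Proof.
move=> [[c hc] hu] [[d hd] hv]; split.
  by exists (c + d) => k; apply: le_trans (norm2_A2D _ _) _; rewrite lerD.
move=> psi; have := nullD (hu psi) (hv psi); congr null; apply/funext => k.
by rewrite inner_A2D.
Qed.

Lemma weak_nullZ a u : weak_null u -> weak_null (fun k => a *: u k).
Proof.
move=> [[c hc] hu]; split.
  by exists (normc a * c) => k; rewrite norm2_A2Z ler_wpM2l ?normc_ge0.
move=> psi; have := nullZ a (hu psi); congr null; apply/funext => k.
by rewrite inner_A2Z.
Qed.

Lemma weak_preserving_commutator S T : weak_preserving S -> weak_preserving T ->
  weak_preserving (commutator S T).
Proof.
move=> wS wT u hu; have := weak_nullD (wS _ (wT _ hu)) (weak_nullZ (-1) (wT _ (wS _ hu))).
by congr weak_null; apply/funext => k /=; rewrite scaleN1r.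
Qed.

Lemma commutator_adjoint S S' Q Q' : is_adjoint S S' -> is_adjoint Q Q' ->
  forall phi psi : A2, inner (commutator S' Q phi) psi = - inner phi (commutator S Q' psi).
Proof.
move=> aS aQ phi psi; have aS' := is_adjoint_sym aS.
rewrite -[commutator S' Q phi]/(S' (Q phi) - Q (S' phi)) inner_A2B aS' !aQ aS'.
by rewrite -[commutator S Q' psi]/(S (Q' psi) - Q' (S psi)) inner_A2Br opprB.
Qed.

Lemma opnorm_comp S T c d : 0 <= c -> opnorm_le S c -> opnorm_le T d -> opnorm_le (S \o T) (c * d).
Proof.
move=> c0 hS hT phi; apply: le_trans (hS _) _.
by rewrite -mulrA ler_wpM2l.
Qed.

Lemma bounded_operatorD S T : bounded_operator S -> bounded_operator T -> bounded_operator (S + T).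
Proof.
move=> [lS [c hc]] [lT [d hd]]; split.
  move=> a x y; rewrite -[LHS]/(S (a *: x + y) + T (a *: x + y)) lS lT.
  by rewrite -[RHS]/(a *: (S x + T x) + (S y + T y)) scalerDr addrACA.
exists (c + d) => x; apply: le_trans (norm2_A2D (S x) (T x)) _.
by rewrite mulrDl lerD.
Qed.

Lemma bounded_operatorZ a S : bounded_operator S -> bounded_operator (a *: S).
Proof.
move=> [lS [c hc]]; split.
  move=> b x y; rewrite -[LHS]/(a *: S (b *: x + y)) lS.
  by rewrite -[RHS]/(b *: (a *: S x) + a *: S y) scalerDr !scalerA mulrC.
exists (normc a * c) => x.
by rewrite -[(a *: S) x]/(a *: S x) norm2_A2Z -mulrA ler_wpM2l ?normc_ge0.
Qed.

Lemma bounded_operator_comp S T : bounded_operator S -> bounded_operator T -> bounded_operator (S \o T).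
Proof.
move=> bS [lT [d hd]]; have [lS _] := bS; have [c c0 hc] := opnorm_pos bS; split.
  by move=> a x y /=; rewrite lT lS.
by exists (c * d); apply: opnorm_comp => //; exact: ltW.
Qed.

Lemma bounded_operator0 : bounded_operator (0 : A2 -> A2).
Proof.
split; first by move=> a x y; rewrite -[RHS]/(a *: (0 : A2) + 0) scaler0 addr0.
by exists 0 => x; rewrite mul0r norm2_A20.
Qed.

Section class.
Variables Q Q' : A2 -> A2.
Hypotheses (bQ : bounded_operator Q) (bQ' : bounded_operator Q').
Hypothesis adjQ : is_adjoint Q Q'.

(* [Q'] is the adjoint of [Q]; both commutators are needed for stability under adjoints. *)
Definition ess_commutant : set (A2 -> A2) := [set S | [/\ bounded_operator S, weak_preserving S,
  compact_like (commutator S Q) & compact_like (commutator S Q')]].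

Let wQ : weak_preserving Q. Proof. exact: adjoint_weak_preserving bQ adjQ. Qed.
Let wQ' : weak_preserving Q'. Proof. exact: adjoint_weak_preserving bQ' (is_adjoint_sym adjQ). Qed.

Lemma compact_like0 : compact_like (0 : A2 -> A2).
Proof.
move=> u hu e e0; exists 0%N => k _; apply: ltW.
by rewrite norm2_A20.
Qed.

Lemma commutator_closed S T : bounded_operator T ->
   (forall e : R, 0 < e -> exists2 U, compact_like (commutator U T) & opnorm_le (S - U) e) ->
   compact_like (commutator S T).
Proof.
move=> bT h; have [lT _] := bT; have [c c0 hc] := opnorm_pos bT.
apply: compact_like_closed => e e0.
(* A commutator with T is at most 2 c times as large as the operator V = S - U in it. *)
have c2 : 0 < 2 * c by rewrite mulr_gt0.
have [U cU SU] := h _ (divr_gt0 e0 c2); exists (commutator U T) => //.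
rewrite -commutatorBl// => x; set V := S - U in SU *.
apply: (@le_trans _ _ (norm2 (V (T x)) + norm2 (- T (V x) : A2))); first exact: norm2_A2D.
rewrite norm2_A2N; apply: (@le_trans _ _ (e / (2 * c) * (c * norm2 x) + c * (e / (2 * c) * norm2 x))).
  apply: lerD.
    by apply: le_trans (SU _) _; rewrite ler_wpM2l ?divr_ge0 ?(ltW e0) ?(ltW c2).
  by apply: le_trans (hc _) _; rewrite ler_wpM2l ?(ltW c0).
rewrite le_eqVlt; apply/orP; left; apply/eqP.
by move: (norm2 x) => y; field; rewrite gt_eqF.
Qed.

Lemma ess_commutant_Cstar : Cstar_subalgebra ess_commutant.
Proof.
have [lQ _] := bQ; have [lQ' _] := bQ'.
split.
- by move=> S [].
- split; first exact: bounded_operator0.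
  + move=> u hu; have := weak_nullZ 0 hu; congr weak_null; apply/funext => k.
    by rewrite scale0r.
  + rewrite (_ : commutator 0 Q = 0); first exact: compact_like0.
    by apply/funext => x; rewrite -[LHS]/(0 - Q 0) op0// subr0.
  + rewrite (_ : commutator 0 Q' = 0); first exact: compact_like0.
    by apply/funext => x; rewrite -[LHS]/(0 - Q' 0) op0// subr0.
- move=> S T [S1 S2 S3 S4] [T1 T2 T3 T4]; split.
  + exact: bounded_operatorD.
  + by move=> u hu; have := weak_nullD (S2 _ hu) (T2 _ hu).
  + by rewrite commutatorDl//; exact: compact_likeD.
  + by rewrite commutatorDl//; exact: compact_likeD.
- move=> a S [S1 S2 S3 S4]; split.
  + exact: bounded_operatorZ.
  + by move=> u hu; have := weak_nullZ a (S2 _ hu).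
  + by rewrite commutatorZl//; exact: compact_likeZ.
  + by rewrite commutatorZl//; exact: compact_likeZ.
- move=> S T [S1 S2 S3 S4] [T1 T2 T3 T4]; have [lS _] := S1; split.
  + exact: bounded_operator_comp.
  + by move=> u /T2 /S2.
  + by rewrite commutator_comp//; apply: compact_likeD; [exact: compact_like_compl|exact: compact_like_compr].
  + by rewrite commutator_comp//; apply: compact_likeD; [exact: compact_like_compl|exact: compact_like_compr].
- move=> S S' [S1 S2 S3 S4] bS' aS.
  have wS' : weak_preserving S' by exact: adjoint_weak_preserving bS' (is_adjoint_sym aS).
  split => //.
  + apply: (compact_like_adjoint _ S4); first exact: weak_preserving_commutator.
    exact: commutator_adjoint.
  + apply: (compact_like_adjoint _ S3); first exact: weak_preserving_commutator.
    exact: commutator_adjoint aS (is_adjoint_sym adjQ).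
- move=> S bS h; split => //.
  + by apply: weak_preserving_closed => // e /h[T [_ wT _ _] ST]; exists T.
  + by apply: commutator_closed => // e /h[T [_ _ cT _] ST]; exists T.
  + by apply: commutator_closed => // e /h[T [_ _ _ cT] ST]; exists T.
Qed.

End class.

Variable mi : nat -> MI.
Hypotheses (mi_inj : injective mi) (mi_surj : forall m, exists k, mi k = m).
Let iproj := inner_proj alpha_gt mi_inj mi_surj.
Let tbounded := toeplitz_bounded alpha_gt mi_inj mi_surj.
Let tadjoint := toeplitz_adjoint alpha_gt mi_inj mi_surj.

Local Notation M j := (@toeplitz R n alpha (@coordf R n j)).
Local Notation N j := (@toeplitz R n alpha (@coord_conj R n j)).

Lemma null_sqr_normc (u : nat -> C) : null u -> null (fun k => (normc (u k) ^+ 2)%:C).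
Proof.
move=> hu e e0; have m0 : 0 < Num.min 1 e by rewrite lt_min ltr01.
have [k0 hk] := hu _ m0; exists k0 => k /hk; rewrite le_min => /andP[h1 h2].
rewrite normc_real ger0_norm ?sqr_ge0//; apply: le_trans h2.
by rewrite expr2 ler_piMl// normc_ge0.
Qed.

Lemma weak_null_coef u m : weak_null u -> null (fun k => coef (u k) m).
Proof.
move=> [_ hu]; have := nullZ ((om m)%:C)^-1 (hu (mono alpha m)); congr null; apply/funext => k.
by rewrite (inner_mono alpha_gt mi_inj mi_surj) mulrC.
Qed.

(** In [hankel_bound] the finitely many coefficients tend to 0 along a weakly null sequence, and its
    norms are bounded. *)
Lemma weak_null_hankel j (u : nat -> A2) : weak_null u -> norm_null (fun k => hankel alpha j (u k)).
Proof.
move=> hu e e0; have [[d hd] _] := hu.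
have d0 : 0 < d ^+ 2 + 1 by rewrite ltr_wpDl ?sqr_ge0.
have e2 : 0 < e ^+ 2 / 2 by rewrite divr_gt0 ?exprn_gt0.
have [K0 hK] := hankel_bound alpha_gt mi_inj mi_surj j (divr_gt0 e2 d0).
have a1 : 0 < alpha + 1 by move: alpha_gt; lra.
have hs := null_sum (index_enum 'I_K0) (fun l : 'I_K0 => nullZ (om (mi l))%:C
  (null_sqr_normc (weak_null_coef (mi l) hu))).
have [k0 hk] := hs _ (mulr_gt0 a1 e2).
exists k0 => k /hk hk'; rewrite -(@ler_pXn2r _ 2)// ?nnegrE ?norm2_ge0 ?(ltW e0)//.
apply: le_trans (hK _) _; rewrite [leRHS]splitr; apply: lerD.
  rewrite mulrC ler_pdivrMr// mulrC; apply: le_trans hk'.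
  rewrite (_ : \sum_(i < K0) _ = (\sum_(i < K0) normc (coef (u k) (mi i)) ^+ 2 * om (mi i))%:C).
    by rewrite normc_real ler_norm.
  by rewrite rmorph_sum; apply: eq_bigr => i _; rewrite mulrC -rmorphM.
rewrite mulrAC ler_pdivrMr// ler_wpM2l ?(ltW e2)//.
apply: (@le_trans _ _ (d ^+ 2)); last by rewrite lerDl.
by rewrite ler_pXn2r// ?nnegrE ?norm2_ge0// (le_trans (norm2_ge0 _ _) (hd 0)).
Qed.

(** Both sides have the inner product <f, z_j k> with each Bergman function k, because z_j k is
    again in the Bergman space. *)
Lemma proj_coord_conj j f : L2 f ->
  P (coord_conj j * (P f : A2)) = P (coord_conj j * f).
Proof.
move=> hf; have hp := A2_L2 (P f); have hc := Linf_coord_conj R j.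
apply: (A2_eq alpha_gt mi_inj mi_surj) => k.
have E (h : Cn -> C) : L2 h -> inner (P (coord_conj j * h)) k = inner h (M j k).
  move=> hh; rewrite iproj; last exact: L2_coord_conj.
  rewrite (inner_mul_conj hc hh (A2_L2 k)); congr inner; apply/funext => z.
  by rewrite (toeplitz_coord alpha_gt mi_inj mi_surj) -[LHS]/(conjc (conjc (z ord0 j)) * k z) conjcK.
by rewrite (E _ hp) (E _ hf) iproj.
Qed.

Lemma toeplitz_commutator_conj g j (phi : A2) : Linf g ->
  commutator (toeplitz g) (N j) phi = - P (g * hankel alpha j phi).
Proof.
move=> hg; have h2 := A2_L2 phi; have hz := L2_coord_conj j h2.
have E1 : N j (toeplitz g phi) = P (coord_conj j * (g * (phi : Cn -> C))).
  by apply: proj_coord_conj; exact: L2_LinfM.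
have E2 : coord_conj j * (g * (phi : Cn -> C)) = g * hankel alpha j phi + g * (N j phi : Cn -> C).
  by rewrite -mulrDr /hankel subrK mulrCA.
have h3 := L2_LinfM hg (L2_hankel j h2).
have h4 := L2_LinfM hg (A2_L2 (N j phi)).
rewrite -[LHS]/(P (g * (N j phi : Cn -> C)) - N j (toeplitz g phi)) E1 E2.
by rewrite (projD alpha_gt mi_inj mi_surj h3 h4) opprD addrCA subrr addr0.
Qed.

Lemma toeplitz_compact_conj g j : Linf g -> compact_like (commutator (toeplitz g) (N j)).
Proof.
move=> hg u hu; have [c c0 hc] := L2_Linf_mul alpha hg.
apply: (norm_null_le (c := c) (weak_null_hankel j hu)) => k.
rewrite toeplitz_commutator_conj// norm2_A2N.
have [h1 h2] := hc _ (L2_hankel j (A2_L2 (u k))).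
exact: le_trans (norm2_proj alpha_gt mi_inj mi_surj h1) h2.
Qed.

Lemma toeplitz_ess_commutant g j : Linf g -> ess_commutant (M j) (N j) (toeplitz g).
Proof.
move=> hg; have hg' := Linf_conj hg.
have wT h : Linf h -> weak_preserving (toeplitz h).
  by move=> hh; exact: adjoint_weak_preserving (tbounded hh) (tadjoint hh).
split.
- exact: tbounded.
- exact: wT.
(* The commutator of T_g with T_{z_j} is minus the adjoint of the one of T_{conj g} with T_{conj
   z_j}, to which the Hankel estimate applies. *)
- apply: (compact_like_adjoint _ (toeplitz_compact_conj j hg')).
    by apply: weak_preserving_commutator; apply: wT => //; exact: Linf_coord.
  apply: commutator_adjoint; last exact: tadjoint (Linf_coord R j).
  exact: is_adjoint_sym (tadjoint hg).
- exact: toeplitz_compact_conj.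
Qed.

Lemma toeplitz_algebra_ess_commutant S j : toeplitz_algebra S -> ess_commutant (M j) (N j) S.
Proof.
move=> hS; apply: hS; split.
  apply: ess_commutant_Cstar.
  - exact: tbounded (Linf_coord R j).
  - exact: tbounded (Linf_coord_conj R j).
  - exact: tadjoint (Linf_coord R j).
by move=> _ [g hg <-]; exact: toeplitz_ess_commutant.
Qed.

End essential_commutant.

(** * Operators commuting with a monomial Toeplitz operator *)

Section moment_growth.
Variables (R : realType) (n : nat) (alpha : R).
Hypothesis alpha_gt : -1 < alpha.
Local Notation om m := (@moment_cst R n alpha m).
Local Notation deg m := (\sum_i m i)%N.

Lemma multi_index_ind (Q : ('I_n -> nat) -> Prop) : Q (fun=> 0%N) ->
  (forall m j, Q m -> Q (fun i => m i + unit_index j i)%N) -> forall m, Q m.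
Proof.
move=> Q0 QS m; move: {-1}(deg m) (leqnn (deg m)) => d.
elim: d m => [|d IH] m md.
  suff -> : m = fun=> 0%N by [].
  apply/funext => j; apply/eqP; rewrite -leqn0; apply: leq_trans md.
  by rewrite (bigD1 j)//= leq_addr.
have [j mj|m0] := pickP (fun j => 0 < m j)%N; last first.
  by apply: IH; rewrite big1// => j _; apply/eqP; rewrite eqn0Ngt m0.
pose m' i := (m i - unit_index j i)%N.
have E : m = fun i => (m' i + unit_index j i)%N.
  apply/funext => i; rewrite /m' /unit_index.
  by case: eqP => [->|_]; rewrite ?subnK// subn0 addn0.
rewrite E; apply: QS; apply: IH.
by move: md; rewrite {1}E sum_unit.
Qed.

(** Each unit step multiplies the moment by (q_j + 1) / (n + |q| + alpha + 1), which is at most 1 as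
    n >= 1 and alpha > -1. *)
Lemma moment_cst_add_le (m l : 'I_n -> nat) : om (fun i => m i + l i)%N <= om m.
Proof.
elim/multi_index_ind: l => [|l j IH].
  by rewrite (@moment_cst_ext _ _ _ _ m)// => i; rewrite addn0.
apply: le_trans IH; set q := (fun i => m i + l i)%N.
rewrite (@moment_cst_ext _ _ _ _ (fun i => q i + unit_index j i)%N); last by move=> i; rewrite addnA.
have d0 := deg_gt0 alpha_gt q.
rewrite (moment_cst_unitE alpha_gt) ler_pdivrMr// ler_wpM2l//; first by rewrite ltW// moment_cst_gt0.
have n1 : 1 <= n%:R :> R by rewrite ler1n; apply: leq_ltn_trans (ltn_ord j).
have qj : (q j)%:R <= (deg q)%:R :> R by rewrite ler_nat (bigD1 j)//= leq_addr.
by rewrite -natr1; move: alpha_gt n1 qj; move: (n%:R) ((q j)%:R) ((deg q)%:R) => x y z; lra.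
Qed.

(** Each of the |l| unit steps costs a factor of at most X, since along the way the degree is at
    most |q| + |l| and the j-th exponent at least q_j. *)
Lemma moment_cst_add_ge (q l : 'I_n -> nat) (X : R) : 0 <= X ->
  (forall j, n%:R + (deg q)%:R + (deg l)%:R + alpha + 1 <= X * (q j).+1%:R) ->
  om q <= X ^+ deg l * om (fun i => q i + l i)%N.
Proof.
move=> X0; elim/multi_index_ind: l => [|l j IH] h.
  rewrite big1// mul1r (@moment_cst_ext _ _ _ (fun i => q i + 0)%N q)// => i.
  by rewrite addn0.
have {}h i : n%:R + (deg q)%:R + (deg l)%:R + 1 + alpha + 1 <= X * (q i).+1%:R.
  by have := h i; rewrite sum_unit -(natr1 (deg l)) !addrA.
apply: le_trans (IH _) _.
  by move=> i; have := h i; move: (X * _) => z; lra.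
rewrite sum_unit exprSr -mulrA ler_wpM2l ?exprn_ge0//.
set p := (fun i => q i + l i)%N.
rewrite (@moment_cst_ext _ _ _ (fun i => q i + (l i + unit_index j i))%N (fun i => p i + unit_index j i)%N); last first.
  by move=> i; rewrite addnA.
have d0 := deg_gt0 alpha_gt p; have w0 := moment_cst_gt0 alpha_gt p.
rewrite (moment_cst_unitE alpha_gt) mulrA ler_pdivlMr// mulrCA ler_wpM2l ?(ltW w0)//.
have -> : (p j).+1%:R = (q j).+1%:R + (l j)%:R :> R by rewrite -natrD addSn.
rewrite /p big_split natrD mulrDr; have := h j.
have : 0 <= X * (l j)%:R by rewrite mulr_ge0.
move: (X * (q j).+1%:R) (X * _) ((deg q)%:R) ((deg l)%:R) (n%:R) => a b c d e; lra.
Qed.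

(** As every L_j is at least 1, each exponent of k L + m is at least k while the degree is linear in
    k; so one X serves in [moment_cst_add_ge] for all k. Adding m once more only decreases the
    moment. *)
Lemma moment_cst_ratio (L m l : 'I_n -> nat) : (forall j, (1 <= L j)%N) ->
  exists2 c, 0 <= c & forall k, om (fun i => k * L i + m i)%N <= c * om (fun i => k * L i + l i)%N.
Proof.
move=> L1; pose X : R := n%:R + (deg L)%:R + (deg m)%:R + (deg l)%:R + `|alpha| + 1.
have X0 : 0 <= X by rewrite !addr_ge0.
exists (X ^+ deg l); first by rewrite exprn_ge0.
move=> k; apply: (le_trans (moment_cst_add_ge (l := l) X0 _)) => [j|].
  apply: (@le_trans _ _ (X * k.+1%:R)); last first.
    by rewrite ler_wpM2l// ler_nat ltnS (leq_trans _ (leq_addr _ _))// leq_pmulr.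
  rewrite big_split -big_distrr natrD natrM -natr1 mulrDr mulr1.
  have : (deg L)%:R * k%:R <= X * k%:R.
    rewrite ler_wpM2r// /X; have : 0 <= n%:R + (deg m)%:R + (deg l)%:R + `|alpha| + 1 by rewrite !addr_ge0.
    by move: (n%:R) ((deg L)%:R) ((deg m)%:R) ((deg l)%:R) (`|alpha|) => a b c d e; lra.
  have := ler_norm alpha.
  have : 0 <= (deg L)%:R :> R by [].
  rewrite /X mulrC; move: (X * _) (_ * (deg L)%:R) => y z; rewrite /X.
  move: (n%:R) ((deg L)%:R) ((deg m)%:R) ((deg l)%:R) (`|alpha|) => a b c d e; lra.
rewrite ler_wpM2l ?exprn_ge0//.
rewrite (@moment_cst_ext _ _ _ _ (fun i => (k * L i + l i) + m i)%N); last by move=> i; rewrite addnAC.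
exact: moment_cst_add_le.
Qed.

End moment_growth.

(** * Compact operators commuting with a monomial multiplier vanish *)

Section commutant.
Variables (R : realType) (n : nat) (alpha : R).
Hypothesis alpha_gt : -1 < alpha.
Local Notation C := R[i].
Local Notation Cn := 'rV[C]_n.
Local Notation B := (@unit_ball R n).
Local Notation L2 := (@L2 R n alpha).
Local Notation inner := (@inner R n alpha).
Local Notation norm2 := (@norm2 R n alpha).
Local Notation om m := (@moment_cst R n alpha m).
Local Notation coef := (@coef R n alpha).
Local Notation MI := {ffun 'I_n -> nat}.
Local Notation A2 := (bergman_space n alpha).
Local Notation P := (@bergman_proj R n alpha).
Variable mi : nat -> MI.
Hypotheses (mi_inj : injective mi) (mi_surj : forall m, exists k, mi k = m).
Let iproj := inner_proj alpha_gt mi_inj mi_surj.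
Let imono := inner_mono alpha_gt mi_inj mi_surj.
Let monoB := monoE alpha_gt mi_inj mi_surj.
Implicit Types S T K : A2 -> A2.

Lemma bergman_density (Q : A2 -> Prop) : Q 0 ->
  (forall a phi psi, Q phi -> Q psi -> Q (a *: phi + psi)) ->
  (forall m, Q (mono alpha m)) ->
  (forall phi, (forall e : R, 0 < e -> exists2 psi : A2, Q psi & norm2 (phi - psi : A2) <= e) -> Q phi) ->
  forall phi, Q phi.
Proof.
move=> Q0 QL Qm Qlim phi; apply: Qlim => e /(bergman_expand alpha_gt mi_inj mi_surj phi)[K0].
move=> /(_ K0 (leqnn _)); set b := fun k => coef phi (mi k) => h.
have [psi Qpsi E] : exists2 psi : A2, Q psi & forall z, B z -> psi z = psum mi b (iota 0 K0) z.
  elim: (iota 0 K0) => [|k s [psi Qpsi E]].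
    by exists 0 => // z _; rewrite /psum big_nil.
  exists (b k *: mono alpha (mi k) + psi); first exact: QL.
  move=> z Bz; rewrite psumE big_cons -psumE -E// -monoB//.
exists psi => //; apply: le_trans h; rewrite le_eqVlt; apply/orP; left; apply/eqP.
by apply: norm2_eq => z Bz; rewrite -[LHS]/(phi z - psi z) E.
Qed.

Lemma mono_shift (m l : 'I_n -> nat) (z : Cn) :
  monomial (fun i => m i + l i)%N z = monomial m z * monomial l z.
Proof. by rewrite /monomial -big_split; apply: eq_bigr => i _; rewrite exprD. Qed.

Lemma toeplitz_mono (m l : 'I_n -> nat) :
  toeplitz (monomial m) (mono alpha l) = mono alpha (fun i => m i + l i)%N.
Proof.
apply: bergman_eqP => z Bz; rewrite (toeplitz_monomial alpha_gt mi_inj mi_surj).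
by rewrite !monoB// mono_shift.
Qed.

Lemma norm2_mono m : norm2 (mono alpha m) = Num.sqrt (om m).
Proof.
rewrite -(ger0_norm (norm2_ge0 _ _)) -sqrtr_sqr; congr Num.sqrt; apply: (@complexI R).
by rewrite -inner_ff imono (mono_inner alpha_gt mi_inj mi_surj) inner_monomial.
Qed.

Lemma Linf_monomial_conj m : Linf (fun z : Cn => conjc (monomial m z)).
Proof. exact: Linf_conj (Linf_monomial R m). Qed.

Lemma proj_conj_monomial (q l : 'I_n -> nat) :
  P ((fun z => conjc (monomial q z)) * monomial (fun i => q i + l i)%N) =
  (om (fun i => q i + l i)%N / om l)%:C *: mono alpha l.
Proof.
set f := (X in P X); set c := (X in X *: _).
have hf : L2 f by apply: L2_LinfM; [exact: Linf_monomial_conj|exact: L2_monomial].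
apply/eqP; rewrite -subr_eq0; apply/eqP/(bergman_total alpha_gt mi_surj) => k.
rewrite -imono inner_A2B iproj// inner_A2Z !imono (mono_inner alpha_gt mi_inj mi_surj).
have -> : inner f (monomial (mi k)) = inner (monomial (fun i => q i + l i)%N) (monomial (fun i => q i + mi k i)%N).
  rewrite (inner_mul_conj (Linf_monomial_conj q) (L2_monomial alpha_gt _) (L2_monomial alpha_gt _)).
  congr inner; apply/funext => z; rewrite mono_shift.
  by rewrite -[LHS]/(conjc (conjc (monomial q z)) * monomial (mi k) z) conjcK.
rewrite !(inner_monomialE alpha_gt).
have -> : [forall j, q j + l j == q j + mi k j]%N = [forall j, l j == mi k j].
  by apply: eq_forallb => j; rewrite eqn_add2l.
case: ifP => _; last by rewrite mulr0 subrr.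
by rewrite /c -rmorphM divfK ?subrr// gt_eqF// moment_cst_gt0.
Qed.

Lemma inner_monomial_mul (h : A2) (q l : 'I_n -> nat) :
  inner (monomial q * (h : Cn -> C)) (monomial (fun i => q i + l i)%N) =
  (om (fun i => q i + l i)%N / om l)%:C * inner h (monomial l).
Proof.
have hm := L2_monomial alpha_gt (fun i => q i + l i)%N.
rewrite (inner_mul_conj (Linf_monomial R q) (A2_L2 h) hm).
set f := _ * _; have hf : L2 f by apply: L2_LinfM => //; exact: Linf_monomial_conj.
rewrite (innerJ hf (A2_L2 h)) -iproj// proj_conj_monomial inner_A2Z.
by rewrite conjcM conjc_real -inner_A2J imono.
Qed.

Section kill.
Variable L : 'I_n -> nat.
Hypotheses (n_gt0 : (0 < n)%N) (L_ge1 : forall j, (1 <= L j)%N).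

Let fam m k : MI := [ffun i => k * L i + m i]%N.

Let famE m k : fam m k = (fun i => k * L i + m i)%N :> ('I_n -> nat).
Proof. by apply/funext => i; rewrite ffunE. Qed.

Let fam_inj m : injective (fam m).
Proof.
move=> k k' /ffunP/(_ (Ordinal n_gt0)); rewrite !ffunE => /addIn/eqP.
by rewrite eqn_pmul2r// => /eqP.
Qed.

(** The normalised p^k z^m, with p = z^L: an orthonormal sequence, hence weakly null. *)
Let frame m k : A2 := ((Num.sqrt (om (fam m k)))^-1)%:C *: mono alpha (fam m k).

Let sqom_gt0 m : 0 < Num.sqrt (om m). Proof. by rewrite sqrtr_gt0 moment_cst_gt0. Qed.

(** These are the inner products of phi with the orthonormal sequence [frame m]; by Bessel their
    squares have bounded partial sums. *)
Lemma coef_null (phi : A2) m : null (fun k => coef phi (fam m k) * (Num.sqrt (om (fam m k)))%:C).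
Proof.
move=> e e0; pose u k := normc (coef phi (fam m k)) ^+ 2 * om (fam m k).
have u0 k : 0 <= u k by rewrite mulr_ge0 ?sqr_ge0// ltW// moment_cst_gt0.
have [K hK] := bounded_series_tail u0 (coef_bound alpha_gt (fam_inj (m := m)) phi) (exprn_gt0 2 e0).
exists K => k Kk.
have h : \sum_(K <= i < k) u i + u k <= e ^+ 2 by have := hK k.+1; rewrite big_nat_recr.
have E : normc (coef phi (fam m k) * (Num.sqrt (om (fam m k)))%:C) ^+ 2 = u k.
  rewrite /u; have := sqom_gt0 (fam m k); have := moment_cst_gt0 alpha_gt (fam m k).
  move: (coef phi (fam m k)) (om (fam m k)) => x w w0 s0.
  by rewrite normcM normc_real (gtr0_norm s0) exprMn [in LHS](sqr_sqrtr (ltW w0)).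
rewrite -(@ler_pXn2r _ 2)// ?nnegrE ?normc_ge0 ?(ltW e0)// E.
by apply: le_trans h; rewrite lerDr; apply: sumr_ge0 => i _.
Qed.

Lemma weak_null_frame m : weak_null (frame m).
Proof.
split.
  exists 1 => k; rewrite norm2_A2Z norm2_mono normc_real ger0_norm ?invr_ge0 ?sqrtr_ge0//.
  by rewrite mulVf// gt_eqF.
move=> psi e e0; have [k0 hk] := coef_null psi m e0; exists k0 => k /hk.
rewrite /frame inner_A2Z inner_A2J imono.
have -> : inner psi (monomial (fam m k)) = coef psi (fam m k) * (om (fam m k))%:C.
  by rewrite coefE divfK// om_neq0.
move: (coef psi (fam m k)) (sqom_gt0 (fam m k)) (moment_cst_gt0 alpha_gt (fam m k)) => x.
move: (om (fam m k)) => w s0 w0.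
rewrite !normcM normcJ !normcM !normc_real (gtr0_norm s0) (gtr0_norm w0) ger0_norm ?invr_ge0 ?(ltW s0)//.
move=> h; apply: le_trans h; rewrite -{2}(sqr_sqrtr (ltW w0)).
rewrite le_eqVlt; apply/orP; left; apply/eqP; field; rewrite gt_eqF//.
Qed.

Variable K : A2 -> A2.
Hypotheses (bK : bounded_operator K) (cK : compact_like K).
Hypothesis comm : forall phi, K (toeplitz (monomial L) phi) = toeplitz (monomial L) (K phi).

Lemma kill_pow m k z : K (mono alpha (fam m k)) z =
  monomial (fun i => k * L i)%N z * K (mono alpha m) z.
Proof.
elim: k => [|k IH].
  have -> : fam m 0 = m :> ('I_n -> nat) by rewrite famE; apply/funext => i; rewrite mul0n.
  by rewrite [monomial _ z]big1 ?mul1r.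
have -> : mono alpha (fam m k.+1) = toeplitz (monomial L) (mono alpha (fam m k)).
  rewrite toeplitz_mono; congr (mono alpha _); apply/funext => i.
  by rewrite !famE mulSn addnA.
rewrite comm (toeplitz_monomial alpha_gt mi_inj mi_surj) IH mulrA; congr (_ * _).
by rewrite -mono_shift; congr monomial; apply/funext => i; rewrite mulSn.
Qed.

(* p^k K(z^m), with p = z^L, is the image of z^(kL+m), hence of norm o(||z^(kL+m)||); as
   ||z^(kL+m)|| and ||z^(kL+l)|| are comparable, no coefficient of K(z^m) survives. *)
Lemma kill_mono m : K (mono alpha m) = 0.
Proof.
apply: (bergman_total alpha_gt mi_surj) => l'; set l : 'I_n -> nat := mi l'.
set h := K (mono alpha m); have [lK _] := bK.
have [c c0 hc] := moment_cst_ratio alpha_gt m l L_ge1.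
have key k : normc (inner h (monomial l)) <= om l * Num.sqrt c * norm2 (K (frame m k)).
  have hF : L2 (monomial (fun i => k * L i)%N * (h : Cn -> C)).
    by apply: L2_LinfM; [exact: Linf_monomial|exact: A2_L2].
  have nF : norm2 (monomial (fun i => k * L i)%N * (h : Cn -> C)) = Num.sqrt (om (fam m k)) * norm2 (K (frame m k)).
    rewrite /frame opZ// norm2_A2Z normc_real ger0_norm ?invr_ge0 ?sqrtr_ge0//.
    rewrite mulVKf ?gt_eqF//; apply: norm2_eq => z Bz.
    by rewrite kill_pow.
  have := cauchy_schwarz hF (A2_L2 (mono alpha (fun i => k * L i + l i)%N)).
  rewrite imono inner_monomial_mul nF norm2_mono famE normcM normc_real.
  have w0 := moment_cst_gt0 alpha_gt l; have wl0 := moment_cst_gt0 alpha_gt (fun i => k * L i + l i)%N.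
  have wm0 := moment_cst_gt0 alpha_gt (fun i => k * L i + m i)%N.
  rewrite ger0_norm; last by rewrite divr_ge0// ltW.
  have sm : Num.sqrt (om (fun i => k * L i + m i)%N) <= Num.sqrt c * Num.sqrt (om (fun i => k * L i + l i)%N).
    by rewrite -sqrtrM// ler_wsqrtr.
  have N0 := norm2_ge0 alpha (K (frame m k)).
  move: (norm2 _) (normc _) sm w0 wl0 (sqom_gt0 (fun i => k * L i + l i)%N) N0 => N x.
  move: (om l) (om (fun i => k * L i + l i)%N) (Num.sqrt (om (fun i => k * L i + m i)%N)) => w wl sm hsm w0 wl0 sl0 N0 hx.
  have h1 : wl / w * x <= wl * (Num.sqrt c * N).
    apply: le_trans hx _; have swl := sqr_sqrtr (ltW wl0).
    apply: (@le_trans _ _ ((Num.sqrt c * Num.sqrt wl) * N * Num.sqrt wl)).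
      by rewrite ler_wpM2r ?(ltW sl0)// ler_wpM2r.
    by rewrite le_eqVlt; apply/orP; left; apply/eqP; rewrite -[in RHS]swl; ring.
  rewrite mulrAC -mulrA ler_pM2l// ler_pdivrMr// in h1.
  by apply: le_trans h1 _; rewrite le_eqVlt; apply/orP; left; apply/eqP; ring.
apply: normc_le0_eq => e e0; have d0 : 0 < om l * Num.sqrt c + 1.
  by rewrite ltr_wpDl// mulr_ge0 ?sqrtr_ge0// ltW// moment_cst_gt0.
have [k0 /(_ k0 (leqnn _)) hk] := cK (weak_null_frame m) (divr_gt0 e0 d0).
rewrite subr0; apply: le_trans (key k0) _.
apply: (@le_trans _ _ ((om l * Num.sqrt c + 1) * norm2 (K (frame m k0)))).
  by rewrite ler_wpM2r ?norm2_ge0// lerDl.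
by rewrite mulrC -ler_pdivlMr.
Qed.

Lemma kill : K = 0.
Proof.
have [lK _] := bK; have [c c0 hc] := opnorm_pos bK.
apply/funext; apply: bergman_density => [|a x y Kx Ky|m|phi h].
- exact: op0.
- by rewrite lK Kx Ky -[RHS]/(0 : A2) scaler0 addr0.
- exact: kill_mono.
apply: (norm2_eq0 alpha_gt mi_inj mi_surj); apply/le_anti; rewrite norm2_ge0 andbT.
apply/ler_addgt0Pr => e e0; rewrite add0r; have [psi Kpsi hpsi] := h _ (divr_gt0 e0 c0).
have -> : K phi = K (phi - psi) by rewrite opB// Kpsi subr0.
by apply: le_trans (hc _) _; rewrite mulrC -ler_pdivlMr.
Qed.

End kill.

Lemma bernoulli_le (r : R) k : 0 <= r -> 1 + k%:R * r <= (1 + r) ^+ k.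
Proof.
move=> r0; elim: k => [|k IH]; first by rewrite mul0r addr0 expr0.
rewrite exprS; apply: (@le_trans _ _ ((1 + r) * (1 + k%:R * r))).
  have : 0 <= k%:R * r * r by rewrite !mulr_ge0.
  by rewrite -natr1; move: (k%:R) => y; nra.
by rewrite ler_wpM2l// addr_ge0.
Qed.

(** If x > c, Bernoulli's inequality makes (x / c)^k larger than E for some k. *)
Lemma power_bounded_le (x c E : R) : 0 < c -> (forall k, x ^+ k <= E * c ^+ k) -> x <= c.
Proof.
move=> c0 h; rewrite leNgt; apply/negP => cx.
have r0 : 0 < x / c - 1 by rewrite subr_gt0 ltr_pdivlMr// mul1r.
pose k := (Num.truncn (`|E| / (x / c - 1))).+1.
have hk : x ^+ k / c ^+ k <= E by rewrite ler_pdivrMr ?exprn_gt0.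
have := bernoulli_le k (ltW r0); rewrite (addrC 1 (x / c - 1)) subrK expr_div_n.
have : `|E| < k%:R * (x / c - 1).
  rewrite -ltr_pdivrMr//.
  by have /andP[_] := truncn_itv (divr_ge0 (normr_ge0 E) (ltW r0)).
have := ler_norm E; move: hk; move: (_ / _ ^+ k) (k%:R * _) (`|E|) => a b d; lra.
Qed.

Lemma commutant_analytic S : bounded_operator S ->
  (forall j phi, S (toeplitz (@coordf R n j) phi) = toeplitz (@coordf R n j) (S phi)) ->
  exists f : Cn -> C, [/\ analytic f, bounded_on_ball f & S = toeplitz f].
Proof.
move=> bS comm; have [lS _] := bS; have [c c0 hc] := opnorm_pos bS.
pose one : A2 := mono alpha (fun=> 0%N); pose f := S one.
have oneE z : B z -> one z = 1 by move=> Bz; rewrite monoB// /monomial big1.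
have pe z : B z -> exists2 E, 0 < E & forall phi : A2, normc (phi z) <= E * norm2 phi.
  move=> Bz; have z1 := Bz; rewrite unit_ballE in z1.
  have z0 : 0 <= sqr_enorm z by apply: sumr_ge0 => j _; rewrite sqr_ge0.
  have [E E0 hE] := point_evaluation alpha_gt mi_inj mi_surj z0 z1.
  by exists E => // phi; apply: hE; exact: lexx.
(* On monomials this follows from commutation with the coordinates by induction on the exponents; it
   passes to limits because S and evaluation at z are bounded. *)
have fE phi z : B z -> S phi z = f z * phi z.
  move=> Bz; move: phi; apply: bergman_density => [|a x y Sx Sy|m|phi h].
  - by rewrite op0// -[RHS]/(f z * 0) mulr0.
  - rewrite lS -[LHS]/(a * S x z + S y z) -[RHS]/(f z * (a * x z + y z)) Sx Sy.
    by move: (f z) (x z) (y z) => u v w; ring.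
  - elim/multi_index_ind: m => [|m j IH]; first by rewrite -/one oneE// mulr1.
    have -> : mono alpha (fun i => m i + unit_index j i)%N = toeplitz (@coordf R n j) (mono alpha m).
      apply: bergman_eqP => y By; rewrite (toeplitz_coord alpha_gt mi_inj mi_surj).
      by rewrite !monoB// mono_shift monomial_unit mulrC.
    rewrite comm (toeplitz_coord alpha_gt mi_inj mi_surj j (S (mono alpha m)) z).
    rewrite (toeplitz_coord alpha_gt mi_inj mi_surj j (mono alpha m) z) IH.
    by move: (f z) (mono alpha m z) => u v; rewrite mulrCA.
  have [E E0 hE] := pe z Bz; apply: normc_le0_eq => e e0.
  have d0 : 0 < E * c + normc (f z) * E.
    by rewrite ltr_pwDl ?mulr_gt0// mulr_ge0 ?normc_ge0// ltW.
  have [psi Spsi hpsi] := h _ (divr_gt0 e0 d0).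
  have -> : S phi z - f z * phi z = S (phi - psi) z - f z * ((phi - psi : A2) z).
    rewrite opB// -[(S phi - S psi : A2) z]/(S phi z - S psi z) -[(phi - psi : A2) z]/(phi z - psi z) Spsi.
    by move: (S phi z) (f z) (phi z) (psi z) => a u v w; ring.
  apply: le_trans (normcB _ _) _; rewrite normcM.
  have h1 := hE (phi - psi); have h2 := le_trans (hE (S (phi - psi))) (ler_wpM2l (ltW E0) (hc (phi - psi))).
  apply: le_trans (lerD h2 (ler_wpM2l (normc_ge0 (f z)) h1)) _.
  rewrite !mulrA -mulrDl mulrC -ler_pdivlMr//.
have f_bounded z : B z -> normc (f z) <= c.
  move=> Bz; have [E E0 hE] := pe z Bz.
  (* The k-th iterate of S on the constant 1 is f^k; the constant E depends on z but not on k, so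
     the resulting bound c is uniform in z. *)
  apply: (@power_bounded_le _ _ (E * norm2 one)) => // k.
  have [h1 h2] : iter k S one z = f z ^+ k /\ norm2 (iter k S one) <= c ^+ k * norm2 one.
    elim: k => [|k [IH1 IH2]]; first by rewrite !expr0 mul1r; split => //; exact: oneE.
    split; first by rewrite iterS fE// IH1 exprS.
    rewrite iterS; apply: le_trans (hc _) _.
    by rewrite exprS -mulrA ler_wpM2l ?(ltW c0).
  rewrite -normcX -h1; apply: le_trans (hE _) _.
  by rewrite -mulrA [norm2 one * _]mulrC ler_wpM2l// ltW.
exists f; split.
- by have [_ af _] := bergmanP f.
- by exists c.
- apply/funext => phi; apply: bergman_eqP => z Bz.
  by rewrite fE// (toeplitz_mul alpha_gt mi_inj mi_surj phi f_bounded).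
Qed.

End commutant.

Theorem theorem1p1 (R : realType) (n : nat) (alpha : R)
  (n_ge1 : (1 <= n)%N) (alpha_gt : -1 < alpha)
  (S : bergman_space n alpha -> bergman_space n alpha)
  (S_in : toeplitz_algebra S)
  (L : 'I_n -> nat) (L_ge1 : forall j, (1 <= L j)%N)
  (S_comm : S \o toeplitz (monomial L) = toeplitz (monomial L) \o S) :
  exists f : 'rV[R[i]]_n -> R[i],
    [/\ analytic f, bounded_on_ball f & S = toeplitz f].
Proof.
have [mi [mi_inj mi_surj]] := multi_index_enum n_ge1.
have ess j := toeplitz_algebra_ess_commutant alpha_gt mi_inj mi_surj j S_in.
have [bS _ _ _] := ess (Ordinal n_ge1); have [lS _] := bS.
have bM j := toeplitz_bounded alpha_gt mi_inj mi_surj (Linf_coord R j).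
apply: (commutant_analytic alpha_gt mi_inj mi_surj bS) => j phi.
have [_ _ cK _] := ess j; set M := toeplitz (@coordf R n j) in cK *.
have hS psi : S (toeplitz (monomial L) psi) = toeplitz (monomial L) (S psi).
  exact: (congr1 (fun T => T psi) S_comm).
have hM psi : M (toeplitz (monomial L) psi) = toeplitz (monomial L) (M psi).
  apply: bergman_eqP => z Bz; rewrite /M.
  have cE := toeplitz_coord alpha_gt mi_inj mi_surj j.
  have mE := toeplitz_monomial alpha_gt mi_inj mi_surj L.
  apply: etrans (cE _ z) _; apply: etrans (congr1 (fun x => z ord0 j * x) (mE psi z)) _.
  apply: etrans _ (esym (mE _ z)).
  by apply: etrans _ (esym (congr1 (fun x => monomial L z * x) (cE psi z))); rewrite mulrCA.
have bK : bounded_operator (commutator S M).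
  have := bounded_operatorD (bounded_operator_comp bS (bM j))
    (bounded_operatorZ (-1) (bounded_operator_comp (bM j) bS)).
  by rewrite scaleN1r.
have comm psi : commutator S M (toeplitz (monomial L) psi) = toeplitz (monomial L) (commutator S M psi).
  have lp := (toeplitz_bounded alpha_gt mi_inj mi_surj (Linf_monomial R L)).1.
  exact: commutator_commute lp hS hM psi.
exact: commutator_eq0 (kill alpha_gt mi_inj mi_surj n_ge1 L_ge1 bK cK comm) phi.
Qed.
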